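(* Let $N \geq 1$ be an integer and let $u=(a,b)$ and $v=(c,d)$ be two nonzero vectors in $(\mathbf{Z}/N\mathbf{Z})^2$. Then \[ \int_0^{i\infty} \eta(g_u,g_v) = \pi\, \Lambda^*\bigl(e_{a,d}\, e_{b,-c}+e_{a,-d}\, e_{b,c},\,0\bigr), \] where the integral is taken along the imaginary axis $\tau = it$, $t$ from $0$ to $\infty$.
   Context: Let $\mathcal{H}$ be the upper half-plane, $q=e^{2\pi i\tau}$, $q^\alpha=e^{2\pi i\alpha\tau}$ for $\alpha\in\mathbf{Q}$, and $\zeta_N=e^{2\pi i/N}$. For $x\in\mathbf{R}$ let $\{x\}=x-\lfloor x\rfloor$ and $B(x)=\{x\}^2-\{x\}+\frac16$. For $(a,b)\in(\mathbf{Z}/N\mathbf{Z})^2\setminus\{(0,0)\}$, the Siegel unit is the holomorphic nonvanishing function on $\mathcal{H}$ \[ g_{a,b}(\tau)=q^{B(a/N)/2}\prod_{n\ge 0}(1-q^nq^{\tilde a/N}\zeta_N^b)\prod_{n\ge1}(1-q^nq^{-\tilde a/N}\zeta_N^{-b}), \] where $\tilde a$ is the representative of $a$ with $0\le\tilde a<N$; for $u=(a,b)$ write $g_u=g_{a,b}$. For holomorphic nonvanishing functions $f,g$ on $\mathcal{H}$, $\eta(f,g)=\log|f|\,\mathrm{d}\arg g-\log|g|\,\mathrm{d}\arg f$ (a well-defined real 1-form). For $a,b\in\mathbf{Z}/N\mathbf{Z}$ define \[ e_{a,b}(\tau)=\alpha_0(a,b)+\sum_{\substack{m,n\ge1\\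 m\equiv a,\ n\equiv b \ (N)}}q^{mn}-\sum_{\substack{m,n\ge1\\ m\equiv -a,\ n\equiv -b\ (N)}}q^{mn}, \] with $\alpha_0(a,b)=0$ if $a=b=0$; $\frac12-\{\frac bN\}$ if $a=0,b\neq0$; $\frac12-\{\frac aN\}$ if $a\neq0,b=0$; $0$ if $a\neq0,b\neq0$. These $e_{a,b}$ are modular forms of weight 1 on $\Gamma_1(N^2)$, so $F=e_{a,d}e_{b,-c}+e_{a,-d}e_{b,c}$ is a modular form of weight 2 on $\Gamma_1(N^2)$. For a modular form $F=\sum_{n\ge0}a_nq^n$ of weight $k$ on $\Gamma_1(M)$ (here $M=N^2$), $L(F,s)=\sum_{n\ge1}a_nn^{-s}$, $\Lambda(F,s)=M^{s/2}(2\pi)^{-s}\Gamma(s)L(F,s)$ (meromorphically continued to $\mathbf{C}$), and the regularized value is $\Lambda^*(F,0)=\lim_{s\to0}\bigl(\Lambda(F,s)+\frac{a_0}{s}\bigr)$. *)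

(* Defs.v *)
(* The complex numbers are written R[i]^o: this is the field R[i] seen as a
   normed module over itself, so that limits and complex derivatives (derive1
   and derivable over the base field R[i]) apply. *)
From HB Require Import structures.
From mathcomp Require Import all_boot all_order all_algebra.
From mathcomp Require Import all_classical all_reals all_analysis.
From mathcomp Require Import complex.

Set Implicit Arguments.
Unset Strict Implicit.
Unset Printing Implicit Defensive.

Import Order.TTheory GRing.Theory Num.Theory.
Import numFieldNormedType.Exports.

Local Open Scope classical_set_scope.
Local Open Scope ring_scope.
Local Open Scope complex_scope.

(* Z/NZ for every N >= 1, N = 1 included; the underlying natural number of
   a residue is its representative in [0, N). *)
Notation Zmod N := 'I_(N.-1.+1).

Section Complex.
Variable R : realType.
Notation C := (R[i]^o).

Definition ci : C := 0 +i* 1.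

Definition cexp (z : C) : C :=
  (expR (complex.Re z) * cos (complex.Im z)) +i*
  (expR (complex.Re z) * sin (complex.Im z)).

(* x^s for a real x > 0 *)
Definition cpow (x : R) (s : C) : C := cexp (s * (ln x)%:C).

Definition logabs (z : C) : R := ln (complex.Re `|z|).

Definition upper_half_plane : set C := [set tau | 0 < complex.Im tau].

(* q^alpha = e^(2 i pi alpha tau), for a real exponent alpha *)
Definition qpow (alpha : R) (tau : C) : C :=
  cexp ((2 * pi * alpha)%:C * ci * tau).

Definition zeta (N : nat) : C := cexp ((2 * pi / N%:R)%:C * ci).

(* Euler's integral; it is only used for Re s > 0, where it converges. *)
Definition cGamma (s : C) : C :=
  let f (t : R) : C := cpow t (s - 1) * (expR (- t))%:C in
  (\int[lebesgue_measure]_(t in `]0%R, +oo[) complex.Re (f t))%R +i*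
  (\int[lebesgue_measure]_(t in `]0%R, +oo[) complex.Im (f t))%R.

(* Near every point p, f is a quotient of a holomorphic function by a power
   of s - p; the value of f at p itself is irrelevant. *)
Definition meromorphic (f : C -> C) : Prop :=
  forall p : C, exists (n : nat) (h : C -> C),
    (\forall s \near p, derivable h s 1) /\
    (\forall s \near p^', (s - p) ^+ n * f s = h s).

(* The 1-form log|f| darg g - log|g| darg f, at the point tau and on the
   tangent vector w; here darg f = Im (df / f). *)
Definition darg (f : C -> C) (tau w : C) : R :=
  complex.Im (derive1 f tau / f tau * w).

Definition eta_form (f g : C -> C) (tau w : C) : R :=
  logabs (f tau) * darg g tau w - logabs (g tau) * darg f tau w.

(* The pull-back of a 1-form omega along t |-> i t (with velocity i), as a
   function of t. *)
Definition along_iR (omega : C -> C -> R) (t : R) : R :=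
  omega (t%:C * ci) ci.

End Complex.

Section Modular.
Variable R : realType.
Notation C := (R[i]^o).

Definition frac_part (x : R) : R := x - (Num.floor x)%:~R.

Definition bern (x : R) : R := frac_part x ^+ 2 - frac_part x + 6^-1.

Definition siegel (N : nat) (u : Zmod N * Zmod N) (tau : C) : C :=
  let x : R := (u.1 : nat)%:R / N%:R in
  let b : nat := u.2 in
  qpow (bern x / 2) tau
  * limn (fun k => \prod_(0 <= n < k)
             (1 - qpow n%:R tau * qpow x tau * zeta R N ^+ b) : C)
  * limn (fun k => \prod_(1 <= n < k)
             (1 - qpow n%:R tau * qpow (- x) tau * zeta R N ^- b) : C).

Definition alpha0 (N : nat) (a b : Zmod N) : R :=
  if a == 0 then
    if b == 0 then 0 else 2^-1 - frac_part ((b : nat)%:R / N%:R)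
  else
    if b == 0 then 2^-1 - frac_part ((a : nat)%:R / N%:R) else 0.

(* The double series of q^(mn) over m, n >= 1 with m = a and n = b mod N; it
   converges absolutely on the upper half-plane, and is summed over squares. *)
Definition qsum (N : nat) (a b : Zmod N) (tau : C) : C :=
  limn (fun k => \sum_(1 <= m < k | m == a %[mod N])
                 \sum_(1 <= n < k | n == b %[mod N]) qpow (m * n)%:R tau : C).

Definition eis (N : nat) (a b : Zmod N) (tau : C) : C :=
  (alpha0 a b)%:C + qsum a b tau - qsum (- a) (- b) tau.

Definition is_qexpansion (F : C -> C) (c : nat -> C) : Prop :=
  forall tau, upper_half_plane tau ->
    series (fun n => c n * qpow n%:R tau) @ \oo --> F tau.

(* Lam is the meromorphic continuation to C of the completed L-function
   M^(s/2) (2 pi)^(-s) Gamma(s) sum_(n >= 1) c_n n^(-s), given by this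
   formula on some right half-plane on which the Dirichlet series converges. *)
Definition is_Lambda (M : nat) (c : nat -> C) (Lam : C -> C) : Prop :=
  meromorphic Lam /\
  exists2 sigma : R, 0 <= sigma &
    forall s : C, sigma < complex.Re s ->
      exists2 L : C,
        series (fun n => c n.+1 * cpow n.+1%:R (- s)) @ \oo --> L &
        Lam s = cpow M%:R (s / 2) * cpow (2 * pi) (- s) * cGamma s * L.

(* l is the regularized value at s = 0 of the completed L-function of F, in
   level M. The coefficients c are determined by F, and Lam is determined by
   them outside a discrete set (identity theorem), hence so is l. *)
Definition is_Lambda_star0 (M : nat) (F : C -> C) (l : C) : Prop :=
  exists (c : nat -> C) (Lam : C -> C),
    [/\ is_qexpansion F c,
        is_Lambda M c Lam &
        Lam s + c 0 / s @[s --> (0 : C)^'] --> l].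

End Modular.

Arguments siegel R {N} u tau.
Arguments eis R {N} a b tau.

(* Main.v *)
(* Along tau = i t the form eta (g_u, g_v) is L_u D_v - L_v D_u, where L_u (t) is
   log |g_u (i t)| and D_v (t) is darg g_v on the velocity vector; both are Lambert
   series, and so are the combinations e_(a,d) - e_(a,-d) = T_(a,d) and
   e_(a,d) + e_(a,-d) = T_(d,a) at i x / N, whence F = (T_(d,a) T_(c,b) - T_(a,d) T_(b,c)) / 2.
   Poisson summation gives modular relations for t -> 1 / t; they turn the integral
   of L_u D_v into that of L_(b,a) (1 / t) D_v (t), or of L_u (1 / t) D_(d,c) (t).
   By the method of Rogers and Zudilin, this expands into a sum over
   (m1, m2, k, j), and substituting t -> t k / m2 in each term regroups it as the
   integral of a product of two weight one Eisenstein series. That integral is a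
   Mellin transform at s = 0; the linear term of L_u (from q^(B/2)) contributes
   exactly the regularizing terms. Finally Lambda (F, s) is split at 1 by the
   functional equation, which yields its continuation and its value at 0. *)
Require Import Defs.
From HB Require Import structures.
From mathcomp Require Import all_boot all_order all_algebra.
From mathcomp Require Import all_classical all_reals all_analysis.
From mathcomp Require Import complex.
From mathcomp Require Import measurable_realfun zify ring lra.

Set Implicit Arguments.
Unset Strict Implicit.
Unset Printing Implicit Defensive.

Import Order.TTheory GRing.Theory Num.Theory.
Import numFieldNormedType.Exports.

Local Open Scope classical_set_scope.
Local Open Scope ring_scope.

(** * Lebesgue integrals on the real line *)

Section Integration.
Variable R : realType.
Notation mu := (@lebesgue_measure R).
Implicit Types (D : set R) (f g : R -> R).

Notation itg D f := (mu.-integrable D (EFin \o (f : R -> R))).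

(** On the axis every object is a real function, so the analysis uses real sine and cosine series;
    complex numbers return only to read off [siegel] and [eis], and in the Mellin variable. The
    choice tau = i x / N turns tau -> -1 / (N^2 tau), the involution of level N^2, into x -> 1 / x.
    The modular relations rest on one duality: the sine series [sf c] is the cosine transform of
    [wf c], a difference of two geometric series of ratio r^N. Poisson summation is Euler-Maclaurin
    against the periodic B2, whose Fourier series is obtained as a limit of finite trigonometric
    sums. The degenerate residues are the obstacle. The exchange of indices needs three nonzero
    residues, hence two routes according to whether a = 0. Completing the exchanged integrand to a
    product of two Eisenstein series adds a multiple of a Clausen value; the linear term of log
    |g_u| produces the opposite multiple, so no such value survives. Finally, u and v being nonzero
    makes the constant coefficient of F vanish, so that Lambda is regular at 0, with its only
    possible pole at 2. *)

Lemma itg_meas D f : itg D f -> measurable_fun D f.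
Proof. by move=> /integrableP[/measurable_EFinP]. Qed.

Lemma itg_le D f g : measurable D -> measurable_fun D f ->
  (forall x, D x -> `|f x| <= g x) -> itg D g -> itg D f.
Proof.
move=> mD mf fg ig;
have := @le_integrable _ _ _ mu D mD (EFin \o f) (EFin \o g).
apply => //; first exact/measurable_EFinP.
move=> x Dx /=; rewrite lee_fin; apply: (le_trans (fg x Dx)).
exact: ler_norm.
Qed.

Lemma eq_itg D f g : (forall x, D x -> f x = g x) -> measurable D ->
  itg D f -> itg D g.
Proof.
move=> fg mD; have := @eq_integrable _ _ _ mu D mD (EFin \o f) (EFin \o g); apply => // x; rewrite inE => Dx /=.
by rewrite fg.
Qed.

Lemma eq_RI D f g : (forall x, D x -> f x = g x) ->
  \int[mu]_(x in D) f x = \int[mu]_(x in D) g x.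
Proof. by move=> fg; apply: eq_Rintegral => x; rewrite inE; exact: fg. Qed.

Lemma itgD D f g : measurable D -> itg D f -> itg D g ->
  itg D (fun x => f x + g x).
Proof. by move=> mD ? ?; have := @integrableD _ _ _ mu D mD (EFin \o f) (EFin \o g); exact. Qed.

Lemma itgB D f g : measurable D -> itg D f -> itg D g ->
  itg D (fun x => f x - g x).
Proof. by move=> mD ? ?; have := @integrableB _ _ _ mu D mD (EFin \o f) (EFin \o g); exact. Qed.

Lemma itgZ D f k : measurable D -> itg D f -> itg D (fun x => k * f x).
Proof. by move=> mD ?; have := @integrableZl _ _ _ mu D mD k (EFin \o f); exact. Qed.

Lemma itg_norm D f : measurable D -> itg D f -> itg D (fun x => `|f x|).
Proof. by move=> mD ?; have := @integrable_norm _ _ _ mu D f; exact. Qed.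

Lemma itgS D E f : measurable D -> measurable E -> E `<=` D -> itg D f -> itg E f.
Proof. by move=> mD mE ED; have := @integrableS _ _ _ mu D E (EFin \o f); exact. Qed.

Lemma RI_E D f : measurable D -> itg D f ->
  (\int[mu]_(x in D) f x)%:E = (\int[mu]_(x in D) (f x)%:E)%E.
Proof.
move=> mD fi; rewrite /Rintegral fineK//.
by have := @integrable_fin_num _ _ _ mu D mD (EFin \o f); exact.
Qed.

Lemma le_RI D f g : measurable D -> itg D f -> itg D g ->
  (forall x, D x -> f x <= g x) ->
  \int[mu]_(x in D) f x <= \int[mu]_(x in D) g x.
Proof. by have := @le_Rintegral _ _ _ mu D f g; exact. Qed.

Lemma RID D f g : measurable D -> itg D f -> itg D g ->
  \int[mu]_(x in D) (f x + g x) = \int[mu]_(x in D) f x + \int[mu]_(x in D) g x.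
Proof. by have := @RintegralD _ _ _ mu D f g; exact. Qed.

Lemma RIB D f g : measurable D -> itg D f -> itg D g ->
  \int[mu]_(x in D) (f x - g x) = \int[mu]_(x in D) f x - \int[mu]_(x in D) g x.
Proof. by have := @RintegralB _ _ _ mu D f g; exact. Qed.

Lemma RIZ D f k : measurable D -> itg D f ->
  \int[mu]_(x in D) (k * f x) = k * \int[mu]_(x in D) f x.
Proof. by have := @RintegralZl _ _ _ mu D f k; exact. Qed.

Lemma RI_le D f g : measurable D -> measurable_fun D f ->
  (forall x, D x -> `|f x| <= g x) -> itg D g ->
  `|\int[mu]_(x in D) f x| <= \int[mu]_(x in D) g x.
Proof.
move=> mD mf fg ig; have fi := itg_le mD mf fg ig.
apply: le_trans (le_RI mD (itg_norm mD fi) ig fg).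
by have := @le_normr_Rintegral _ _ _ mu D f; exact.
Qed.

(** The dominating function may be infinite: [series_itg_abs] dominates by a sum of absolute values
    that is only known to be finite almost everywhere. *)
Lemma itg_edct D (S : nat -> R -> R) (F : R -> R) (G : R -> \bar R) :
  measurable D ->
  (forall n, measurable_fun D (S n)) ->
  (forall x, D x -> S ^~ x @ \oo --> F x) ->
  (forall n x, D x -> (`|S n x|%:E <= G x)%E) ->
  mu.-integrable D G ->
  [/\ itg D F, (forall n, itg D (S n)) &
  \int[mu]_(x in D) S n x @[n --> \oo] --> \int[mu]_(x in D) F x].
Proof.
move=> mD mS fF fG iG.
have iS n : itg D (S n).
  have := @le_integrable _ _ _ mu D mD (EFin \o S n) G.
  apply; [exact: ((measurable_EFinP D (S n)).2 (mS n))| |exact: iG].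
  by move=> x Dx /=; apply: le_trans (fG n x Dx) _; exact: lee_abs.
have mF : measurable_fun D F.
  apply: (@measurable_fun_cvg _ _ _ D S) => // x Dx; exact: fF.
have cS x : D x -> (EFin \o S n) x @[n --> \oo] --> (F x)%:E.
  by move=> Dx; apply: cvg_EFin; [exact: nearW|exact: fF].
have bS x n : D x -> (`|(EFin \o S n) x| <= G x)%E.
  by move=> Dx; exact: fG.
have [iF _ cF] := @dominated_convergence _ _ R mu D mD
  (fun n => EFin \o S n) (EFin \o F) G
  (fun n => (measurable_EFinP D (S n)).2 (mS n)) ((measurable_EFinP D F).2 mF)
  (aeW mu cS) iG (aeW mu bS).
split => //.
by apply: fine_cvg; rewrite RI_E//; exact: cF.
Qed.

Lemma itg_dct D (S : nat -> R -> R) (F G : R -> R) : measurable D ->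
  (forall n, measurable_fun D (S n)) ->
  (forall x, D x -> S ^~ x @ \oo --> F x) ->
  (forall n x, D x -> `|S n x| <= G x) -> itg D G ->
  [/\ itg D F, (forall n, itg D (S n)) &
  \int[mu]_(x in D) S n x @[n --> \oo] --> \int[mu]_(x in D) F x].
Proof. by move=> mD mf fF fG; apply: itg_edct. Qed.

Lemma series_itg_edom D (f : nat -> R -> R) (F : R -> R) (G : R -> \bar R) :
  measurable D ->
  (forall n, measurable_fun D (f n)) ->
  (forall x, D x -> series (fun n => f n x) @ \oo --> F x) ->
  (forall n x, D x -> (`|series (fun k => f k x) n|%:E <= G x)%E) ->
  mu.-integrable D G ->
  [/\ itg D F, (forall n, itg D (f n)) &
  series (fun n => \int[mu]_(x in D) f n x) @ \oo --> \int[mu]_(x in D) F x].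
Proof.
move=> mD mf fF fG iG.
pose S n x := series (fun k => f k x) n.
have mS n : measurable_fun D (S n).
  rewrite /S /series /=; apply: measurable_sum => i; exact: mf.
have [iF iS cF] := itg_edct mD mS fF fG iG.
(* Only partial sums are dominated; a single term is a difference of two of them. *)
have fi n : itg D (f n).
  apply: (@eq_itg D (fun x => S n.+1 x - S n x)) => //.
    by move=> x Dx; rewrite /S /series /= big_nat_recr//= addrAC subrr add0r.
  exact: itgB.
split => //.
have -> : series (fun n => \int[mu]_(x in D) f n x) =
   (fun n => \int[mu]_(x in D) S n x).
  apply/funext => n; rewrite /S /series /=; elim: n => [|n IH].
    rewrite big_geq//; rewrite (@eq_RI _ _ (fun=> 0)); last first.
      by move=> x _; rewrite big_geq.
    by rewrite Rintegral_cst// mul0r.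
  rewrite big_nat_recr//= IH -RID//; last exact: iS.
  by apply: eq_RI => x _; rewrite big_nat_recr.
exact: cF.
Qed.

Lemma series_itg_dom D (f : nat -> R -> R) (F G : R -> R) : measurable D ->
  (forall n, measurable_fun D (f n)) ->
  (forall x, D x -> series (fun n => f n x) @ \oo --> F x) ->
  (forall n x, D x -> `|series (fun k => f k x) n| <= G x) -> itg D G ->
  [/\ itg D F, (forall n, itg D (f n)) &
  series (fun n => \int[mu]_(x in D) f n x) @ \oo --> \int[mu]_(x in D) F x].
Proof.
by move=> mD mf fF fG; apply: series_itg_edom.
Qed.

(** By Tonelli the sum of the absolute values has a finite integral, so it dominates all partial
    sums. *)
Lemma series_itg_abs D (f : nat -> R -> R) (F : R -> R) : measurable D ->
  (forall n, itg D (f n)) ->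
  cvgn (series (fun n => \int[mu]_(x in D) `|f n x|)) ->
  (forall x, D x -> series (fun n => f n x) @ \oo --> F x) ->
  itg D F /\
  series (fun n => \int[mu]_(x in D) f n x) @ \oo --> \int[mu]_(x in D) F x.
Proof.
move=> mD fi cf fF.
have mf n : measurable_fun D (f n) by exact: itg_meas.
have mfa n : measurable_fun D (fun x => `|f n x|%:E).
  by apply/measurable_EFinP; apply: measurableT_comp.
pose G x := (\sum_(n <oo) `|f n x|%:E)%E.
have G0 x : (0 <= G x)%E by apply: nneseries_ge0 => n _ _; rewrite lee_fin.
have iG : mu.-integrable D G.
  apply/integrableP; split.
    have := @ge0_emeasurable_sum _ _ R D (fun n x => `|f n x|%:E) xpredT.
    by apply => // k x _ _; rewrite lee_fin.
  under eq_integral do rewrite gee0_abs//.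
  have -> : (\int[mu]_(x in D) G x = \sum_(n <oo) \int[mu]_(x in D) `|f n x|%:E)%E.
    by have := @integral_nneseries _ _ R mu D mD (fun n x => `|f n x|%:E)%E; apply.
  have -> : (\sum_(n <oo) \int[mu]_(x in D) `|f n x|%:E =
             \sum_(n <oo) (\int[mu]_(x in D) `|f n x|)%:E)%E.
    by apply: eq_eseriesr => n _; rewrite (RI_E mD (itg_norm mD (fi n))).
  have -> : (\sum_(n <oo) (\int[mu]_(x in D) `|f n x|)%:E =
      (limn (series (fun n => \int[mu]_(x in D) `|f n x|)))%:E)%E.
    rewrite -EFin_lim//; congr (limn _); apply/funext => n /=.
    by rewrite sumEFin.
  exact: ltry.
have [] := @series_itg_edom D f F G mD mf fF _ iG; last by [].
move=> n x Dx; apply: (@le_trans _ _ (\sum_(0 <= k < n) `|f k x|%:E)%E).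
  by rewrite sumEFin lee_fin /series/=; exact: ler_norm_sum.
by apply: nneseries_lim_ge => k _; rewrite lee_fin.
Qed.

End Integration.

Notation itg D f := ((@lebesgue_measure _).-integrable D (EFin \o f)).

(** * Derivatives and the fundamental theorem of calculus *)

Section FTC.
Variable R : realType.
Notation mu := (@lebesgue_measure R).
Implicit Types (D : set R) (f g : R -> R).

Notation dv f x d := (is_derive (x : R) (1 : R) (f : R -> R) (d : R)).

Lemma dv_eq f (x d d' : R) : d = d' -> dv f x d -> dv f x d'.
Proof. by move=> ->. Qed.

Lemma dv_ext f g (x d : R) : (forall y, f y = g y) -> dv f x d -> dv g x d.
Proof. by move=> /funext ->. Qed.

Lemma dv_cst (c x : R) : dv (fun=> c) x 0.
Proof. exact: is_derive_cst. Qed.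

Lemma dv_id (x : R) : dv (fun y => y) x 1.
Proof. exact: is_derive_id. Qed.

Lemma dvD f g (x a b : R) : dv f x a -> dv g x b ->
  dv (fun y => f y + g y) x (a + b).
Proof. exact: is_deriveD. Qed.

Lemma dvB f g (x a b : R) : dv f x a -> dv g x b ->
  dv (fun y => f y - g y) x (a - b).
Proof. exact: is_deriveB. Qed.

Lemma dvN f (x a : R) : dv f x a -> dv (fun y => - f y) x (- a).
Proof. exact: is_deriveN. Qed.

Lemma dvM f g (x a b : R) : dv f x a -> dv g x b ->
  dv (fun y => f y * g y) x (a * g x + f x * b).
Proof.
move=> fa gb; apply: dv_eq (is_deriveM fa gb).
by rewrite addrC /GRing.scale /= [g x * a]mulrC.
Qed.

Lemma dvZ f (k x a : R) : dv f x a -> dv (fun y => k * f y) x (k * a).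
Proof. exact: is_deriveZ. Qed.

Lemma dvV f (x a : R) : f x != 0 -> dv f x a ->
  dv (fun y => (f y)^-1) x (- a / f x ^+ 2).
Proof.
move=> fx0 fa; apply: dv_eq (is_deriveV fx0 fa).
by rewrite /GRing.scale /= !mulNr mulrC.
Qed.

Lemma dv_comp g f (x a b : R) : dv g (f x) a -> dv f x b ->
  dv (fun y => g (f y)) x (a * b).
Proof. by move=> ga fb; have := is_derive1_comp ga fb. Qed.

Lemma dv_exp f (x a : R) : dv f x a -> dv (fun y => expR (f y)) x (expR (f x) * a).
Proof. by apply: dv_comp; exact: is_derive_expR. Qed.

Lemma dv_cos f (x a : R) : dv f x a -> dv (fun y => cos (f y)) x (- sin (f x) * a).
Proof. by apply: dv_comp; exact: is_derive_cos. Qed.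

Lemma dv_sin f (x a : R) : dv f x a -> dv (fun y => sin (f y)) x (cos (f x) * a).
Proof. by apply: dv_comp; exact: is_derive_sin. Qed.

Lemma dv_ln f (x a : R) : 0 < f x -> dv f x a ->
  dv (fun y => ln (f y)) x (a / f x).
Proof. by move=> f0 fa; rewrite mulrC; apply: dv_comp fa; exact: is_derive1_ln. Qed.

Lemma dv_lin (k x : R) : dv (fun y => k * y) x k.
Proof. by apply: dv_eq (dvZ _ (dv_id x)); rewrite mulr1. Qed.

Lemma within_cts (A : set R) f : (forall x, A x -> {for x, continuous f}) ->
  {within A, continuous f}.
Proof. by move=> cf; apply: continuous_in_subspaceT => x; rewrite inE => /cf. Qed.

Lemma is_derive_cts f (df x : R) : is_derive x 1 f df -> {for x, continuous f}.
Proof.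
by move=> [d _]; apply/differentiable_continuous; rewrite -derivable1_diffP.
Qed.

Lemma itg_cc f (a b : R) : (forall x, a <= x <= b -> {for x, continuous f}) ->
  itg `[a, b] f.
Proof.
move=> cf; have := @continuous_compact_integrable R f `[a, b]; apply.
  exact: segment_compact.
by apply: within_cts => x /=; rewrite in_itv /=; exact: cf.
Qed.

Lemma ftc (F f : R -> R) (a b : R) : a <= b ->
  (forall x, a <= x <= b -> is_derive x 1 F (f x)) ->
  (forall x, a <= x <= b -> {for x, continuous f}) ->
  \int[mu]_(x in `[a, b]) f x = F b - F a.
Proof.
rewrite le_eqVlt => /predU1P[-> _ _|ab dF cf].
  by rewrite set_itv1 Rintegral_set1 subrr.
have cF x : a <= x <= b -> {for x, continuous F}.
  by move=> /dF; exact: is_derive_cts.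
rewrite /Rintegral (@continuous_FTC2 _ f F)//.
- by apply: within_cts => x /=; rewrite in_itv /=; exact: cf.
- split.
  + by move=> x; rewrite in_itv/= => /andP[ax xb]; case: (dF x _); rewrite // !ltW.
  + by apply: cvg_at_right_filter; apply: cF; rewrite lexx ltW.
  + by apply: cvg_at_left_filter; apply: cF; rewrite lexx ltW.
- move=> x; rewrite in_itv/= => /andP[ax xb]; rewrite derive1E.
  have h : a <= x <= b by rewrite !ltW.
  by have := dF x h => d; rewrite derive_val.
Qed.

(** Dominated convergence for [f] cut off by the indicator of [A n]. *)
Lemma RI_exhaust (A : nat -> set R) D f : measurable D ->
  (forall n, measurable (A n)) -> (forall n, A n `<=` D) ->
  (forall x, D x -> \forall n \near \oo, A n x) -> itg D f ->
  \int[mu]_(x in A n) f x @[n --> \oo] --> \int[mu]_(x in D) f x.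
Proof.
move=> mD mA AD cA fi.
have mf := itg_meas fi.
pose S n x := f x * \1_(A n) x.
have mS n : measurable_fun D (S n).
  by apply: measurable_funM => //; exact: measurable_indic.
have cS x : D x -> S ^~ x @ \oo --> f x.
  move=> Dx; apply: cvg_near_cst; near=> n.
  rewrite /S indicE mem_set ?mulr1//; near: n; exact: cA.
have bS n x : D x -> `|S n x| <= `|f x|.
  by move=> Dx; rewrite /S indicE; case: (x \in A n); rewrite ?mulr1// mulr0 normr0.
have [_ _] := itg_dct mD mS cS bS (itg_norm mD fi).
rewrite (_ : (fun n => _) = (fun n => \int[mu]_(x in A n) f x)) //.
apply/funext => n; rewrite /S -[in RHS](setIidr (AD n)).
rewrite Rintegral_mkcondr; apply: eq_RI => x Dx.
by rewrite patchE indicE; case: (x \in A n); rewrite ?mulr1 ?mulr0.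
Unshelve. all: by end_near. Qed.

Lemma near_nat_ge (x : R) : \forall n \near \oo, x <= n%:R.
Proof. exact: nbhs_infty_ger. Qed.

(** The integrand may change sign, so integrability is assumed and the half-line is exhausted by the
    segments from a to a + n. *)
Lemma ftcy (F f : R -> R) (a l : R) :
  (forall x, a <= x -> is_derive x 1 F (f x)) ->
  (forall x, a <= x -> {for x, continuous f}) ->
  itg `[a, +oo[ f -> F x @[x --> +oo] --> l ->
  \int[mu]_(x in `[a, +oo[) f x = l - F a.
Proof.
move=> dF cf fi Fl.
have h : \int[mu]_(x in `[a, a + n%:R]) f x @[n --> \oo] -->
    \int[mu]_(x in `[a, +oo[) f x.
  apply: (@RI_exhaust (fun n => `[a, a + n%:R]%classic)) => //.
    by move=> n x /=; rewrite !in_itv/= => /andP[-> _].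
  move=> x; rewrite /= in_itv/= andbT => ax.
  near=> n; rewrite in_itv/= ax /= -lerBlDl; near: n; exact: near_nat_ge.
apply: (cvg_unique _ h) => //.
rewrite (_ : (fun n => _) = (fun n => F (a + n%:R) - F a)); last first.
  apply/funext => n; apply: ftc.
  - by rewrite lerDl.
  - by move=> x /andP[ax _]; exact: dF.
  - by move=> x /andP[ax _]; exact: cf.
apply: cvgB; last exact: cvg_cst.
apply: (@cvg_comp _ _ _ (fun n => a + n%:R) F \oo (+oo%R)) => //.
apply/cvgryPge => M; near=> n; rewrite -lerBlDl; near: n; exact: near_nat_ge.
Unshelve. all: by end_near. Qed.

(* Change of variables on an exhaustion: integrability is transported by the
   same formula applied to the absolute values. *)
Lemma RI_change (A B : nat -> set R) D E f g :
  measurable D -> measurable E ->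
  (forall n, measurable (A n)) -> (forall n, measurable (B n)) ->
  nondecreasing_seq A -> nondecreasing_seq B ->
  \bigcup_n A n = D -> \bigcup_n B n = E ->
  measurable_fun D g -> itg E f ->
  (forall n, \int[mu]_(x in B n) (f x)%:E = \int[mu]_(x in A n) (g x)%:E)%E ->
  (forall n, \int[mu]_(x in B n) (`|f x|)%:E = \int[mu]_(x in A n) (`|g x|)%:E)%E ->
  itg D g /\ \int[mu]_(x in E) f x = \int[mu]_(x in D) g x.
Proof.
move=> mD mE mA mB ndA ndB AD BE mg fi fg fga.
have AsD n : A n `<=` D by rewrite -AD; exact: bigcup_sup.
have BsE n : B n `<=` E by rewrite -BE; exact: bigcup_sup.
have cvgabs (X : nat -> set R) Y (h : R -> R) : (forall n, measurable (X n)) ->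
    nondecreasing_seq X -> \bigcup_n X n = Y -> measurable_fun Y h ->
    (\int[mu]_(x in X n) `|h x|%:E @[n --> \oo] --> \int[mu]_(x in Y) `|h x|%:E)%E.
  move=> mX ndX XY mh; rewrite -XY.
  have := @ge0_nondecreasing_set_cvg_integral _ (measurableTypeR R) R X (fun x => `|h x|%:E) mu.
  apply => //.
  move=> n; apply/measurable_EFinP; apply: measurableT_comp => //.
  apply: measurable_funS mh => //; rewrite -XY.
    exact: bigcupT_measurable.
  exact: bigcup_sup.
have mf := itg_meas fi.
have eqabs : (\int[mu]_(x in E) `|f x|%:E = \int[mu]_(x in D) `|g x|%:E)%E.
  have h1 := cvgabs B E f mB ndB BE mf.
  have h2 := cvgabs A D g mA ndA AD mg.
  apply: (cvg_unique _ h1) => //.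
  by have -> : (fun n => \int[mu]_(x in B n) `|f x|%:E)%E =
    (fun n => \int[mu]_(x in A n) `|g x|%:E)%E by apply/funext.
have gi : itg D g.
  apply/integrableP; split; first exact/measurable_EFinP.
  by move: fi => /integrableP[_]; rewrite /= eqabs.
split => //.
have near_in (X : nat -> set R) x : nondecreasing_seq X -> (\bigcup_n X n) x ->
    \forall n \near \oo, X n x.
  move=> ndX [n _ Xnx]; exists n => // m /= nm.
  by have /subsetPset := ndX _ _ nm; apply.
have h1 : \int[mu]_(x in B n) f x @[n --> \oo] --> \int[mu]_(x in E) f x.
  by apply: RI_exhaust => // x Ex; apply: near_in => //; rewrite BE.
have h2 : \int[mu]_(x in A n) g x @[n --> \oo] --> \int[mu]_(x in D) g x.
  by apply: RI_exhaust => // x Ex; apply: near_in => //; rewrite AD.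
apply: (cvg_unique _ h1) => //.
rewrite (_ : (fun n => _) = (fun n => \int[mu]_(x in A n) g x))//.
by apply/funext => n; rewrite /Rintegral fg.
Qed.

End FTC.

Notation dv f x d := (is_derive (x : Real.sort _) (1 : Real.sort _) (f : Real.sort _ -> Real.sort _) (d : Real.sort _)).

(** * Changes of variables on the positive half-line *)

Section Substitution.
Variable R : realType.
Notation mu := (@lebesgue_measure R).
Local Notation Rp := (`]0%R, +oo[%classic : set R).
Implicit Types (D : set R) (f g : R -> R).

(** Several functions below are singular or carry a junk value at 0, so continuity is asked at
    positive points only; it already gives measurability on the open half-line. *)
Definition cpos f := forall x : R, 0 < x -> {for x, continuous f}.

Lemma cpos_meas f : cpos f -> measurable_fun (`]0, +oo[ : set R) f.
Proof.
move=> cf; apply: open_continuous_measurable_fun; first exact: interval_open.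
by move=> x; rewrite inE/= in_itv/= andbT => /cf.
Qed.

Lemma cpos_norm f : cpos f -> cpos (fun x => `|f x|).
Proof. by move=> cf x x0; apply: continuous_comp; [exact: cf|exact: norm_continuous]. Qed.

Lemma is_derive_inv (x : R) : x != 0 -> dv (fun y : R => y^-1) x (- x ^- 2).
Proof. by move=> x0; apply: dv_eq (dvV x0 (dv_id x)); rewrite mulN1r. Qed.

(** Kept as an identity of extended integrals on segments, the form in which [RI_change] needs it
    for [f] and for its absolute value. *)
Lemma subst_inv f (a b : R) : 0 < a -> a <= b -> cpos f ->
  (\int[mu]_(x in `[b^-1%R, a^-1%R]) (f x)%:E =
   \int[mu]_(x in `[a, b]) (x ^- 2 * f x^-1)%R%:E)%E.
Proof.
move=> a0 ab cf.
have b0 : 0 < b by exact: lt_le_trans ab.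
have pos x : x \in `[a, b] -> 0 < x.
  by rewrite in_itv/= => /andP[ax _]; exact: lt_le_trans ax.
have dE x : 0 < x -> derive1 (fun y : R => y^-1) x = - x ^- 2.
  move=> x0; rewrite derive1E; have := @is_derive_inv x (lt0r_neq0 x0) => h.
  by rewrite derive_val.
have cd x : 0 < x -> {for x, continuous (fun y : R => - y ^- 2)}.
  move=> x0; apply: cvgN; apply: cvgV; first by rewrite expf_neq0// lt0r_neq0.
  exact: exprn_continuous.
have cdE x : 0 < x -> {for x, continuous (derive1 (fun y : R => y^-1))}.
  move=> x0; rewrite /prop_for /continuous_at (dE x x0).
  apply: cvg_trans (cd x x0); apply: near_eq_cvg.
  by near=> y; rewrite dE//; near: y; exact: lt_nbhsr.
rewrite (@integration_by_substitution_decreasing R (fun y => y^-1) f a b)//.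
- apply: eq_integral => x; rewrite inE/= => xab.
  change ((f x^-1 * - derive1 (fun y : R => y^-1) x)%:E =
          (x ^- 2 * f x^-1)%:E).
  by rewrite dE ?pos// opprK mulrC.
- by move=> x y xab yab xy; rewrite ltf_pV2// posrE pos.
- by move=> x xab; apply: cdE; apply: pos; exact: subset_itv_oo_cc.
- apply/cvg_ex; eexists; apply: cvg_at_right_filter; exact: cdE.
- apply/cvg_ex; eexists; apply: cvg_at_left_filter; exact: cdE.
- split.
  + move=> x xab; have := @is_derive_inv x => h.
    have /h [] // : x != 0 by rewrite lt0r_neq0// pos//; exact: subset_itv_oo_cc.
  + by apply: cvg_at_right_filter; apply: inv_continuous; rewrite lt0r_neq0.
  + by apply: cvg_at_left_filter; apply: inv_continuous; rewrite lt0r_neq0.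
- apply: within_cts => x; rewrite /= in_itv/= => /andP[bx _]; apply: cf.
  by apply: lt_le_trans bx; rewrite invr_gt0.
Unshelve. all: by end_near. Qed.

Lemma subst_scale f (k a b : R) : 0 < k -> 0 < a -> a <= b -> cpos f ->
  (\int[mu]_(x in `[(k * a)%R, (k * b)%R]) (f x)%:E =
   \int[mu]_(x in `[a, b]) (k * f (k * x))%R%:E)%E.
Proof.
move=> k0 a0 ab cf.
have d (x : R) : is_derive x 1 ( *%R k) k.
  exact: dv_lin.
have dE : derive1 ( *%R k) = cst k.
  by apply/funext => x; rewrite derive1E; have := d x => h; rewrite derive_val.
rewrite (@integration_by_substitution_increasing R ( *%R k) f a b)//.
- apply: eq_integral => x _.
  change ((f (k * x) * derive1 ( *%R k) x)%:E = (k * f (k * x))%:E).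
  by rewrite dE mulrC.
- by move=> x y _ _ xy; rewrite ltr_pM2l.
- by rewrite dE => x _; exact: cst_continuous.
- by rewrite dE; exact: is_cvg_cst.
- by rewrite dE; exact: is_cvg_cst.
- split.
  + by move=> x _; have [] := d x.
  + by apply: cvg_at_right_filter; have := d a; exact: is_derive_cts.
  + by apply: cvg_at_left_filter; have := d b; exact: is_derive_cts.
- apply: within_cts => x; rewrite /= in_itv/= => /andP[bx _]; apply: cf.
  by apply: lt_le_trans bx; rewrite mulr_gt0.
Qed.

Lemma cpos_inv f : cpos f -> cpos (fun x => x ^- 2 * f x^-1).
Proof.
move=> cf x x0; apply: cvgM.
  apply: cvgV; first by rewrite expf_neq0// lt0r_neq0.
  exact: exprn_continuous.
apply: (@continuous_comp _ _ _ (fun y : R => y^-1) f).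
  by apply: inv_continuous; rewrite lt0r_neq0.
by apply: cf; rewrite invr_gt0.
Qed.

Lemma cpos_scale f (k : R) : 0 < k -> cpos f -> cpos (fun x => k * f (k * x)).
Proof.
move=> k0 cf x x0; apply: cvgM; first exact: cvg_cst.
apply: (@continuous_comp _ _ _ (fun y : R => k * y) f).
  by have := dv_lin k x; exact: is_derive_cts.
by apply: cf; rewrite mulr_gt0.
Qed.

Let nd_cc (u v : nat -> R) : (forall m n, (m <= n)%N -> u n <= u m) ->
  (forall m n, (m <= n)%N -> v m <= v n) ->
  nondecreasing_seq (fun n => `[u n, v n]%classic).
Proof.
move=> hu hv m n mn; apply/subsetPset => x /=; rewrite !in_itv/= => /andP[ax xb].
by rewrite (le_trans (hu _ _ mn))//= (le_trans xb)// hv.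
Qed.

Let ndinv m n : (m <= n)%N -> n.+1%:R^-1 <= m.+1%:R^-1 :> R.
Proof. by move=> mn; rewrite lef_pV2// ?posrE// ler_nat. Qed.

Let exn (x : R) : exists n : nat, x <= n.+1%:R.
Proof.
have [n _ /(_ n (leqnn _)) /= h] := near_nat_ge x; exists n.
by apply: (le_trans h); rewrite ler_nat.
Qed.

Let bigcup_cc (c d : R) : 0 < c -> 0 < d ->
  \bigcup_n `[c * n.+1%:R^-1, d * n.+1%:R]%classic = Rp.
Proof.
move=> c0 d0; apply/seteqP; split => [x [n _]|x] /=; rewrite !in_itv/=.
  by move=> /andP[h _]; rewrite andbT; apply: lt_le_trans h; rewrite mulr_gt0.
rewrite andbT => x0.
have [n hn] := exn (x / d + c / x); exists n => //=; rewrite in_itv/=.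
have h1 : x / d <= n.+1%:R by apply: le_trans hn; rewrite lerDl divr_ge0// ltW.
have h2 : c / x <= n.+1%:R by apply: le_trans hn; rewrite lerDr divr_ge0// ltW.
by rewrite ler_pdivrMr// mulrC -ler_pdivrMr// h2 mulrC -ler_pdivrMr.
Qed.

Let bigcup_c1 : \bigcup_n `[n.+1%:R^-1, 1]%classic = `]0, 1]%classic :> set R.
Proof.
apply/seteqP; split => [x [n _]|x] /=; rewrite !in_itv/=.
  by move=> /andP[h ->]; rewrite andbT; apply: lt_le_trans h; rewrite invr_gt0.
move=> /andP[x0 x1]; have [n hn] := exn x^-1; exists n => //=.
by rewrite in_itv/= x1 andbT invf_ple// posrE.
Qed.

Let bigcup_1c : \bigcup_n `[1, n.+1%:R]%classic = `[1, +oo[%classic :> set R.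
Proof.
apply/seteqP; split => [x [n _]|x] /=; rewrite !in_itv/=; first by case/andP => ->.
by rewrite andbT => x1; have [n hn] := exn x; exists n => //=; rewrite in_itv/= x1.
Qed.

Lemma RI_scale f (k : R) : 0 < k -> cpos f -> itg Rp f ->
  itg Rp (fun x => k * f (k * x)) /\
  \int[mu]_(x in Rp) f x = \int[mu]_(x in Rp) (k * f (k * x)).
Proof.
move=> k0 cf fi.
have h n : n.+1%:R^-1 <= n.+1%:R :> R.
  by rewrite (@le_trans _ _ 1)// ?invf_le1// ?ler1n.
apply: (@RI_change _ (fun n => `[n.+1%:R^-1, n.+1%:R]%classic)
  (fun n => `[k * n.+1%:R^-1, k * n.+1%:R]%classic)) => //.
- by apply: nd_cc => [|m n mn]; [exact: ndinv|rewrite ler_nat].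
- by apply: nd_cc => m n mn; rewrite ler_pM2l//; [exact: ndinv|rewrite ler_nat].
- have := @bigcup_cc 1 1 ltr01 ltr01.
  by under eq_bigcupr do rewrite !mul1r.
- exact: bigcup_cc.
- by apply: cpos_meas; exact: cpos_scale.
- by move=> n; exact: subst_scale.
- move=> n; rewrite (subst_scale _ _ _ (cpos_norm cf))//.
  by apply: eq_integral => x _; rewrite normrM gtr0_norm.
Qed.

Lemma RI_inv f : cpos f -> itg Rp f ->
  itg Rp (fun x => x ^- 2 * f x^-1) /\
  \int[mu]_(x in Rp) f x = \int[mu]_(x in Rp) (x ^- 2 * f x^-1).
Proof.
move=> cf fi.
have h n : n.+1%:R^-1 <= n.+1%:R :> R.
  by rewrite (@le_trans _ _ 1)// ?invf_le1// ?ler1n.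
have nd : nondecreasing_seq (fun n => `[n.+1%:R^-1, n.+1%:R : R]%classic).
  by apply: nd_cc => [|m n mn]; [exact: ndinv|rewrite ler_nat].
have bc : \bigcup_n `[n.+1%:R^-1, n.+1%:R]%classic = Rp.
  have := @bigcup_cc 1 1 ltr01 ltr01.
  by under eq_bigcupr do rewrite !mul1r.
apply: (@RI_change _ (fun n => `[n.+1%:R^-1, n.+1%:R]%classic)
  (fun n => `[n.+1%:R^-1, n.+1%:R]%classic)) => //.
- by apply: cpos_meas; exact: cpos_inv.
- move=> n; have i0 : 0 < n.+1%:R^-1 :> R by rewrite invr_gt0.
  by have := subst_inv i0 (h n) cf; rewrite invrK.
- move=> n; have i0 : 0 < n.+1%:R^-1 :> R by rewrite invr_gt0.
  have := subst_inv i0 (h n) (cpos_norm cf); rewrite invrK => ->.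
  by apply: eq_integral => x _; rewrite normrM ger0_norm// invr_ge0 sqr_ge0.
Qed.

Lemma RI_inv01 f : cpos f -> itg `[1, +oo[ f ->
  itg `]0, 1] (fun x => x ^- 2 * f x^-1) /\
  \int[mu]_(x in `[1, +oo[) f x = \int[mu]_(x in `]0, 1]) (x ^- 2 * f x^-1).
Proof.
move=> cf fi.
have h n : n.+1%:R^-1 <= 1 :> R by rewrite invf_le1// ler1n.
apply: (@RI_change _ (fun n => `[n.+1%:R^-1, 1]%classic)
  (fun n => `[1, n.+1%:R]%classic)) => //.
- by apply: nd_cc => [|m n mn]; [exact: ndinv|].
- by apply: nd_cc => // m n mn; rewrite ler_nat.
- apply: (measurable_funS _ _ (cpos_meas (cpos_inv cf))) => //.
  by move=> x /=; rewrite !in_itv/= => /andP[->].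
- move=> n; have i0 : 0 < n.+1%:R^-1 :> R by rewrite invr_gt0.
  by have := subst_inv i0 (h n) cf; rewrite invrK invr1.
- move=> n; have i0 : 0 < n.+1%:R^-1 :> R by rewrite invr_gt0.
  have := subst_inv i0 (h n) (cpos_norm cf); rewrite invrK invr1 => ->.
  by apply: eq_integral => x _; rewrite normrM ger0_norm// invr_ge0 sqr_ge0.
Qed.

Lemma RI_inv1y f : cpos f -> itg `]0, 1] f ->
  itg `[1, +oo[ (fun x => x ^- 2 * f x^-1) /\
  \int[mu]_(x in `]0, 1]) f x = \int[mu]_(x in `[1, +oo[) (x ^- 2 * f x^-1).
Proof.
move=> cf fi.
have h n : 1 <= n.+1%:R :> R by rewrite ler1n.
apply: (@RI_change _ (fun n => `[1, n.+1%:R]%classic)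
  (fun n => `[n.+1%:R^-1, 1]%classic)) => //.
- by apply: nd_cc => // m n mn; rewrite ler_nat.
- by apply: nd_cc => [|m n mn]; [exact: ndinv|].
- apply: (measurable_funS _ _ (cpos_meas (cpos_inv cf))) => //.
  by move=> x /=; rewrite !in_itv/= => /andP[x1 _]; rewrite andbT; apply: lt_le_trans x1.
- by move=> n; have := subst_inv ltr01 (h n) cf; rewrite invr1.
- move=> n; have := subst_inv ltr01 (h n) (cpos_norm cf); rewrite invr1 => ->.
  by apply: eq_integral => x _; rewrite normrM ger0_norm// invr_ge0 sqr_ge0.
Qed.

(* Weierstrass M-test on every ray [delta, +oo[. *)
Lemma cpos_series (f : nat -> R -> R) (F : R -> R) :
  (forall n, cpos (f n)) ->
  (forall x, 0 < x -> series (fun n => f n x) @ \oo --> F x) ->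
  (forall d, 0 < d -> exists2 M : nat -> R, cvgn (series M) &
     forall n x, d <= x -> `|f n x| <= M n) ->
  cpos F.
Proof.
move=> cf fF hM x x0.
have d0 : 0 < x / 2 by rewrite divr_gt0.
have [M cM fM] := hM _ d0.
have M0 n : 0 <= M n.
  by apply: le_trans (fM n x _) => //; rewrite ler_pdivrMr// ler_peMr// ?ler1n// ltW.
have tail n y : x / 2 <= y -> `|F y - series (fun k => f k y) n| <= limn (series M) - series M n.
  move=> y2; have y0 : 0 < y by exact: lt_le_trans y2.
  have h1 : `|series (fun k => f k y) m - series (fun k => f k y) n| @[m --> \oo] -->
    `|F y - series (fun k => f k y) n|.
    by apply: cvg_norm; apply: cvgB; [exact: fF|exact: cvg_cst].
  have h2 : series M m - series M n @[m --> \oo] --> limn (series M) - series M n.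
    by apply: cvgB => //; exact: cvg_cst.
  apply: (ler_cvg_to h1 h2); near=> m.
  have nm : (n <= m)%N by near: m; exact: nbhs_infty_ge.
  rewrite !sub_series_geq//; apply: (le_trans (ler_norm_sum _ _ _)).
  by apply: ler_sum => k _; exact: fM.
apply/cvgrPdist_lt => e e0.
have [n hn] : exists n, limn (series M) - series M n < e / 3.
  have e3 : 0 < e / 3 by rewrite divr_gt0.
  have /cvgrPdist_lt/(_ _ e3) [n _ /(_ n (leqnn n)) /=] : series M @ \oo --> limn (series M) by [].
  by move=> h; exists n; apply: le_lt_trans h; exact: ler_norm.
have cS : {for x, continuous (fun y => series (fun k => f k y) n)}.
  rewrite /prop_for /continuous_at /series /=.
  elim: n {hn} => [|n IH].
    rewrite (_ : (fun y => _) = fun=> 0); last by apply/funext => y; rewrite big_geq.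
    by rewrite big_geq//; exact: cvg_cst.
  rewrite (_ : (fun y => _) = (fun y => \sum_(0 <= k < n) f k y + f n y)); last first.
    by apply/funext => y; rewrite big_nat_recr.
  by rewrite big_nat_recr//=; apply: cvgD => //; exact: cf.
have e3 : 0 < e / 3 by rewrite divr_gt0.
have /cvgrPdist_lt/(_ _ e3) cSx := cS.
near=> y.
have y2 : x / 2 <= y.
  rewrite ltW//; near: y; apply: lt_nbhsr => //.
  by rewrite ltr_pdivrMr// ltr_pMr// ltr1n.
have x2 : x / 2 <= x by rewrite ler_pdivrMr// ler_peMr// ?ler1n// ltW.
have t1 := tail n x x2; have t2 := tail n y y2.
have t3 : `|series (fun k => f k x) n - series (fun k => f k y) n| < e / 3 by near: y.
have -> : F x - F y = (F x - series (fun k => f k x) n) +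
  (series (fun k => f k x) n - series (fun k => f k y) n) -
  (F y - series (fun k => f k y) n) by ring.
apply: le_lt_trans (ler_normB _ _) _.
apply: le_lt_trans (lerD (ler_normD _ _) (lexx _)) _.
lra.
Unshelve. all: by end_near. Qed.

End Substitution.

(** * Integrals of exponentials against sines, cosines and powers *)

Section ExpIntegrals.
Variable R : realType.
Notation mu := (@lebesgue_measure R).
Local Notation Rp := (`]0%R, +oo[%classic : set R).
Implicit Types (f g : R -> R).

(** With rate [lam] and argument n x this is q^n at the point i x / N. Rate and argument play
    symmetric roles, and factors are moved freely from one to the other. *)
Definition ee (l x : R) : R := expR (- (l * x)).

Lemma ee_gt0 (l x : R) : 0 < ee l x. Proof. exact: expR_gt0. Qed.

Lemma ee_ge0 (l x : R) : 0 <= ee l x. Proof. exact: expR_ge0. Qed.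

Lemma dv_ee (l x : R) : dv (ee l) x (- l * ee l x).
Proof.
apply: dv_eq (dv_exp (dvN (dv_lin l x))).
by rewrite mulrC.
Qed.

Lemma ee0 (l : R) : ee l 0 = 1. Proof. by rewrite /ee mulr0 oppr0 expR0. Qed.

Lemma eeD (l x y : R) : ee l (x + y) = ee l x * ee l y.
Proof. by rewrite /ee mulrDr opprD expRD. Qed.

Lemma ee_le1 (l x : R) : 0 <= l -> 0 <= x -> ee l x <= 1.
Proof. by move=> l0 x0; rewrite /ee expR_le1 oppr_le0 mulr_ge0. Qed.

Lemma ee_lt1 (l x : R) : 0 < l -> 0 < x -> ee l x < 1.
Proof. by move=> l0 x0; rewrite /ee expR_lt1 oppr_lt0 mulr_gt0. Qed.

Lemma ee_scale (l k x : R) : ee l (k * x) = ee (l * k) x.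
Proof. by rewrite /ee mulrA. Qed.

Lemma ee_nat (l x : R) n : ee l (n%:R * x) = ee l x ^+ n.
Proof.
rewrite /ee -expRM_natl; congr expR.
by rewrite mulrN mulrCA.
Qed.

Lemma ee_decr (l x y : R) : 0 <= l -> x <= y -> ee l y <= ee l x.
Proof. by move=> l0 xy; rewrite ler_expR lerN2 ler_wpM2l. Qed.

Lemma ee_cvg0 (l : R) : 0 < l -> ee l x @[x --> +oo] --> (0 : R).
Proof.
move=> l0; apply: (@cvg_comp _ _ _ (fun x => l * x) (fun x => expR (- x)) _ (+oo)).
  apply/cvgryPge => M; near=> x.
  by rewrite mulrC -ler_pdivrMr//; near: x; exact: nbhs_pinfty_ge.
apply/cvgr0Pnorm_lt => e e0; near=> x.
rewrite ger0_norm ?expR_ge0// -[e]lnK ?posrE// ltr_expR ltrNl.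
by near: x; apply: nbhs_pinfty_gt; exact: num_real.
Unshelve. all: by end_near. Qed.

Lemma bounded_cvg0 (f g : R -> R) (C : R) : (forall x, 0 <= x -> `|f x| <= C * g x) ->
  g x @[x --> +oo] --> (0 : R) -> f x @[x --> +oo] --> (0 : R).
Proof.
move=> fg g0; have Cg0 : C * g x @[x --> +oo] --> (0 : R).
  by rewrite -[X in _ --> X](mulr0 C); apply: cvgM => //; exact: cvg_cst.
apply/norm_cvg0P; apply: (@squeeze_cvgr _ _ _ _ (fun=> 0) (fun x => C * g x)) => //; last exact: cvg_cst.
by near=> x; rewrite normr_ge0 fg.
Unshelve. all: by end_near. Qed.

Lemma cts_meas f : continuous f -> measurable_fun Rp f.
Proof. by move=> cf; apply: cpos_meas => x _; exact: cf. Qed.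

Lemma cts_measT D f : continuous f -> measurable_fun (D : set R) f.
Proof. by move=> cf; apply: measurable_funTS; exact: continuous_measurable_fun. Qed.

Lemma itg_cy f (a : R) : measurable_fun `]a, +oo[ f ->
  itg `[a, +oo[ f <-> itg `]a, +oo[ f.
Proof.
move=> mf; split => h.
  by apply: (itgS _ _ _ h) => // x /=; rewrite !in_itv/= !andbT => /ltW.
have mf' : measurable_fun `[a, +oo[ f by apply/measurable_fun_itv_obnd_cbndP.
apply/integrableP; split; first exact/measurable_EFinP.
rewrite -integral_itv_obnd_cbnd; first by case/integrableP : h.
by apply/measurable_EFinP; apply: measurableT_comp.
Qed.

Lemma RI_cy f (a : R) : itg `]a, +oo[ f ->
  \int[mu]_(x in `[a, +oo[) f x = \int[mu]_(x in `]a, +oo[) f x.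
Proof. by move=> fi; rewrite Rintegral_itv_obnd_cbnd. Qed.

Lemma ftc0y (F f : R -> R) (l : R) :
  (forall x, 0 <= x -> dv F x (f x)) ->
  (forall x, 0 <= x -> {for x, continuous f}) ->
  itg Rp f -> F x @[x --> +oo] --> l ->
  \int[mu]_(x in Rp) f x = l - F 0.
Proof.
move=> dF cf fi Fl; rewrite -RI_cy// (@ftcy _ F f 0 l)//.
by apply/itg_cy => //; exact: itg_meas fi.
Qed.

Lemma itg_ee (l : R) : 0 < l -> itg Rp (ee l).
Proof.
move=> l0; apply: (itgS (D := `[0, +oo[)) => //.
  by move=> x /=; rewrite !in_itv/= !andbT => /ltW.
have ce : continuous (ee l) by move=> x; have := dv_ee l x; exact: is_derive_cts.
have dF x : dv (fun y => - l^-1 * ee l y) x (ee l x).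
  apply: dv_eq (dvZ _ (dv_ee l x)).
  by rewrite mulrA mulrNN mulVf ?mul1r// lt0r_neq0.
apply/integrableP; split; first by apply/measurable_EFinP; exact: cts_measT.
under eq_integral do rewrite /= ger0_norm ?ee_ge0//.
rewrite (@ge0_continuous_FTC2y _ _ (fun y => - l^-1 * ee l y) 0 0).
- exact: ltry.
- by move=> x _; exact: ee_ge0.
- by apply: within_cts => x _; exact: ce.
- rewrite -[X in _ --> X](mulr0 (- l^-1)); apply: cvgM; first exact: cvg_cst.
  exact: ee_cvg0.
- by move=> x _; have [] := dF x.
- by apply: cvg_at_right_filter; have := dF 0; exact: is_derive_cts.
- by move=> x _; rewrite derive1E; have := dF x => h; rewrite derive_val.
Qed.

Lemma itg_bee f (C l : R) : 0 < l -> measurable_fun Rp f ->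
  (forall x, 0 < x -> `|f x| <= C * ee l x) -> itg Rp f.
Proof.
move=> l0 mf fC; apply: (itg_le _ mf (g := fun x => C * ee l x)) => //.
  by move=> x /=; rewrite in_itv/= andbT; exact: fC.
by apply: itgZ => //; exact: itg_ee.
Qed.

Lemma RI_ee (l : R) : 0 < l -> \int[mu]_(x in Rp) ee l x = l^-1.
Proof.
move=> l0.
have dF x : dv (fun y => - l^-1 * ee l y) x (ee l x).
  apply: dv_eq (dvZ _ (dv_ee l x)).
  by rewrite mulrA mulrNN mulVf ?mul1r// lt0r_neq0.
have ci x : {for x, continuous (ee l)} by have := dv_ee l x; exact: is_derive_cts.
rewrite (@ftc0y _ _ 0 (fun x _ => dF x) (fun x _ => ci x)).
- by rewrite ee0 sub0r mulr1 opprK.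
- exact: itg_ee.
- rewrite -[X in _ --> X](mulr0 (- l^-1)); apply: cvgM; first exact: cvg_cst.
  exact: ee_cvg0.
Qed.

Lemma RI_bee f (C l : R) : 0 < l -> measurable_fun Rp f ->
  (forall x, 0 < x -> `|f x| <= C * ee l x) -> `|\int[mu]_(x in Rp) f x| <= C / l.
Proof.
move=> l0 mf fC; rewrite -(RI_ee l0) -RIZ//; last exact: itg_ee.
apply: RI_le => //; first by move=> x /=; rewrite in_itv/= andbT; exact: fC.
by apply: itgZ => //; exact: itg_ee.
Qed.

Lemma cts_cosM (k : R) f : continuous f -> continuous (fun x => cos (k * x) * f x).
Proof.
move=> cf x; apply: cvgM; last exact: cf.
by have := dv_cos (dv_lin k x); exact: is_derive_cts.
Qed.

Lemma cts_sinM (k : R) f : continuous f -> continuous (fun x => sin (k * x) * f x).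
Proof.
move=> cf x; apply: cvgM; last exact: cf.
by have := dv_sin (dv_lin k x); exact: is_derive_cts.
Qed.

Lemma cosM_le (u y : R) : `|cos u * y| <= `|y|.
Proof. by rewrite normrM ler_piMl// cos_max. Qed.

Lemma sinM_le (u y : R) : `|sin u * y| <= `|y|.
Proof. by rewrite normrM ler_piMl// sin_max. Qed.

Lemma cts_ee (l : R) : continuous (ee l).
Proof. by move=> x; have := dv_ee l x; exact: is_derive_cts. Qed.

Lemma den_gt0 (l k : R) : 0 < l -> 0 < l ^+ 2 + k ^+ 2.
Proof. by move=> l0; rewrite ltr_pwDl ?exprn_gt0 ?sqr_ge0. Qed.

Lemma RI_cos_ee (k l : R) : 0 < l ->
  \int[mu]_(x in Rp) (cos (k * x) * ee l x) = l / (l ^+ 2 + k ^+ 2).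
Proof.
move=> l0; have d0 := den_gt0 k l0; set d := _ + _ in d0 *.
(* The real part of the antiderivative of e^((i k - l) x); its imaginary part serves for the
   sine. *)
pose F x := d^-1 * ((k * sin (k * x) - l * cos (k * x)) * ee l x).
have dF x : dv F x (cos (k * x) * ee l x).
  apply: dv_eq (dvZ _ (dvM (dvB (dvZ k (dv_sin (dv_lin k x))) (dvZ l (dv_cos (dv_lin k x)))) (dv_ee l x))).
  apply: (mulfI (lt0r_neq0 d0)); rewrite [LHS]mulrA mulfV ?lt0r_neq0// mul1r /d; ring.
have ci : continuous (fun x => cos (k * x) * ee l x) by apply: cts_cosM; exact: cts_ee.
rewrite (@ftc0y _ _ 0 (fun x _ => dF x) (fun x _ => ci x)).
- by rewrite /F !mulr0 sin0 cos0 ee0 /d; field; rewrite lt0r_neq0.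
- apply: (itg_bee l0 (C := 1)); first exact: cts_meas.
  by move=> x _; rewrite mul1r (le_trans (cosM_le _ _))// ger0_norm ?ee_ge0.
- apply: (bounded_cvg0 (C := d^-1 * (`|k| + `|l|)) _ (ee_cvg0 l0)) => x _.
  rewrite normrM gtr0_norm ?invr_gt0// -mulrA ler_wpM2l// ?invr_ge0 ?(ltW d0)//.
  rewrite normrM (ger0_norm (ee_ge0 _ _)) ler_wpM2r ?ee_ge0//.
  by apply: (le_trans (ler_normB _ _)); rewrite lerD// normrM ler_piMr// ?sin_max ?cos_max.
Qed.

Lemma RI_sin_ee (k l : R) : 0 < l ->
  \int[mu]_(x in Rp) (sin (k * x) * ee l x) = k / (l ^+ 2 + k ^+ 2).
Proof.
move=> l0; have d0 := den_gt0 k l0; set d := _ + _ in d0 *.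
pose F x := d^-1 * ((- k * cos (k * x) - l * sin (k * x)) * ee l x).
have dF x : dv F x (sin (k * x) * ee l x).
  apply: dv_eq (dvZ _ (dvM (dvB (dvZ (- k) (dv_cos (dv_lin k x))) (dvZ l (dv_sin (dv_lin k x)))) (dv_ee l x))).
  apply: (mulfI (lt0r_neq0 d0)); rewrite [LHS]mulrA mulfV ?lt0r_neq0// mul1r /d; ring.
have ci : continuous (fun x => sin (k * x) * ee l x) by apply: cts_sinM; exact: cts_ee.
rewrite (@ftc0y _ _ 0 (fun x _ => dF x) (fun x _ => ci x)).
- by rewrite /F !mulr0 sin0 cos0 ee0 /d; field; rewrite lt0r_neq0.
- apply: (itg_bee l0 (C := 1)); first exact: cts_meas.
  by move=> x _; rewrite mul1r (le_trans (sinM_le _ _))// ger0_norm ?ee_ge0.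
- apply: (bounded_cvg0 (C := d^-1 * (`|k| + `|l|)) _ (ee_cvg0 l0)) => x _.
  rewrite normrM gtr0_norm ?invr_gt0// -mulrA ler_wpM2l// ?invr_ge0 ?(ltW d0)//.
  rewrite normrM (ger0_norm (ee_ge0 _ _)) ler_wpM2r ?ee_ge0//.
  by apply: (le_trans (ler_normB _ _)); rewrite lerD// normrM ?normrN ler_piMr// ?sin_max ?cos_max.
Qed.

(* From [y <= exp y] with [y = l x / 2]. *)
Lemma xee_le (l x : R) : 0 < l -> 0 <= x -> x * ee l x <= 2 / l * ee (l / 2) x.
Proof.
move=> l0 x0.
have -> : ee l x = ee (l / 2) x * ee (l / 2) x.
  by rewrite /ee -expRD; congr expR; field.
rewrite mulrA ler_wpM2r ?ee_ge0//.
have h : l / 2 * x <= expR (l / 2 * x) by apply: le_trans (expR_ge1Dx _); rewrite lerDr.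
have e1 : ee (l / 2) x * expR (l / 2 * x) = 1 by rewrite /ee -expRD addNr expR0.
have : ee (l / 2) x * (l / 2 * x) <= 1 by rewrite -[leRHS]e1 ler_wpM2l ?ee_ge0.
rewrite ler_pdivlMr//; lra.
Qed.

Lemma RI_x_ee (l : R) : 0 < l ->
  itg Rp (fun x : R => x * ee l x) /\ \int[mu]_(x in Rp) (x * ee l x) = l ^- 2.
Proof.
move=> l0; have l20 : 0 < l / 2 by rewrite divr_gt0.
have ci : continuous (fun x : R => x * ee l x).
  by move=> x; apply: cvgM; [exact: cvg_id|exact: cts_ee].
have ii : itg Rp (fun x : R => x * ee l x).
  apply: (itg_bee l20 (C := 2 / l)); first exact: cts_meas.
  by move=> x x0; rewrite ger0_norm ?xee_le ?mulr_ge0 ?ee_ge0 ?ltW.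
split => //.
pose F x := - l^-1 * (x * ee l x) - l^-1 ^+ 2 * ee l x.
have dF x : dv F x (x * ee l x).
  apply: dv_eq (dvB (dvZ _ (dvM (dv_id x) (dv_ee l x))) (dvZ _ (dv_ee l x))).
  by field; rewrite lt0r_neq0.
rewrite (@ftc0y _ _ 0 (fun x _ => dF x) (fun x _ => ci x))//.
- by rewrite /F mul0r mulr0 ee0 exprVn; ring.
- apply: (bounded_cvg0 (C := l^-1 * (2 / l) + l^-1 ^+ 2) _ (ee_cvg0 l20)) => x x0.
  rewrite mulrDl; apply: (le_trans (ler_normB _ _)); apply: lerD.
    have li : 0 < l^-1 by rewrite invr_gt0.
    rewrite normrM normrN (gtr0_norm li) -[leRHS]mulrA ler_wpM2l ?(ltW li)//.
    by rewrite ger0_norm ?mulr_ge0 ?ee_ge0// xee_le.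
  rewrite normrM !ger0_norm ?ee_ge0 ?exprn_ge0 ?invr_ge0 ?(ltW l0)//.
  rewrite ler_wpM2l ?exprn_ge0 ?invr_ge0 ?(ltW l0)//.
  rewrite /ee ler_expR lerN2 ler_wpM2r//; lra.
Qed.

End ExpIntegrals.

(** * The Fourier series of B2 *)

Section Series.
Variable R : realType.
Implicit Types (u v M : nat -> R).

Lemma series_abs_cvg u M : (forall n, `|u n| <= M n) -> cvgn (series M) ->
  cvgn (series u).
Proof.
move=> uM cM; apply: normed_cvg; apply: series_le_cvg cM => n //=.
by apply: le_trans (uM n).
Qed.

Lemma lim_series_lee u v : (forall n, u n <= v n) -> cvgn (series u) ->
  cvgn (series v) -> limn (series u) <= limn (series v).
Proof.
move=> uv cu cv; apply: ler_lim => //; near=> n.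
by rewrite /series /=; apply: ler_sum.
Unshelve. all: by end_near. Qed.

Lemma series_tail u M (l : R) n : (forall k, `|u k| <= M k) -> cvgn (series M) ->
  series u @ \oo --> l -> `|l - series u n| <= limn (series M) - series M n.
Proof.
move=> uM cM cu.
have h1 : `|series u m - series u n| @[m --> \oo] --> `|l - series u n|.
  by apply: cvg_norm; apply: cvgB; [exact: cu|exact: cvg_cst].
have h2 : series M m - series M n @[m --> \oo] --> limn (series M) - series M n.
  by apply: cvgB => //; exact: cvg_cst.
apply: (ler_cvg_to h1 h2); near=> m.
have nm : (n <= m)%N by near: m; exact: nbhs_infty_ge.
rewrite !sub_series_geq//; apply: (le_trans (ler_norm_sum _ _ _)).
by apply: ler_sum => k _; exact: uM.
Unshelve. all: by end_near. Qed.

Lemma cvg_small_tail M (e : R) : cvgn (series M) -> 0 < e ->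
  exists n, limn (series M) - series M n < e.
Proof.
move=> cM e0.
have /cvgrPdist_lt/(_ _ e0) [n _ /(_ n (leqnn n)) /=] : series M @ \oo --> limn (series M) by [].
by move=> h; exists n; apply: le_lt_trans h; exact: ler_norm.
Qed.

(** Tannery's theorem in diagonal form: the parameter [h] is also the length of the partial sum,
    which suits finite sums whose terms and length vary together. *)
Lemma tannery_lim (u : nat -> nat -> R) (v M : nat -> R) :
  (forall h j, `|u h j| <= M j) -> cvgn (series M) ->
  (forall j, u h j @[h --> \oo] --> v j) ->
  cvgn (series v) /\ series (u h) h @[h --> \oo] --> limn (series v).
Proof.
move=> uM cM uv.
have vM j : `|v j| <= M j.
  have h : `|u k j| @[k --> \oo] --> `|v j| by apply: cvg_norm.
  by apply: (cvgr_to_le h); near=> k; exact: uM.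
have cv : cvgn (series v) by exact: series_abs_cvg cM.
split=> //.
have M0 j : 0 <= M j by apply: le_trans (vM j).
apply/cvgrPdist_lt => e e0.
have e3 : 0 < e / 3 by rewrite divr_gt0.
have [m hm] := cvg_small_tail cM e3.
have c1 : series (u h) m @[h --> \oo] --> series v m.
  elim: m {hm} => [|m IH].
    rewrite /series /= big_geq//; under eq_fun do rewrite big_geq//.
    exact: cvg_cst.
  rewrite (_ : (fun h => _) = (fun h => series (u h) m + u h m)); last first.
    by apply/funext => h; rewrite seriesSr.
  by rewrite seriesSr; apply: cvgD.
have /cvgrPdist_lt/(_ _ e3) c1e := c1.
have t1 := series_tail m vM cM cv.
near=> h.
have mh : (m <= h)%N by near: h; exact: nbhs_infty_ge.
have h1 : `|series v m - series (u h) m| < e / 3 by near: h.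
have h2 : `|series (u h) h - series (u h) m| <= limn (series M) - series M m.
  rewrite sub_series_geq//; apply: le_trans (ler_norm_sum _ _ _) _.
  apply: (@le_trans _ _ (series M h - series M m)).
    by rewrite sub_series_geq//; apply: ler_sum.
  rewrite lerB//; apply: nondecreasing_cvgn_le => //.
  by apply: nondecreasing_series.
have -> : limn (series v) - series (u h) h = (limn (series v) - series v m) +
  (series v m - series (u h) m) - (series (u h) h - series (u h) m) by ring.
apply: le_lt_trans (ler_normB _ _) _.
apply: le_lt_trans (lerD (ler_normD _ _) (lexx _)) _.
lra.
Unshelve. all: by end_near. Qed.

Lemma tannery (u : nat -> nat -> R) (v M : nat -> R) (l : R) :
  (forall h j, `|u h j| <= M j) -> cvgn (series M) ->
  (forall j, u h j @[h --> \oo] --> v j) ->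
  series (u h) h @[h --> \oo] --> l -> series v @ \oo --> l.
Proof.
move=> uM cM uv ul; have [cv] := tannery_lim uM cM uv.
by move=> /(cvg_unique _ ul) ->.
Qed.

Lemma cvg_invsq : cvgn (series (fun k => (k.+1%:R ^+ 2)^-1 : R)).
Proof.
apply: (@series_le_cvg _ _ (fun k => 2 * (k.+1%:R^-1 - k.+2%:R^-1))) => [k|k|k|].
- by rewrite invr_ge0 sqr_ge0.
- by rewrite mulr_ge0// subr_ge0 lef_pV2// ?posrE// ler_nat.
- rewrite -subr_ge0 [X in 0 <= X](_ : _ = k%:R / (k.+1%:R ^+ 2 * k.+2%:R)); last first.
    rewrite -[k.+2]addn1 -[k.+1]addn1 !natrD.
    have h1 : k%:R + 1 != 0 :> R by rewrite natr1.
    have h2 : k%:R + 1 + 1 != 0 :> R by rewrite !natr1.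
    by field; rewrite h1 h2.
  by rewrite divr_ge0// mulr_ge0// sqr_ge0.
- rewrite (_ : series _ = (fun n => 2 * (1 - n.+1%:R^-1))).
    apply: is_cvgM; first exact: is_cvg_cst.
    apply: is_cvgB; first exact: is_cvg_cst.
    by apply/cvg_ex; exists 0; exact: cvg_harmonic.
  apply/funext => n; rewrite /series /= -big_distrr /=; congr (_ * _).
  elim: n => [|n IH]; first by rewrite big_geq// invr1 subrr.
  by rewrite big_nat_recr//= IH; ring.
Qed.

End Series.

Section Basel.
Variable R : realType.

Definition B2 (x : R) : R := x ^+ 2 - x + 6^-1.

Lemma sin_jn (n j : nat) : (0 < j < n)%N -> 0 < sin (pi * (j%:R / n%:R) : R).
Proof.
move=> /andP[j0 jn]; have n0 : (0 < n)%N by exact: leq_ltn_trans jn.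
apply: sin_gt0_pi; rewrite mulr_gt0 ?pi_gt0 ?divr_gt0 ?ltr0n//=.
by rewrite gtr_pMr ?pi_gt0// ltr_pdivrMr ?ltr0n// mul1r ltr_nat.
Qed.

(** Multiplying by sin (pi r / n) makes the sum telescope, and the two end points differ by a
    multiple of 2 pi. *)
Lemma cos_sum0 (n r : nat) : (0 < r < n)%N ->
  \sum_(0 <= j < n) cos (2 * pi * (j%:R * r%:R / n%:R)) = 0 :> R.
Proof.
move=> /andP[r0 rn].
have n0 : 0 < n%:R :> R by rewrite ltr0n (leq_ltn_trans _ rn).
set y : R := pi * (r%:R / n%:R).
have sy : 0 < sin y by apply: sin_jn; rewrite r0.
apply: (mulfI (lt0r_neq0 sy)); rewrite mulr0 big_distrr /=.
have -> : \sum_(0 <= j < n) sin y * cos (2 * pi * (j%:R * r%:R / n%:R)) =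
   \sum_(0 <= j < n) (sin ((2 * j.+1%:R - 1) * y) / 2 - sin ((2 * j%:R - 1) * y) / 2).
  apply: eq_bigr => j _.
  have -> : 2 * pi * (j%:R * r%:R / n%:R) = 2 * j%:R * y by rewrite /y; ring.
  have -> : (2 * j.+1%:R - 1) * y = 2 * j%:R * y + y by rewrite -natr1; ring.
  have -> : (2 * j%:R - 1) * y = 2 * j%:R * y - y by ring.
  by rewrite sinD sinB; field.
rewrite telescope_sumr//.
have -> : (2 * n%:R - 1) * y = - y + r%:R * (pi *+ 2).
  rewrite /y mulr2n; field; exact: lt0r_neq0.
have -> : (2 * 0%:R - 1) * y = - y by ring.
have -> : r%:R * (pi *+ 2) = (pi *+ 2) *+ r :> R by rewrite mulr_natl.
by rewrite (periodicn (@sinD2pi R)) subrr.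
Qed.

(** A finite model of the Fourier series of [B2], in which n sin (pi j / n) stands for pi j. Unlike
    the series, it can be evaluated by algebra. *)
Definition dsum (n r : nat) : R :=
  \sum_(1 <= j < n) cos (2 * pi * (j%:R * r%:R / n%:R)) / sin (pi * (j%:R / n%:R)) ^+ 2.

(** The second difference in r of the cosine is the cosine times - 4 sin^2, which cancels the
    denominator; what is left is the sum of [cos_sum0] without its term j = 0. *)
Lemma dsum_diff (n r : nat) : (0 < r < n)%N ->
  dsum n r.+1 - 2 * dsum n r + dsum n r.-1 = 4.
Proof.
move=> /andP[r0 rn]; have n0 : (0 < n)%N by exact: leq_ltn_trans rn.
have n1 : n%:R != 0 :> R by rewrite pnatr_eq0 -lt0n.
rewrite /dsum big_distrr /= -sumrB -big_split /=.
have S1 : \sum_(1 <= j < n) cos (2 * pi * (j%:R * r%:R / n%:R)) = - 1 :> R.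
  have : \sum_(0 <= j < n) cos (2 * pi * (j%:R * r%:R / n%:R)) = 0 :> R.
    by apply: cos_sum0; rewrite r0.
  rewrite big_ltn// mulr0n !mul0r mulr0 cos0; lra.
transitivity (\sum_(1 <= j < n) (- 4 * cos (2 * pi * (j%:R * r%:R / n%:R))) : R); last first.
  by rewrite -big_distrr /= S1; ring.
apply: eq_big_nat => j /sin_jn; set y := pi * _ => sy.
have sy0 : sin y != 0 by rewrite lt0r_neq0.
have -> : 2 * pi * (j%:R * r.+1%:R / n%:R) = 2 * pi * (j%:R * r%:R / n%:R) + y + y.
  by rewrite /y -natr1; ring.
have -> : 2 * pi * (j%:R * r.-1%:R / n%:R) = 2 * pi * (j%:R * r%:R / n%:R) - y - y.
  by rewrite /y -[in RHS](prednK r0) -natr1; ring.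
set x := 2 * pi * _.
rewrite -!addrA -opprD !cosD cosN sinN !cosD !sinD.
have h : cos y * cos y = 1 - sin y ^+ 2 by rewrite -expr2 cos2sin2.
have -> : cos x * (cos y * cos y - sin y * sin y) - sin x * (sin y * cos y + cos y * sin y) =
  cos x * (1 - 2 * sin y ^+ 2) - 2 * sin x * sin y * cos y by rewrite h; ring.
have -> : cos x * (cos y * cos y - sin y * sin y) - sin x * - (sin y * cos y + cos y * sin y) =
  cos x * (1 - 2 * sin y ^+ 2) + 2 * sin x * sin y * cos y by rewrite h; ring.
by field.
Qed.

(** A constant second difference makes [dsum n] quadratic in r on [0, n]; the periodicity
    [dsum n n = dsum n 0] then fixes the linear coefficient. *)
Lemma dsumE0 (n r : nat) : (0 < n)%N -> (r <= n)%N ->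
  dsum n r = dsum n 0 - 2 * r%:R * n%:R + 2 * r%:R ^+ 2.
Proof.
move=> n0.
pose c : R := dsum n 1 - dsum n 0 - 2.
have E m : (m <= n)%N -> dsum n m = dsum n 0 + c * m%:R + 2 * m%:R ^+ 2.
  elim/ltn_ind: m => -[_ _|[_ _|m IH mn]]; [by ring|by rewrite /c; ring|].
  have := @dsum_diff n m.+1; rewrite /= mn => /(_ isT).
  rewrite (IH m.+1) ?(IH m)//; [|lia..].
  by rewrite -[m.+2]addn2 -[m.+1]addn1 !natrD; lra.
have dn : dsum n n = dsum n 0.
  have n1 : n%:R != 0 :> R by rewrite pnatr_eq0 -lt0n.
  apply: eq_big_nat => j _; congr (_ / _).
  have -> : 2 * pi * (j%:R * n%:R / n%:R) = 0 + (pi *+ 2) *+ j :> R.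
    by rewrite -mulr_natl mulr2n; field.
  by rewrite (periodicn (@cosD2pi R)) mulr0n mulr0 mul0r mulr0.
have nn : n%:R != 0 :> R by rewrite pnatr_eq0 -lt0n.
have cE : c = - 2 * n%:R.
  apply: (mulIf nn); have := E n (leqnn n); rewrite dn; lra.
by move=> rn; rewrite E// cE; ring.
Qed.

Lemma dsum_sum (n : nat) : \sum_(0 <= r < n) dsum n r = 0.
Proof.
rewrite /dsum exchange_big_nat /= big_nat big1// => j /andP[j0 jn].
rewrite -big_distrl /=.
rewrite (eq_bigr (fun r => cos (2 * pi * (r%:R * j%:R / n%:R)))); last first.
  by move=> r _; rewrite [in RHS](mulrC r%:R).
by rewrite cos_sum0 ?j0// mul0r.
Qed.

(** The sum over a full period vanishes by [dsum_sum], and this determines the one constant that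
    [dsumE0] leaves open. *)
Lemma dsum0 (n : nat) : (0 < n)%N -> dsum n 0 = (n%:R ^+ 2 - 1) / 3.
Proof.
move=> n0; have nn : n%:R != 0 :> R by rewrite pnatr_eq0 -lt0n.
have S1 m : \sum_(0 <= r < m) (dsum n 0 - 2 * r%:R * n%:R + 2 * r%:R ^+ 2) =
  m%:R * dsum n 0 - m%:R * (m%:R - 1) * n%:R + m%:R * (m%:R - 1) * (2 * m%:R - 1) / 3.
  elim: m => [|m IH]; first by rewrite big_geq//; field.
  by rewrite big_nat_recr//= IH -natr1; field.
have := dsum_sum n; rewrite (eq_big_nat _ _ (F2 := fun r : nat => dsum n 0 - 2 * r%:R * n%:R + 2 * r%:R ^+ 2)); last first.
  by move=> r /andP[_ rn]; rewrite dsumE0// ltnW.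
rewrite S1 => h; apply: (mulfI nn); lra.
Qed.

(* [sin y >= cos 1 * y] on [0, 1] by the mean value theorem. *)
Lemma sin_lower : exists2 c : R, 0 < c & forall y : R, 0 <= y <= pi / 2 -> c * y <= sin y.
Proof.
exists (cos 1 / 2); first by rewrite divr_gt0 ?cos1_gt0.
move=> y /andP[y0 y2].
have c1 := @cos1_gt0 R.
have h (z : R) : 0 <= z <= 1 -> cos 1 * z <= sin z.
  move=> /andP[z0 z1].
  have := @MVT_segment R sin cos 0 z z0 (fun x _ => is_derive_sin x).
  have cs : {within `[0, z], continuous (@sin R)}.
    by apply: within_cts => x _; exact: continuous_sin.
  move=> /(_ cs) [w wz]; rewrite sin0 !subr0 => ->.
  rewrite ler_wpM2r//.
  move: wz; rewrite in_itv/= => /andP[w0 wz].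
  have w1 : w <= 1 by exact: le_trans z1.
  have [->//|wn1] := eqVneq w 1.
  rewrite ltW// ltr_cos ?in_itv/= ?ler01 ?w0 ?(le_trans _ (@pi_ge2 R)) ?ler1n//.
    by rewrite lt_neqAle wn1.
  by rewrite (le_trans w1)// ler1n.
(* Beyond 1 one has sin y >= sin 1 >= cos 1, and y <= pi / 2 < 2 accounts for the factor 1/2 in the
   constant. *)
have [y1|y1] := leP y 1.
  by apply: le_trans (h y _); [rewrite ler_wpM2r//; lra|rewrite y0].
have p2 := @pihalf_lt2 R.
have s1 : cos 1 <= sin 1 :> R by have := h 1; rewrite lexx ler01 mulr1; apply.
have p1 := @pihalf_ge1 R.
have sm : sin 1 <= sin y.
  rewrite ltW// ltr_sin// in_itv/=; apply/andP; split => //; lra.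
nra.
Qed.

Lemma cos_continuous_at (x : R) : {for x, continuous (@cos R)}.
Proof. exact: continuous_cos. Qed.

(** The limit of [dsumE0] divided by n^2 as r / n tends to b: the quadratic polynomial becomes
    [2 * B2 b] and n sin (pi j / n) tends to pi j. The bound of [sin_lower] allows the limit to be
    taken term by term with [tannery]. *)
Lemma cos_invsq (b : R) : 0 <= b <= 1 ->
  series (fun k => cos (2 * pi * (k.+1%:R * b)) / k.+1%:R ^+ 2) @ \oo -->
    pi ^+ 2 * B2 b.
Proof.
move=> /andP[b0 b1].
have pi0 := @pi_gt0 R.
(* An odd modulus: j -> n - j pairs the indices 1, ..., 2 h without fixed point, so the sum is twice
   its first h terms. *)
pose n h := h.*2.+1.
pose r h := Num.truncn (b * (n h)%:R).
have n0 h : 0 < (n h)%:R :> R by [].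
have rn h : (r h <= n h)%N.
  rewrite -(ler_nat R); apply: le_trans (_ : b * (n h)%:R <= _).
    by rewrite truncn_le ?mulr_ge0// ltW.
  by rewrite ler_piMl.
have rb h : `|(r h)%:R / (n h)%:R - b| <= (n h)%:R^-1.
  have h1 : (r h)%:R <= b * (n h)%:R by rewrite truncn_le ?mulr_ge0// ltW.
  have h2 : b * (n h)%:R < (r h)%:R + 1 by rewrite natr1 truncnS_gt.
  rewrite ler_norml !lerBrDr !lerBlDr ler_pdivrMr// ler_pdivlMr//.
  by apply/andP; split; rewrite mulrDl ?mulNr mulVf ?lt0r_neq0//; lra.
have ninv : (n h)%:R^-1 @[h --> \oo] --> (0 : R).
  apply: (@squeeze_cvgr _ _ _ _ (fun=> 0) (fun h => h.+1%:R^-1)).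
  - near=> h; rewrite invr_ge0 ler0n/= lef_pV2 ?posrE// ler_nat /n; lia.
  - exact: cvg_cst.
  - exact: cvg_harmonic.
have rbc : (r h)%:R / (n h)%:R @[h --> \oo] --> b.
  rewrite (_ : (fun h => _) = (fun h => (r h)%:R / (n h)%:R - b + b)); last first.
    by apply/funext => h; rewrite subrK.
  rewrite -[X in _ --> X]add0r; apply: cvgD; last exact: cvg_cst.
  apply/norm_cvg0P.
  apply: (@squeeze_cvgr _ _ _ _ (fun=> 0) (fun h => (n h)%:R^-1)) => //.
    by near=> h; rewrite normr_ge0 rb.
  exact: cvg_cst.
(* The derivative at 0 of x -> sin (y x), sampled along 1 / n. *)
have nsin (y : R) : (n h)%:R * sin (y * (n h)%:R^-1) @[h --> \oo] --> y.
  have d0 : dv (fun x => sin (y * x)) 0 y.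
    by apply: dv_eq (dv_sin (dv_lin y 0)); rewrite mulr0 cos0 mul1r.
  have [dd dy] := d0.
  have : (fun k : R => k^-1 * sin (y * k)) k @[k --> 0^'] --> y.
    rewrite -[X in _ --> X]dy; apply: cvg_trans dd; apply: near_eq_cvg.
    near=> k; rewrite /= addr0 mulr0 sin0 subr0.
    by rewrite /GRing.scale /= mulr1.
  move=> /(@cvg_comp _ _ _ (fun h => (n h)%:R^-1) _ \oo) H.
  have : (fun k : R => k^-1 * sin (y * k)) (n h)%:R^-1 @[h --> \oo] --> y.
    apply: H => A /= [e e0 eA].
    have /cvgr0Pnorm_lt/(_ _ e0) := ninv.
    apply: filterS => h /= he; apply: eA; first by rewrite /= sub0r normrN.
    by rewrite invr_eq0 lt0r_neq0.
  rewrite (_ : (fun h => _) = (fun h => (n h)%:R * sin (y * (n h)%:R^-1)))//.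
  by apply/funext => h; rewrite invrK.
have [c c0 hc] := sin_lower.
pose den h j : R := ((n h)%:R * sin (pi * j.+1%:R * (n h)%:R^-1)) ^+ 2.
(* Cut off at h because for j < h the angle pi (j + 1) / n is at most pi / 2, the range of
   [sin_lower]. *)
pose u h j := if (j < h)%N then
  2 * cos (2 * pi * (j.+1%:R * ((r h)%:R / (n h)%:R))) / den h j else 0.
pose v j := 2 * cos (2 * pi * (j.+1%:R * b)) / (pi * j.+1%:R) ^+ 2.
pose M (j : nat) := 2 / (c * pi) ^+ 2 * (j.+1%:R ^+ 2)^-1.
have cp0 : 0 < (c * pi) ^+ 2 by rewrite exprn_gt0// mulr_gt0.
have uM h j : `|u h j| <= M j.
  rewrite /u; case: ifP => jh; last first.
    by rewrite normr0 mulr_ge0 ?divr_ge0 ?invr_ge0 ?sqr_ge0.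
  have d1 : (c * pi * j.+1%:R) ^+ 2 <= den h j.
    rewrite /den ler_sqr ?nnegrE; last 2 first.
    - by rewrite !mulr_ge0// ltW.
    - rewrite mulr_ge0// ltW// -mulrA sin_jn// /n; lia.
    have := hc (pi * j.+1%:R * (n h)%:R^-1).
    rewrite mulr_ge0 ?mulr_ge0 ?(ltW pi0) ?invr_ge0//= => hh.
    have -> : c * pi * j.+1%:R = (n h)%:R * (c * (pi * j.+1%:R * (n h)%:R^-1)).
      by field; rewrite lt0r_neq0.
    rewrite ler_wpM2l//; apply: hh.
    rewrite ler_pdivrMr// mulrAC ler_pdivlMr// -mulrA ler_pM2l// -natrM ler_nat /n; lia.
  have dp : 0 < (c * pi * j.+1%:R) ^+ 2 by rewrite exprn_gt0// !mulr_gt0.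
  have dp' : 0 < den h j by exact: lt_le_trans d1.
  rewrite normrM normfV (gtr0_norm dp') normrM ger0_norm//.
  rewrite ler_pdivrMr//; apply: (@le_trans _ _ 2).
    by rewrite ler_piMr// cos_max.
  apply: le_trans (_ : M j * (c * pi * j.+1%:R) ^+ 2 <= _).
    rewrite /M le_eqVlt; apply/orP; left; apply/eqP.
    have := lt0r_neq0 pi0; move: (@pi R) => p p0; field.
    by rewrite nat1r pnatr_eq0 p0 lt0r_neq0.
  by rewrite ler_wpM2l// /M mulr_ge0 ?divr_ge0 ?invr_ge0 ?sqr_ge0.
have cM : cvgn (series M).
  rewrite (_ : M = 2 / (c * pi) ^+ 2 *: (fun j => (j.+1%:R ^+ 2)^-1)).
    by apply: is_cvg_seriesZ; exact: cvg_invsq.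
  by apply/funext => j; rewrite /M.
have uv j : u h j @[h --> \oo] --> v j.
  have : 2 * cos (2 * pi * (j.+1%:R * ((r h)%:R / (n h)%:R))) / den h j @[h --> \oo] --> v j.
    apply: cvgM.
      apply: cvgM; first exact: cvg_cst.
      apply: (@cvg_comp _ _ _ _ (@cos R) \oo (nbhs (2 * pi * (j.+1%:R * b)))).
        by apply: cvgM; [exact: cvg_cst|apply: cvgM; [exact: cvg_cst|exact: rbc]].
      exact: cos_continuous_at.
    apply: cvgV; first by rewrite expf_neq0// mulf_neq0// lt0r_neq0.
    apply: (@cvg_comp _ _ _ _ (fun x : R => x ^+ 2) \oo (nbhs (pi * j.+1%:R))).
      exact: nsin.
    exact: exprn_continuous.
  apply: cvg_trans; apply: near_eq_cvg; near=> h.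
  by rewrite /u ifT//; near: h; exact: nbhs_infty_gt.
have sumE h : series (u h) h = dsum (n h) (r h) / (n h)%:R ^+ 2.
  rewrite /series /=.
  have -> : \sum_(0 <= k < h) u h k = \sum_(0 <= k < h)
     2 * (cos (2 * pi * (k.+1%:R * (r h)%:R / (n h)%:R)) /
      sin (pi * (k.+1%:R / (n h)%:R)) ^+ 2) / (n h)%:R ^+ 2.
    apply: eq_big_nat => k /andP[_ kh]; rewrite /u kh /den -[pi * _ * _]mulrA.
    rewrite [k.+1%:R * (_ / _)]mulrA.
    have : sin (pi * (k.+1%:R / (n h)%:R)) != 0 :> R.
      by rewrite lt0r_neq0// sin_jn// /n; lia.
    have := lt0r_neq0 (n0 h); move: (cos _) (sin _) => C S.
    by move: ((n h)%:R : R) => m m0 S0; field; rewrite m0 S0.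
  rewrite -big_distrl -big_distrr /=; congr (_ / _).
  have hn : (h.+1 <= n h)%N by rewrite /n; lia.
  rewrite /dsum [RHS](big_cat_nat (n := h.+1))//=.
  have -> : \sum_(h.+1 <= j < n h) cos (2 * pi * (j%:R * (r h)%:R / (n h)%:R)) /
      sin (pi * (j%:R / (n h)%:R)) ^+ 2 = \sum_(0 <= k < h)
      (cos (2 * pi * (k.+1%:R * (r h)%:R / (n h)%:R)) /
      sin (pi * (k.+1%:R / (n h)%:R)) ^+ 2) :> R.
    rewrite -{1}[h.+1]add0n big_addn.
    have -> : (n h - h.+1 = h)%N by rewrite /n; lia.
    rewrite big_nat_rev /= add0n; apply: eq_big_nat => k /andP[_ kh].
    have -> : (h - k.+1 + h.+1 = n h - k.+1)%N by rewrite /n; lia.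
    have kn : (k.+1 <= n h)%N by rewrite /n; lia.
    rewrite natrB//; congr (_ / _ ^+ 2).
      have -> : 2 * pi * (((n h)%:R - k.+1%:R) * (r h)%:R / (n h)%:R) =
        - (2 * pi * (k.+1%:R * (r h)%:R / (n h)%:R)) + (pi *+ 2) *+ r h :> R.
        by rewrite -[_ *+ r h]mulr_natl mulr2n; field; rewrite lt0r_neq0.
      by rewrite (periodicn (@cosD2pi R)) cosN.
    have -> : pi * (((n h)%:R - k.+1%:R) / (n h)%:R) =
      - (pi * (k.+1%:R / (n h)%:R)) + pi :> R by field; rewrite lt0r_neq0.
    by rewrite sinDpi sinN opprK.
  by rewrite big_add1 /=; ring.
have lim : series (u h) h @[h --> \oo] --> 2 * B2 b.
  rewrite (_ : (fun h => _) = (fun h => (1 - (n h)%:R^-1 ^+ 2) / 3 -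
    2 * ((r h)%:R / (n h)%:R) + 2 * ((r h)%:R / (n h)%:R) ^+ 2)).
    have -> : 2 * B2 b = (1 - 0 ^+ 2) / 3 - 2 * b + 2 * b ^+ 2.
      by rewrite /B2; field.
    apply: cvgD; last first.
      apply: cvgM; first exact: cvg_cst.
      exact: (@cvg_comp _ _ _ _ (fun x : R => x ^+ 2) \oo (nbhs b) _ rbc (@exprn_continuous _ 2 b)).
    apply: cvgB; last by apply: cvgM; [exact: cvg_cst|exact: rbc].
    apply: cvgM; last exact: cvg_cst.
    apply: cvgB; first exact: cvg_cst.
    exact: (@cvg_comp _ _ _ _ (fun x : R => x ^+ 2) \oo (nbhs 0) _ ninv (@exprn_continuous _ 2 0)).
  apply/funext => h; rewrite sumE dsumE0// dsum0//.
  by field; rewrite lt0r_neq0.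
have tn := tannery uM cM uv lim.
have -> : pi ^+ 2 * B2 b = pi ^+ 2 / 2 * (2 * B2 b) by field.
rewrite (_ : series _ = (fun m => pi ^+ 2 / 2 * series v m)).
  by apply: cvgM => //; exact: cvg_cst.
apply/funext => m; rewrite /series /= big_distrr /=; apply: eq_bigr => k _.
have := lt0r_neq0 pi0; rewrite /v; move: (@pi R) => p p0; field.
by rewrite nat1r pnatr_eq0 p0.
Unshelve. all: by end_near. Qed.

End Basel.

(** * Poisson summation *)

Section Poisson.
Variable R : realType.
Notation mu := (@lebesgue_measure R).
Local Notation Rp := (`]0%R, +oo[%classic : set R).
Implicit Types (f g : R -> R).

Definition zeta2 : R := limn (series (fun k => (k.+1%:R ^+ 2)^-1 : R)).

(* The 1-periodic extension of [B2]. *)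
Definition P2 (x : R) : R :=
  limn (series (fun k => cos (2 * pi * (k.+1%:R * x)) / k.+1%:R ^+ 2)) / pi ^+ 2.

Lemma P2_term (x : R) k :
  `|cos (2 * pi * (k.+1%:R * x)) / k.+1%:R ^+ 2| <= (k.+1%:R ^+ 2)^-1.
Proof.
apply: (le_trans (cosM_le _ _)).
by rewrite ger0_norm// invr_ge0 sqr_ge0.
Qed.

Lemma P2_cvg (x : R) :
  series (fun k => cos (2 * pi * (k.+1%:R * x)) / k.+1%:R ^+ 2) @ \oo --> pi ^+ 2 * P2 x.
Proof.
rewrite /P2 [X in _ --> X]mulrC divfK ?expf_neq0 ?lt0r_neq0 ?pi_gt0//.
exact: (series_abs_cvg (P2_term x) (@cvg_invsq R)).
Qed.

Lemma P2_B2 (x : R) : 0 <= x <= 1 -> P2 x = B2 x.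
Proof.
move=> /cos_invsq h.
apply: (mulfI (expf_neq0 2 (lt0r_neq0 (@pi_gt0 R)))).
exact: (cvg_unique _ (@P2_cvg x) h).
Qed.

Lemma P2D1 (x : R) : P2 (x + 1) = P2 x.
Proof.
rewrite /P2; congr (_ / _); congr (limn (series _)); apply/funext => k; congr (_ / _).
have -> : 2 * pi * (k.+1%:R * (x + 1)) = 2 * pi * (k.+1%:R * x) + (pi *+ 2) *+ k.+1 :> R.
  by rewrite -[_ *+ k.+1]mulr_natl mulr2n; ring.
by rewrite (periodicn (@cosD2pi R)).
Qed.

Lemma P2Dn (x : R) n : P2 (x + n%:R) = P2 x.
Proof.
elim: n => [|n IH]; first by rewrite addr0.
by rewrite -natr1 addrA P2D1.
Qed.

Lemma P2_bound (x : R) : `|P2 x| <= zeta2 / pi ^+ 2.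
Proof.
rewrite normrM normfV (ger0_norm (sqr_ge0 _)) ler_wpM2r// ?invr_ge0 ?sqr_ge0//.
have i0 (k : nat) : 0 <= (k.+1%:R ^+ 2)^-1 :> R by rewrite invr_ge0 sqr_ge0.
have cn := @series_le_cvg R _ _ (fun k => normr_ge0 _) i0 (P2_term x) (@cvg_invsq R).
apply: le_trans (lim_series_norm cn) _.
by apply: lim_series_lee => //; [exact: P2_term|exact: cvg_invsq].
Qed.

(** The M-test of [cpos_series] concerns positive points only; periodicity carries continuity to the
    whole line. *)
Lemma P2_cts : continuous P2.
Proof.
have cp : cpos (fun x => pi ^+ 2 * P2 x).
  apply: (@cpos_series _ (fun k x => cos (2 * pi * (k.+1%:R * x)) / k.+1%:R ^+ 2)).
  - move=> n x _; apply: cvgM; last exact: cvg_cst.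
    by have := dv_cos (dvZ (2 * pi) (dv_lin n.+1%:R x)); exact: is_derive_cts.
  - by move=> x _; exact: P2_cvg.
  - move=> d _; exists (fun k => (k.+1%:R ^+ 2)^-1); first exact: cvg_invsq.
    by move=> n x _; exact: P2_term.
have cp2 (x : R) : 0 < x -> {for x, continuous P2}.
  move=> x0; have -> : P2 = (fun y => pi ^- 2 * (pi ^+ 2 * P2 y)).
    apply/funext => y; rewrite mulrA mulVf ?mul1r//.
    by rewrite expf_neq0 ?lt0r_neq0 ?pi_gt0.
  by apply: cvgM; [exact: cvg_cst|exact: cp].
move=> x; have [n _ /(_ n (leqnn n)) /= hn] := near_nat_ge (- x + 1).
have -> : P2 = (fun y : R => P2 (y + n%:R)) by apply/funext => y; rewrite P2Dn.
apply: (@continuous_comp _ _ _ (fun y : R => y + n%:R) P2).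
  by apply: cvgD; [exact: cvg_id|exact: cvg_cst].
by apply: cp2; lra.
Qed.

(** What second order Euler-Maclaurin asks of a summand. The bounds concern the half-line where the
    sums and integrals live, whereas the derivatives exist on the whole line, so that 0 is an
    ordinary point. *)
Definition edecay f f1 f2 (C l : R) := [/\ 0 < l, forall x, dv f x (f1 x),
  forall x, dv f1 x (f2 x), continuous f2 &
  forall x, 0 <= x ->
    [/\ `|f x| <= C * ee l x, `|f1 x| <= C * ee l x & `|f2 x| <= C * ee l x]].

Lemma RI_split f (a b c : R) : a <= b -> b <= c -> continuous f ->
  \int[mu]_(x in `[a, c]) f x =
  \int[mu]_(x in `[a, b]) f x + \int[mu]_(x in `[b, c]) f x.
Proof.
move=> ab bc cf.
have ii u v : itg `[u, v] f by apply: itg_cc => x _; exact: cf.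
have := @Rintegral_itvB R f (BLeft a) (BRight c) b (ii a c).
rewrite !bnd_simp => /(_ ab bc) /eqP; rewrite subr_eq addrC => /eqP ->.
congr (_ + _); rewrite Rintegral_itv_obnd_cbnd//.
by apply: (itgS _ _ _ (ii b c)) => // x /=; rewrite !in_itv/= => /andP[/ltW-> ->].
Qed.

Section Fix.
Variables (f f1 f2 : R -> R) (C l : R).
Hypothesis Ef : edecay f f1 f2 C l.

Let l0 : 0 < l. Proof. by case: Ef. Qed.
Let df x : dv f x (f1 x). Proof. by case: Ef. Qed.
Let df1 x : dv f1 x (f2 x). Proof. by case: Ef. Qed.
Let cf2 : continuous f2. Proof. by case: Ef. Qed.
Let cf : continuous f. Proof. by move=> x; have := df x; exact: is_derive_cts. Qed.
Let cf1 : continuous f1. Proof. by move=> x; have := df1 x; exact: is_derive_cts. Qed.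
Let bf x : 0 <= x -> `|f x| <= C * ee l x. Proof. by case: Ef => _ _ _ _ h /h[]. Qed.
Let bf1 x : 0 <= x -> `|f1 x| <= C * ee l x. Proof. by case: Ef => _ _ _ _ h /h[]. Qed.
Let bf2 x : 0 <= x -> `|f2 x| <= C * ee l x. Proof. by case: Ef => _ _ _ _ h /h[]. Qed.

Lemma edecay_itg : itg Rp f.
Proof. by apply: (itg_bee l0) => [|x /ltW]; [exact: cts_meas|exact: bf]. Qed.

(** Two integrations by parts: as [B2] has second derivative 2, the integrand is the derivative of
    B2 (x - u) f' - B2' (x - u) f. *)
Let ep_step (u a b : R) : a <= b ->
  \int[mu]_(x in `[a, b]) (B2 (x - u) * f2 x - 2 * f x) =
  (B2 (b - u) * f1 b - (2 * (b - u) - 1) * f b) -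
  (B2 (a - u) * f1 a - (2 * (a - u) - 1) * f a).
Proof.
move=> ab.
pose F x := B2 (x - u) * f1 x - (2 * (x - u) - 1) * f x.
have dlin (x : R) : dv (fun y => y - u) x 1.
  by apply: dv_eq (dvB (dv_id x) (dv_cst u x)); rewrite subr0.
have dB (x : R) : dv (fun y => B2 (y - u)) x (2 * (x - u) - 1).
  have h := dvD (dvB (dvM (dlin x) (dlin x)) (dlin x)) (dv_cst 6^-1 x).
  by apply: dv_eq h; ring.
have d1 (x : R) : dv (fun y => 2 * (y - u) - 1) x 2.
  by apply: dv_eq (dvB (dvZ 2 (dlin x)) (dv_cst 1 x)); ring.
have dF (x : R) : dv F x (B2 (x - u) * f2 x - 2 * f x).
  by apply: dv_eq (dvB (dvM (dB x) (df1 x)) (dvM (d1 x) (df x))); ring.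
apply: (@ftc _ F _ a b ab (fun x _ => dF x)) => x _.
apply: cvgB; apply: cvgM.
- by have := dB x; exact: is_derive_cts.
- exact: cf2.
- exact: cvg_cst.
- exact: cf.
Qed.

Let g (b x : R) := P2 (x - b) * f2 x - 2 * f x.

Let cg b : continuous (g b).
Proof.
move=> x; apply: cvgB; apply: cvgM; [|exact: cf2|exact: cvg_cst|exact: cf].
apply: (@continuous_comp _ _ _ (fun y : R => y - b) P2); last exact: P2_cts.
by apply: cvgB; [exact: cvg_id|exact: cvg_cst].
Qed.

Let K : R := zeta2 / pi ^+ 2.

Let iPf2 b : itg Rp (fun x => P2 (x - b) * f2 x).
Proof.
apply: (itg_bee (C := K * C) l0).
  apply: cts_meas => x; apply: cvgM; last exact: cf2.
  apply: (@continuous_comp _ _ _ (fun y : R => y - b) P2); last exact: P2_cts.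
  by apply: cvgB; [exact: cvg_id|exact: cvg_cst].
move=> x /ltW x0; rewrite normrM -mulrA.
by apply: ler_pM => //; [exact: P2_bound|exact: bf2].
Qed.

(** At each integer translate of [b] the values [B2 0] and [B2 1] agree, while 2 x - 1 jumps from 1
    to -1; this jump produces the terms - 2 f (m + b). *)
Let EM_fin (b : R) (M : nat) : 0 <= b <= 1 ->
  \int[mu]_(x in `[0, b + M%:R]) g b x =
  - 2 * series (fun m => f (m%:R + b)) M + f1 (b + M%:R) / 6 - f (b + M%:R)
  - B2 b * f1 0 + (1 - 2 * b) * f 0.
Proof.
move=> /andP[b0 b1]; elim: M => [|M IH].
  (* On the initial piece [0, b] the periodic kernel is [B2] of x - b + 1. *)
  rewrite addr0 (@eq_RI _ _ _ (fun x => B2 (x - (b - 1)) * f2 x - 2 * f x)); last first.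
    move=> x; rewrite /= in_itv/= => /andP[x0 xb]; rewrite /g.
    by rewrite -P2D1 P2_B2; [congr (B2 _ * _ - _); ring|lra].
  by rewrite ep_step// /series /= big_geq// /B2; field.
have Mb : b + M%:R <= b + M.+1%:R by rewrite lerD2l ler_nat.
rewrite (RI_split (addr_ge0 b0 (ler0n R M)) Mb (@cg b)).
rewrite IH (@eq_RI _ _ _ (fun x => B2 (x - (b + M%:R)) * f2 x - 2 * f x)); last first.
  move=> x; rewrite /= in_itv/= -natr1 => /andP[x0 xb]; rewrite /g.
  rewrite -[x - b](subrK M%:R) P2Dn P2_B2; last by lra.
  by congr (B2 _ * _ - _); ring.
rewrite (ep_step _ Mb) seriesSr -[M.+1%:R]natr1 [M%:R + b]addrC /B2; by field.
Qed.

Let shift_cvg (h : R -> R) (b : R) : 0 <= b -> (forall x, 0 <= x -> `|h x| <= C * ee l x) ->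
  h (b + M%:R) @[M --> \oo] --> (0 : R).
Proof.
move=> b0 bh.
apply: (@cvg_comp _ _ _ (fun M => b + M%:R) h \oo (+oo%R)).
  apply/cvgryPge => A; near=> n; rewrite -lerBlDl; near: n; exact: near_nat_ge.
exact: (bounded_cvg0 bh (ee_cvg0 l0)).
Unshelve. all: by end_near. Qed.

Lemma euler_maclaurin (b : R) : 0 <= b <= 1 ->
  series (fun m => f (m%:R + b)) @ \oo -->
  \int[mu]_(x in Rp) f x + (1 / 2 - b) * f 0 - B2 b * f1 0 / 2
  - (\int[mu]_(x in Rp) (P2 (x - b) * f2 x)) / 2.
Proof.
move=> b01; have /andP[b0 b1] := b01.
have ig : itg Rp (g b) by apply: itgB => //; apply: itgZ => //; exact: edecay_itg.
have mg := itg_meas ig.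
have igc : itg `[0, +oo[ (g b) by apply/itg_cy.
have h1 : \int[mu]_(x in `[0, b + M%:R]) g b x @[M --> \oo] --> \int[mu]_(x in Rp) g b x.
  rewrite -RI_cy//.
  apply: (@RI_exhaust _ (fun M => `[0, b + M%:R]%classic)) => //.
    by move=> n x /=; rewrite !in_itv/= => /andP[-> _].
  move=> x; rewrite /= in_itv/= andbT => ax.
  near=> n; rewrite in_itv/= ax /= -lerBlDl; near: n; exact: near_nat_ge.
have eg : \int[mu]_(x in Rp) g b x =
    \int[mu]_(x in Rp) (P2 (x - b) * f2 x) - 2 * \int[mu]_(x in Rp) f x.
  rewrite RIB//; last by apply: itgZ => //; exact: edecay_itg.
  by rewrite RIZ//; exact: edecay_itg.
rewrite eg in h1.
set If := \int[mu]_(x in Rp) f x in h1 *; set IP := \int[mu]_(x in Rp) (_ * f2 _) in h1 *.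
rewrite (_ : series _ = (fun M => - 2^-1 * (\int[mu]_(x in `[0, b + M%:R]) g b x
   - f1 (b + M%:R) / 6 + f (b + M%:R) + B2 b * f1 0 - (1 - 2 * b) * f 0))).
  have -> : If + (1 / 2 - b) * f 0 - B2 b * f1 0 / 2 - IP / 2 =
    - 2^-1 * (IP - 2 * If - 0 / 6 + 0 + B2 b * f1 0 - (1 - 2 * b) * f 0) by field.
  apply: cvgM; first exact: cvg_cst.
  apply: cvgB; last exact: cvg_cst.
  apply: cvgD; last exact: cvg_cst.
  apply: cvgD; last exact: shift_cvg.
  apply: cvgB => //; apply: cvgM; last exact: cvg_cst.
  exact: shift_cvg.
by apply/funext => M; rewrite EM_fin//; field.
Unshelve. all: by end_near. Qed.

Let J k := \int[mu]_(x in Rp) (cos (2 * pi * k.+1%:R * x) * f x).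

(** Two integrations by parts; since the sine vanishes at 0, only [f1 0] survives as a boundary
    term. *)
Let JE k : J k = - (2 * pi * k.+1%:R) ^- 2 * (f1 0 +
  \int[mu]_(x in Rp) (cos (2 * pi * k.+1%:R * x) * f2 x)).
Proof.
rewrite /J; set c := 2 * pi * k.+1%:R.
have c0 : c != 0 by rewrite /c !mulf_neq0// lt0r_neq0 ?pi_gt0.
clearbody c.
pose F x := c^-1 * (sin (c * x) * f x) + c ^- 2 * (cos (c * x) * f1 x).
have dF (x : R) : dv F x (cos (c * x) * f x + c ^- 2 * (cos (c * x) * f2 x)).
  apply: dv_eq (dvD (dvZ c^-1 (dvM (dv_sin (dv_lin c x)) (df x)))
                    (dvZ (c ^- 2) (dvM (dv_cos (dv_lin c x)) (df1 x)))).
  by field.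
have ic (h : R -> R) : continuous h -> (forall x, 0 <= x -> `|h x| <= C * ee l x) ->
    itg Rp (fun x => cos (c * x) * h x).
  move=> ch bh; apply: (itg_bee l0); first by apply: cts_meas; exact: cts_cosM.
  by move=> x /ltW x0; apply: (le_trans (cosM_le _ _)); exact: bh.
have cg2 : continuous (fun x => cos (c * x) * f x + c ^- 2 * (cos (c * x) * f2 x)).
  move=> x; apply: cvgD; first exact: (cts_cosM cf).
  by apply: cvgM; [exact: cvg_cst|exact: (cts_cosM cf2)].
have := @ftc0y _ F _ 0 (fun x _ => dF x) (fun x _ => cg2 x).
rewrite RID//; last 2 first.
- exact: ic.
- by apply: itgZ => //; exact: ic.
rewrite RIZ//; last exact: ic.
have -> : F 0 = c ^- 2 * f1 0 by rewrite /F !mulr0 sin0 cos0; ring.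
move=> H.
set I1 := \int[mu]_(x in Rp) (_ * f _) in H *; set I2 := \int[mu]_(x in Rp) (_ * f2 _) in H *.
have -> : I1 = I1 + c ^- 2 * I2 - c ^- 2 * I2 by ring.
rewrite H; first by ring.
  by apply: itgD => //; [exact: ic|apply: itgZ => //; exact: ic].
apply: (bounded_cvg0 (C := (`|c^-1| + `|c ^- 2|) * C) _ (ee_cvg0 l0)) => x x0.
rewrite -mulrA mulrDl; apply: (le_trans (ler_normD _ _)); apply: lerD.
  rewrite normrM ler_wpM2l//; apply: (le_trans (sinM_le _ _)); exact: bf.
rewrite normrM ler_wpM2l//; apply: (le_trans (cosM_le _ _)); exact: bf1.
Qed.

(* Poisson summation in Euler-Maclaurin form: the kernel [P2] is replaced by
   its Fourier series and the integrations by parts are undone termwise. *)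
Lemma poisson (b : R) : 0 <= b <= 1 ->
  exists2 S : R, series (fun k => cos (2 * pi * (k.+1%:R * b)) * J k) @ \oo --> S &
  series (fun m => f (m%:R + b) + f (m%:R + (1 - b))) @ \oo -->
     2 * \int[mu]_(x in Rp) f x + 4 * S.
Proof.
move=> b01; have /andP[b0 b1] := b01.
(* Adding the formulas for b and 1 - b cancels the boundary terms in [f 0] and leaves pure cosines:
   this is Poisson summation over Z + b of the even extension of [f], whose corner at 0 is measured
   by [f1 0]. *)
have b01' : 0 <= 1 - b <= 1 by lra.
pose h k (x : R) := cos (2 * pi * (k.+1%:R * b)) * (cos (2 * pi * k.+1%:R * x) * f2 x) / k.+1%:R ^+ 2.
pose H (x : R) := pi ^+ 2 / 2 * (P2 (x - b) * f2 x + P2 (x - (1 - b)) * f2 x).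
have hE k x : h k x = (cos (2 * pi * (k.+1%:R * (x - b))) / k.+1%:R ^+ 2 +
     cos (2 * pi * (k.+1%:R * (x + b))) / k.+1%:R ^+ 2) * (f2 x / 2).
  rewrite /h.
  have -> : 2 * pi * (k.+1%:R * (x - b)) = 2 * pi * k.+1%:R * x - 2 * pi * (k.+1%:R * b) by ring.
  have -> : 2 * pi * (k.+1%:R * (x + b)) = 2 * pi * k.+1%:R * x + 2 * pi * (k.+1%:R * b) by ring.
  rewrite cosB cosD; field.
  by rewrite nat1r pnatr_eq0.
have ch k : continuous (h k).
  move=> x; apply: cvgM; last exact: cvg_cst.
  by apply: cvgM; [exact: cvg_cst|exact: (cts_cosM cf2)].
have hH x : Rp x -> series (fun k => h k x) @ \oo --> H x.
  move=> _; rewrite (_ : series _ = (fun n => (series (fun k => cos (2 * pi * (k.+1%:R * (x - b))) / k.+1%:R ^+ 2) n +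
    series (fun k => cos (2 * pi * (k.+1%:R * (x + b))) / k.+1%:R ^+ 2) n) * (f2 x / 2))).
    have -> : H x = (pi ^+ 2 * P2 (x - b) + pi ^+ 2 * P2 (x + b)) * (f2 x / 2).
      rewrite /H; have -> : P2 (x + b) = P2 (x - (1 - b)).
        by rewrite -[in RHS]P2D1; congr P2; ring.
      by field.
    by apply: cvgM; [apply: cvgD; exact: P2_cvg|exact: cvg_cst].
  apply/funext => n; rewrite /series /= -big_split /= big_distrl /=.
  by apply: eq_bigr => k _; exact: hE.
pose Z : R := zeta2.
have hb n x : Rp x -> `|series (fun k => h k x) n| <= Z * `|f2 x|.
  move=> _; rewrite /series /=; apply: (le_trans (ler_norm_sum _ _ _)).
  apply: (@le_trans _ _ (series (fun k => (k.+1%:R ^+ 2)^-1) n * `|f2 x|)).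
    rewrite /series /= big_distrl /=; apply: ler_sum => k _.
    rewrite /h normrM mulrC ger0_norm ?invr_ge0 ?sqr_ge0// ler_wpM2l ?invr_ge0 ?sqr_ge0//.
    by apply: (le_trans (cosM_le _ _)); exact: cosM_le.
  rewrite ler_wpM2r//; apply: nondecreasing_cvgn_le; last exact: cvg_invsq.
  by apply: nondecreasing_series => k _ _; rewrite invr_ge0 sqr_ge0.
have if2 : itg Rp f2 by apply: (itg_bee l0) => [|x /ltW]; [exact: cts_meas|exact: bf2].
have [iH ih cH] := @series_itg_dom _ Rp h H (fun x => Z * `|f2 x|) (measurable_itv _)
  (fun n => cts_meas (ch n)) hH hb (itgZ _ (measurable_itv _) (itg_norm (measurable_itv _) if2)).
(* The sum over k of the identities [JE] weighted by cosines: the terms in [f1 0] add up to the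
   series of [B2 b], the integrals to that of [H]. *)
pose S := - (4 * pi ^+ 2)^-1 * (f1 0 * (pi ^+ 2 * B2 b) + \int[mu]_(x in Rp) H x).
exists S.
  rewrite (_ : series _ = (fun n => - (4 * pi ^+ 2)^-1 *
     (f1 0 * series (fun k => cos (2 * pi * (k.+1%:R * b)) / k.+1%:R ^+ 2) n +
      series (fun k => \int[mu]_(x in Rp) h k x) n))).
    apply: cvgM; first exact: cvg_cst.
    by apply: cvgD => //; apply: cvgM; [exact: cvg_cst|exact: cos_invsq].
  apply/funext => n; rewrite /series /= big_distrr /= -big_split /= big_distrr /=.
  apply: eq_bigr => k _; rewrite JE.
  have -> : \int[mu]_(x in Rp) h k x = cos (2 * pi * (k.+1%:R * b)) / k.+1%:R ^+ 2 *
     \int[mu]_(x in Rp) (cos (2 * pi * k.+1%:R * x) * f2 x).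
    rewrite -RIZ//; first by apply: eq_RI => x _; rewrite /h; ring.
    apply: (itg_bee l0); first by apply: cts_meas; exact: cts_cosM.
    by move=> x /ltW x0; apply: (le_trans (cosM_le _ _)); exact: bf2.
  have := lt0r_neq0 (@pi_gt0 R); set cb := cos _; set I2 := \int[mu]_(x in _) _.
  move: cb I2 (f1 0) => cb I2 f10; move: (@pi R) => p p0.
  by field; rewrite nat1r pnatr_eq0 p0.
rewrite (_ : series _ = (fun n => series (fun m => f (m%:R + b)) n +
   series (fun m => f (m%:R + (1 - b))) n)); last first.
  by apply/funext => n; rewrite /series /= -big_split.
rewrite (_ : _ + 4 * S = (\int[mu]_(x in Rp) f x + (1 / 2 - b) * f 0 - B2 b * f1 0 / 2
  - (\int[mu]_(x in Rp) (P2 (x - b) * f2 x)) / 2) +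
  (\int[mu]_(x in Rp) f x + (1 / 2 - (1 - b)) * f 0 - B2 (1 - b) * f1 0 / 2
  - (\int[mu]_(x in Rp) (P2 (x - (1 - b)) * f2 x)) / 2)).
  by apply: cvgD; exact: euler_maclaurin.
rewrite /S /H RIZ//; last by apply: itgD.
rewrite RID// /B2.
have := lt0r_neq0 (@pi_gt0 R); move: (\int[mu]_(x in _) _) (\int[mu]_(x in _) _) (\int[mu]_(x in _) _).
move=> I1 I2 I3; move: (@pi R) => p p0.
by field.
Qed.

End Fix.
End Poisson.

(** * Rational functions of an exponential *)

Section RatExp.
Variable R : realType.
Notation mu := (@lebesgue_measure R).
Local Notation Rp := (`]0%R, +oo[%classic : set R).
Implicit Types (f g : R -> R) (P Q : {poly R}).

(** The factor r = e^(-l x) in front gives the decay. The denominator is positive for every r >= 0,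
    not only on [0, 1], so [f] is smooth on the whole line, and the class is stable under
    differentiation. *)
Definition ratexp (l : R) f := exists P Q, (forall r, 0 <= r -> 0 < Q.[r]) /\
  forall x, f x = ee l x * P.[ee l x] / Q.[ee l x].

Lemma dv_horner P (x : R) : dv (horner P) x P^`().[x].
Proof.
apply: DeriveDef; first exact: derivable_horner.
by rewrite -derive1E -derivE.
Qed.

Lemma dv_horner_comp P f (x a : R) : dv f x a ->
  dv (fun y => P.[f y]) x (P^`().[f x] * a).
Proof. by apply: dv_comp; exact: dv_horner. Qed.

Lemma ratexp_dv (l : R) f : ratexp l f ->
  exists2 g, ratexp l g & forall x : R, dv f x (g x).
Proof.
move=> [P [Q [Q0 fE]]].
pose P' : {poly R} := (- l)%:P * ((P + 'X * P^`()) * Q - 'X * P * Q^`()).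
exists (fun x => ee l x * P'.[ee l x] / (Q * Q).[ee l x]).
  exists P', (Q * Q); split => // r /Q0 h; rewrite hornerM mulr_gt0//.
move=> x; have -> : f = (fun y => ee l y * P.[ee l y] * (Q.[ee l y])^-1) by apply/funext.
have q0 : Q.[ee l x] != 0 by rewrite lt0r_neq0// Q0// ee_ge0.
apply: dv_eq (dvM (dvM (dv_ee l x) (dv_horner_comp P (dv_ee l x)))
                  (@dvV _ (fun y => Q.[ee l y]) x _ q0 (dv_horner_comp Q (dv_ee l x)))).
rewrite /P' !(hornerM, hornerD, hornerN, hornerC, hornerX).
by field.
Qed.

(** For x >= 0 the exponential lies in [0, 1], where P / Q is bounded by compactness. *)
Lemma ratexp_bound (l : R) f : 0 < l -> ratexp l f ->
  exists2 C, 0 <= C & forall x : R, 0 <= x -> `|f x| <= C * ee l x.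
Proof.
move=> l0 [P [Q [Q0 fE]]].
have cg : {within `[0, 1], continuous (fun r => `|P.[r] / Q.[r]| : R)}.
  apply: within_cts => r; rewrite /= in_itv/= => /andP[r0 _].
  apply: (@continuous_comp _ _ _ (fun r => P.[r] / Q.[r]) (fun y => `|y|)); last exact: norm_continuous.
  apply: cvgM; first exact: continuous_horner.
  apply: cvgV; first by rewrite lt0r_neq0// Q0.
  exact: continuous_horner.
have [c _ hc] := EVT_max ler01 cg.
exists `|P.[c] / Q.[c]| => // x x0.
rewrite fE -mulrA mulrC normrM (ger0_norm (ee_ge0 _ _)) ler_wpM2r ?ee_ge0//.
by apply: hc; rewrite in_itv/= ee_ge0 ee_le1// ltW.
Qed.

Lemma ratexp_cts (l : R) f : ratexp l f -> continuous f.
Proof. by move=> /ratexp_dv[g _ fg] x; have := fg x; exact: is_derive_cts. Qed.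

(** Only the derivative is asked to be rational in the exponential: this covers the logarithm [Kf],
    whose own bound is supplied separately. *)
Lemma ratexp_decay (l : R) f f1 : 0 < l -> ratexp l f1 ->
  (forall x : R, dv f x (f1 x)) ->
  (exists2 C, 0 <= C & forall x : R, 0 <= x -> `|f x| <= C * ee l x) ->
  exists f2 C, edecay f f1 f2 C l.
Proof.
move=> l0 r1 d1 [C C0 hC]; have [f2 r2 d2] := ratexp_dv r1.
have [C1 C10 h1] := ratexp_bound l0 r1.
have [C2 C20 h2] := ratexp_bound l0 r2.
exists f2, (C + C1 + C2); split => //; first exact: (ratexp_cts r2).
have e0 x := ee_ge0 l x.
move=> x x0; split.
- by apply: (le_trans (hC x x0)); rewrite ler_wpM2r//; lra.
- by apply: (le_trans (h1 x x0)); rewrite ler_wpM2r//; lra.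
- by apply: (le_trans (h2 x x0)); rewrite ler_wpM2r//; lra.
Qed.

Lemma edecay_scale f f1 f2 (C l k : R) : 0 < k -> edecay f f1 f2 C l ->
  edecay (fun x => f (k * x)) (fun x => k * f1 (k * x)) (fun x => k ^+ 2 * f2 (k * x))
    (C * (1 + k + k ^+ 2)) (l * k).
Proof.
move=> k0 [l0 d1 d2 c2 bd]; split.
- exact: mulr_gt0.
- by move=> x; apply: dv_eq (dv_comp (d1 (k * x)) (dv_lin k x)); rewrite mulrC.
- by move=> x; apply: dv_eq (dvZ k (dv_comp (d2 (k * x)) (dv_lin k x))); ring.
- move=> x; apply: cvgM; first exact: cvg_cst.
  apply: (@continuous_comp _ _ _ (fun y : R => k * y) f2); last exact: c2.
  by have := dv_lin k x; exact: is_derive_cts.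
- move=> x x0; have kx : 0 <= k * x by rewrite mulr_ge0// ltW.
  have [b0 b1 b2] := bd _ kx; rewrite -ee_scale.
  set e := ee l (k * x) in b0 b1 b2 *.
  have Ce : 0 <= C * e by apply: le_trans b0.
  have k2 : 0 <= k ^+ 2 by exact: sqr_ge0.
  have -> : C * (1 + k + k ^+ 2) * e = (1 + k + k ^+ 2) * (C * e) by ring.
  split.
  + by apply: (le_trans b0); nra.
  + rewrite normrM (gtr0_norm k0); apply: (@le_trans _ _ (k * (C * e))); first by rewrite ler_pM2l.
    by rewrite ler_wpM2r//; lra.
  + rewrite normrM (ger0_norm k2); apply: (@le_trans _ _ (k ^+ 2 * (C * e))); first by rewrite ler_wpM2l.
    by rewrite ler_wpM2r//; lra.
Qed.

Lemma edecay_sin f f1 f2 (C l k : R) : edecay f f1 f2 C l ->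
  edecay (fun x => sin (k * x) * f x)
   (fun x => k * (cos (k * x) * f x) + sin (k * x) * f1 x)
   (fun x => - k ^+ 2 * (sin (k * x) * f x) + 2 * k * (cos (k * x) * f1 x)
       + sin (k * x) * f2 x)
    (C * (1 + 2 * `|k| + k ^+ 2)) l.
Proof.
move=> [l0 d1 d2 c2 bd].
have c0 : continuous f by move=> x; have := d1 x; exact: is_derive_cts.
have c1 : continuous f1 by move=> x; have := d2 x; exact: is_derive_cts.
split => //.
- by move=> x; apply: dv_eq (dvM (dv_sin (dv_lin k x)) (d1 x)); ring.
- move=> x; apply: dv_eq (dvD (dvZ k (dvM (dv_cos (dv_lin k x)) (d1 x)))
    (dvM (dv_sin (dv_lin k x)) (d2 x))); ring.
- move=> x; apply: cvgD; last exact: (cts_sinM c2).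
  apply: cvgD; apply: cvgM; [exact: cvg_cst|exact: (cts_sinM c0)|exact: cvg_cst|exact: (cts_cosM c1)].
- move=> x x0; have [b0 b1 b2] := bd _ x0; set e := ee l x in b0 b1 b2 *.
  have Ce : 0 <= C * e by apply: le_trans b0.
  have k2 : 0 <= k ^+ 2 by exact: sqr_ge0.
  have -> : C * (1 + 2 * `|k| + k ^+ 2) * e = C * e + `|k| * (C * e) + `|k| * (C * e) + k ^+ 2 * (C * e).
    by ring.
  have kk : 0 <= `|k| * (C * e) by rewrite mulr_ge0.
  have k2k : 0 <= k ^+ 2 * (C * e) by rewrite mulr_ge0.
  have s0 := le_trans (sinM_le (k * x) _) b0.
  have s1 := le_trans (sinM_le (k * x) _) b1.
  have s2 := le_trans (sinM_le (k * x) _) b2.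
  have t0 := le_trans (cosM_le (k * x) _) b0.
  have t1 := le_trans (cosM_le (k * x) _) b1.
  split; first by lra.
  + apply: (le_trans (ler_normD _ _)); rewrite normrM.
    have := ler_wpM2l (normr_ge0 k) t0; lra.
  + apply: (le_trans (ler_normD _ _)); apply: (le_trans (lerD (ler_normD _ _) (lexx _))).
    have n1 : `|- k ^+ 2 * (sin (k * x) * f x)| <= k ^+ 2 * (C * e).
      by rewrite normrM normrN (ger0_norm k2) ler_wpM2l.
    have n2 : `|2 * k * (cos (k * x) * f1 x)| <= 2 * (`|k| * (C * e)).
      by rewrite 2!normrM normr_nat -[leLHS]mulrA ler_wpM2l// ler_wpM2l.
    lra.
Qed.

Lemma edecay_ee (l : R) : 0 < l -> edecay (ee l) (fun x => - l * ee l x)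
  (fun x => l ^+ 2 * ee l x) (1 + l + l ^+ 2) l.
Proof.
move=> l0; have l2 : 0 <= l ^+ 2 by exact: sqr_ge0.
split => //.
- exact: dv_ee.
- by move=> x; apply: dv_eq (dvZ (- l) (dv_ee l x)); ring.
- by move=> x; apply: cvgM; [exact: cvg_cst|exact: cts_ee].
- move=> x _; have e0 := ee_ge0 l x; set e := ee l x in e0 *.
  have le0 : 0 <= l * e by rewrite mulr_ge0// ltW.
  have l2e : 0 <= l ^+ 2 * e by rewrite mulr_ge0.
  rewrite mulNr normrN !ger0_norm// 2!mulrDl mul1r; split; lra.
Qed.

End RatExp.

(** * Poisson summation of sine series *)

Section PoissonSin.
Variable R : realType.
Notation mu := (@lebesgue_measure R).
Local Notation Rp := (`]0%R, +oo[%classic : set R).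
Variable N : nat.
Hypothesis N0 : (0 < N)%N.

Definition lam : R := 2 * pi / N%:R.

Lemma lam_gt0 : 0 < lam.
Proof. by rewrite /lam divr_gt0 ?ltr0n// mulr_gt0// pi_gt0. Qed.

Lemma lamN : lam * N%:R = 2 * pi.
Proof. by rewrite /lam divfK// pnatr_eq0 -lt0n. Qed.

Variables (g g1 g2 : R -> R) (C l : R).
Hypothesis Eg : edecay g g1 g2 C l.

Definition sint (m : nat) : R := \int[mu]_(x in Rp) (sin (lam * m%:R * x) * g x).

Let cg : continuous g.
Proof. by move=> x; case: Eg => _ h _ _ _; have := h x; exact: is_derive_cts. Qed.

Let ig (k : R) : itg Rp (fun x => sin (k * x) * g x).
Proof. exact: (edecay_itg (edecay_sin k Eg)). Qed.

(** Riemann-Lebesgue at rate 1 / m, by one integration by parts. It disposes of the term left over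
    by the reindexing in [psin]. *)
Lemma sint_cvg0 (d : nat) : (0 < d)%N -> sint (N * n + d)%N @[n --> \oo] --> (0 : R).
Proof.
move=> d0; case: (Eg) => l0 dg dg1 _ bg.
have c1 : continuous g1 by move=> x; have := dg1 x; exact: is_derive_cts.
have bs (m : nat) : (0 < m)%N -> `|sint m| <= (`|g 0| + C / l) / lam * m%:R^-1.
  move=> m0; set c := lam * m%:R.
  have c0 : 0 < c by rewrite mulr_gt0 ?lam_gt0// ltr0n.
  have cn : c != 0 by rewrite lt0r_neq0.
  pose F x := - c^-1 * (cos (c * x) * g x).
  have dF (x : R) : dv F x (sin (c * x) * g x - c^-1 * (cos (c * x) * g1 x)).
    apply: dv_eq (dvZ (- c^-1) (dvM (dv_cos (dv_lin c x)) (dg x))).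
    by move: (c) (cn) => c' cn'; field.
  have ccf : continuous (fun x => sin (c * x) * g x - c^-1 * (cos (c * x) * g1 x)).
    move=> x; apply: cvgB; first exact: (cts_sinM cg).
    by apply: cvgM; [exact: cvg_cst|exact: (cts_cosM c1)].
  have b1 x : 0 < x -> `|cos (c * x) * g1 x| <= C * ee l x.
    by move=> /ltW x0; apply: (le_trans (cosM_le _ _)); case: (bg x x0).
  have ic : itg Rp (fun x => cos (c * x) * g1 x).
    by apply: (itg_bee l0 _ b1); apply: cts_meas; exact: cts_cosM.
  have := @ftc0y _ F _ 0 (fun x _ => dF x) (fun x _ => ccf x).
  rewrite (RIB (measurable_itv _) (ig c) (itgZ _ (measurable_itv _) ic)).
  have F0 : F 0 = - c^-1 * g 0 by rewrite /F mulr0 cos0 mul1r.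
  rewrite RIZ// -/(sint m) F0 sub0r mulNr opprK => H.
  have -> : sint m = c^-1 * (g 0 + \int[mu]_(x in Rp) (cos (c * x) * g1 x)).
    rewrite mulrDr -H; first by rewrite subrK.
      exact: (itgB (measurable_itv _) (ig c) (itgZ _ (measurable_itv _) ic)).
    apply: (bounded_cvg0 (C := c^-1 * C) _ (ee_cvg0 l0)) => x x0.
    rewrite /F normrM normrN (gtr0_norm (_ : 0 < c^-1)) ?invr_gt0// -[leRHS]mulrA ler_wpM2l ?invr_ge0 ?(ltW c0)//.
    by apply: (le_trans (cosM_le _ _)); case: (bg x x0).
  rewrite normrM (gtr0_norm (_ : 0 < c^-1)) ?invr_gt0// [leLHS]mulrC.
  rewrite -mulrA -invfM -/c ler_wpM2r ?invr_ge0 ?(ltW c0)//.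
  apply: (le_trans (ler_normD _ _)); rewrite lerD2l.
  apply: RI_bee => //; apply: cts_meas; exact: cts_cosM.
apply/norm_cvg0P.
pose B : R := (`|g 0| + C / l) / lam.
apply: (@squeeze_cvgr _ _ _ _ (fun=> 0) (fun n => B * n.+1%:R^-1)).
- near=> n; rewrite normr_ge0 /=.
  have B0 : 0 <= B.
    rewrite /B divr_ge0 ?(ltW lam_gt0)// addr_ge0// divr_ge0 ?(ltW l0)//.
    have [h _ _] := bg 0 (lexx 0); rewrite ee0 mulr1 in h; exact: le_trans h.
  apply: (le_trans (bs _ _)); first by rewrite addn_gt0 d0 orbT.
  rewrite ler_wpM2l// lef_pV2 ?posrE ?ltr0n ?addn_gt0 ?d0 ?orbT//.
  rewrite ler_nat; nia.
- exact: cvg_cst.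
- by rewrite -[X in _ --> X](mulr0 B); apply: cvgM; [exact: cvg_cst|exact: cvg_harmonic].
Unshelve. all: by end_near. Qed.

(** Poisson summation at b = 0 for sin (lam d x) g x. Since lam N = 2 pi, the product with cos (2 pi
    k x) splits into sines of frequencies lam (N k + d) and lam (N k - d), whence the odd pairs of
    residues mod N. *)
Lemma psin (d : nat) : (0 < d < N)%N -> exists2 X : R,
  series (fun k => sin (lam * d%:R * k.+1%:R) * g k.+1%:R) @ \oo --> X &
  series (fun j => sint (N * j + d)%N - sint (N * j + (N - d))%N) @ \oo --> X.
Proof.
move=> /andP[d0 dN]; case: (Eg) => l0 dg dg1 _ bg.
pose f x := sin (lam * d%:R * x) * g x.
have Ef := edecay_sin (lam * d%:R) Eg.
have h01 : 0 <= (0 : R) <= 1 by rewrite lexx ler01.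
have [S hS hP] := poisson Ef h01.
set I := \int[mu]_(x in Rp) _ in hP.
have f0 : f 0 = 0 by rewrite /f mulr0 sin0 mul0r.
have fn : f n%:R @[n --> \oo] --> (0 : R).
  apply: (@cvg_comp _ _ _ (fun n : nat => n%:R : R) f \oo (+oo%R)).
    by apply/cvgryPge => A; near=> n; near: n; exact: near_nat_ge.
  apply: (bounded_cvg0 (C := C) _ (ee_cvg0 l0)) => x x0.
  by apply: (le_trans (sinM_le _ _)); case: (bg x x0).
exists (I + 2 * S).
  rewrite (_ : series _ = (fun n => 2^-1 * (series (fun m => f (m%:R + 0) + f (m%:R + (1 - 0))) n + f n%:R))).
    have -> : I + 2 * S = 2^-1 * (2 * I + 4 * S + 0) by field.
    by apply: cvgM; [exact: cvg_cst|apply: cvgD].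
  apply/funext => n; rewrite /series /=; elim: n => [|n IH].
    by rewrite !big_geq// f0 addr0 mulr0.
  by rewrite !big_nat_recr//= IH -/(f _) addr0 subr0 natr1; field.
pose J k := \int[mu]_(x in Rp) (cos (2 * pi * k.+1%:R * x) * f x).
have JE k : J k = 2^-1 * (sint (N * k.+1 + d)%N - sint (N * k + (N - d))%N).
  rewrite /sint -RIB//; [|exact: ig..].
  rewrite -RIZ//; last by apply: itgB => //; exact: ig.
  apply: eq_RI => x _; rewrite /f.
  have -> : lam * (N * k.+1 + d)%:R * x = 2 * pi * k.+1%:R * x + lam * d%:R * x.
    by rewrite natrD natrM -lamN; ring.
  have -> : lam * (N * k + (N - d))%:R * x = 2 * pi * k.+1%:R * x - lam * d%:R * x.
    by rewrite natrD natrM natrB ?(ltnW dN)// -lamN -natr1; ring.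
  by rewrite sinB sinD; field.
have EI : I = sint d by [].
(* The integral [I] is the sine transform of index d. Putting it in front moves the frequencies N (k
   + 1) + d down to N j + d and leaves one term, which tends to 0. *)
rewrite (_ : series _ = (fun n => I + 2 * series (fun k => cos (2 * pi * (k.+1%:R * 0)) * J k) n
   - sint (N * n + d)%N)).
  rewrite -[X in _ --> X]subr0; apply: cvgB; last exact: sint_cvg0.
  by apply: cvgD; [exact: cvg_cst|apply: cvgM => //; exact: cvg_cst].
apply/funext => n; rewrite /series /=; elim: n => [|n IH].
  by rewrite !big_geq// muln0 add0n EI mulr0 addr0 subrr.
by rewrite !big_nat_recr//= IH JE !mulr0 cos0; field.
Unshelve. all: by end_near. Qed.

End PoissonSin.

(** * Kernels of the Lambert series *)

Section Trig.
Variable R : realType.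
Notation mu := (@lebesgue_measure R).
Local Notation Rp := (`]0%R, +oo[%classic : set R).

Definition den (t r : R) : R := 1 - 2 * r * cos t + r ^+ 2.

Lemma den_pos1 (t r : R) : 0 <= r < 1 -> 0 < den t r.
Proof.
move=> /andP[r0 r1]; have c1 := @cos_le1 R t.
have -> : den t r = (1 - r) ^+ 2 + 2 * (r * (1 - cos t)) by rewrite /den; ring.
by rewrite ltr_pwDl ?exprn_gt0 ?subr_gt0// mulr_ge0// mulr_ge0// subr_ge0.
Qed.

Lemma den_pos2 (t r : R) : cos t < 1 -> 0 <= r -> 0 < den t r.
Proof.
move=> c1 r0; have [r1|r1] := ltP r 1; first by rewrite den_pos1// r0.
have -> : den t r = (1 - r) ^+ 2 + 2 * (r * (1 - cos t)) by rewrite /den; ring.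
by rewrite ltr_wpDl ?sqr_ge0// mulr_gt0// mulr_gt0 ?subr_gt0//; lra.
Qed.

Lemma sinS (t : R) n : sin (t * n.+2%:R) = 2 * cos t * sin (t * n.+1%:R) - sin (t * n%:R).
Proof.
have -> : t * n.+2%:R = t * n.+1%:R + t by rewrite -[n.+2%:R]natr1; ring.
have -> : t * n%:R = t * n.+1%:R - t by rewrite -[n.+1%:R]natr1; ring.
by rewrite sinB sinD; ring.
Qed.

Lemma cosS (t : R) n : cos (t * n.+2%:R) = 2 * cos t * cos (t * n.+1%:R) - cos (t * n%:R).
Proof.
have -> : t * n.+2%:R = t * n.+1%:R + t by rewrite -[n.+2%:R]natr1; ring.
have -> : t * n%:R = t * n.+1%:R - t by rewrite -[n.+1%:R]natr1; ring.
by rewrite cosB cosD; ring.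
Qed.

Let trig0 (r : R) (u : nat -> R) : 0 <= r < 1 -> (forall n, `|u n| <= 1) ->
  u n * r ^+ n.+1 @[n --> \oo] --> (0 : R).
Proof.
move=> /andP[r0 r1] u1; apply/norm_cvg0P.
have cr : r ^+ n.+1 @[n --> \oo] --> (0 : R).
  have := @cvg_expr _ r; rewrite ger0_norm// => /(_ r1).
  by rewrite -(cvg_shiftS (fun n => r ^+ n)).
apply: (@squeeze_cvgr _ _ _ _ (fun=> 0) (fun n => r ^+ n.+1)) => //; last exact: cvg_cst.
near=> n; rewrite normr_ge0 normrM (ger0_norm (exprn_ge0 _ r0)) ler_piMl// exprn_ge0//.
Unshelve. all: by end_near. Qed.

(** The recurrence [sinS] gives the partial sums in closed form. *)
Lemma sin_geometric_series (t r : R) : 0 <= r < 1 ->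
  series (fun k => sin (t * k.+1%:R) * r ^+ k.+1) @ \oo --> r * sin t / den t r.
Proof.
move=> r01; have d0 := den_pos1 t r01.
have z1 := @trig0 r (fun n => sin (t * n.+1%:R)) r01 (fun n => sin_max _).
have z2 := @trig0 r (fun n => sin (t * n%:R)) r01 (fun n => sin_max _).
rewrite (_ : series _ = (fun n => (r * sin t - sin (t * n.+1%:R) * r ^+ n.+1 +
  r * (sin (t * n%:R) * r ^+ n.+1)) / den t r)).
  have -> : r * sin t / den t r = (r * sin t - 0 + r * 0) / den t r by ring.
  apply: cvgM; last exact: cvg_cst.
  apply: cvgD; first by apply: cvgB => //; exact: cvg_cst.
  by apply: cvgM => //; exact: cvg_cst.
apply/funext => n; apply/eqP; rewrite -[_ == _](inj_eq (mulIf (lt0r_neq0 d0))) divfK ?lt0r_neq0//.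
apply/eqP; rewrite /series /=; elim: n => [|n IH].
  by rewrite big_geq// mulr1 mulr0 sin0 expr1; ring.
by rewrite big_nat_recr//= mulrDl IH sinS /den !exprS; ring.
Qed.

Lemma cos_geometric_series (t r : R) : 0 <= r < 1 ->
  series (fun k => cos (t * k.+1%:R) * r ^+ k.+1) @ \oo --> (r * cos t - r ^+ 2) / den t r.
Proof.
move=> r01; have d0 := den_pos1 t r01.
have z1 := @trig0 r (fun n => cos (t * n.+1%:R)) r01 (fun n => cos_max _).
have z2 := @trig0 r (fun n => cos (t * n%:R)) r01 (fun n => cos_max _).
rewrite (_ : series _ = (fun n => (r * cos t - r ^+ 2 - cos (t * n.+1%:R) * r ^+ n.+1 +
  r * (cos (t * n%:R) * r ^+ n.+1)) / den t r)).
  have -> : (r * cos t - r ^+ 2) / den t r = (r * cos t - r ^+ 2 - 0 + r * 0) / den t r by ring.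
  apply: cvgM; last exact: cvg_cst.
  apply: cvgD; first by apply: cvgB => //; exact: cvg_cst.
  by apply: cvgM => //; exact: cvg_cst.
apply/funext => n; apply/eqP; rewrite -[_ == _](inj_eq (mulIf (lt0r_neq0 d0))) divfK ?lt0r_neq0//.
apply/eqP; rewrite /series /=; elim: n => [|n IH].
  by rewrite big_geq// mulr1 mulr0 cos0 expr1; ring.
by rewrite big_nat_recr//= mulrDl IH cosS /den !exprS; ring.
Qed.

Lemma geometric_series (r : R) : 0 <= r < 1 -> series (fun k => r ^+ k) @ \oo --> (1 - r)^-1.
Proof.
move=> /andP[r0 r1]; have := @cvg_geometric_series R 1 r.
rewrite ger0_norm// div1r => /(_ r1).
by rewrite (_ : geometric 1 r = (fun k => r ^+ k))//; apply/funext => k /=; rewrite mul1r.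
Qed.

Lemma arith_geometric_series (a b z : R) : 0 < z < 1 ->
  series (fun j => (b * j%:R + a) * z ^+ j) @ \oo --> a / (1 - z) + b * z / (1 - z) ^+ 2.
Proof.
move=> /andP[z0 z1]; have d0 : 1 - z != 0 by rewrite lt0r_neq0// subr_gt0.
have cz : z ^+ n @[n --> \oo] --> (0 : R) by apply: cvg_expr; rewrite gtr0_norm.
have cnz : n%:R * z ^+ n @[n --> \oo] --> (0 : R).
  pose l := - ln z; have l0 : 0 < l by rewrite /l oppr_gt0 ln_lt0// z0.
  have zE n : z ^+ n = ee l n%:R.
    by rewrite /ee /l mulNr opprK mulrC expRM_natl lnK// posrE.
  apply/norm_cvg0P.
  apply: (@squeeze_cvgr _ _ _ _ (fun=> 0) (fun n => 2 / l * ee (l / 2) n%:R)).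
  - by near=> n; rewrite normr_ge0 zE ger0_norm ?mulr_ge0 ?ee_ge0// xee_le.
  - exact: cvg_cst.
  - rewrite -[X in _ --> X](mulr0 (2 / l)); apply: cvgM; first exact: cvg_cst.
    apply: (@cvg_comp _ _ _ (fun n : nat => n%:R : R) (ee (l / 2)) \oo (+oo%R)).
      by apply/cvgryPge => A; near=> n; near: n; exact: near_nat_ge.
    by apply: ee_cvg0; rewrite divr_gt0.
rewrite (_ : series _ = (fun n => a / (1 - z) + b * z / (1 - z) ^+ 2
   - (b * (n%:R * z ^+ n)) / (1 - z) - (a / (1 - z) + b * z / (1 - z) ^+ 2) * z ^+ n)).
  rewrite -[X in _ --> X]subr0 -[X in _ --> X - 0]subr0.
  apply: cvgB.
    apply: cvgB; first exact: cvg_cst.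
    rewrite -[X in _ --> X](mul0r (1 - z)^-1); apply: cvgM; last exact: cvg_cst.
    by rewrite -[X in _ --> X](mulr0 b); apply: cvgM => //; exact: cvg_cst.
  rewrite -[X in _ --> X](mulr0 (a / (1 - z) + b * z / (1 - z) ^+ 2)).
  by apply: cvgM => //; exact: cvg_cst.
apply/funext => n; rewrite /series /=; elim: n => [|n IH].
  by rewrite big_geq// mul0r expr0; ring.
rewrite big_nat_recr//= IH -[n.+1%:R]natr1 [z ^+ n.+1]exprS; move: (z ^+ n) => zn.
by field.
Unshelve. all: by end_near. Qed.

(** The bound on [f1] is integrated from x0 to infinity, where [f] vanishes. *)
Lemma decay_antider (f f1 : R -> R) (C l x0 : R) : 0 < l ->
  (forall x, x0 <= x -> dv f x (f1 x)) -> (forall x, x0 <= x -> {for x, continuous f1}) ->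
  (forall x, x0 <= x -> `|f1 x| <= C * ee l x) -> f x @[x --> +oo] --> (0 : R) ->
  itg `[x0, +oo[ f1 /\ `|f x0| <= C / l * ee l x0.
Proof.
move=> l0 df cf bf f0.
have mf : measurable_fun `[x0, +oo[ f1.
  apply: subspace_continuous_measurable_fun => //; apply: within_cts => x.
  by rewrite /= in_itv/= andbT; exact: cf.
have dE (x : R) : dv (fun y => - l^-1 * ee l y) x (ee l x).
  apply: dv_eq (dvZ _ (dv_ee l x)).
  by rewrite mulrA mulrNN mulVf ?mul1r// lt0r_neq0.
have E0 : - l^-1 * ee l x @[x --> +oo] --> (0 : R).
  rewrite -[X in _ --> X](mulr0 (- l^-1)); apply: cvgM; first exact: cvg_cst.
  exact: ee_cvg0.
have ie : itg `[x0, +oo[ (ee l).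
  apply/integrableP; split; first by apply/measurable_EFinP; apply: cts_measT; exact: cts_ee.
  under eq_integral do rewrite /= ger0_norm ?ee_ge0//.
  rewrite (@ge0_continuous_FTC2y _ _ (fun y => - l^-1 * ee l y) x0 0).
  - exact: ltry.
  - by move=> x _; exact: ee_ge0.
  - by apply: within_cts => x _; exact: cts_ee.
  - exact: E0.
  - by move=> x _; have [] := dE x.
  - by apply: cvg_at_right_filter; have := dE x0; exact: is_derive_cts.
  - by move=> x _; rewrite derive1E; have := dE x => h; rewrite derive_val.
have iCe : itg `[x0, +oo[ (fun x => C * ee l x) by exact: itgZ.
have b' x : `[x0, +oo[%classic x -> `|f1 x| <= C * ee l x.
  by rewrite /= in_itv/= andbT; exact: bf.
have i1 : itg `[x0, +oo[ f1 by exact: (itg_le _ mf b' iCe).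
split => //.
have h1 := ftcy df cf i1 f0.
have h2 := ftcy (fun x _ => dE x) (fun x _ => @cts_ee R l x) ie E0.
have : `|\int[mu]_(x in `[x0, +oo[) f1 x| <= \int[mu]_(x in `[x0, +oo[) (C * ee l x).
  by apply: RI_le.
by rewrite RIZ// h1 h2 sub0r normrN mulNr sub0r opprK mulrA.
Qed.

End Trig.

(** * The kernels of the Lambert series and their expansions *)

Section Functions.
Variable R : realType.
Notation mu := (@lebesgue_measure R).
Local Notation Rp := (`]0%R, +oo[%classic : set R).
Variable N : nat.
Hypothesis N0 : (0 < N)%N.
Notation lam := (lam R N).

Let l0 : 0 < lam. Proof. exact: lam_gt0. Qed.
Let q x := ee lam x.
Definition th (d : nat) : R := lam * d%:R.

Lemma q01 (x : R) : 0 < x -> 0 <= ee lam x < 1.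
Proof. by move=> x0; rewrite ee_ge0 ee_lt1. Qed.

Lemma cos_th_lt1 d : (0 < d < N)%N -> cos (th d) < 1.
Proof.
move=> dN; have s0 := @sin_jn R N d dN.
have -> : th d = (pi * (d%:R / N%:R)) *+ 2 by rewrite /th /lam mulr2n; ring.
by rewrite cos_mulr2n cos2sin2 mulr2n; have := mulr_gt0 s0 s0; rewrite -expr2; lra.
Qed.

(* With [r = e^(-lam x)]: [sf d x = sum_k sin (k th_d) r^k],
   [Kf b x = sum_k cos (k th_b) r^k / k = - ln |1 - r e^(i th_b)|], and
   [wf c x = (r^c - r^(N-c)) / (1 - r^N)], where the common factor [1 - r] is
   cancelled to make it smooth at [x = 0]. *)
Definition sf (d : nat) (x : R) : R := ee lam x * sin (th d) / den (th d) (ee lam x).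
Definition Kf (b : nat) (x : R) : R := - 2^-1 * ln (den (th b) (ee lam x)).
Definition Kf1 (b : nat) (x : R) : R :=
  - lam * (ee lam x * cos (th b) - ee lam x ^+ 2) / den (th b) (ee lam x).
Definition wf (c : nat) (x : R) : R := ee lam x *
  (\sum_(i < (N - c).-1) 'X^i - \sum_(i < c.-1) 'X^i : {poly R}).[ee lam x] /
  (\sum_(i < N) 'X^i : {poly R}).[ee lam x].

Lemma sf_ratexp d : (0 < d < N)%N -> ratexp lam (sf d).
Proof.
move=> dN; exists (sin (th d))%:P, (1 - (2 * cos (th d)) *: 'X + 'X^2); split.
  move=> r r0; rewrite !(hornerD, hornerN, hornerZ, hornerX, hornerXn, hornerC).
  have := den_pos2 (cos_th_lt1 dN) r0; rewrite /den mulrAC; lra.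
move=> x; rewrite !(hornerD, hornerN, hornerZ, hornerX, hornerXn, hornerC) /sf /den.
by congr (_ / _); ring.
Qed.

Lemma sf_series d (x : R) : 0 < x ->
  series (fun k => sin (th d * k.+1%:R) * ee lam (k.+1%:R * x)) @ \oo --> sf d x.
Proof.
move=> x0; have := @sin_geometric_series R (th d) _ (q01 x0).
rewrite (_ : (fun k => _) = (fun k => sin (th d * k.+1%:R) * ee lam (k.+1%:R * x)))//.
by apply/funext => k; rewrite ee_nat.
Qed.

Lemma Kf1_ratexp b : (0 < b < N)%N -> ratexp lam (Kf1 b).
Proof.
move=> bN; exists ((- lam)%:P * ((cos (th b))%:P - 'X)), (1 - (2 * cos (th b)) *: 'X + 'X^2); split.
  move=> r r0; rewrite !(hornerD, hornerN, hornerZ, hornerX, hornerXn, hornerC).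
  have := den_pos2 (cos_th_lt1 bN) r0; rewrite /den mulrAC; lra.
move=> x; rewrite !(hornerD, hornerN, hornerZ, hornerX, hornerXn, hornerC, hornerM) /Kf1 /den.
by congr (_ / _); ring.
Qed.

Lemma dv_Kf b (x : R) : 0 < den (th b) (ee lam x) -> dv (Kf b) x (Kf1 b x).
Proof.
move=> d0.
have dden : dv (fun y => den (th b) (ee lam y)) x
    (- (2 * (- lam * ee lam x) * cos (th b)) + 2 * ee lam x * (- lam * ee lam x)).
  have de := dv_ee lam x.
  apply: dv_ext (dv_eq _ (dvD (dvB (dv_cst 1 x) (dvM (dvZ 2 de) (dv_cst (cos (th b)) x))) (dvM de de))).
    by move=> y; rewrite /den expr2.
  by ring.
apply: dv_eq (dvZ (- 2^-1) (@dv_ln _ (fun y => den (th b) (ee lam y)) x _ d0 dden)).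
by rewrite /Kf1; field; rewrite lt0r_neq0.
Qed.

Lemma Kf_cvg0 b : Kf b x @[x --> +oo] --> (0 : R).
Proof.
have -> : (0 : R) = - 2^-1 * ln (den (th b) 0).
  by rewrite /den !mulr0 !mul0r subr0 expr0n addr0 ln1 mulr0.
apply: cvgM; first exact: cvg_cst.
apply: (@cvg_comp _ _ _ (ee lam) (fun r => ln (den (th b) r)) _ (nbhs 0)).
  exact: ee_cvg0.
have d0 : dv (den (th b)) 0 (- (2 * 1 * cos (th b)) + 2 * 0).
  apply: dv_ext (dv_eq _ (dvD (dvB (dv_cst 1 0) (dvM (dvZ 2 (dv_id 0)) (dv_cst (cos (th b)) 0))) (dvM (dv_id 0) (dv_id 0)))).
    by move=> y; rewrite /den expr2.
  by ring.
have p0 : 0 < den (th b) 0 by rewrite den_pos1// lexx ltr01.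
by have := @dv_ln _ (den (th b)) 0 _ p0 d0; exact: is_derive_cts.
Qed.

Lemma Kf_edecay b : (0 < b < N)%N -> exists f2 C, edecay (Kf b) (Kf1 b) f2 C lam.
Proof.
move=> bN; have r1 := Kf1_ratexp bN.
have dK (x : R) : dv (Kf b) x (Kf1 b x) by apply: dv_Kf; apply: den_pos2 (cos_th_lt1 bN) (ee_ge0 _ _).
apply: ratexp_decay => //.
have [C C0 hC] := ratexp_bound l0 r1.
exists (C / lam); first by rewrite divr_ge0// ltW.
move=> x x0; have [] := @decay_antider R (Kf b) (Kf1 b) C lam x l0 => //.
- by move=> y _; exact: (ratexp_cts r1).
- by move=> y xy; apply: hC; exact: le_trans xy.
- exact: Kf_cvg0.
Qed.

(** The cosine geometric series, equal to the derivative of [Kf] up to a factor, is integrated term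
    by term on the ray from x. The case b = 0, where [Kf] has a logarithmic singularity at 0, is
    included. *)
Lemma Kf_series b (x : R) : 0 < x ->
  series (fun k => cos (th b * k.+1%:R) / k.+1%:R * ee lam (k.+1%:R * x)) @ \oo --> Kf b x.
Proof.
move=> x0; have /andP[r0 r1] := q01 x0.
pose h k (y : R) := cos (th b * k.+1%:R) * ee lam y ^+ k.+1.
pose H (y : R) := (ee lam y * cos (th b) - ee lam y ^+ 2) / den (th b) (ee lam y).
have ypos (y : R) : x <= y -> 0 < y by exact: lt_le_trans.
have dpos (y : R) : x <= y -> 0 < den (th b) (ee lam y).
  by move=> /ypos y0; apply: den_pos1; exact: q01.
have cH (y : R) : x <= y -> {for y, continuous (Kf1 b)}.
  move=> xy; apply: cvgM.
    apply: cvgM; first exact: cvg_cst.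
    apply: cvgB; first by apply: cvgM; [exact: cts_ee|exact: cvg_cst].
    by have := dvM (dv_ee lam y) (dv_ee lam y) => dd; apply: (is_derive_cts (df := _) dd).
  apply: cvgV; first by rewrite lt0r_neq0// dpos.
  have de := dv_ee lam y.
  by have := dvD (dvB (dv_cst 1 y) (dvM (dvZ 2 de) (dv_cst (cos (th b)) y))) (dvM de de) => dd;
    apply: (is_derive_cts (df := _) dd).
pose G (y : R) := (1 - ee lam x)^-1 * ee lam y.
have s0 : 0 < 1 - ee lam x by rewrite subr_gt0.
have bh n y : `[x, +oo[%classic y -> `|series (fun k => h k y) n| <= G y.
  rewrite /= in_itv/= andbT => xy.
  have ry : ee lam y <= ee lam x by apply: ee_decr => //; exact: ltW.
  rewrite /series /=; apply: (le_trans (ler_norm_sum _ _ _)).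
  apply: (@le_trans _ _ (series (fun k => ee lam x ^+ k) n * ee lam y)).
    rewrite /series /= big_distrl /=; apply: ler_sum => k _.
    apply: (le_trans (cosM_le _ _)); rewrite ger0_norm ?exprn_ge0 ?ee_ge0//.
    by rewrite exprSr ler_wpM2r ?ee_ge0// lerXn2r ?nnegrE ?ee_ge0.
  rewrite ler_wpM2r ?ee_ge0//.
  have gg := geometric_series (q01 x0).
  rewrite -(cvg_lim _ gg)//; apply: nondecreasing_cvgn_le; last by apply: cvgP gg.
  by apply: nondecreasing_series => k _ _; rewrite exprn_ge0.
have Kb y : x <= y -> `|Kf1 b y| <= lam * (1 - ee lam x)^-1 * ee lam y.
  move=> xy; rewrite /Kf1 mulNr mulNr normrN -mulrA normrM (gtr0_norm l0) -mulrA ler_wpM2l ?(ltW l0)//.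
  have := @cos_geometric_series R (th b) _ (q01 (ypos y xy)) => /cvg_norm hh.
  apply: (cvgr_to_le hh); near=> n; apply: bh.
  by rewrite /= in_itv/= xy.
have [iK _] := @decay_antider R (Kf b) (Kf1 b) _ lam x l0
  (fun y xy => dv_Kf (dpos y xy)) cH Kb (@Kf_cvg0 b).
have mh k : measurable_fun `[x, +oo[ (h k).
  apply: cts_measT => y; apply: cvgM; first exact: cvg_cst.
  apply: (@continuous_comp _ _ _ (ee lam) (fun z => z ^+ k.+1)); first exact: cts_ee.
  exact: exprn_continuous.
have iee (l : R) : 0 < l -> itg `[x, +oo[ (ee l) /\ \int[mu]_(y in `[x, +oo[) ee l y = l^-1 * ee l x.
  move=> l1.
  have dE (y : R) : dv (fun y => - l^-1 * ee l y) y (ee l y).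
    apply: dv_eq (dvZ _ (dv_ee l y)).
    by rewrite mulrA mulrNN mulVf ?mul1r// lt0r_neq0.
  have E0 : - l^-1 * ee l x @[x --> +oo] --> (0 : R).
    rewrite -[X in _ --> X](mulr0 (- l^-1)); apply: cvgM; first exact: cvg_cst.
    exact: ee_cvg0.
  have [ie _] := @decay_antider R (fun y => - l^-1 * ee l y) (ee l) 1 l x l1 (fun y _ => dE y)
    (fun y _ => @cts_ee R l y) (fun y _ => ltac:(rewrite mul1r ger0_norm ?ee_ge0//)) E0.
  split => //; rewrite (ftcy (fun y _ => dE y) (fun y _ => @cts_ee R l y) ie E0).
  by rewrite sub0r mulNr opprK.
have [ie _] := iee lam l0.
have hH y : `[x, +oo[%classic y -> series (fun k => h k y) @ \oo --> H y.
  by rewrite /= in_itv/= andbT => xy; apply: cos_geometric_series; apply: q01; exact: ypos.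
have [_ _ cS] := @series_itg_dom _ `[x, +oo[%classic h H G (measurable_itv _) mh hH bh
  (itgZ _ (measurable_itv _) ie).
have HE : \int[mu]_(y in `[x, +oo[) H y = lam^-1 * Kf b x.
  rewrite (@eq_RI _ _ _ (fun y => - lam^-1 * Kf1 b y)).
    rewrite RIZ// (ftcy (fun y xy => dv_Kf (dpos y xy)) cH iK (@Kf_cvg0 b)).
    by rewrite sub0r mulrNN.
  move=> y _; rewrite /Kf1 /H; move: (den _ _) => d.
  by move: (lam) (lt0r_neq0 l0) => l ln0; rewrite !mulrA; congr (_ / _); field.
rewrite HE in cS.
rewrite (_ : series _ = (fun n => lam * series (fun k => \int[mu]_(y in `[x, +oo[) h k y) n)).
  have -> : Kf b x = lam * (lam^-1 * Kf b x) by rewrite mulrA divff ?mul1r// lt0r_neq0.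
  by apply: cvgM => //; exact: cvg_cst.
apply/funext => n; rewrite /series /= big_distrr /=; apply: eq_bigr => k _.
have lk : 0 < lam * k.+1%:R by rewrite mulr_gt0.
have [ik ek] := iee _ lk.
rewrite (@eq_RI _ _ (h k) (fun y => cos (th b * k.+1%:R) * ee (lam * k.+1%:R) y)); last first.
  by move=> y _; rewrite /h -ee_nat ee_scale.
rewrite RIZ// ek ee_scale; move: (lam) (lt0r_neq0 l0) => l ln0.
by field; rewrite nat1r pnatr_eq0 ln0.
Unshelve. all: by end_near. Qed.

(** Read off the series, hence valid for b = 0 as well, in contrast to [Kf_edecay]. *)
Lemma Kf_bound b (x : R) : 0 < x -> `|Kf b x| <= ee lam x / (1 - ee lam x).
Proof.
move=> x0; have /andP[r0 r1] := q01 x0.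
have s0 : 0 < 1 - ee lam x by rewrite subr_gt0.
have h : `|series (fun k => cos (th b * k.+1%:R) / k.+1%:R * ee lam (k.+1%:R * x)) n|
    @[n --> \oo] --> `|Kf b x| by apply: cvg_norm; exact: Kf_series.
apply: (cvgr_to_le h); near=> n; rewrite /series /=.
apply: (le_trans (ler_norm_sum _ _ _)).
apply: (@le_trans _ _ (ee lam x * series (fun k => ee lam x ^+ k) n)).
  rewrite /series /= big_distrr /=; apply: ler_sum => k _.
  rewrite -mulrA; apply: (le_trans (cosM_le _ _)).
  rewrite ger0_norm ?mulr_ge0 ?invr_ge0 ?ee_ge0// ee_nat exprS.
  by rewrite ler_piMl ?mulr_ge0 ?exprn_ge0// invf_le1// ler1n.
rewrite ler_wpM2l//; have gg := geometric_series (q01 x0).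
rewrite -(cvg_lim _ gg)//; apply: nondecreasing_cvgn_le; last by apply: cvgP gg.
by apply: nondecreasing_series => k _ _; rewrite exprn_ge0.
Unshelve. all: by end_near. Qed.

Let hsum n (r : R) : (\sum_(i < n) 'X^i : {poly R}).[r] = \sum_(i < n) r ^+ i.
Proof. by rewrite horner_sum; apply: eq_bigr => i _; rewrite hornerXn. Qed.

Let gsum n (r : R) : (1 - r) * (\sum_(i < n) r ^+ i) = 1 - r ^+ n.
Proof. by rewrite -[in RHS](expr1n _ n) subrXX; congr (_ * _); apply: eq_bigr => i _; rewrite expr1n mul1r. Qed.

Lemma wf_ratexp c : ratexp lam (wf c).
Proof.
exists (\sum_(i < (N - c).-1) 'X^i - \sum_(i < c.-1) 'X^i), (\sum_(i < N) 'X^i); split => //.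
move=> r r0; rewrite hsum -(prednK N0) big_ord_recl expr0.
by rewrite ltr_wpDr// sumr_ge0// => i _; rewrite exprn_ge0.
Qed.

(** Both r^c and r^(N - c) have the form r - r (1 - r^n), so r drops out of their difference and 1 -
    r can be divided out; the truncated sums of powers are the quotients. *)
Lemma wfE c (x : R) : (0 < c < N)%N ->
  (1 - ee lam x ^+ N) * wf c x = ee lam x ^+ c - ee lam x ^+ (N - c).
Proof.
move=> /andP[c0 cN]; rewrite /wf; set r := ee lam x.
rewrite hornerD hornerN !hsum.
have Q0 : \sum_(i < N) r ^+ i != 0.
  rewrite lt0r_neq0// -(prednK N0) big_ord_recl expr0.
  by rewrite ltr_wpDr// sumr_ge0// => i _; rewrite exprn_ge0 ?ee_ge0.
rewrite -gsum.
have -> : r ^+ c = r - r * ((1 - r) * \sum_(i < c.-1) r ^+ i).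
  by rewrite gsum mulrBr mulr1 -exprS prednK// opprB addrCA subrr addr0.
have -> : r ^+ (N - c) = r - r * ((1 - r) * \sum_(i < (N - c).-1) r ^+ i).
  by rewrite gsum mulrBr mulr1 -exprS prednK ?subn_gt0// opprB addrCA subrr addr0.
by move: (\sum_(i < N) _) Q0 => Q Q0; field.
Qed.

Lemma wf0 c : (0 < c < N)%N -> wf c 0 = 1 - 2 * (c%:R / N%:R).
Proof.
move=> /andP[c0 cN]; rewrite /wf ee0 hornerD hornerN !hsum mul1r.
have hs n : \sum_(i < n) (1 : R) ^+ i = n%:R.
  by under eq_bigr do rewrite expr1n; rewrite sumr_const card_ord.
rewrite !hs.
have NN : N%:R != 0 :> R by rewrite pnatr_eq0 -lt0n.
have -> : (N - c).-1%:R = N%:R - c%:R - 1 :> R.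
  by rewrite -subn1 !natrB ?subn_gt0 ?(ltnW cN).
have -> : c.-1%:R = c%:R - 1 :> R by rewrite -subn1 natrB.
by field.
Qed.

Lemma qN1 (x : R) : 0 < x -> 0 < ee lam x ^+ N < 1.
Proof. by move=> x0; rewrite exprn_gt0 ?ee_gt0//= exprn_ilt1 ?ee_ge0 ?ee_lt1// -lt0n. Qed.

(** The indices run over the absolute values of the integers congruent to [a] mod N, and [pairm]
    weighs them by the sign of the integer. For a = 0 the pair is N j, N (j + 1): the odd sum
    telescopes, and in the even one 0 occurs once and every other multiple of N twice. *)
Definition pairm (g : nat -> R) (a j : nat) : R := g (N * j + a)%N - g (N * j + (N - a))%N.
Definition pairp (g : nat -> R) (a j : nat) : R := g (N * j + a)%N + g (N * j + (N - a))%N.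

Lemma wf_series c (x : R) : (0 < c < N)%N -> 0 < x ->
  series (pairm (fun m => ee lam (m%:R * x)) c) @ \oo --> wf c x.
Proof.
move=> cN x0; have /andP[z0 z1] := qN1 x0.
have s0 : 1 - ee lam x ^+ N != 0 by rewrite lt0r_neq0// subr_gt0.
have zz : 0 <= ee lam x ^+ N < 1 by rewrite z1 (ltW z0).
rewrite (_ : series _ = (fun n => (ee lam x ^+ c - ee lam x ^+ (N - c)) *
   series (fun k => (ee lam x ^+ N) ^+ k) n)).
  have -> : wf c x = (ee lam x ^+ c - ee lam x ^+ (N - c)) * (1 - ee lam x ^+ N)^-1.
    by rewrite -wfE// mulrAC mulfV// mul1r.
  by apply: cvgM; [exact: cvg_cst|exact: geometric_series].
apply/funext => n; rewrite /series /= big_distrr /=; apply: eq_bigr => k _.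
by rewrite /pairm !ee_nat !exprD !exprM; ring.
Qed.

(** The partial sums are 1 - r^(N n) times the limit, so the limit itself dominates them when
    integrating term by term. *)
Lemma wf_partial c (x : R) n : (0 < c < N)%N -> 0 < x ->
  `|series (pairm (fun m => ee lam (m%:R * x)) c) n| <= `|wf c x|.
Proof.
move=> cN x0; have /andP[z0 z1] := qN1 x0.
have s0 : 1 - ee lam x ^+ N != 0 by rewrite lt0r_neq0// subr_gt0.
have -> : series (pairm (fun m => ee lam (m%:R * x)) c) n = (1 - (ee lam x ^+ N) ^+ n) * wf c x.
  apply: (mulfI s0); rewrite mulrCA wfE//.
  rewrite /series /=; elim: n => [|n IH]; first by rewrite big_geq// expr0; ring.
  by rewrite big_nat_recr//= mulrDr IH /pairm !ee_nat !exprD !exprM !exprS; ring.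
have p1 : (ee lam x ^+ N) ^+ n <= 1 by rewrite exprn_ile1// ltW.
have p0 : 0 <= (ee lam x ^+ N) ^+ n by rewrite exprn_ge0// ltW.
by rewrite normrM ler_piMl// ger0_norm; lra.
Qed.

(** The closed form [wfE] is differentiated rather than the series, and the result is matched with
    two arithmetic-geometric series. *)
Lemma wf1_series c (x d : R) : (0 < c < N)%N -> 0 < x -> dv (wf c) x d ->
  series (pairm (fun m => - lam * (m%:R * ee lam (m%:R * x))) c) @ \oo --> d.
Proof.
move=> cN x0 dw; have /andP[c0 cN'] := cN; have /andP[z0 z1] := qN1 x0.
have s0 : 1 - ee lam x ^+ N != 0 by rewrite lt0r_neq0// subr_gt0.
have dq n : dv (fun y => ee lam y ^+ n) x (- lam * (n%:R * ee lam x ^+ n)).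
  apply: dv_ext (dv_eq _ (dv_ee (n%:R * lam) x)).
    by move=> y; rewrite -ee_nat ee_scale [lam * _]mulrC.
  by rewrite -ee_nat ee_scale [X in ee X x]mulrC; ring.
have e1 := dvM (dvB (dv_cst 1 x) (dq N)) dw.
have e2 := dvB (dq c) (dq (N - c)%N).
have e1' := dv_ext (fun y => wfE y cN) e1.
have E : (0 - (- lam * (N%:R * ee lam x ^+ N))) * wf c x + (1 - ee lam x ^+ N) * d =
   (- lam * (c%:R * ee lam x ^+ c)) - (- lam * ((N - c)%:R * ee lam x ^+ (N - c))).
  by rewrite -(@derive_val _ _ _ _ _ _ _ e1') (@derive_val _ _ _ _ _ _ _ e2).
have g1 := @arith_geometric_series R c%:R N%:R _ (qN1 x0).
have g2 := @arith_geometric_series R (N - c)%:R N%:R _ (qN1 x0).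
rewrite (_ : series _ = (fun n => - lam * (ee lam x ^+ c *
   series (fun j => (N%:R * j%:R + c%:R) * (ee lam x ^+ N) ^+ j) n - ee lam x ^+ (N - c) *
   series (fun j => (N%:R * j%:R + (N - c)%:R) * (ee lam x ^+ N) ^+ j) n))).
  have -> : d = - lam * (ee lam x ^+ c * (c%:R / (1 - ee lam x ^+ N) + N%:R * ee lam x ^+ N / (1 - ee lam x ^+ N) ^+ 2)
    - ee lam x ^+ (N - c) * ((N - c)%:R / (1 - ee lam x ^+ N) + N%:R * ee lam x ^+ N / (1 - ee lam x ^+ N) ^+ 2)).
    apply: (mulfI s0); have := wfE x cN.
    move: E s0; move: (ee lam x ^+ N) (ee lam x ^+ c) (ee lam x ^+ (N - c)) (wf c x) => z A B w E s0 W.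
    have wE : w = (A - B) / (1 - z) by rewrite -W mulrAC mulfV// mul1r.
    have -> : (1 - z) * d = - lam * (c%:R * A) - - lam * ((N - c)%:R * B)
      - (0 - - lam * (N%:R * z)) * w by rewrite -E; ring.
    by rewrite wE; move: (lam) (c%:R : R) ((N - c)%:R : R) (N%:R : R) => l c' Nc N'; field.
  apply: cvgM; first exact: cvg_cst.
  by apply: cvgB; apply: cvgM => //; exact: cvg_cst.
apply/funext => n; rewrite /series /= !big_distrr /= -sumrB big_distrr /=.
apply: eq_bigr => k _; rewrite /pairm !ee_nat !exprD !exprM !natrD !natrM; ring.
Qed.

End Functions.

(** * Modular relations *)

Section Bounds.
Variable R : realType.
Notation mu := (@lebesgue_measure R).
Local Notation Rp := (`]0%R, +oo[%classic : set R).

Lemma series_ext (u v : nat -> R) : (forall n, u n = v n) -> series u = series v.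
Proof. by move=> /funext ->. Qed.

Lemma cvg_seriesZ (u : nat -> R) (k l : R) : series u @ \oo --> l ->
  series (fun n => k * u n) @ \oo --> k * l.
Proof.
move=> h; rewrite (_ : series _ = (fun n => k * series u n)).
  by apply: cvgM => //; exact: cvg_cst.
by apply/funext => n; rewrite /series /= big_distrr.
Qed.

Lemma cvg_seriesD (u v : nat -> R) (l m : R) : series u @ \oo --> l ->
  series v @ \oo --> m -> series (fun n => u n + v n) @ \oo --> l + m.
Proof.
move=> hu hv; rewrite (_ : series _ = (fun n => series u n + series v n)).
  exact: cvgD.
by apply/funext => n; rewrite /series /= -big_split.
Qed.

Lemma ee_lt1_01 (l x : R) : 0 < l -> 0 < x -> 0 <= ee l x < 1.
Proof. by move=> l0 x0; rewrite ee_ge0 ee_lt1. Qed.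

Lemma cvg_ee_series (C l : R) : 0 < l -> cvgn (series (fun j => C * ee l j%:R)).
Proof.
move=> l0; apply/cvg_ex; exists (C * (1 - ee l 1)^-1); apply: cvg_seriesZ.
have := geometric_series (ee_lt1_01 l0 ltr01).
rewrite (_ : (fun k => _) = (fun j => ee l j%:R))//.
by apply/funext => k; rewrite -ee_nat mulr1.
Qed.

(* [e^-y / (1 - e^-y)] with [z = e^(-y/2)] is at most [z * z / (1 - z)]. *)
Lemma geo_bound (y : R) : 0 < y ->
  expR (- y) / (1 - expR (- y)) <= 2 / y * expR (- (y / 2)).
Proof.
move=> y0; set z := expR (- (y / 2)).
have z0 : 0 < z by exact: expR_gt0.
have y2 : 0 < y / 2 by rewrite divr_gt0.
have z1 : z < 1 by rewrite /z expR_lt1 oppr_lt0.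
have -> : expR (- y) = z * z by rewrite /z -expRD; congr expR; field.
have h : z * (y / 2) <= 1 - z.
  have h1 : 1 + y / 2 <= expR (y / 2) by exact: expR_ge1Dx.
  have h2 : z * expR (y / 2) = 1 by rewrite /z -expRD addNr expR0.
  have := ler_wpM2l (ltW z0) h1; rewrite h2 mulrDr mulr1; lra.
have d0 : 0 < 1 - z * z by nra.
have E : 2 / y * z * (1 - z * z) = z * ((1 + z) * (2 / y * (1 - z))) by ring.
rewrite ler_pdivrMr// E.
rewrite ler_wpM2l ?ltW//.
have h3 : z <= 2 / y * (1 - z).
  rewrite -[z as X in X <= _]mulr1 -[X in z * X](_ : y / 2 * (2 / y) = 1); last by field; rewrite lt0r_neq0.
  by rewrite mulrA [leRHS]mulrC ler_wpM2r// divr_ge0// ltW.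
have h4 : 0 <= 2 / y * (1 - z) by rewrite mulr_ge0 ?divr_ge0 ?ltW// subr_gt0.
nra.
Qed.

(** Tannery's theorem with the j-th row truncated at h and rows beyond h set to 0. *)
Lemma series_square (a : nat -> nat -> R) (A B r : nat -> R) :
  (forall j k, `|a j k| <= A j * B k) -> cvgn (series A) -> cvgn (series B) ->
  (forall k, 0 <= B k) ->
  (forall j, series (a j) @ \oo --> r j) ->
  cvgn (series r) /\
  (\sum_(0 <= j < h) \sum_(0 <= k < h) a j k) @[h --> \oo] --> limn (series r).
Proof.
move=> ab cA cB B0 ar.
pose u h j := if (j < h)%N then series (a j) h else 0.
pose Z := limn (series B).
have A0 j : 0 <= A j * Z.
  have [B00|B00] := eqVneq (B 0%N) 0; last first.
    have Aj : 0 <= A j.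
      by have := le_trans (normr_ge0 _) (ab j 0%N); rewrite pmulr_lge0// lt_def B00 B0.
    rewrite mulr_ge0// /Z; apply: limr_ge => //; near=> n.
    by rewrite /series /= sumr_ge0.
  have hr : series (fun k => A j * B k) @ \oo --> A j * Z by apply: cvg_seriesZ.
  apply: (cvgr_to_ge hr); near=> n; rewrite /series /= sumr_ge0// => k _.
  exact: le_trans (normr_ge0 _) (ab j k).
have [//|||cr] := @tannery_lim R u r (fun j => A j * Z).
- move=> h j; rewrite /u; case: ifP => _; last by rewrite normr0.
  have hr : series (fun k => A j * B k) @ \oo --> A j * Z by apply: cvg_seriesZ.
  rewrite /series /=; apply: (le_trans (ler_norm_sum _ _ _)).
  apply: (@le_trans _ _ (series (fun k => A j * B k) h)); first by apply: ler_sum.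
  rewrite -(cvg_lim _ hr)//; apply: nondecreasing_cvgn_le; last exact: cvgP hr.
  apply: nondecreasing_series => k _ _; exact: le_trans (normr_ge0 _) (ab j k).
- apply/cvg_ex; exists (Z * limn (series A)).
  rewrite (_ : (fun j => A j * Z) = (fun j => Z * A j)); first exact: cvg_seriesZ.
  by apply/funext => j; rewrite mulrC.
- move=> j; apply: cvg_trans (ar j); apply: near_eq_cvg; near=> h.
  by rewrite /u ifT//; near: h; exact: nbhs_infty_gt.
move=> h; split => //.
rewrite (_ : (fun h => _) = (fun h => series (u h) h))//.
by apply/funext => n; rewrite /series /=; apply: eq_big_nat => j /andP[_ jn]; rewrite /u jn.
Unshelve. all: by end_near. Qed.

(** Square partial sums are symmetric in the two indices, and both iterated sums are their limit. *)
Lemma series_swap (a : nat -> nat -> R) (A B r c : nat -> R) (Y : R) :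
  (forall j k, `|a j k| <= A j * B k) -> cvgn (series A) -> cvgn (series B) ->
  (forall j, 0 <= A j) -> (forall k, 0 <= B k) ->
  (forall j, series (a j) @ \oo --> r j) ->
  (forall k, series (fun j => a j k) @ \oo --> c k) ->
  series c @ \oo --> Y -> series r @ \oo --> Y.
Proof.
move=> ab cA cB A0 B0 ar ac cY.
have [cr sr] := series_square ab cA cB B0 ar.
have ba k j : `|a j k| <= B k * A j by rewrite mulrC.
have [cc sc] := @series_square (fun k j => a j k) B A c ba cB cA A0 ac.
have <- : limn (series r) = Y; last by [].
rewrite -(cvg_lim _ cY)//.
apply: (cvg_unique _ sr) => //.
rewrite (_ : (fun h => _) = (fun h => \sum_(0 <= k < h) \sum_(0 <= j < h) a j k))//.
by apply/funext => h; rewrite exchange_big.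
Qed.

Variable N : nat.
Hypothesis N0 : (0 < N)%N.

(** Uniform in the rate m, which later depends on t: the bound grows only like 1 / m for small m and
    decays exponentially for large m. As every index k satisfies k >= 1 and k >= j, one half of the
    exponent gives the decay and the other half the geometric series. *)
Lemma pair_bound (F : nat -> R) (C m : R) (a : nat) n : 0 < m -> 0 <= C -> (0 < a < N)%N ->
  (forall k, (0 < k)%N -> `|F k| <= C * ee m k%:R) ->
  \sum_(0 <= j < n) (`|F (N * j + a)%N| + `|F (N * j + (N - a))%N|) <= 8 * C / m * ee m (1 / 4).
Proof.
move=> m0 C0 /andP[a0 aN] FC.
have m2 : 0 < m / 2 by rewrite divr_gt0.
have h k j : (0 < k)%N -> (j <= k)%N -> `|F k| <= C * (ee m (1 / 2) * ee (m / 2) j%:R).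
  move=> k0 jk; apply: (le_trans (FC k k0)); rewrite ler_wpM2l// /ee -expRD ler_expR.
  have k1 : 1 <= k%:R :> R by rewrite ler1n.
  have jk' : j%:R <= k%:R :> R by rewrite ler_nat.
  rewrite -opprD lerN2; have := ler_wpM2l (ltW m0) (_ : 1 / 2 + j%:R / 2 <= k%:R) => h.
  by apply: le_trans (h _); [rewrite le_eqVlt; apply/orP; left; apply/eqP; field|lra].
apply: (@le_trans _ _ (\sum_(0 <= j < n) 2 * C * ee m (1 / 2) * ee (m / 2) 1 ^+ j)).
  apply: ler_sum => j _; rewrite -ee_nat mulr1.
  have h1 := @h (N * j + a)%N j; have h2 := @h (N * j + (N - a))%N j.
  have := h1 _ _; have := h2 _ _.
  move=> /(_ ltac:(lia) ltac:(nia)) {}h2 /(_ ltac:(lia) ltac:(nia)) {}h1; lra.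
rewrite -big_distrr /=.
have gg := geometric_series (ee_lt1_01 m2 ltr01).
apply: (@le_trans _ _ (2 * C * ee m (1 / 2) * (1 - ee (m / 2) 1)^-1)).
  rewrite ler_wpM2l ?mulr_ge0 ?ee_ge0// -(cvg_lim _ gg)//.
  apply: nondecreasing_cvgn_le; last by apply: cvgP gg.
  by apply: nondecreasing_series => k _ _; rewrite exprn_ge0// ee_ge0.
have := geo_bound m2.
have -> : expR (- (m / 2)) = ee m (1 / 2) by rewrite /ee; congr expR; ring.
have -> : ee (m / 2) 1 = ee m (1 / 2) by rewrite /ee; congr expR; ring.
have -> : expR (- (m / 2 / 2)) = ee m (1 / 4) by rewrite /ee; congr expR; field.
move=> hb; rewrite -mulrA; apply: (le_trans (ler_wpM2l (mulr_ge0 (ler0n _ _) C0) hb)).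
rewrite le_eqVlt; apply/orP; left; apply/eqP.
by move: (ee m (1/4)) => e; field; rewrite lt0r_neq0.
Qed.

Lemma pairm_le (F : nat -> R) a j : `|pairm N F a j| <= `|F (N * j + a)%N| + `|F (N * j + (N - a))%N|.
Proof. exact: ler_normB. Qed.

Lemma pairp_le (F : nat -> R) a j : `|pairp N F a j| <= `|F (N * j + a)%N| + `|F (N * j + (N - a))%N|.
Proof. exact: ler_normD. Qed.

Lemma pair_summable (F : nat -> R) (C m : R) (a : nat) : 0 < m -> 0 <= C -> (a < N)%N ->
  (forall k, `|F k| <= C * ee m k%:R) ->
  cvgn (series (pairm N F a)) /\ cvgn (series (pairp N F a)).
Proof.
move=> m0 C0 aN FC.
have b j : `|F (N * j + a)%N| + `|F (N * j + (N - a))%N| <= 2 * C * ee m j%:R.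
  have h k : (j <= k)%N -> `|F k| <= C * ee m j%:R.
    by move=> jk; apply: (le_trans (FC k)); rewrite ler_wpM2l// ee_decr ?ler_nat// ltW.
  have := @h (N * j + a)%N ltac:(nia); have := @h (N * j + (N - a))%N ltac:(nia); lra.
have cc := @cvg_ee_series (2 * C) m m0.
split; apply: series_abs_cvg cc => j.
  by apply: le_trans (pairm_le _ _ _) (b j).
by apply: le_trans (pairp_le _ _ _) (b j).
Qed.

End Bounds.

(** * Fourier transforms of the kernels *)

Section Modular.
Variable R : realType.
Notation mu := (@lebesgue_measure R).
Local Notation Rp := (`]0%R, +oo[%classic : set R).
Variable N : nat.
Hypothesis N0 : (0 < N)%N.
Notation lam := (lam R N).
Notation sf := (@sf R N).
Notation wf := (@wf R N).
Notation Kf := (@Kf R N).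
Notation th := (@th R N).

Let l0 : 0 < lam. Proof. exact: lam_gt0. Qed.
Let NN0 : 0 < N%:R :> R. Proof. by rewrite ltr0n. Qed.

(** The cosine transform of e^(-lam m x) at lam xi equals the sine transform of e^(-lam xi x) at lam
    m. So the integral, expanded in exponentials, is the dual side of [psin] for e^(-lam xi x),
    whose other side is the sine series [sf c xi]. *)
Lemma ft_wf_pos c (xi : R) : (0 < c < N)%N -> 0 < xi ->
  \int[mu]_(x in Rp) (cos (lam * xi * x) * wf c x) = sf c xi.
Proof.
move=> cN xi0; have lx0 : 0 < lam * xi by rewrite mulr_gt0.
have [X X1 X2] := psin N0 (edecay_ee lx0) cN.
have XE : X = sf c xi.
  apply: (cvg_unique _ X1) => //; have := @sf_series R N N0 c xi xi0.
  rewrite (_ : (fun k => _) = (fun k => sin (lam * c%:R * k.+1%:R) * ee (lam * xi) k.+1%:R))//.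
  by apply/funext => k; rewrite -ee_scale [k.+1%:R * _]mulrC.
rewrite -XE.
pose f j (x : R) := cos (lam * xi * x) * pairm N (fun m => ee lam (m%:R * x)) c j.
have cf j : continuous (f j).
  have ceek (k : R) : continuous (fun x => ee lam (k * x)).
    move=> x; apply: (@continuous_comp _ _ _ (fun z : R => k * z) (ee lam)); last exact: cts_ee.
    by have := dv_lin k x; exact: is_derive_cts.
  apply: (@cts_cosM R _ (fun x => pairm N (fun m => ee lam (m%:R * x)) c j)) => y.
  by apply: cvgB; exact: ceek.
have [Cw Cw0 hw] := ratexp_bound l0 (@wf_ratexp R N N0 c).
have iw : itg Rp (wf c).
  apply: (itg_bee l0) => [|x /ltW]; last exact: hw.
  by apply: cts_meas; exact: (ratexp_cts (@wf_ratexp R N N0 c)).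
have fw x : Rp x -> series (fun j => f j x) @ \oo --> cos (lam * xi * x) * wf c x.
  by rewrite /= in_itv/= andbT => x0; apply: cvg_seriesZ; exact: wf_series.
have bw n x : Rp x -> `|series (fun j => f j x) n| <= `|wf c x|.
  rewrite /= in_itv/= andbT => x0; rewrite /series /= -big_distrr /=.
  by apply: (le_trans (cosM_le _ _)); exact: wf_partial.
have [_ _ cI] := @series_itg_dom _ Rp f _ _ (measurable_itv _) (fun n => cts_meas (cf n)) fw bw
  (itg_norm (measurable_itv _) iw).
apply: (cvg_unique _ cI) => //.
rewrite (_ : series _ = series (fun j => sint N (ee (lam * xi)) (N * j + c)%N - sint N (ee (lam * xi)) (N * j + (N - c))%N))//.
apply: series_ext => j.
have ic (m : R) : 0 < m -> itg Rp (fun x => cos (lam * xi * x) * ee (lam * m) x).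
  move=> m0; have lm : 0 < lam * m by rewrite mulr_gt0.
  apply: (itg_bee (C := 1) lm); first by apply: cts_meas; apply: cts_cosM; exact: cts_ee.
  by move=> x _; rewrite mul1r (le_trans (cosM_le _ _))// ger0_norm ?ee_ge0.
have /andP[c0 cN'] := cN.
have p1 : 0 < (N * j + c)%:R :> R by rewrite ltr0n; lia.
have p2 : 0 < (N * j + (N - c))%:R :> R by rewrite ltr0n; lia.
rewrite (@eq_RI _ _ _ (fun x => cos (lam * xi * x) * ee (lam * (N * j + c)%:R) x -
   cos (lam * xi * x) * ee (lam * (N * j + (N - c))%:R) x)); last first.
  by move=> x _; rewrite /f /pairm !ee_scale; ring.
rewrite RIB//; [|exact: ic..].
rewrite (RI_cos_ee _ (mulr_gt0 l0 p1)) (RI_cos_ee _ (mulr_gt0 l0 p2)) /sint !RI_sin_ee//.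
by congr (_ / _ - _ / _); rewrite addrC.
Qed.

Lemma wf_itg c : itg Rp (wf c).
Proof.
have [Cw Cw0 hw] := ratexp_bound l0 (@wf_ratexp R N N0 c).
apply: (itg_bee l0) => [|x /ltW]; last exact: hw.
by apply: cts_meas; exact: (ratexp_cts (@wf_ratexp R N N0 c)).
Qed.

(** [psin] needs a positive rate, so the frequency 0 is reached as the limit of the frequencies 1 /
    n. *)
Lemma ft_wf0 c : (0 < c < N)%N -> \int[mu]_(x in Rp) wf c x = sf c 0.
Proof.
move=> cN.
have cw := ratexp_cts (@wf_ratexp R N N0 c).
pose S n (x : R) := cos (lam * n.+1%:R^-1 * x) * wf c x.
have mS n : measurable_fun Rp (S n) by apply: cts_meas; exact: cts_cosM.
have inv0 : n.+1%:R^-1 @[n --> \oo] --> (0 : R) by exact: cvg_harmonic.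
have cS x : Rp x -> S ^~ x @ \oo --> wf c x.
  move=> _; rewrite -[X in _ --> X]mul1r; apply: cvgM; last exact: cvg_cst.
  rewrite -[X in _ --> X](_ : cos (lam * 0 * x) = 1); last by rewrite mulr0 mul0r cos0.
  apply: (@cvg_comp _ _ _ _ (@cos R) \oo (nbhs (lam * 0 * x))); last exact: continuous_cos.
  by apply: cvgM; [apply: cvgM => //; exact: cvg_cst|exact: cvg_cst].
have bS n x : Rp x -> `|S n x| <= `|wf c x| by move=> _; exact: cosM_le.
have [_ _ cI] := itg_dct (measurable_itv _) mS cS bS (itg_norm (measurable_itv _) (wf_itg c)).
apply: (cvg_unique _ cI) => //.
rewrite (_ : (fun n => _) = (fun n => sf c n.+1%:R^-1)).
  apply: (@cvg_comp _ _ _ (fun n => n.+1%:R^-1) (sf c) \oo (nbhs 0)) => //.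
  have cs := ratexp_cts (@sf_ratexp R N c cN); exact: cs.
by apply/funext => n; rewrite -ft_wf_pos// invr_gt0.
Qed.

(** Poisson summation at b = a / N for x -> wf d (N t x). By [ft_wf_pos] the dual terms are the
    values of [sf d] at k / t, and [ft_wf0] supplies the frequency 0. *)
Lemma wf_pair_modular a d (t : R) : (a < N)%N -> (0 < d < N)%N -> 0 < t ->
  exists2 S : R, series (fun k => cos (th a * k.+1%:R) * sf d (k.+1%:R / t)) @ \oo --> S &
  series (pairp N (fun m => wf d (m%:R * t)) a) @ \oo --> 4 / (N%:R * t) * (sf d 0 / 2 + S).
Proof.
move=> aN dN t0.
have rw := @wf_ratexp R N N0 d.
have [w1 r1 dw] := ratexp_dv rw.
have [w2 [C Ew]] := ratexp_decay l0 r1 dw (ratexp_bound l0 rw).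
have k0 : 0 < N%:R * t by rewrite mulr_gt0.
have cw := ratexp_cts rw.
have Ef := edecay_scale k0 Ew.
have b01 : 0 <= (a%:R : R) / N%:R <= 1.
  by rewrite divr_ge0//= ler_pdivrMr// mul1r ler_nat ltnW.
have [S0 hS hP] := poisson Ef b01.
have cp (k : R) : cpos (fun x => cos (k * x) * wf d x) by move=> x _; exact: (cts_cosM cw).
have ip (k : R) : itg Rp (fun x => cos (k * x) * wf d x).
  apply: (itg_le _ _ _ (itg_norm _ (wf_itg d))) => //.
    by apply: cts_meas; exact: cts_cosM.
  by move=> x _; exact: cosM_le.
have sc (k : R) : \int[mu]_(x in Rp) (cos (k * x) * wf d (N%:R * t * x)) =
    (N%:R * t)^-1 * \int[mu]_(x in Rp) (cos (k / (N%:R * t) * x) * wf d x).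
  have [i1 ->] := RI_scale k0 (cp (k / (N%:R * t))) (ip _).
  have e : forall x, Rp x -> (N%:R * t)^-1 * (N%:R * t * (cos (k / (N%:R * t) * (N%:R * t * x)) * wf d (N%:R * t * x))) =
     cos (k * x) * wf d (N%:R * t * x).
    by move=> x _; rewrite mulKf ?lt0r_neq0// [k / _ * _]mulrA divfK ?lt0r_neq0.
  by rewrite -RIZ//; apply: eq_RI => x Dx; rewrite e.
have JE k : \int[mu]_(x in Rp) (cos (2 * pi * k.+1%:R * x) * wf d (N%:R * t * x)) =
    (N%:R * t)^-1 * sf d (k.+1%:R / t).
  rewrite sc -ft_wf_pos ?divr_gt0//; congr (_ * _); apply: eq_RI => x _; congr (cos (_ * _) * _).
  rewrite /lam; move: (@pi R) (N%:R : R) (k.+1%:R : R) (lt0r_neq0 NN0) (lt0r_neq0 t0) => p n k' n0 t1.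
  by field; rewrite n0 t1.
have I0 : \int[mu]_(x in Rp) wf d (N%:R * t * x) = (N%:R * t)^-1 * sf d 0.
  rewrite -ft_wf0//; have := sc 0; rewrite mul0r.
  rewrite (@eq_RI _ _ _ (fun x => wf d (N%:R * t * x))); last by move=> x _; rewrite mul0r cos0 mul1r.
  move=> ->; congr (_ * _); apply: eq_RI => x _; by rewrite mul0r cos0 mul1r.
exists (N%:R * t * S0).
  rewrite (_ : series _ = series (fun k => N%:R * t * (cos (2 * pi * (k.+1%:R * (a%:R / N%:R))) *
    \int[mu]_(x in Rp) (cos (2 * pi * k.+1%:R * x) * wf d (N%:R * t * x))))).
    exact: cvg_seriesZ.
  apply: series_ext => k; rewrite JE [RHS]mulrCA mulVKf ?lt0r_neq0//.
  by congr (cos _ * _); rewrite /th /lam; ring.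
rewrite I0 in hP.
rewrite (_ : _ * (_ + _) = 2 * ((N%:R * t)^-1 * sf d 0) + 4 * S0); last first.
  move: (sf d 0) (N%:R : R) (lt0r_neq0 NN0) (lt0r_neq0 t0) => s n n0 t1.
  by field; rewrite n0 t1.
rewrite (_ : series _ = series (fun m => wf d (N%:R * t * (m%:R + a%:R / N%:R)) +
   wf d (N%:R * t * (m%:R + (1 - a%:R / N%:R)))))//.
have nn : N%:R != 0 :> R by rewrite lt0r_neq0.
apply: series_ext => m; rewrite /pairp; congr (wf d _ + wf d _).
  by rewrite natrD natrM; field.
by rewrite natrD natrM natrB ?(ltnW aN)//; field.
Qed.

(** From m + k <= 2 m (k + 1): the exponential of a product of indices is bounded by a product of
    exponentials, the kind of domination that [series_swap] asks for. *)
Lemma mexp_bound (t : R) m k : 0 < t -> (0 < m)%N ->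
  m%:R * ee lam (m%:R * (k.+1%:R * t)) <= 4 / (lam * t) * ee (lam * t / 4) m%:R * ee (lam * t / 2) k%:R.
Proof.
move=> t0 m0; have lt0 : 0 < lam * t by rewrite mulr_gt0.
have lt2 : 0 < lam * t / 2 by rewrite divr_gt0.
have h := xee_le lt2 (ler0n R m).
have -> : 4 / (lam * t) = 2 / (lam * t / 2).
  by move: (lam) (lt0r_neq0 l0) => l ln; field; rewrite ln lt0r_neq0.
have -> : lam * t / 4 = lam * t / 2 / 2 by field.
apply: (le_trans _ (ler_wpM2r (ee_ge0 _ _) h)); rewrite -[leRHS]mulrA ler_wpM2l// /ee -expRD ler_expR.
rewrite -opprD lerN2 -mulrDr.
have -> : lam * (m%:R * (k.+1%:R * t)) = lam * t / 2 * (2 * (m%:R * k.+1%:R)) by field.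
rewrite ler_wpM2l ?(ltW lt2)//.
have -> : 2 * (m%:R * k.+1%:R) = (2 * (m * k.+1))%:R :> R by rewrite !natrM.
by rewrite -natrD ler_nat; nia.
Qed.

(** The series of sin (th_d k) times the derivative of [wf c] at k t is evaluated twice. Expanding
    the derivative in exponentials and exchanging the sums gives a Lambert series at t; [psin]
    followed by an integration by parts gives one at 1 / t. The derivative stays in the statement
    for the sake of [RI_Yf_inv]. *)
Lemma sf_pair_modular c d (t : R) : (0 < c < N)%N -> (0 < d < N)%N -> 0 < t ->
  exists w1, (forall x : R, dv (wf c) x (w1 x)) /\
  exists2 Y : R, series (pairm N (fun m => m%:R * sf d (m%:R * t)) c) @ \oo --> Y &
  series (fun k => sin (th d * k.+1%:R) * w1 (k.+1%:R * t)) @ \oo --> - lam * Y /\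
  series (pairm N (fun m => m%:R * sf c (m%:R / t)) d) @ \oo --> t ^+ 2 * Y.
Proof.
move=> cN dN t0; have /andP[c0 cN'] := cN.
have rw := @wf_ratexp R N N0 c.
have [w1 r1 dw] := ratexp_dv rw.
have [w2 r2 dw1] := ratexp_dv r1.
have [w3 [C Ew]] := ratexp_decay l0 r2 dw1 (ratexp_bound l0 r1).
have cw := ratexp_cts rw.
have cw1 := ratexp_cts r1.
have Eg := edecay_scale t0 Ew.
have [X X1 X2] := psin N0 Eg dN.
exists w1; split => //.
have lt0 : 0 < lam * t by rewrite mulr_gt0.
exists (- lam^-1 * X); last split.
- pose a j k := pairm N (fun m => m%:R * ee lam (m%:R * (k.+1%:R * t))) c j * sin (th d * k.+1%:R).
  pose A j := 8 / (lam * t) * ee (lam * t / 4) j%:R.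
  pose B k := ee (lam * t / 2) k%:R.
  have q4 : 0 < lam * t / 4 by rewrite divr_gt0.
  have q2 : 0 < lam * t / 2 by rewrite divr_gt0.
  have ab j k : `|a j k| <= A j * B k.
    rewrite /a mulrC; apply: (le_trans (sinM_le _ _)).
    apply: (le_trans (pairm_le _ _ _ _)).
    have hm m : (0 < m)%N -> (j <= m)%N ->
       `|m%:R * ee lam (m%:R * (k.+1%:R * t))| <= 4 / (lam * t) * ee (lam * t / 4) j%:R * B k.
      move=> m0 jm; rewrite ger0_norm ?mulr_ge0 ?ee_ge0//.
      apply: (le_trans (mexp_bound k t0 m0)); rewrite ler_wpM2r ?ee_ge0//.
      by rewrite ler_wpM2l ?divr_ge0 ?(ltW lt0)// ee_decr ?ler_nat// ltW.
    have := @hm (N * j + c)%N ltac:(lia) ltac:(nia); have := @hm (N * j + (N - c))%N ltac:(lia) ltac:(nia).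
    rewrite /A; have -> : 8 / (lam * t) = 2 * (4 / (lam * t)) by ring.
    lra.
  have cA : cvgn (series A) by exact: cvg_ee_series.
  have cB : cvgn (series B).
    have := @cvg_ee_series R 1 _ q2; rewrite (_ : (fun j => _) = B)//.
    by apply/funext => j; rewrite mul1r.
  apply: (@series_swap R a A B _ (fun k => - lam^-1 * (sin (th d * k.+1%:R) * w1 (t * k.+1%:R))) _ ab cA cB).
  + by move=> j; rewrite mulr_ge0 ?ee_ge0 ?divr_ge0 ?(ltW lt0).
  + by move=> k; exact: ee_ge0.
  + move=> j; rewrite /pairm.
    have ss m : (0 < m)%N -> series (fun k => m%:R * ee lam (m%:R * (k.+1%:R * t)) * sin (th d * k.+1%:R)) @ \oo -->
        m%:R * sf d (m%:R * t).
      move=> m0; have mt : 0 < m%:R * t by rewrite mulr_gt0// ltr0n.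
      have := @cvg_seriesZ R _ m%:R _ (@sf_series R N N0 d _ mt).
      rewrite (_ : series _ = series (fun k => m%:R * ee lam (m%:R * (k.+1%:R * t)) * sin (th d * k.+1%:R)))//.
      apply: series_ext => k; rewrite -mulrA; congr (_ * _); rewrite mulrC; congr (ee _ _ * _); ring.
    have s1 := @ss (N * j + c)%N ltac:(lia).
    have s2 := @cvg_seriesZ R _ (-1) _ (@ss (N * j + (N - c))%N ltac:(lia)).
    have := cvg_seriesD s1 s2; rewrite mulN1r.
    rewrite (_ : series _ = series (a j))//.
    by apply: series_ext => k; rewrite /a /pairm; ring.
  + move=> k; have kt : 0 < k.+1%:R * t by rewrite mulr_gt0.
    have := @cvg_seriesZ R _ (- lam^-1 * sin (th d * k.+1%:R)) _ (wf1_series N0 cN kt (dw _)).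
    rewrite (_ : series _ = series (a^~ k)).
      by rewrite -mulrA [t * _]mulrC.
    apply: series_ext => j; rewrite /a /pairm.
    by move: (lam) (lt0r_neq0 l0) (ee lam) => l ln E; field.
  + exact: cvg_seriesZ.
- rewrite mulrA mulrNN divff ?lt0r_neq0// mul1r.
  rewrite (_ : series _ = series (fun k => sin (lam * d%:R * k.+1%:R) * w1 (t * k.+1%:R)))//.
  by apply: series_ext => k; rewrite [t * _]mulrC.
(* The antiderivative [F] vanishes at 0 and at infinity, so the sine transform of the derivative is
   a multiple of the cosine transform of [wf c], known from [ft_wf_pos]. *)
- have sE m : (0 < m)%N -> sint N (fun x => w1 (t * x)) m = - (lam / t ^+ 2) * (m%:R * sf c (m%:R / t)).
    move=> m0; rewrite /sint.
    have mp : 0 < m%:R :> R by rewrite ltr0n.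
    pose k := lam * m%:R.
    pose F (x : R) := t^-1 * (sin (k * x) * wf c (t * x)).
    have tn : t != 0 by rewrite lt0r_neq0.
    have dF (x : R) : dv F x (t^-1 * k * (cos (k * x) * wf c (t * x)) + sin (k * x) * w1 (t * x)).
      apply: dv_eq (dvZ t^-1 (dvM (dv_sin (dv_lin k x)) (dv_comp (dw (t * x)) (dv_lin t x)))).
      by field.
    have cct (h : R -> R) : continuous h -> continuous (fun x => h (t * x)).
      move=> ch x; apply: (@continuous_comp _ _ _ (fun y : R => t * y) h); last exact: ch.
      by have := dv_lin t x; exact: is_derive_cts.
    have cF : continuous (fun x => t^-1 * k * (cos (k * x) * wf c (t * x)) + sin (k * x) * w1 (t * x)).
      move=> x; apply: cvgD; last exact: (cts_sinM (cct _ cw1)).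
      by apply: cvgM; [exact: cvg_cst|exact: (cts_cosM (cct _ cw))].
    have [Cw Cw0 hw] := ratexp_bound l0 rw.
    have [C1 C10 hw1] := ratexp_bound l0 r1.
    have bt (h : R -> R) D : (forall x, 0 <= x -> `|h x| <= D * ee lam x) ->
        forall x, 0 <= x -> `|h (t * x)| <= D * ee (lam * t) x.
      by move=> hh x x0; rewrite -ee_scale; apply: hh; rewrite mulr_ge0// ltW.
    have ic : itg Rp (fun x => cos (k * x) * wf c (t * x)).
      apply: (itg_bee lt0 (C := Cw)); first by apply: cts_meas; apply: cts_cosM; exact: cct.
      by move=> x /ltW x0; apply: (le_trans (cosM_le _ _)); exact: (bt _ _ hw).
    have is1 : itg Rp (fun x => sin (k * x) * w1 (t * x)).
      apply: (itg_bee lt0 (C := C1)); first by apply: cts_meas; apply: cts_sinM; exact: cct.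
      by move=> x /ltW x0; apply: (le_trans (sinM_le _ _)); exact: (bt _ _ hw1).
    have ick := itgZ (t^-1 * k) (measurable_itv `]0, +oo[) ic.
    have := @ftc0y _ F _ 0 (fun x _ => dF x) (fun x _ => cF x) (itgD (measurable_itv _) ick is1).
    rewrite (RID (measurable_itv _) ick is1) (RIZ _ (measurable_itv _) ic).
    have F0 : F 0 = 0 by rewrite /F !mulr0 sin0 mul0r mulr0.
    rewrite F0 subr0 => H.
    have E : t^-1 * k * (\int[mu]_(x in Rp) (cos (k * x) * wf c (t * x))) +
       \int[mu]_(x in Rp) (sin (k * x) * w1 (t * x)) = 0.
      apply: H; apply: (bounded_cvg0 (C := t^-1 * Cw) _ (ee_cvg0 lt0)) => x x0.
      rewrite /F normrM (gtr0_norm (_ : 0 < t^-1)) ?invr_gt0// -[leRHS]mulrA ler_wpM2l ?invr_ge0 ?(ltW t0)//.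
      by apply: (le_trans (sinM_le _ _)); exact: (bt _ _ hw).
    have -> : \int[mu]_(x in Rp) (sin (k * x) * w1 (t * x)) =
      - (t^-1 * k * \int[mu]_(x in Rp) (cos (k * x) * wf c (t * x))).
      by apply/eqP; rewrite -addr_eq0 addrC E.
    have sc : \int[mu]_(x in Rp) (cos (k * x) * wf c (t * x)) = t^-1 * sf c (m%:R / t).
      rewrite -ft_wf_pos ?divr_gt0//.
      have cp : cpos (fun x => cos (lam * (m%:R / t) * x) * wf c x) by move=> x _; exact: (cts_cosM cw).
      have ip : itg Rp (fun x => cos (lam * (m%:R / t) * x) * wf c x).
        apply: (itg_le _ _ _ (itg_norm _ (wf_itg c))) => //; first by apply: cts_meas; exact: cts_cosM.
        by move=> x _; exact: cosM_le.
      have [i1 ->] := RI_scale t0 cp ip.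
      rewrite -RIZ//; apply: eq_RI => x _; rewrite mulKf//.
      by congr (cos _ * _); rewrite /k; field.
    rewrite sc /k; move: (sf c _) => s; move: (lam) => l; by field.
  have : series (fun j => - (t ^+ 2 / lam) * (sint N (fun x => w1 (t * x)) (N * j + d)%N -
      sint N (fun x => w1 (t * x)) (N * j + (N - d))%N)) @ \oo --> - (t ^+ 2 / lam) * X.
    exact: cvg_seriesZ.
  have -> : - (t ^+ 2 / lam) * X = t ^+ 2 * (- lam^-1 * X) by ring.
  rewrite (_ : series _ = series (pairm N (fun m => m%:R * sf c (m%:R / t)) d))//.
  have /andP[d0 dN'] := dN.
  apply: series_ext => j; rewrite /pairm !sE//; [|lia..].
  have tn : t != 0 by rewrite lt0r_neq0.
  move: (sf c _) (sf c _) => s1 s2; move: (lam) (lt0r_neq0 l0) => l ln; by field; rewrite tn ln.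
Qed.

End Modular.

(** * The Rogers-Zudilin identity *)

Ltac nonneg := repeat first [ done | exact: ltW | apply: ee_ge0 | apply: expR_ge0
  | apply: sqr_ge0 | apply: exprn_ge0 | apply: addr_ge0 | rewrite invr_ge0 | apply: mulr_ge0 ].

(** * The functions on the axis and their bounds *)

Section PairFunctions.
Variable R : realType.
Notation mu := (@lebesgue_measure R).
Local Notation Rp := (`]0%R, +oo[%classic : set R).
Variable N : nat.
Hypothesis N0 : (0 < N)%N.
Notation lam := (lam R N).
Notation sf := (@sf R N).
Notation wf := (@wf R N).
Notation Kf := (@Kf R N).
Notation th := (@th R N).

Let l0 : 0 < lam. Proof. exact: lam_gt0. Qed.

Lemma Rp_gt0 (x : R) : Rp x <-> 0 < x.
Proof. by rewrite /= in_itv/= andbT. Qed.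

(** Common source of convergence and continuity for [Tf], [Vf] and [Yf]: on each ray away from 0,
    exponential decay in the index feeds the M-test. *)
Lemma pair_cpos (F : nat -> R -> R) (a : nat) : (a < N)%N ->
  (forall m, cpos (F m)) ->
  (forall d : R, 0 < d -> exists C m, [/\ 0 <= C, 0 < m &
     forall k x, d <= x -> `|F k x| <= C * ee m k%:R]) ->
  [/\ forall x : R, 0 < x -> series (pairm N (F^~ x) a) @ \oo --> limn (series (pairm N (F^~ x) a)),
     forall x : R, 0 < x -> series (pairp N (F^~ x) a) @ \oo --> limn (series (pairp N (F^~ x) a)),
     cpos (fun x => limn (series (pairm N (F^~ x) a))) &
     cpos (fun x => limn (series (pairp N (F^~ x) a)))].
Proof.
move=> aN cF bF.
have cm (x : R) : 0 < x -> cvgn (series (pairm N (F^~ x) a)) /\ cvgn (series (pairp N (F^~ x) a)).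
  move=> x0; have [C [m [C0 m0 h]]] := bF x x0.
  by apply: (pair_summable N0 m0 C0 aN) => k; apply: h.
have bd (d : R) : 0 < d -> exists C m, [/\ 0 <= C, 0 < m & forall j x, d <= x ->
    `|F (N * j + a)%N x| + `|F (N * j + (N - a))%N x| <= C * ee m j%:R].
  move=> d0; have [C [m [C0 m0 h]]] := bF d d0.
  exists (2 * C), m; split; [by rewrite mulr_ge0|by []|] => j x dx.
  have hh k : (j <= k)%N -> `|F k x| <= C * ee m j%:R.
    by move=> jk; apply: (le_trans (h k x dx)); rewrite ler_wpM2l// ee_decr ?ler_nat// ltW.
  have := hh (N * j + a)%N ltac:(nia); have := hh (N * j + (N - a))%N ltac:(nia); lra.
split.
- by move=> x /cm[].
- by move=> x /cm[].
- apply: (@cpos_series _ (fun j x => pairm N (F^~ x) a j)).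
  + by move=> n x x0; apply: cvgB; exact: cF.
  + by move=> x /cm[].
  + move=> d d0; have [C [m [C0 m0 h]]] := bd d d0.
    exists (fun j => C * ee m j%:R); first exact: cvg_ee_series.
    by move=> j x dx; apply: (le_trans (pairm_le _ _ _ _)); exact: h.
- apply: (@cpos_series _ (fun j x => pairp N (F^~ x) a j)).
  + by move=> n x x0; apply: cvgD; exact: cF.
  + by move=> x /cm[].
  + move=> d d0; have [C [m [C0 m0 h]]] := bd d d0.
    exists (fun j => C * ee m j%:R); first exact: cvg_ee_series.
    by move=> j x dx; apply: (le_trans (pairp_le _ _ _ _)); exact: h.
Qed.

(* On the axis, [- Vf] is [log |g_(a,b)|] up to the linear term and [lam * Yf]
   is [darg g_(c,d)]; [Tf] and [Af] are exchanged by [x -> 1 / x]. *)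
Definition Tf a d (x : R) : R := limn (series (pairp N (fun m => wf d (m%:R * x)) a)).
Definition Vf a b (x : R) : R := limn (series (pairp N (fun m => Kf b (m%:R * x)) a)).
Definition Yf c d (x : R) : R := limn (series (pairm N (fun m => m%:R * sf d (m%:R * x)) c)).
Definition Af a d (x : R) : R := limn (series (fun k => cos (th a * k.+1%:R) * sf d (k.+1%:R * x))).

Lemma cpos_lin (h : R -> R) (k : R) : 0 < k -> cpos h -> cpos (fun x => h (k * x)).
Proof.
move=> k0 ch x x0; apply: (@continuous_comp _ _ _ (fun y : R => k * y) h).
  by have := dv_lin k x; exact: is_derive_cts.
by apply: ch; rewrite mulr_gt0.
Qed.

Lemma cpos_linm (h : R -> R) (m : nat) : cpos h -> cpos (fun x => h (m%:R * x)).
Proof.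
case: m => [|m] ch; last by apply: cpos_lin.
have -> : (fun x => h (0%:R * x)) = (fun=> h 0) by apply/funext => x; rewrite mul0r.
by move=> x _; exact: cvg_cst.
Qed.

Lemma cposM (f g : R -> R) : cpos f -> cpos g -> cpos (fun x => f x * g x).
Proof. by move=> cf cg x x0; apply: cvgM; [exact: cf|exact: cg]. Qed.

Lemma cpos_comp_inv (f : R -> R) : cpos f -> cpos (fun x => f x^-1).
Proof.
move=> cf x x0; apply: (@continuous_comp _ _ _ (fun y : R => y^-1) f).
  by apply: inv_continuous; rewrite lt0r_neq0.
by apply: cf; rewrite invr_gt0.
Qed.

Lemma cts_cpos (f : R -> R) : continuous f -> cpos f.
Proof. by move=> cf x _; exact: cf. Qed.

Lemma Kf_cpos b : cpos (Kf b).
Proof.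
move=> x x0; have := @dv_Kf R N b x; move=> h; apply: (@is_derive_cts _ _ (Kf1 N b x)).
by apply: h; apply: den_pos1; exact: q01.
Qed.

Lemma sf_bound d : (0 < d < N)%N -> exists2 C, 0 <= C & forall x : R, 0 <= x -> `|sf d x| <= C * ee lam x.
Proof. by move=> dN; exact: (ratexp_bound l0 (@sf_ratexp R N d dN)). Qed.

Lemma sf_cts d : (0 < d < N)%N -> continuous (sf d).
Proof. by move=> dN; exact: (ratexp_cts (@sf_ratexp R N d dN)). Qed.

Lemma wf_cts d : continuous (wf d).
Proof. exact: (ratexp_cts (@wf_ratexp R N N0 d)). Qed.

Lemma wf_bound d : exists2 C, 0 <= C & forall x : R, 0 <= x -> `|wf d x| <= C * ee lam x.
Proof. exact: (ratexp_bound l0 (@wf_ratexp R N N0 d)). Qed.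

Lemma Kf_bound_inv b (x : R) : 0 < x -> `|Kf b x| <= 2 / (lam * x) * ee (lam / 2) x.
Proof.
move=> x0; apply: (le_trans (Kf_bound N0 b x0)).
have := geo_bound (mulr_gt0 l0 x0); rewrite /ee.
by have -> : lam / 2 * x = lam * x / 2 by ring.
Qed.

Lemma ee_mx (d x : R) m : 0 < d -> d <= x -> ee lam (m%:R * x) <= ee (lam * d) m%:R.
Proof.
move=> d0 dx; rewrite -ee_scale; apply: ee_decr; first exact: ltW.
by rewrite [d * _]mulrC ler_wpM2l.
Qed.

Lemma Tf_prop a d : (a < N)%N ->
  (forall x : R, 0 < x -> series (pairp N (fun m => wf d (m%:R * x)) a) @ \oo --> Tf a d x) /\ cpos (Tf a d).
Proof.
move=> aN; have [C C0 hC] := wf_bound d.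
have [] := @pair_cpos (fun m x => wf d (m%:R * x)) a aN; last by [].
- by move=> m; apply: cpos_linm; apply: cts_cpos; exact: wf_cts.
- move=> e e0; exists C, (lam * e); split => //; first by rewrite mulr_gt0.
  move=> k x ex; apply: (le_trans (hC _ _)); first by rewrite mulr_ge0// (le_trans _ ex)// ltW.
  by rewrite ler_wpM2l// ee_mx.
Qed.

Lemma Vf_prop a b : (a < N)%N ->
  (forall x : R, 0 < x -> series (pairp N (fun m => Kf b (m%:R * x)) a) @ \oo --> Vf a b x) /\ cpos (Vf a b).
Proof.
move=> aN.
have [] := @pair_cpos (fun m x => Kf b (m%:R * x)) a aN; last by [].
- by move=> m; apply: cpos_linm; exact: Kf_cpos.
(* For a = 0 the index 0 occurs, and [Kf b 0] has to be absorbed in the constant. *)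
- move=> e e0; exists (2 / (lam * e) + `|Kf b 0|), (lam * e / 2).
  have le0 : 0 < lam * e by rewrite mulr_gt0.
  split; [by rewrite addr_ge0// divr_ge0// ltW|by rewrite divr_gt0|].
  move=> [|k] x ex; first by rewrite mul0r ee0 mulr1 lerDr divr_ge0// ltW.
  have x0 : 0 < x by exact: lt_le_trans ex.
  have kx : 0 < k.+1%:R * x by rewrite mulr_gt0.
  apply: (le_trans (Kf_bound_inv b kx)); rewrite [leRHS]mulrDl -[leLHS]addr0.
  apply: lerD; last by rewrite mulr_ge0 ?ee_ge0.
  apply: ler_pM.
  + by rewrite divr_ge0// mulr_ge0 ?(ltW l0)// ltW.
  + exact: ee_ge0.
  + rewrite ler_wpM2l// lef_pV2 ?posrE//; last exact: mulr_gt0.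
    rewrite ler_pM2l//.
    by apply: (le_trans ex); rewrite ler_peMl ?(ltW x0)// ler1n.
  + rewrite /ee ler_expR lerN2; have -> : lam * e / 2 * k.+1%:R = lam / 2 * (k.+1%:R * e) by ring.
    apply: ler_wpM2l; first by nonneg.
    exact: ler_wpM2l.
Qed.

Lemma msf_bound d : (0 < d < N)%N -> exists2 C, 0 <= C & forall (t : R) (m : nat), 0 < t ->
  `|m%:R * sf d (m%:R * t)| <= C * (2 / (lam * t)) * ee (lam * t / 2) m%:R.
Proof.
move=> dN; have [C C0 hC] := sf_bound dN; exists C => // t m t0.
have lt0 : 0 < lam * t by rewrite mulr_gt0.
rewrite normrM ger0_norm//.
apply: (@le_trans _ _ (m%:R * (C * ee lam (m%:R * t)))).
  by rewrite ler_wpM2l// hC// mulr_ge0// ltW.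
have := xee_le lt0 (ler0n R m).
have -> : ee lam (m%:R * t) = ee (lam * t) m%:R by rewrite -ee_scale [m%:R * t]mulrC.
by move=> h; rewrite mulrCA -[leRHS]mulrA ler_wpM2l.
Qed.

Lemma Yf_prop c d : (c < N)%N -> (0 < d < N)%N ->
  (forall x : R, 0 < x -> series (pairm N (fun m => m%:R * sf d (m%:R * x)) c) @ \oo --> Yf c d x) /\ cpos (Yf c d).
Proof.
move=> cN dN; have [C C0 hC] := sf_bound dN.
have [] := @pair_cpos (fun m x => m%:R * sf d (m%:R * x)) c cN; last by [].
- move=> m; apply: cposM; first by move=> x _; exact: cvg_cst.
  by apply: cpos_linm; apply: cts_cpos; exact: sf_cts.
- move=> e e0; have le0 : 0 < lam * e by rewrite mulr_gt0.
  exists (C * (2 / (lam * e))), (lam * e / 2).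
  split; [by rewrite mulr_ge0// divr_ge0// ltW|by rewrite divr_gt0|].
  move=> k x ex; rewrite normrM ger0_norm//.
  apply: (@le_trans _ _ (k%:R * (C * ee (lam * e) k%:R))).
    rewrite ler_wpM2l//; apply: (le_trans (hC _ _)); first by rewrite mulr_ge0// (le_trans _ ex)// ltW.
    by rewrite ler_wpM2l// ee_mx.
  by rewrite mulrCA -[leRHS]mulrA ler_wpM2l// xee_le.
Qed.

(** Bounds all partial sums for all t > 0 and thus serves as a domination; the factor 1 / t will be
    compensated by exponentials in 1 / t. *)
Lemma Asum_bound a d : (0 < d < N)%N -> exists2 C, 0 <= C & forall n (t : R), 0 < t ->
  `|series (fun k => cos (th a * k.+1%:R) * sf d (k.+1%:R * t)) n| <= C / t * ee (lam / 2) t.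
Proof.
move=> dN; have [C C0 hC] := sf_bound dN; exists (C * (2 / lam)); first by rewrite mulr_ge0// divr_ge0// ltW.
move=> n t t0; have lt0 : 0 < lam * t by rewrite mulr_gt0.
have /andP[r0 r1] := q01 N0 t0.
rewrite /series /=; apply: (le_trans (ler_norm_sum _ _ _)).
apply: (@le_trans _ _ (C * (ee lam t * series (fun k => ee lam t ^+ k) n))).
  rewrite /series /= !big_distrr /=; apply: ler_sum => k _.
  apply: (le_trans (cosM_le _ _)); apply: (le_trans (hC _ _)); first by rewrite mulr_ge0// ltW.
  by rewrite ee_nat exprS.
have gg := geometric_series (q01 N0 t0).
have h1 : series (fun k => ee lam t ^+ k) n <= (1 - ee lam t)^-1.
  rewrite -(cvg_lim _ gg)//; apply: nondecreasing_cvgn_le; last by apply: cvgP gg.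
  by apply: nondecreasing_series => k _ _; rewrite exprn_ge0.
have h2 := geo_bound lt0.
apply: (@le_trans _ _ (C * (2 / (lam * t) * expR (- (lam * t / 2))))).
  rewrite ler_wpM2l//; apply: le_trans h2; exact: ler_wpM2l.
rewrite le_eqVlt; apply/orP; left; apply/eqP; rewrite /ee.
have -> : lam / 2 * t = lam * t / 2 by ring.
by move: (lam) (lt0r_neq0 l0) (expR _) => l ln E; field; rewrite ln lt0r_neq0.
Qed.

Lemma Af_prop a d : (0 < d < N)%N ->
  (forall x : R, 0 < x -> series (fun k => cos (th a * k.+1%:R) * sf d (k.+1%:R * x)) @ \oo --> Af a d x) /\ cpos (Af a d).
Proof.
move=> dN; have [C C0 hC] := sf_bound dN.
have bd (e : R) : 0 < e -> forall k x, e <= x ->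
    `|cos (th a * k.+1%:R) * sf d (k.+1%:R * x)| <= C * ee (lam * e) k%:R.
  move=> e0 k x ex; apply: (le_trans (cosM_le _ _)).
  apply: (le_trans (hC _ _)); first by rewrite mulr_ge0// (le_trans _ ex)// ltW.
  rewrite ler_wpM2l//; apply: (le_trans (ee_mx _ e0 ex)).
  by rewrite ee_decr ?ler_nat// ltW// mulr_gt0.
have cv (x : R) : 0 < x -> series (fun k => cos (th a * k.+1%:R) * sf d (k.+1%:R * x)) @ \oo --> Af a d x.
  move=> x0; apply: (series_abs_cvg (fun k => bd x x0 k x (lexx x))).
  by apply: cvg_ee_series; rewrite mulr_gt0.
split => //; apply: (cpos_series _ cv).
- move=> n; apply: cposM; first by move=> x _; exact: cvg_cst.
  by apply: cpos_lin => //; apply: cts_cpos; exact: sf_cts.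
- move=> e e0; exists (fun k => C * ee (lam * e) k%:R); first by apply: cvg_ee_series; rewrite mulr_gt0.
  by move=> k x; exact: bd.
Qed.

Lemma Af_bound a d : (0 < d < N)%N -> exists2 C, 0 <= C & forall t : R, 0 < t ->
  `|Af a d t| <= C / t * ee (lam / 2) t.
Proof.
move=> dN; have [C C0 hC] := @Asum_bound a d dN; exists C => // t t0.
have [cA _] := @Af_prop a d dN.
have h : `|series (fun k => cos (th a * k.+1%:R) * sf d (k.+1%:R * t)) n| @[n --> \oo] --> `|Af a d t|.
  by apply: cvg_norm; exact: cA.
by apply: (cvgr_to_le h); near=> n; exact: hC.
Unshelve. all: by end_near. Qed.

Lemma Ysum_bound c d : (0 < c < N)%N -> (0 < d < N)%N -> exists2 C, 0 <= C & forall n (t : R), 0 < t ->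
  `|series (pairm N (fun m => m%:R * sf d (m%:R * t)) c) n| <= C / t ^+ 2 * ee (lam / 8) t.
Proof.
move=> cN dN; have [C C0 hC] := msf_bound dN.
exists (32 * C / lam ^+ 2); first by nonneg.
move=> n t t0; have lt0 : 0 < lam * t by rewrite mulr_gt0.
have lt2 : 0 < lam * t / 2 by rewrite divr_gt0.
have D0 : 0 <= C * (2 / (lam * t)) by rewrite mulr_ge0// divr_ge0// ltW.
rewrite /series /=; apply: (le_trans (ler_norm_sum _ _ _)).
apply: (le_trans (ler_sum _ (fun j _ => pairm_le N _ c j))).
apply: (le_trans (@pair_bound R N N0 (fun m => m%:R * sf d (m%:R * t)) _ _ c n lt2 D0 cN (fun m _ => hC t m t0))).
have -> : ee (lam * t / 2) (1 / 4) = ee (lam / 8) t by rewrite /ee; congr expR; field.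
rewrite ler_wpM2r ?ee_ge0// le_eqVlt; apply/orP; left; apply/eqP.
by move: (lam) (lt0r_neq0 l0) => l ln; field; rewrite ln lt0r_neq0.
Qed.

Lemma Yf_bound c d : (0 < c < N)%N -> (0 < d < N)%N -> exists2 C, 0 <= C & forall t : R, 0 < t ->
  `|Yf c d t| <= C / t ^+ 2 * ee (lam / 8) t.
Proof.
move=> cN dN; have [C C0 hC] := Ysum_bound cN dN; exists C => // t t0.
have /andP[_ cN'] := cN; have [cY _] := Yf_prop cN' dN.
have h : `|series (pairm N (fun m => m%:R * sf d (m%:R * t)) c) n| @[n --> \oo] --> `|Yf c d t|.
  by apply: cvg_norm; exact: cY.
by apply: (cvgr_to_le h); near=> n; exact: hC.
Unshelve. all: by end_near. Qed.

Lemma ee_le_inv (l x : R) : 0 < l -> 0 < x -> ee l x <= (l * x)^-1.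
Proof.
move=> l1 x0; have lx : 0 < l * x by rewrite mulr_gt0.
rewrite /ee expRN lef_pV2 ?posrE ?expR_gt0//.
by apply: le_trans (expR_ge1Dx _); rewrite lerDr.
Qed.

Lemma Kinv_bound b m (t : R) : (0 < m)%N -> 0 < t ->
  `|Kf b (m%:R * t^-1)| <= 2 * t / lam * ee (lam / (2 * t)) m%:R.
Proof.
move=> m0 t0; have mp : 0 < m%:R :> R by rewrite ltr0n.
have mt : 0 < m%:R * t^-1 by rewrite mulr_gt0// invr_gt0.
apply: (le_trans (Kf_bound_inv b mt)).
have -> : ee (lam / 2) (m%:R * t^-1) = ee (lam / (2 * t)) m%:R.
  by rewrite /ee; congr expR; move: (lam) => l; field; rewrite lt0r_neq0.
rewrite ler_wpM2r ?ee_ge0//.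
have -> : 2 / (lam * (m%:R * t^-1)) = 2 * t / lam * m%:R^-1.
  by move: (lam) (lt0r_neq0 l0) => l ln; field; rewrite ln !lt0r_neq0.
apply: ler_piMr; [by nonneg|by rewrite invf_le1 ?ltr0n// ler1n].
Qed.

(** The power t^2 is what cancels the t^-2 of [Yf_bound], so the products in [rogers_zudilin] are
    dominated by a pure exponential. *)
Lemma Vsum_bound a b n (t : R) : (0 < a < N)%N -> 0 < t ->
  `|series (pairp N (fun m => Kf b (m%:R * t^-1)) a) n| <= 32 / lam ^+ 2 * t ^+ 2.
Proof.
move=> aN t0.
have lt2 : 0 < lam / (2 * t) by rewrite divr_gt0// mulr_gt0.
have D0 : 0 <= 2 * t / lam by nonneg.
rewrite /series /=; apply: (le_trans (ler_norm_sum _ _ _)).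
apply: (le_trans (ler_sum _ (fun j _ => pairp_le N _ a j))).
apply: (le_trans (@pair_bound R N N0 (fun m => Kf b (m%:R * t^-1)) _ _ a n lt2 D0 aN (fun m m0 => Kinv_bound b m0 t0))).
apply: (@le_trans _ _ (8 * (2 * t / lam) / (lam / (2 * t)) * 1)).
  rewrite ler_wpM2l// ?ee_le1 ?(ltW lt2)//.
  by nonneg.
rewrite le_eqVlt; apply/orP; left; apply/eqP.
by move: (lam) (lt0r_neq0 l0) => l ln; field; rewrite ln lt0r_neq0.
Qed.

End PairFunctions.

(** * The exchange of indices *)

Section RogersZudilin.
Variable R : realType.
Notation mu := (@lebesgue_measure R).
Local Notation Rp := (`]0%R, +oo[%classic : set R).
Variable N : nat.
Hypothesis N0 : (0 < N)%N.
Notation lam := (lam R N).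
Notation sf := (@sf R N).
Notation wf := (@wf R N).
Notation Kf := (@Kf R N).
Notation th := (@th R N).
Notation Tf := (@Tf R N).
Notation Vf := (@Vf R N).
Notation Yf := (@Yf R N).
Notation Af := (@Af R N).
Let l0 : 0 < lam. Proof. exact: lam_gt0. Qed.
Variables (al be ga de : nat).
Hypotheses (alN : (0 < al < N)%N) (gaN : (0 < ga < N)%N) (deN : (0 < de < N)%N).

Let K m (t : R) := Kf be (m%:R * t^-1).
Let S m (t : R) := m%:R * sf de (m%:R * t).

Let cK m : cpos (K m).
Proof. by apply: (@cpos_comp_inv R (fun x => Kf be (m%:R * x))); apply: cpos_linm; exact: Kf_cpos. Qed.

Let cS m : cpos (S m).
Proof.
apply: cposM; first by move=> x _; exact: cvg_cst.
by apply: cpos_linm; apply: cts_cpos; exact: sf_cts.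
Qed.

Let gaN' : (ga < N)%N. Proof. by case/andP: gaN. Qed.
Let alN' : (al < N)%N. Proof. by case/andP: alN. Qed.
Let mRp : measurable Rp. Proof. exact: measurable_itv. Qed.

Let cY : cpos (Yf ga de). Proof. by have [] := @Yf_prop R N N0 ga de gaN' deN. Qed.
Let cA : cpos (Af be de). Proof. by have [] := @Af_prop R N N0 be de deN. Qed.

(** The common value of the exchanged terms: m and m' enter only through the product p = m m'. *)
Let Z (p : nat) := \int[mu]_(t in Rp) (ee lam (p%:R * t^-1) * Af be de t).

Let ceinv p : cpos (fun t => ee lam (p%:R * t^-1)).
Proof. by apply: (@cpos_comp_inv R (fun x => ee lam (p%:R * x))); apply: cpos_linm; apply: cts_cpos; exact: cts_ee. Qed.

(** The factor t makes up for the 1 / t of [Af_bound] near 0. *)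
Let ee_inv_le p (t : R) : (0 < p)%N -> 0 < t -> ee lam (p%:R * t^-1) <= t / lam.
Proof.
move=> p0 t0; have pp : 0 < p%:R :> R by rewrite ltr0n.
have pt : 0 < p%:R * t^-1 by rewrite mulr_gt0// invr_gt0.
apply: (le_trans (ee_le_inv l0 pt)).
have -> : (lam * (p%:R * t^-1))^-1 = t / lam * p%:R^-1.
  by move: (lam) (lt0r_neq0 l0) => l ln; field; rewrite ln !lt0r_neq0.
apply: ler_piMr; [by nonneg|by rewrite invf_le1// ler1n].
Qed.

(** The heart of the method. [Kf] at m / t is expanded over k while the single term of index m' is
    kept from the other factor; after the substitution the sum over k rebuilds [Af], and the
    exponential sees m m' only. *)
Let step3 m m' : (0 < m)%N -> (0 < m')%N ->
  itg Rp (fun t => K m t * S m' t) /\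
  \int[mu]_(t in Rp) (K m t * S m' t) = Z (m * m').
Proof.
move=> m0 m'0.
have mp : 0 < m%:R :> R by rewrite ltr0n.
have mp' : 0 < m'%:R :> R by rewrite ltr0n.
have [C C0 hC] := @sf_bound R N N0 de deN.
pose f k (t : R) := cos (th be * k.+1%:R) / k.+1%:R * ee lam (k.+1%:R * (m%:R * t^-1)) * S m' t.
have cek k : cpos (fun t => ee lam (k.+1%:R * (m%:R * t^-1))).
  suff -> : (fun t => ee lam (k.+1%:R * (m%:R * t^-1))) = (fun t => ee lam ((k.+1 * m)%:R * t^-1)) by exact: ceinv.
  by apply/funext => t; rewrite natrM mulrA.
have cf k : cpos (f k).
  by apply: cposM => //; apply: cposM => // x _; exact: cvg_cst.
have fK t : Rp t -> series (fun k => f k t) @ \oo --> K m t * S m' t.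
  rewrite Rp_gt0 => t0; have mt : 0 < m%:R * t^-1 by rewrite mulr_gt0// invr_gt0.
  rewrite mulrC; have := @cvg_seriesZ R _ (S m' t) _ (@Kf_series R N N0 be _ mt).
  rewrite (_ : series _ = series (fun k => f k t))//.
  by apply: series_ext => k; rewrite /f mulrC.
have l' : 0 < lam * m'%:R / 2 by rewrite divr_gt0// mulr_gt0.
have bf n t : Rp t -> `|series (fun k => f k t) n| <= 4 * C / lam ^+ 2 * ee (lam * m'%:R / 2) t.
  rewrite Rp_gt0 => t0; have mt : 0 < m%:R * t^-1 by rewrite mulr_gt0// invr_gt0.
  rewrite /series /= -big_distrl /= normrM.
  have b1 : `|\sum_(0 <= k < n) (cos (th be * k.+1%:R) / k.+1%:R * ee lam (k.+1%:R * (m%:R * t^-1)))| <= 2 * t / lam.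
    have /andP[r0 r1] := q01 N0 mt.
    apply: (le_trans (ler_norm_sum _ _ _)).
    apply: (@le_trans _ _ (ee lam (m%:R * t^-1) * series (fun k => ee lam (m%:R * t^-1) ^+ k) n)).
      rewrite /series /= big_distrr /=; apply: ler_sum => k _.
      rewrite -mulrA; apply: (le_trans (cosM_le _ _)).
      rewrite ger0_norm ?mulr_ge0 ?invr_ge0 ?ee_ge0// ee_nat exprS.
      by rewrite ler_piMl ?mulr_ge0 ?exprn_ge0// invf_le1// ler1n.
    have gg := geometric_series (q01 N0 mt).
    have h1 : series (fun k => ee lam (m%:R * t^-1) ^+ k) n <= (1 - ee lam (m%:R * t^-1))^-1.
      rewrite -(cvg_lim _ gg)//; apply: nondecreasing_cvgn_le; last by apply: cvgP gg.
      by apply: nondecreasing_series => k _ _; rewrite exprn_ge0.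
    apply: (le_trans (ler_wpM2l r0 h1)).
    apply: (le_trans (geo_bound (mulr_gt0 l0 mt))).
    apply: (@le_trans _ _ (2 / (lam * (m%:R * t^-1)) * 1)).
      apply: ler_wpM2l; first by nonneg.
      by rewrite expR_le1 oppr_le0; nonneg.
    have -> : 2 / (lam * (m%:R * t^-1)) * 1 = 2 * t / lam * m%:R^-1.
      by move: (lam) (lt0r_neq0 l0) => l ln; field; rewrite ln !lt0r_neq0.
    apply: ler_piMr; [by nonneg|by rewrite invf_le1 ?ltr0n// ler1n].
  have b2 : `|S m' t| <= m'%:R * (C * ee (lam * m'%:R) t).
    rewrite /S normrM ger0_norm// ler_wpM2l// -ee_scale; apply: hC.
    by rewrite mulr_ge0// ltW.
  have lm : 0 < lam * m'%:R by rewrite mulr_gt0.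
  have b3 := xee_le lm (ltW t0).
  apply: (le_trans (ler_pM _ _ b1 b2)) => //.
  have -> : 2 * t / lam * (m'%:R * (C * ee (lam * m'%:R) t)) =
     2 * m'%:R * C / lam * (t * ee (lam * m'%:R) t) by ring.
  apply: (le_trans (ler_wpM2l _ b3)).
    by nonneg.
  rewrite le_eqVlt; apply/orP; left; apply/eqP.
  move: (ee _ _) => E; move: (lam) (lt0r_neq0 l0) => l ln; by field; rewrite ln lt0r_neq0.
have iG : itg Rp (fun t => 4 * C / lam ^+ 2 * ee (lam * m'%:R / 2) t) by apply: itgZ => //; exact: itg_ee.
have [iKS fi c1] := @series_itg_dom _ Rp f _ _ mRp (fun n => cpos_meas (cf n)) fK bf iG.
split => //.
pose g k (t : R) := ee lam ((m * m')%:R * t^-1) * (cos (th be * k.+1%:R) * sf de (k.+1%:R * t)).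
have cg k : cpos (g k).
  apply: cposM => //; apply: cposM; first by move=> x _; exact: cvg_cst.
  by apply: cpos_lin => //; apply: cts_cpos; exact: sf_cts.
have gA t : Rp t -> series (fun k => g k t) @ \oo --> ee lam ((m * m')%:R * t^-1) * Af be de t.
  by rewrite Rp_gt0 => t0; apply: cvg_seriesZ; have [+ _] := @Af_prop R N N0 be de deN; exact.
have [C2 C20 hC2] := @Asum_bound R N N0 be de deN.
have mm0 : (0 < m * m')%N by rewrite muln_gt0 m0.
have l2 : 0 < lam / 2 by rewrite divr_gt0.
have bg n t : Rp t -> `|series (fun k => g k t) n| <= C2 / lam * ee (lam / 2) t.
  rewrite Rp_gt0 => t0; rewrite /series /= -big_distrr /= normrM.
  have e1 : `|ee lam ((m * m')%:R * t^-1)| <= t / lam by rewrite ger0_norm ?ee_ge0// ee_inv_le.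
  apply: (le_trans (ler_pM _ _ e1 (hC2 n t t0))) => //.
  rewrite le_eqVlt; apply/orP; left; apply/eqP.
  move: (ee _ _) => E; move: (lam) (lt0r_neq0 l0) => l ln; by field; rewrite ln lt0r_neq0.
have iG2 : itg Rp (fun t => C2 / lam * ee (lam / 2) t) by apply: itgZ => //; exact: itg_ee.
have [_ gi c2] := @series_itg_dom _ Rp g _ _ mRp (fun n => cpos_meas (cg n)) gA bg iG2.
apply: (cvg_unique (@norm_hausdorff _ R) c1).
suff -> : series (fun k => \int[mu]_(x in Rp) f k x) = series (fun k => \int[mu]_(x in Rp) g k x) by exact: c2.
apply: series_ext => k.
have k0 : 0 < k.+1%:R / m'%:R :> R by rewrite divr_gt0.
(* The substitution t -> t k / m' has Jacobian k / m', which cancels the coefficient 1 / k of [Kf]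
   and the factor m' of [S]. *)
have [_ ->] := RI_scale k0 (cf k) (fi k).
apply: eq_RI => t; rewrite Rp_gt0 => t0; rewrite /f /g /S.
have pn : k.+1%:R != 0 :> R by rewrite pnatr_eq0.
have mn := lt0r_neq0 mp; have mn' := lt0r_neq0 mp'; have tn := lt0r_neq0 t0.
rewrite natrM; move: (k.+1%:R : R) (m%:R : R) (m'%:R : R) pn mn mn' => p x y pn xn yn.
have -> : p * (x * (p / y * t)^-1) = x * y * t^-1 by field; rewrite pn yn tn.
have -> : y * (p / y * t) = p * t by field; rewrite yn.
move: (ee _ _) (sf _ _) (cos _) => E s c; by field; rewrite pn yn.
Qed.

Let W m := \int[mu]_(t in Rp) (wf ga (m%:R * t^-1) * Af be de t).

Let cwinv m : cpos (fun t => wf ga (m%:R * t^-1)).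
Proof. by apply: (@cpos_comp_inv R (fun x => wf ga (m%:R * x))); apply: cpos_linm; apply: cts_cpos; exact: wf_cts. Qed.

(** The sum over m' of e^(-lam m m' / t), with the signs of [pairm], rebuilds [wf ga] at m / t. *)
Let step4 m : (0 < m)%N -> itg Rp (fun t => wf ga (m%:R * t^-1) * Af be de t) /\
  series (pairm N (fun m' => Z (m * m')%N) ga) @ \oo --> W m.
Proof.
move=> m0; have mp : 0 < m%:R :> R by rewrite ltr0n.
have [C C0 hC] := @Af_bound R N N0 be de deN.
have [Cw Cw0 hw] := @wf_bound R N N0 ga.
pose f j (t : R) := pairm N (fun m' => ee lam ((m * m')%:R * t^-1)) ga j * Af be de t.
have cf j : cpos (f j) by apply: cposM => // x x0; apply: cvgB; exact: ceinv.
have fw t : Rp t -> series (fun j => f j t) @ \oo --> wf ga (m%:R * t^-1) * Af be de t.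
  rewrite Rp_gt0 => t0; have mt : 0 < m%:R * t^-1 by rewrite mulr_gt0// invr_gt0.
  rewrite mulrC; have := @cvg_seriesZ R _ (Af be de t) _ (wf_series N0 gaN mt).
  rewrite (_ : series _ = series (fun j => f j t))//.
  apply: series_ext => j; rewrite /f mulrC; congr (_ * _).
  by rewrite /pairm !natrM; congr (ee _ _ - ee _ _); ring.
have l2 : 0 < lam / 2 by rewrite divr_gt0.
have bf n t : Rp t -> `|series (fun j => f j t) n| <= Cw * C / lam * ee (lam / 2) t.
  rewrite Rp_gt0 => t0; have mt : 0 < m%:R * t^-1 by rewrite mulr_gt0// invr_gt0.
  rewrite /series /= -big_distrl /= normrM.
  have e1 : `|\sum_(0 <= j < n) pairm N (fun m' => ee lam ((m * m')%:R * t^-1)) ga j| <= Cw * (t / lam).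
    have -> : \sum_(0 <= j < n) pairm N (fun m' => ee lam ((m * m')%:R * t^-1)) ga j =
      series (pairm N (fun m' => ee lam (m'%:R * (m%:R * t^-1))) ga) n.
      rewrite /series /=; apply: eq_bigr => j _; rewrite /pairm !natrM.
      by congr (ee _ _ - ee _ _); ring.
    apply: (le_trans (wf_partial N0 n gaN mt)); apply: (le_trans (hw _ (ltW mt))).
    by rewrite ler_wpM2l// ee_inv_le.
  apply: (le_trans (ler_pM _ _ e1 (hC t t0))) => //.
  rewrite le_eqVlt; apply/orP; left; apply/eqP.
  move: (ee _ _) => E; move: (lam) (lt0r_neq0 l0) => l ln; by field; rewrite ln lt0r_neq0.
have iG : itg Rp (fun t => Cw * C / lam * ee (lam / 2) t) by apply: itgZ => //; exact: itg_ee.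
have [iw fi c1] := @series_itg_dom _ Rp f _ _ mRp (fun n => cpos_meas (cf n)) fw bf iG.
split => //.
have ieA p : (0 < p)%N -> itg Rp (fun t => ee lam (p%:R * t^-1) * Af be de t).
  move=> p0; apply: (itg_bee (C := C / lam) l2); first by apply: cpos_meas; exact: cposM.
  move=> t t0; rewrite normrM.
  have e1 : `|ee lam (p%:R * t^-1)| <= t / lam by rewrite ger0_norm ?ee_ge0// ee_inv_le.
  apply: (le_trans (ler_pM _ _ e1 (hC t t0))) => //.
  rewrite le_eqVlt; apply/orP; left; apply/eqP.
  move: (ee _ _) => E; move: (lam) (lt0r_neq0 l0) => l ln; by field; rewrite ln lt0r_neq0.
rewrite (_ : series _ = series (fun j => \int[mu]_(t in Rp) f j t))//.
apply: series_ext => j; rewrite /pairm /Z.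
have /andP[g0 _] := gaN.
rewrite -RIB//; [|by apply: ieA; lia..].
by apply: eq_RI => t _; rewrite /f /pairm mulrBl.
Qed.

Let step5 : itg Rp (fun t => Tf al ga t^-1 * Af be de t) /\
  series (pairp N W al) @ \oo --> \int[mu]_(t in Rp) (Tf al ga t^-1 * Af be de t).
Proof.
have [C C0 hC] := @Af_bound R N N0 be de deN.
have [Cw Cw0 hw] := @wf_bound R N N0 ga.
pose f j (t : R) := pairp N (fun m => wf ga (m%:R * t^-1)) al j * Af be de t.
have cf j : cpos (f j) by apply: cposM => // x x0; apply: cvgD; exact: cwinv.
have [cT _] := @Tf_prop R N N0 al ga alN'.
have fw t : Rp t -> series (fun j => f j t) @ \oo --> Tf al ga t^-1 * Af be de t.
  rewrite Rp_gt0 => t0; have ti : 0 < t^-1 by rewrite invr_gt0.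
  rewrite mulrC; have := @cvg_seriesZ R _ (Af be de t) _ (cT _ ti).
  rewrite (_ : series _ = series (fun j => f j t))//.
  by apply: series_ext => j; rewrite /f mulrC.
have l2 : 0 < lam / 2 by rewrite divr_gt0.
have bf n t : Rp t -> `|series (fun j => f j t) n| <= 8 * Cw * C / lam * ee (lam / 2) t.
  rewrite Rp_gt0 => t0; have ti : 0 < t^-1 by rewrite invr_gt0.
  rewrite /series /= -big_distrl /= normrM.
  have e1 : `|\sum_(0 <= j < n) pairp N (fun m => wf ga (m%:R * t^-1)) al j| <= 8 * Cw / (lam / t).
    have lt0 : 0 < lam / t by rewrite divr_gt0.
    apply: (le_trans (ler_norm_sum _ _ _)).
    apply: (le_trans (ler_sum _ (fun j _ => pairp_le N _ al j))).
    apply: (@le_trans _ _ (8 * Cw / (lam / t) * ee (lam / t) (1 / 4))); last first.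
      by rewrite ler_piMr ?ee_le1 ?(ltW lt0)// divr_ge0 ?(ltW lt0)// mulr_ge0.
    apply: (@pair_bound R N N0 (fun m => wf ga (m%:R * t^-1))) => // m _; apply: (le_trans (hw _ _)); first by rewrite mulr_ge0// ltW.
    by rewrite ler_wpM2l// -ee_scale [m%:R * _]mulrC.
  apply: (le_trans (ler_pM _ _ e1 (hC t t0))) => //.
  rewrite le_eqVlt; apply/orP; left; apply/eqP.
  move: (ee _ _) => E; move: (lam) (lt0r_neq0 l0) => l ln; by field; rewrite ln lt0r_neq0.
have iG : itg Rp (fun t => 8 * Cw * C / lam * ee (lam / 2) t) by apply: itgZ => //; exact: itg_ee.
have [iw fi c1] := @series_itg_dom _ Rp f _ _ mRp (fun n => cpos_meas (cf n)) fw bf iG.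
split => //.
rewrite (_ : series _ = series (fun j => \int[mu]_(t in Rp) f j t))//.
apply: series_ext => j; rewrite /pairp /W.
have /andP[a0 _] := alN.
have [i1 _] := @step4 (N * j + al)%N ltac:(lia).
have [i2 _] := @step4 (N * j + (N - al))%N ltac:(lia).
by rewrite -RID//; apply: eq_RI => t _; rewrite /f /pairp mulrDl.
Qed.

(** The same signed sum over m' before the substitution, where it rebuilds [Yf]; by [step3] it
    agrees term by term with that of [step4]. *)
Let step2 m : (0 < m)%N -> itg Rp (fun t => K m t * Yf ga de t) /\
  \int[mu]_(t in Rp) (K m t * Yf ga de t) = W m.
Proof.
move=> m0; have mp : 0 < m%:R :> R by rewrite ltr0n.
have [C C0 hC] := @Ysum_bound R N N0 ga de gaN deN.
pose f j (t : R) := K m t * pairm N (S^~ t) ga j.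
have cf j : cpos (f j) by apply: cposM => // x x0; apply: cvgB; exact: cS.
have [cYs _] := @Yf_prop R N N0 ga de gaN' deN.
have fw t : Rp t -> series (fun j => f j t) @ \oo --> K m t * Yf ga de t.
  by rewrite Rp_gt0 => t0; apply: cvg_seriesZ; exact: cYs.
have l8 : 0 < lam / 8 by rewrite divr_gt0.
have bf n t : Rp t -> `|series (fun j => f j t) n| <= 4 * C / lam ^+ 2 * ee (lam / 8) t.
  rewrite Rp_gt0 => t0; rewrite /series /= -big_distrr /= normrM.
  have e1 : `|K m t| <= 4 * t ^+ 2 / lam ^+ 2.
    apply: (le_trans (Kinv_bound N0 be m0 t0)).
    have lt2 : 0 < lam / (2 * t) by rewrite divr_gt0// mulr_gt0.
    apply: (@le_trans _ _ (2 * t / lam * (lam / (2 * t) * m%:R)^-1)).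
      apply: ler_wpM2l; first by nonneg.
      exact: ee_le_inv.
    have -> : 2 * t / lam * (lam / (2 * t) * m%:R)^-1 = 4 * t ^+ 2 / lam ^+ 2 * m%:R^-1.
      by move: (lam) (lt0r_neq0 l0) => l ln; field; rewrite ln !lt0r_neq0.
    apply: ler_piMr; [by nonneg|by rewrite invf_le1 ?ltr0n// ler1n].
  apply: (le_trans (ler_pM _ _ e1 (hC n t t0))) => //.
  rewrite le_eqVlt; apply/orP; left; apply/eqP.
  move: (ee _ _) => E; move: (lam) (lt0r_neq0 l0) => l ln; by field; rewrite ln lt0r_neq0.
have iG : itg Rp (fun t => 4 * C / lam ^+ 2 * ee (lam / 8) t) by apply: itgZ => //; exact: itg_ee.
have [iw fi c1] := @series_itg_dom _ Rp f _ _ mRp (fun n => cpos_meas (cf n)) fw bf iG.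
split; first exact: iw.
have [_ c2] := step4 m0.
apply: (cvg_unique (@norm_hausdorff _ R) c1).
suff -> : series (fun j => \int[mu]_(x in Rp) f j x) = series (pairm N (fun m' => Z (m * m')%N) ga) by exact: c2.
apply: series_ext => j; rewrite /pairm.
have /andP[g0 _] := gaN.
have [i1 e1] := @step3 m (N * j + ga)%N m0 ltac:(lia).
have [i2 e2] := @step3 m (N * j + (N - ga))%N m0 ltac:(lia).
by rewrite -e1 -e2 -RIB//; apply: eq_RI => t _; rewrite /f /pairm mulrBr.
Qed.

(** The remaining sum over m rebuilds [Vf] on the left through [step2] and [Tf] on the right through
    [step5], with equal terms [W m]. *)
Lemma rogers_zudilin : [/\ itg Rp (fun t => Vf al be t^-1 * Yf ga de t),
  itg Rp (fun t => Tf al ga t^-1 * Af be de t) &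
  \int[mu]_(t in Rp) (Vf al be t^-1 * Yf ga de t) =
  \int[mu]_(t in Rp) (Tf al ga t^-1 * Af be de t)].
Proof.
have [iT c5] := step5.
have [C C0 hC] := @Yf_bound R N N0 ga de gaN deN.
pose f j (t : R) := pairp N (K^~ t) al j * Yf ga de t.
have cf j : cpos (f j) by apply: cposM => // x x0; apply: cvgD; apply: cK.
have [cV _] := @Vf_prop R N N0 al be alN'.
have fw t : Rp t -> series (fun j => f j t) @ \oo --> Vf al be t^-1 * Yf ga de t.
  rewrite Rp_gt0 => t0; have ti : 0 < t^-1 by rewrite invr_gt0.
  rewrite mulrC; have := @cvg_seriesZ R _ (Yf ga de t) _ (cV _ ti).
  rewrite (_ : series _ = series (fun j => f j t))//.
  by apply: series_ext => j; rewrite /f mulrC.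
have l8 : 0 < lam / 8 by rewrite divr_gt0.
have bf n t : Rp t -> `|series (fun j => f j t) n| <= 32 * C / lam ^+ 2 * ee (lam / 8) t.
  rewrite Rp_gt0 => t0; rewrite /series /= -big_distrl /= normrM.
  apply: (le_trans (ler_pM _ _ (Vsum_bound N0 be n alN t0) (hC t t0))) => //.
  rewrite le_eqVlt; apply/orP; left; apply/eqP.
  move: (ee _ _) => E; move: (lam) (lt0r_neq0 l0) => l ln; by field; rewrite ln lt0r_neq0.
have iG : itg Rp (fun t => 32 * C / lam ^+ 2 * ee (lam / 8) t) by apply: itgZ => //; exact: itg_ee.
have [iw fi c1] := @series_itg_dom _ Rp f _ _ mRp (fun n => cpos_meas (cf n)) fw bf iG.
split; [exact: iw|exact: iT|].
apply: (cvg_unique (@norm_hausdorff _ R) c1).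
suff -> : series (fun j => \int[mu]_(x in Rp) f j x) = series (pairp N W al) by exact: c5.
apply: series_ext => j; rewrite /pairp.
have /andP[a0 _] := alN.
have [i1 e1] := @step2 (N * j + al)%N ltac:(lia).
have [i2 e2] := @step2 (N * j + (N - al))%N ltac:(lia).
by rewrite -e1 -e2 -RID//; apply: eq_RI => t _; rewrite /f /pairp mulrDl.
Qed.

End RogersZudilin.

(** * Inversion formulas, moments and Clausen values *)

Section ModularRelations.
Variable R : realType.
Notation mu := (@lebesgue_measure R).
Local Notation Rp := (`]0%R, +oo[%classic : set R).
Variable N : nat.
Hypothesis N0 : (0 < N)%N.
Notation lam := (lam R N).
Notation sf := (@sf R N).
Notation wf := (@wf R N).
Notation Kf := (@Kf R N).
Notation th := (@th R N).
Notation Tf := (@Tf R N).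
Notation Vf := (@Vf R N).
Notation Yf := (@Yf R N).
Notation Af := (@Af R N).
Let l0 : 0 < lam. Proof. exact: lam_gt0. Qed.
Let NN0 : 0 < N%:R :> R. Proof. by rewrite ltr0n. Qed.
Let mRp : measurable Rp. Proof. exact: measurable_itv. Qed.

Lemma Yf_sym c d (t : R) : (0 < c < N)%N -> (0 < d < N)%N -> 0 < t ->
  Yf c d t = t ^- 2 * Yf d c t^-1.
Proof.
move=> cN dN t0; have [w1 [dw [Y Y1 [Y2 Y3]]]] := sf_pair_modular N0 cN dN t0.
have -> : Yf c d t = Y by exact: cvg_lim Y1.
have -> : Yf d c t^-1 = t ^+ 2 * Y by exact: cvg_lim Y3.
by rewrite mulKf// expf_neq0// lt0r_neq0.
Qed.

Lemma Tf_modular a d (t : R) : (a < N)%N -> (0 < d < N)%N -> 0 < t ->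
  Tf a d t = 4 / (N%:R * t) * (sf d 0 / 2 + Af a d t^-1).
Proof.
move=> aN dN t0; have [S S1 S2] := wf_pair_modular N0 aN dN t0.
have -> : Af a d t^-1 = S by exact: cvg_lim S1.
exact: cvg_lim S2.
Qed.

(** The Clausen function at the angle 2 pi c / N. It enters through first moments and cancels in
    [Lf_inv_pairing]. *)
Definition Cl c : R := limn (series (fun k => sin (th c * k.+1%:R) / k.+1%:R ^+ 2)).

Lemma cvg_Cl c : series (fun k => sin (th c * k.+1%:R) / k.+1%:R ^+ 2) @ \oo --> Cl c.
Proof.
apply: (@series_abs_cvg _ _ (fun k => (k.+1%:R ^+ 2)^-1)); last exact: cvg_invsq.
by move=> k; apply: (le_trans (sinM_le _ _)); rewrite ger0_norm// invr_ge0 sqr_ge0.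
Qed.

Lemma cos_th_sum a : (a <= N)%N ->
  series (fun k => cos (th a * k.+1%:R) / k.+1%:R ^+ 2) @ \oo --> pi ^+ 2 * B2 (a%:R / N%:R : R).
Proof.
move=> aN; have h : 0 <= (a%:R : R) / N%:R <= 1.
  by rewrite divr_ge0//= ler_pdivrMr// mul1r ler_nat.
suff -> : series (fun k => cos (th a * k.+1%:R) / k.+1%:R ^+ 2) =
  series (fun k => cos (2 * pi * (k.+1%:R * (a%:R / N%:R))) / k.+1%:R ^+ 2) by exact: cos_invsq.
by apply: series_ext => k; congr (cos _ / _); rewrite /th /lam; ring.
Qed.

(** By scaling, the k-th integral is a fixed one times c_k / k^2; absolute summability in k permits
    integration term by term. *)
Lemma scaled_series (c : nat -> R) (h F : R -> R) : (forall k, `|c k| <= 1) ->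
  cpos h -> itg Rp h ->
  (forall t, 0 < t -> series (fun k => c k / k.+1%:R * h (k.+1%:R * t)) @ \oo --> F t) ->
  itg Rp F /\
  series (fun k => c k / k.+1%:R ^+ 2 * \int[mu]_(x in Rp) h x) @ \oo --> \int[mu]_(x in Rp) F x.
Proof.
move=> c1 ch ih hF.
have kp k : 0 < k.+1%:R :> R by rewrite ltr0n.
pose f k t := c k / k.+1%:R ^+ 2 * (k.+1%:R * h (k.+1%:R * t)).
have fi k : itg Rp (f k) by apply: itgZ => //; have [] := RI_scale (kp k) ch ih.
have fE k : \int[mu]_(x in Rp) f k x = c k / k.+1%:R ^+ 2 * \int[mu]_(x in Rp) h x.
  by have [i1 e1] := RI_scale (kp k) ch ih; rewrite RIZ// -e1.
have fN k : \int[mu]_(x in Rp) `|f k x| = `|c k| / k.+1%:R ^+ 2 * \int[mu]_(x in Rp) `|h x|.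
  have [i1 e1] := RI_scale (kp k) (cpos_norm ch) (itg_norm mRp ih).
  rewrite e1 -RIZ//; apply: eq_RI => x _.
  by rewrite /f normrM normf_div normrX normrM (ger0_norm (ltW (kp k))).
have cN : cvgn (series (fun k => \int[mu]_(x in Rp) `|f k x|)).
  apply: (@series_abs_cvg _ _ (fun k => (\int[mu]_(x in Rp) `|h x|) * (k.+1%:R ^+ 2)^-1)).
    move=> k; rewrite fN; have I0 : 0 <= \int[mu]_(x in Rp) `|h x| by apply: Rintegral_ge0.
    have p0 : 0 <= (k.+1%:R ^+ 2)^-1 :> R by rewrite invr_ge0 sqr_ge0.
    rewrite ger0_norm ?mulr_ge0// mulrC ler_wpM2l//.
    by rewrite ler_piMl.
  by apply/cvg_ex; exists ((\int[mu]_(x in Rp) `|h x|) * limn (series (fun k => (k.+1%:R ^+ 2)^-1 : R)));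
     apply: cvg_seriesZ; exact: cvg_invsq.
have fF t : Rp t -> series (fun k => f k t) @ \oo --> F t.
  rewrite Rp_gt0 => t0.
  suff -> : series (fun k => f k t) = series (fun k => c k / k.+1%:R * h (k.+1%:R * t)) by exact: hF.
  apply: series_ext => k; rewrite /f; move: (k.+1%:R : R) (lt0r_neq0 (kp k)) (h _) => n n0 y.
  by field; rewrite n0.
have [iF] := series_itg_abs mRp fi cN fF; split => //.
by rewrite -(series_ext fE).
Qed.

Lemma RI_x_sf d : (0 < d < N)%N ->
  itg Rp (fun x => x * sf d x) /\ \int[mu]_(x in Rp) (x * sf d x) = lam ^- 2 * Cl d.
Proof.
move=> dN; have [ix ex] := RI_x_ee l0.
have cx : cpos (fun x => x * ee lam x).
  by move=> x _; apply: cvgM; [exact: cvg_id|exact: cts_ee].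
have [] := @scaled_series (fun k => sin (th d * k.+1%:R)) _ (fun x => x * sf d x) _ cx ix.
- by move=> k; rewrite ler_norml sin_geN1 sin_le1.
- move=> t t0.
  suff -> : series (fun k => sin (th d * k.+1%:R) / k.+1%:R * (k.+1%:R * t * ee lam (k.+1%:R * t))) =
    series (fun k => t * (sin (th d * k.+1%:R) * ee lam (k.+1%:R * t))).
    by apply: cvg_seriesZ; exact: sf_series.
  apply: series_ext => k; have kn : k.+1%:R != 0 :> R by rewrite pnatr_eq0.
  move: (ee _ _) (sin _) => E s; move: (k.+1%:R : R) kn => n n0; by field; rewrite n0.
- move=> i1 c1; split => //; apply: (cvg_unique (@norm_hausdorff _ R) c1).
  suff -> : series (fun k => sin (th d * k.+1%:R) / k.+1%:R ^+ 2 * \int[mu]_(x in Rp) (x * ee lam x)) =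
    series (fun k => lam ^- 2 * (sin (th d * k.+1%:R) / k.+1%:R ^+ 2)).
    by apply: cvg_seriesZ; exact: cvg_Cl.
  by apply: series_ext => k; rewrite ex mulrC.
Qed.

Lemma cpos_id : cpos (fun x : R => x).
Proof. by move=> x _; exact: cvg_id. Qed.

Lemma RI_x_Af a d : (a < N)%N -> (0 < d < N)%N ->
  itg Rp (fun x => x * Af a d x) /\
  \int[mu]_(x in Rp) (x * Af a d x) = pi ^+ 2 * B2 (a%:R / N%:R) * (lam ^- 2 * Cl d).
Proof.
move=> aN dN; have [ix ex] := RI_x_sf dN.
have [cA _] := @Af_prop R N N0 a d dN.
have cx : cpos (fun x => x * sf d x).
  by apply: cposM; [exact: cpos_id|apply: cts_cpos; exact: sf_cts].
have [] := @scaled_series (fun k => cos (th a * k.+1%:R)) _ (fun x => x * Af a d x) _ cx ix.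
- by move=> k; rewrite ler_norml cos_geN1 cos_le1.
- move=> t t0.
  suff -> : series (fun k => cos (th a * k.+1%:R) / k.+1%:R * (k.+1%:R * t * sf d (k.+1%:R * t))) =
    series (fun k => t * (cos (th a * k.+1%:R) * sf d (k.+1%:R * t))).
    by apply: cvg_seriesZ; exact: cA.
  apply: series_ext => k; have kn : k.+1%:R != 0 :> R by rewrite pnatr_eq0.
  move: (sf _ _) (cos _) => E s; move: (k.+1%:R : R) kn => n n0; by field; rewrite n0.
- move=> i1 c1; split => //; apply: (cvg_unique (@norm_hausdorff _ R) c1).
  suff -> : series (fun k => cos (th a * k.+1%:R) / k.+1%:R ^+ 2 * \int[mu]_(x in Rp) (x * sf d x)) =
    series (fun k => lam ^- 2 * Cl d * (cos (th a * k.+1%:R) / k.+1%:R ^+ 2)).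
    by rewrite [pi ^+ 2 * _ * _]mulrC; apply: cvg_seriesZ; apply: cos_th_sum; exact: ltnW.
  by apply: series_ext => k; rewrite ex mulrC.
Qed.

Lemma RI_x_wf1 d (g : R -> R) : (0 < d < N)%N -> ratexp lam g -> (forall x, dv (wf d) x (g x)) ->
  itg Rp (fun x => x * g x) /\ \int[mu]_(x in Rp) (x * g x) = - sf d 0.
Proof.
move=> dN rg dw.
have [C C0 hC] := ratexp_bound l0 rg.
have [C' C'0 hC'] := @wf_bound R N N0 d.
have cg := ratexp_cts rg; have cw := @wf_cts R N N0 d.
have l2 : 0 < lam / 2 by rewrite divr_gt0.
have xb (k : R -> R) D : 0 <= D -> (forall x, 0 <= x -> `|k x| <= D * ee lam x) ->
    forall x, 0 <= x -> `|x * k x| <= D * (2 / lam) * ee (lam / 2) x.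
  move=> D0 hk x x0; rewrite normrM ger0_norm//.
  apply: (le_trans (ler_wpM2l x0 (hk x x0))).
  by rewrite mulrCA -[leRHS]mulrA ler_wpM2l// xee_le.
have ig : itg Rp (fun x => x * g x).
  apply: (itg_bee (C := C * (2 / lam)) l2) => [|x /ltW x0]; last exact: xb.
  by apply: cts_meas => x; apply: cvgM; [exact: cvg_id|exact: cg].
split => //.
have iw := @wf_itg R N N0 d.
have e1 : \int[mu]_(x in Rp) (wf d x + x * g x) = 0 - 0 * wf d 0.
  apply: (@ftc0y _ (fun x => x * wf d x) _ 0).
  - by move=> x _; apply: dv_eq (dvM (dv_id x) (dw x)); rewrite mul1r.
  - by move=> x _; apply: cvgD; [exact: cw|apply: cvgM; [exact: cvg_id|exact: cg]].
  - exact: itgD.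
  - exact: (bounded_cvg0 (xb _ _ C'0 hC') (ee_cvg0 l2)).
by move: e1; rewrite RID// ft_wf0// mul0r subr0 => /eqP; rewrite addrC addr_eq0 => /eqP.
Qed.

(** [Yf_sym] and x -> 1 / x turn the weight 1 / x into x with c and d exchanged. There
    [sf_pair_modular] writes [Yf d c] as a sine series in the derivative of [wf d], to which
    [scaled_series] applies. *)
Lemma RI_Yf_inv c d : (0 < c < N)%N -> (0 < d < N)%N ->
  itg Rp (fun x => x^-1 * Yf c d x) /\
  \int[mu]_(x in Rp) (x^-1 * Yf c d x) = lam^-1 * (sf d 0 * Cl c).
Proof.
move=> cN dN; have /andP[_ dN'] := dN.
have [g rg dg] := ratexp_dv (@wf_ratexp R N N0 d).
have [ix ex] := RI_x_wf1 dN rg dg.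
have [cY cpY] := @Yf_prop R N N0 d c dN' cN.
have cx : cpos (fun x => x * g x).
  by apply: cposM; [exact: cpos_id|apply: cts_cpos; exact: (ratexp_cts rg)].
have hc k : `|sin (th c * k.+1%:R)| <= 1 by rewrite ler_norml sin_geN1 sin_le1.
have hF t : 0 < t -> series (fun k => sin (th c * k.+1%:R) / k.+1%:R * (k.+1%:R * t * g (k.+1%:R * t)))
    @ \oo --> t * (- lam * Yf d c t).
  move=> t0.
  suff -> : series (fun k => sin (th c * k.+1%:R) / k.+1%:R * (k.+1%:R * t * g (k.+1%:R * t))) =
    series (fun k => t * (sin (th c * k.+1%:R) * g (k.+1%:R * t))).
    apply: cvg_seriesZ.
    have [w1 [dw [Y Y1 [Y2 _]]]] := sf_pair_modular N0 dN cN t0.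
    have -> : Yf d c t = Y by exact: cvg_lim Y1.
    suff -> : g = w1 by [].
    by apply/funext => x; case: (dg x) => _ <-; case: (dw x) => _ <-.
  apply: series_ext => k; have kn : k.+1%:R != 0 :> R by rewrite pnatr_eq0.
  move: (g _) (sin _) => E s; move: (k.+1%:R : R) kn => n n0; by field; rewrite n0.
have [i1 c1] := scaled_series hc cx ix hF.
have e1 : \int[mu]_(x in Rp) (x * (- lam * Yf d c x)) = - (sf d 0 * Cl c).
  apply: (cvg_unique (@norm_hausdorff _ R) c1).
  suff -> : series (fun k => sin (th c * k.+1%:R) / k.+1%:R ^+ 2 * \int[mu]_(x in Rp) (x * g x)) =
    series (fun k => - sf d 0 * (sin (th c * k.+1%:R) / k.+1%:R ^+ 2)).
    have -> : - (sf d 0 * Cl c) = - sf d 0 * Cl c by rewrite mulNr.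
    by apply: cvg_seriesZ; exact: cvg_Cl.
  by apply: series_ext => k; rewrite ex mulrC.
have e2 x : - lam^-1 * (x * (- lam * Yf d c x)) = x * Yf d c x.
  by move: (lam) (lt0r_neq0 l0) => l ln; field; rewrite ln.
have i2 : itg Rp (fun x => x * Yf d c x).
  have := itgZ (- lam^-1) mRp i1; apply: eq_itg => // x _; exact: e2.
have e3 : \int[mu]_(x in Rp) (x * Yf d c x) = lam^-1 * (sf d 0 * Cl c).
  rewrite -[RHS]opprK -mulrN -e1 -mulNr -RIZ//; apply: eq_RI => x _.
  by rewrite e2.
have [i3 e4] := RI_inv (cposM cpos_id cpY) i2.
have e5 x : Rp x -> x ^- 2 * (x^-1 * Yf d c x^-1) = x^-1 * Yf c d x.
  by rewrite Rp_gt0 => x0; rewrite (@Yf_sym c d x)// mulrCA.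
split; first exact: eq_itg i3.
by rewrite -e3 e4; apply: eq_RI => x Dx; rewrite e5.
Qed.

Lemma RI_cos_scale (h : R -> R) (k s : R) : 0 < s -> continuous h -> itg Rp h ->
  \int[mu]_(x in Rp) (cos (k * x) * h (s * x)) =
  s^-1 * \int[mu]_(x in Rp) (cos (k / s * x) * h x).
Proof.
move=> s0 ch ih.
have ic : itg Rp (fun x => cos (k / s * x) * h x).
  apply: (itg_le _ _ _ (itg_norm _ ih)) => //; first by apply: cts_meas; exact: cts_cosM.
  by move=> x _; exact: cosM_le.
have cc : cpos (fun x => cos (k / s * x) * h x) by apply: cts_cpos; exact: cts_cosM.
have [i1 ->] := RI_scale s0 cc ic.
rewrite -RIZ//; apply: eq_RI => x _.
by rewrite mulKf ?lt0r_neq0// [k / _ * _]mulrA divfK ?lt0r_neq0.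
Qed.

Lemma ft_Kf b (xi : R) : (0 < b < N)%N ->
  series (fun k => lam^-1 * (cos (th b * k.+1%:R) / (k.+1%:R ^+ 2 + xi ^+ 2))) @ \oo -->
  \int[mu]_(x in Rp) (cos (lam * xi * x) * Kf b x).
Proof.
move=> bN.
pose f k x := cos (th b * k.+1%:R) / k.+1%:R * (cos (lam * xi * x) * ee (lam * k.+1%:R) x).
have kp k : 0 < k.+1%:R :> R by rewrite ltr0n.
have lk k : 0 < lam * k.+1%:R by rewrite mulr_gt0.
have ie k : itg Rp (fun x => cos (lam * xi * x) * ee (lam * k.+1%:R) x).
  apply: (itg_bee (C := 1) (lk k)); first by apply: cts_meas; apply: cts_cosM; exact: cts_ee.
  by move=> x _; apply: (le_trans (cosM_le _ _)); rewrite mul1r ger0_norm// ee_ge0.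
have fi k : itg Rp (f k) by exact: itgZ.
have fE k : \int[mu]_(x in Rp) f k x =
    lam^-1 * (cos (th b * k.+1%:R) / (k.+1%:R ^+ 2 + xi ^+ 2)).
  have d0 : k.+1%:R ^+ 2 + xi ^+ 2 != 0 :> R by rewrite lt0r_neq0// ltr_pwDl ?exprn_gt0// sqr_ge0.
  have d1 : (lam * k.+1%:R) ^+ 2 + (lam * xi) ^+ 2 != 0 :> R.
    move: (lam) (lt0r_neq0 l0) => l ln.
    by rewrite !exprMn -mulrDr mulf_neq0// expf_neq0.
  rewrite RIZ// RI_cos_ee//; move: (cos _) => c.
  move: (lam) (lt0r_neq0 l0) (k.+1%:R : R) (lt0r_neq0 (kp k)) d0 d1 => l ln n nn d0 d1.
  by field; rewrite ln nn d0 d1.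
have cN : cvgn (series (fun k => \int[mu]_(x in Rp) `|f k x|)).
  apply: (@series_abs_cvg _ _ (fun k => lam^-1 * (k.+1%:R ^+ 2)^-1)); last first.
    by apply/cvg_ex; exists (lam^-1 * limn (series (fun k => (k.+1%:R ^+ 2)^-1 : R)));
     apply: cvg_seriesZ; exact: cvg_invsq.
  move=> k.
  have -> : lam^-1 * (k.+1%:R ^+ 2)^-1 = k.+1%:R^-1 / (lam * k.+1%:R).
    by move: (lam) (lt0r_neq0 l0) (k.+1%:R : R) (lt0r_neq0 (kp k)) => l ln n nn; field; rewrite ln nn.
  apply: (RI_bee (lk k)).
    by have := itg_meas (itg_norm mRp (fi k)).
  move=> x _; rewrite normr_id /f -mulrA; apply: (le_trans (cosM_le _ _)).
  rewrite normrM ger0_norm ?invr_ge0// ler_wpM2l ?invr_ge0//.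
  by apply: (le_trans (cosM_le _ _)); rewrite ger0_norm// ee_ge0.
have fF t : Rp t -> series (fun k => f k t) @ \oo --> cos (lam * xi * t) * Kf b t.
  rewrite Rp_gt0 => t0.
  suff -> : series (fun k => f k t) = series (fun k => cos (lam * xi * t) *
     (cos (th b * k.+1%:R) / k.+1%:R * ee lam (k.+1%:R * t))).
    by apply: cvg_seriesZ; exact: Kf_series.
  by apply: series_ext => k; rewrite /f ee_scale mulrCA.
have [iF] := series_itg_abs mRp fi cN fF.
by rewrite (series_ext fE).
Qed.

Lemma pair_exp b (x : R) : (b <= N)%N -> 0 < x -> exists2 S,
  series (fun k => cos (th b * k.+1%:R) * (x / (x ^+ 2 + k.+1%:R ^+ 2))) @ \oo --> S &
  series (pairp N (fun m => ee lam (m%:R * x)) b) @ \oo --> (pi * x)^-1 + 2 / pi * S.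
Proof.
move=> bN x0; have lx : 0 < lam * (N%:R * x) by apply: mulr_gt0 => //; exact: mulr_gt0.
have b01 : 0 <= (b%:R : R) / N%:R <= 1.
  by rewrite divr_ge0//= ler_pdivrMr// mul1r ler_nat.
have [S hS hP] := poisson (edecay_ee lx) b01.
have p0 := @pi_gt0 R.
have lE : lam * (N%:R * x) = 2 * pi * x by rewrite mulrA lamN.
exists (2 * pi * S).
  suff -> : series (fun k => cos (th b * k.+1%:R) * (x / (x ^+ 2 + k.+1%:R ^+ 2))) =
    series (fun k => 2 * pi * (cos (2 * pi * (k.+1%:R * (b%:R / N%:R))) *
      \int[mu]_(y in Rp) (cos (2 * pi * k.+1%:R * y) * ee (lam * (N%:R * x)) y))).
    exact: cvg_seriesZ.
  apply: series_ext => k; rewrite RI_cos_ee//.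
  have -> : th b * k.+1%:R = 2 * pi * (k.+1%:R * (b%:R / N%:R)) by rewrite /th /lam; ring.
  rewrite lE.
  have d0 : x ^+ 2 + k.+1%:R ^+ 2 != 0 by rewrite lt0r_neq0// ltr_pwDl ?exprn_gt0// sqr_ge0.
  have d1 : (2 * pi * x) ^+ 2 + (2 * pi * k.+1%:R) ^+ 2 != 0 :> R.
    rewrite !exprMn -mulrDr; apply: mulf_neq0 => //; apply: mulf_neq0; apply: expf_neq0 => //; exact: lt0r_neq0.
  move: (cos _) => c; move: (@pi R) (lt0r_neq0 p0) (k.+1%:R : R) d0 d1 => p pn n d0 d1.
  by field; rewrite d0 d1.
have -> : (pi * x)^-1 + 2 / pi * (2 * pi * S) =
    2 * \int[mu]_(y in Rp) ee (lam * (N%:R * x)) y + 4 * S.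
  rewrite RI_ee// lE; move: (@pi R) (lt0r_neq0 p0) (lt0r_neq0 x0) => p pn xn.
  by field; rewrite pn xn.
suff -> : series (pairp N (fun m => ee lam (m%:R * x)) b) =
  series (fun m => ee (lam * (N%:R * x)) (m%:R + b%:R / N%:R) +
   ee (lam * (N%:R * x)) (m%:R + (1 - b%:R / N%:R))) by [].
have nn : N%:R != 0 :> R by rewrite lt0r_neq0.
apply: series_ext => m; rewrite /pairp -!ee_scale; congr (ee _ _ + ee _ _).
  by rewrite natrD natrM; field.
by rewrite natrD natrM natrB//; field.
Qed.

End ModularRelations.

(** * The integral of log |g_u| darg g_v *)

Section Interchange.
Variable R : realType.
Notation mu := (@lebesgue_measure R).
Local Notation Rp := (`]0%R, +oo[%classic : set R).
Variable N : nat.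
Hypothesis N0 : (0 < N)%N.
Notation lam := (lam R N).
Notation sf := (@sf R N).
Notation wf := (@wf R N).
Notation Kf := (@Kf R N).
Notation th := (@th R N).
Notation Tf := (@Tf R N).
Notation Vf := (@Vf R N).
Notation Yf := (@Yf R N).
Notation Af := (@Af R N).
Notation Cl := (@Cl R N).
Let l0 : 0 < lam. Proof. exact: lam_gt0. Qed.
Let NN0 : 0 < N%:R :> R. Proof. by rewrite ltr0n. Qed.
Let mRp : measurable Rp. Proof. exact: measurable_itv. Qed.
Let lN : lam * N%:R = 2 * pi. Proof. exact: lamN. Qed.

(** For (a, b) nonzero and t > 0 this is log |g_(a,b)| at i t, by [siegel_it]. *)
Definition Lf a b (t : R) : R := - (pi * B2 (a%:R / N%:R) * t) - Vf a b t.

Lemma B2_0 : B2 (0 : R) = 6^-1.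
Proof. by rewrite /B2 expr0n subr0 add0r. Qed.

Section M1.
Variables (b : nat) (t : R).
Hypotheses (bN : (0 < b < N)%N) (t0 : 0 < t).
Let G k := \int[mu]_(x in Rp) (cos (lam * (k.+1%:R / t) * x) * Kf b x).

Let Kf_itg : itg Rp (Kf b).
Proof. by have [f2 [C /edecay_itg]] := @Kf_edecay R N N0 b bN. Qed.

Let Kf_cts : continuous (Kf b).
Proof.
have [f2 [C [_ d _ _ _]]] := @Kf_edecay R N N0 b bN.
by move=> x; have := d x; exact: is_derive_cts.
Qed.

Let RI_Kf : \int[mu]_(x in Rp) Kf b x = lam^-1 * (pi ^+ 2 * B2 (b%:R / N%:R)).
Proof.
have /andP[_ bN'] := bN.
have h := @ft_Kf R N N0 b 0 bN.
have -> : \int[mu]_(x in Rp) Kf b x = \int[mu]_(x in Rp) (cos (lam * 0 * x) * Kf b x).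
  by apply: eq_RI => x _; rewrite mulr0 mul0r cos0 mul1r.
apply: (cvg_unique (@norm_hausdorff _ R) h).
suff -> : series (fun k => lam^-1 * (cos (th b * k.+1%:R) / (k.+1%:R ^+ 2 + 0 ^+ 2))) =
  series (fun k => lam^-1 * (cos (th b * k.+1%:R) / k.+1%:R ^+ 2)).
  by apply: cvg_seriesZ; apply: cos_th_sum => //; exact: ltnW.
by apply: series_ext => k; rewrite expr0n addr0.
Qed.

(** Poisson summation at b = 0 for x -> Kf b (N t x), which is smooth at 0 because b is nonzero; the
    frequency 0 yields the term in B2 (b / N). *)
Let Vf0 : exists2 S, series G @ \oo --> S &
  Vf 0 b t = pi / t * B2 (b%:R / N%:R) + 4 / (N%:R * t) * S.
Proof.
have k0 : 0 < N%:R * t by rewrite mulr_gt0.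
have [f2 [C Ew]] := @Kf_edecay R N N0 b bN.
have Ef := edecay_scale k0 Ew.
have b01 : 0 <= (0 : R) <= 1 by rewrite lexx ler01.
have [S hS hP] := poisson Ef b01.
have JE k : \int[mu]_(x in Rp) (cos (2 * pi * k.+1%:R * x) * Kf b (N%:R * t * x)) = (N%:R * t)^-1 * G k.
  rewrite RI_cos_scale//; congr (_ * _); apply: eq_RI => x _; congr (cos (_ * _) * _).
  rewrite -lN; move: (lam) (N%:R : R) (k.+1%:R : R) (lt0r_neq0 NN0) (lt0r_neq0 t0) => p n k' n0 t1.
  by field; rewrite n0 t1.
have I0 : \int[mu]_(x in Rp) Kf b (N%:R * t * x) = (N%:R * t)^-1 * (lam^-1 * (pi ^+ 2 * B2 (b%:R / N%:R))).
  have := @RI_cos_scale R (Kf b) 0 _ k0 Kf_cts Kf_itg; rewrite mul0r.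
  have e (h : R -> R) : \int[mu]_(x in Rp) (cos (0 * x) * h x) = \int[mu]_(x in Rp) h x.
    by apply: eq_RI => x _; rewrite mul0r cos0 mul1r.
  by rewrite (e (fun x => Kf b (N%:R * t * x))) e RI_Kf.
exists (N%:R * t * S).
  suff -> : series G = series (fun k => N%:R * t * (cos (2 * pi * (k.+1%:R * 0)) *
    \int[mu]_(x in Rp) (cos (2 * pi * k.+1%:R * x) * Kf b (N%:R * t * x)))).
    exact: cvg_seriesZ.
  by apply: series_ext => k; rewrite JE !mulr0 cos0 mul1r mulVKf ?lt0r_neq0.
rewrite I0 in hP.
have -> : pi / t * B2 (b%:R / N%:R) + 4 / (N%:R * t) * (N%:R * t * S) =
   2 * ((N%:R * t)^-1 * (lam^-1 * (pi ^+ 2 * B2 (b%:R / N%:R)))) + 4 * S.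
  have p0 := lt0r_neq0 (@pi_gt0 R).
  have -> : lam^-1 = N%:R / (2 * pi) by rewrite -lN; move: (lam) (lt0r_neq0 l0) => l ln; field; rewrite ln lt0r_neq0.
  move: (B2 _) => s; move: (N%:R : R) (@pi R) p0 (lt0r_neq0 NN0) (lt0r_neq0 t0) => n p p0 n0 t1.
  by field; rewrite n0 t1 p0.
apply: cvg_lim => //.
suff -> : series (pairp N (fun m => Kf b (m%:R * t)) 0) = series (fun m => Kf b (N%:R * t * (m%:R + 0)) +
   Kf b (N%:R * t * (m%:R + (1 - 0)))) by [].
apply: series_ext => m; rewrite /pairp; congr (Kf b _ + Kf b _).
  by rewrite natrD natrM; ring.
by rewrite natrD natrM subn0; ring.
Qed.

(** Here the kernel is [Kf 0], whose singularity at 0 rules out [poisson]. Its exponential series is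
    exchanged with the sum over the residue class, and [pair_exp] resolves each sum of exponentials
    into the same transforms [G]. *)
Let Vfb S : series G @ \oo --> S ->
  Vf b 0 t^-1 = t * pi / 6 + 4 / (N%:R * t) * S.
Proof.
move=> hS; have /andP[b0 bN'] := bN.
have ti : 0 < t^-1 by rewrite invr_gt0.
have [cV _] := @Vf_prop R N N0 b 0 bN'.
pose q := lam / (2 * t).
have q0 : 0 < q by rewrite divr_gt0// mulr_gt0.
pose a j k := pairp N (fun m => k.+1%:R^-1 * ee lam (k.+1%:R * (m%:R * t^-1))) b j.
pose A j := 2 * ee q j%:R; pose B k := 1 * ee q k%:R.
have ab j k : `|a j k| <= A j * B k.
  have hm m : (0 < m)%N -> (j <= m)%N ->
      `|k.+1%:R^-1 * ee lam (k.+1%:R * (m%:R * t^-1))| <= ee q j%:R * ee q k%:R.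
    move=> m0 jm; rewrite ger0_norm ?mulr_ge0 ?ee_ge0 ?invr_ge0//.
    apply: (@le_trans _ _ (1 * ee lam (k.+1%:R * (m%:R * t^-1)))).
      by rewrite ler_wpM2r ?ee_ge0// invf_le1 ?ltr0n// ler1n.
    rewrite mul1r -eeD /ee ler_expR lerN2.
    have -> : lam * (k.+1%:R * (m%:R * t^-1)) = q * (2 * (k.+1 * m)%:R).
      by rewrite natrM /q; move: (lam) => l; field; rewrite lt0r_neq0.
    rewrite ler_wpM2l ?(ltW q0)// -natrD -natrM ler_nat; nia.
  apply: (le_trans (pairp_le _ _ _ _)); rewrite /A /B mul1r.
  have := @hm (N * j + b)%N ltac:(lia) ltac:(nia).
  have := @hm (N * j + (N - b))%N ltac:(lia) ltac:(nia).
  by move: (ee _ _) (ee _ _) => x y; lra.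
have ss m : (0 < m)%N -> series (fun k => k.+1%:R^-1 * ee lam (k.+1%:R * (m%:R * t^-1))) @ \oo -->
    Kf 0 (m%:R * t^-1).
  move=> m0; have mt : 0 < m%:R * t^-1 by rewrite mulr_gt0// ltr0n.
  suff -> : series (fun k => k.+1%:R^-1 * ee lam (k.+1%:R * (m%:R * t^-1))) =
    series (fun k => cos (th 0 * k.+1%:R) / k.+1%:R * ee lam (k.+1%:R * (m%:R * t^-1))) by exact: Kf_series.
  by apply: series_ext => k; rewrite /th mulr0 mul0r cos0 mul1r.
have cc k : series (fun j => a j k) @ \oo --> t / pi * (k.+1%:R ^+ 2)^-1 + 2 / (pi * t) * (lam * G k).
  have x0 : 0 < k.+1%:R / t by rewrite divr_gt0.
  have [Sk S1 S2] := pair_exp N0 (ltnW bN') x0.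
  have SG : Sk = k.+1%:R / t * (lam * G k).
    apply: (cvg_unique (@norm_hausdorff _ R) S1).
    have h := @ft_Kf R N N0 b (k.+1%:R / t) bN.
    suff -> : series (fun k0 => cos (th b * k0.+1%:R) * (k.+1%:R / t / ((k.+1%:R / t) ^+ 2 + k0.+1%:R ^+ 2))) =
      series (fun k0 => k.+1%:R / t * lam * (lam^-1 * (cos (th b * k0.+1%:R) / (k0.+1%:R ^+ 2 + (k.+1%:R / t) ^+ 2)))).
      rewrite [k.+1%:R / t * (lam * _)]mulrA; apply: cvg_seriesZ; exact: h.
    apply: series_ext => j; rewrite -[RHS]mulrA mulVKf ?lt0r_neq0//.
    by rewrite mulrCA [_ + j.+1%:R ^+ 2]addrC.
  have -> : t / pi * (k.+1%:R ^+ 2)^-1 + 2 / (pi * t) * (lam * G k) =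
    k.+1%:R^-1 * ((pi * (k.+1%:R / t))^-1 + 2 / pi * Sk).
    rewrite SG; have kn : k.+1%:R != 0 :> R by rewrite pnatr_eq0.
    move: (lam * G k) => g; move: (k.+1%:R : R) kn (@pi R) (lt0r_neq0 (@pi_gt0 R)) (lt0r_neq0 t0) => n nn p pn tn.
    by field; rewrite nn pn tn.
  suff -> : series (fun j => a j k) = series (fun j => k.+1%:R^-1 * pairp N (fun m => ee lam (m%:R * (k.+1%:R / t))) b j).
    exact: cvg_seriesZ S2.
  apply: series_ext => j; rewrite /a /pairp -mulrDr; congr (_ * (ee _ _ + ee _ _)); exact: mulrCA.
have cG : series (fun k => t / pi * (k.+1%:R ^+ 2)^-1 + 2 / (pi * t) * (lam * G k)) @ \oo -->
    t / pi * (pi ^+ 2 * B2 0) + 2 / (pi * t) * (lam * S).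
  apply: cvg_seriesD; apply: cvg_seriesZ; last exact: cvg_seriesZ.
  have h := @cos_th_sum R N N0 0 (leq0n N); rewrite mul0r in h.
  suff -> : series (fun k => (k.+1%:R ^+ 2)^-1 : R) = series (fun k => cos (th 0 * k.+1%:R) / k.+1%:R ^+ 2) by exact: h.
  by apply: series_ext => k; rewrite /th mulr0 mul0r cos0 mul1r.
have -> : t * pi / 6 + 4 / (N%:R * t) * S = t / pi * (pi ^+ 2 * B2 0) + 2 / (pi * t) * (lam * S).
  have -> : lam = 2 * pi / N%:R by [].
  rewrite B2_0; move: (N%:R : R) (@pi R) (lt0r_neq0 (@pi_gt0 R)) (lt0r_neq0 NN0) (lt0r_neq0 t0) => n p p0 n0 t1.
  by field; rewrite n0 t1 p0.
apply: cvg_lim => //.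
apply: (@series_swap R a A B _ _ _ ab _ _ _ _ _ cc cG).
- exact: cvg_ee_series.
- exact: cvg_ee_series.
- by move=> j; rewrite mulr_ge0 ?ee_ge0.
- by move=> j; rewrite mulr_ge0 ?ee_ge0.
- move=> j; apply: cvg_seriesD; apply: ss; lia.
Qed.

(** Both sides contain the same dual series, and the elementary term in the expansion of [Vf] on
    either side is the linear term of [Lf] on the other. *)
Lemma Lf_sym : Lf 0 b t = Lf b 0 t^-1.
Proof.
have [S S1 S2] := Vf0; rewrite /Lf S2 (Vfb S1) mul0r B2_0.
move: (4 / _ * S) (B2 _) (@pi R) (lt0r_neq0 t0) => x y p tn.
by field; rewrite tn.
Qed.
End M1.

Lemma sf0E (x : R) : sf 0 x = 0.
Proof. by rewrite /sf /th mulr0 sin0 mulr0 mul0r. Qed.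

Lemma series0 : series (fun=> 0 : R) @ \oo --> (0 : R).
Proof.
suff -> : series (fun=> 0 : R) = (fun=> 0) by exact: cvg_cst.
by apply/funext => n; rewrite /series /= big1.
Qed.

Lemma Af0E a (x : R) : Af a 0 x = 0.
Proof.
apply: cvg_lim => //.
suff -> : series (fun k => cos (th a * k.+1%:R) * sf 0 (k.+1%:R * x)) = series (fun=> 0) by exact: series0.
by apply: series_ext => k; rewrite sf0E mulr0.
Qed.

Lemma Yf0r c (x : R) : Yf c 0 x = 0.
Proof.
apply: cvg_lim => //.
suff -> : series (pairm N (fun m => m%:R * sf 0 (m%:R * x)) c) = series (fun=> 0) by exact: series0.
by apply: series_ext => k; rewrite /pairm !sf0E !mulr0 subr0.
Qed.

(** For c = 0 the odd pairs telescope, and the remaining term decays. *)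
Lemma Yf0l d (x : R) : (0 < d < N)%N -> 0 < x -> Yf 0 d x = 0.
Proof.
move=> dN x0; have [C C0 hC] := @msf_bound R N N0 d dN.
apply: cvg_lim => //.
have lx : 0 < lam * x by rewrite mulr_gt0.
suff -> : series (pairm N (fun m => m%:R * sf d (m%:R * x)) 0) =
   (fun n => - ((N * n)%:R * sf d ((N * n)%:R * x))).
  rewrite -[X in _ --> X]oppr0; apply: cvgN.
  apply/norm_cvg0P.
  apply: (@squeeze_cvgr _ _ _ _ (fun=> 0) (fun n => C * (2 / (lam * x)) * ee (lam * x / 2) n%:R)).
  - near=> n; rewrite normr_ge0 /=; apply: (le_trans (hC x (N * n)%N x0)).
    rewrite ler_wpM2l; [by []|by nonneg|].
    apply: ee_decr; first by nonneg.
    by rewrite ler_nat; nia.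
  - exact: cvg_cst.
  - have -> : (0 : R) = C * (2 / (lam * x)) * 0 by rewrite mulr0.
    apply: cvgM; first exact: cvg_cst.
    apply: (cvg_comp _ _ (@cvgr_idn R)); apply: ee_cvg0; exact: divr_gt0.
apply/funext; elim => [|n IH]; first by rewrite /series /= big_geq// muln0 mul0r oppr0.
rewrite /series /= big_nat_recr//=; move: IH; rewrite /series /= => ->.
by rewrite /pairm subn0 addn0 mulnS [(N + N * n)%N]addnC; ring.
Unshelve. all: by end_near. Qed.

(* [e_(a,d) - e_(a,-d)] at [i x / N]; the junk value [Tf a 0] is not zero. *)
Definition Tz a d (x : R) : R := if d == 0%N then 0 else Tf a d x.

Definition psi a d b c (t : R) : R := 16 / N%:R ^+ 2 *
  (Af a d t * Af b c t + 2^-1 * sf d 0 * Af b c t + 2^-1 * sf c 0 * Af a d t).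

Definition g0 d c : R := 4 / N%:R ^+ 2 * (sf d 0 * sf c 0).

(* The regularized value at 0 of the completed Mellin transform of
   [Tz a d * Tz b c], whose value at [1 / t] is [t ^+ 2 * (g0 + psi t)]. *)
Definition Lam0 a d b c : R :=
  \int[mu]_(x in `[1%R, +oo[) (x^-1 * (Tz a d x * Tz b c x)) +
  \int[mu]_(x in `[1%R, +oo[) (x * psi a d b c x) - g0 d c / 2.

Lemma Tz_cpos a d : (a < N)%N -> cpos (Tz a d).
Proof.
move=> aN; rewrite /Tz; case: eqP => _; first by move=> x _; exact: cvg_cst.
by have [] := @Tf_prop R N N0 a d aN.
Qed.

Lemma Af_cpos a d : (d < N)%N -> cpos (Af a d).
Proof.
case: d => [|d] dN; last by have [] := @Af_prop R N N0 a d.+1 dN.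
suff -> : Af a 0 = (fun=> 0) by move=> x _; exact: cvg_cst.
by apply/funext => x; rewrite Af0E.
Qed.

Lemma psi_cpos a d b c : (d < N)%N -> (c < N)%N -> cpos (psi a d b c).
Proof.
move=> dN cN; have cst (k : R) : cpos (fun=> k) by move=> x _; exact: cvg_cst.
have A1 := @Af_cpos a d dN; have A2 := @Af_cpos b c cN.
have cD (f g : R -> R) : cpos f -> cpos g -> cpos (fun x => f x + g x).
  by move=> cf cg x x0; apply: cvgD; [exact: cf|exact: cg].
exact (cposM (cst _) (cD _ _ (cD _ _ (cposM A1 A2) (cposM (cst _) A2)) (cposM (cst _) A1))).
Qed.

Lemma Tz_modular a d (t : R) : (a < N)%N -> (d < N)%N -> 0 < t ->
  Tz a d t^-1 = 4 * t / N%:R * (sf d 0 / 2 + Af a d t).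
Proof.
move=> aN dN t0; rewrite /Tz; case: eqP => [->|/eqP d0].
  by rewrite sf0E Af0E mul0r addr0 mulr0.
have dN' : (0 < d < N)%N by rewrite lt0n d0.
have ti : 0 < t^-1 by rewrite invr_gt0.
have -> := @Tf_modular R N N0 a d t^-1 aN dN' ti; rewrite invrK; congr (_ * _).
by move: (N%:R : R) (lt0r_neq0 NN0) (lt0r_neq0 t0) => n nn tn; field; rewrite nn tn.
Qed.

Lemma psi_modular a d b c (t : R) : (a < N)%N -> (d < N)%N -> (b < N)%N -> (c < N)%N -> 0 < t ->
  Tz a d t^-1 * Tz b c t^-1 = t ^+ 2 * (g0 d c + psi a d b c t).
Proof.
move=> aN dN bN cN t0; rewrite !Tz_modular// /psi /g0.
by field; rewrite lt0r_neq0.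
Qed.

Lemma Af_bound_ge1 a d : (d < N)%N -> exists2 C, 0 <= C & forall t : R, 1 <= t ->
  `|Af a d t| <= C * ee (lam / 2) t.
Proof.
case: d => [|d] dN; first by exists 0 => // t _; rewrite Af0E normr0 mul0r.
have [C C0 hC] := @Af_bound R N N0 a d.+1 dN.
exists C => // t t1; have t0 : 0 < t by exact: lt_le_trans t1.
apply: (le_trans (hC t t0)); rewrite ler_wpM2r ?ee_ge0// ler_piMr// invf_le1//.
Qed.

(** For a = 0 there is a nonzero constant term at infinity, so boundedness is all that holds for
    every a; it is read off the behavior of [Af] near 0 through the modular relation. *)
Lemma Tz_bound_weak a d : (a < N)%N -> (d < N)%N -> exists2 C, 0 <= C & forall t : R, 1 <= t -> `|Tz a d t| <= C.
Proof.
move=> aN; case: d => [|d] dN; first by exists 0 => // t _; rewrite /Tz eqxx normr0.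
have [C C0 hC] := @Af_bound R N N0 a d.+1 dN.
exists (4 / N%:R * (`|sf d.+1 0| / 2 + C)); first by nonneg.
move=> t t1; have t0 : 0 < t by exact: lt_le_trans t1.
have ti : 0 < t^-1 by rewrite invr_gt0.
rewrite -[t]invrK Tz_modular// normrM ger0_norm; last by nonneg.
have -> : 4 * t^-1 / N%:R * `|sf d.+1 0 / 2 + Af a d.+1 t^-1| =
   4 / N%:R * (t^-1 * `|sf d.+1 0 / 2 + Af a d.+1 t^-1|) by ring.
apply: ler_wpM2l; first by nonneg.
apply: (@le_trans _ _ (t^-1 * (`|sf d.+1 0| / 2 + C * t))).
  apply: ler_wpM2l; first by nonneg.
  apply: (le_trans (ler_normD _ _)); apply: lerD; first by rewrite normrM [`|2^-1|]ger0_norm.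
  apply: (le_trans (hC _ ti)); rewrite invrK ler_piMr ?ee_le1//; nonneg.
rewrite mulrDr; apply: lerD; first by rewrite ler_piMl ?invf_le1//; nonneg.
by rewrite mulrCA mulVf ?mulr1// lt0r_neq0.
Qed.

Lemma Tz_bound a d : (0 < a < N)%N -> exists2 C, 0 <= C & forall t : R, 1 <= t ->
  `|Tz a d t| <= C * ee (lam / 4) t.
Proof.
move=> aN; have /andP[_ aN'] := aN.
rewrite /Tz; case: eqP => [_|_]; first by exists 0 => // t _; rewrite normr0 mul0r.
have [C C0 hC] := @wf_bound R N N0 d.
have [cT _] := @Tf_prop R N N0 a d aN'.
exists (8 * C / lam); first by nonneg.
move=> t t1; have t0 : 0 < t by exact: lt_le_trans t1.
have h : `|series (pairp N (fun m => wf d (m%:R * t)) a) n| @[n --> \oo] --> `|Tf a d t|.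
  by apply: cvg_norm; exact: cT.
apply: (cvgr_to_le h); near=> n.
rewrite /series /=; apply: (le_trans (ler_norm_sum _ _ _)).
apply: (le_trans (ler_sum _ (fun j _ => pairp_le N _ a j))).
have lt0 : 0 < lam * t by rewrite mulr_gt0.
apply: (@le_trans _ _ (8 * C / (lam * t) * ee (lam * t) (1 / 4))).
  apply: (@pair_bound R N N0 (fun m => wf d (m%:R * t))) => // m _.
  apply: (le_trans (hC _ _)); first by rewrite mulr_ge0// ltW.
  by rewrite ler_wpM2l// -ee_scale [m%:R * _]mulrC.
have -> : ee (lam * t) (1 / 4) = ee (lam / 4) t by rewrite /ee; congr expR; ring.
rewrite ler_wpM2r ?ee_ge0//; apply: ler_wpM2l; first by nonneg.
rewrite lef_pV2 ?posrE// -[leLHS]mulr1; apply: ler_wpM2l => //; exact: ltW.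
Unshelve. all: by end_near. Qed.

(** One factor has a nonzero first index and decays; the other is bounded. *)
Lemma TT_bound a d b c : (a < N)%N -> (d < N)%N -> (b < N)%N -> (c < N)%N ->
  (0 < a)%N || (0 < b)%N -> exists2 C, 0 <= C & forall t : R, 1 <= t ->
  `|Tz a d t * Tz b c t| <= C * ee (lam / 4) t.
Proof.
move=> aN dN bN cN; wlog a0 : a d b c aN dN bN cN / (0 < a)%N => [hw /orP[h|h]|_].
- by apply: hw => //; rewrite h.
- have [||||||C C0 hC] := hw b c a d => //; first by rewrite h.
  by exists C => // t t1; rewrite mulrC hC.
have [C1 C10 h1] := @Tz_bound a d ltac:(by rewrite a0 aN).
have [C2 C20 h2] := Tz_bound_weak bN cN.
exists (C1 * C2); first by rewrite mulr_ge0.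
move=> t t1; rewrite normrM mulrAC.
by apply: ler_pM => //; [exact: h1|exact: h2].
Qed.

Lemma psi_bound a d b c : (d < N)%N -> (c < N)%N -> exists2 C, 0 <= C & forall t : R, 1 <= t ->
  `|psi a d b c t| <= C * ee (lam / 2) t.
Proof.
move=> dN cN; have [C1 C10 h1] := @Af_bound_ge1 a d dN; have [C2 C20 h2] := @Af_bound_ge1 b c cN.
exists (16 / N%:R ^+ 2 * (C1 * C2 + 2^-1 * `|sf d 0| * C2 + 2^-1 * `|sf c 0| * C1)); first by nonneg.
move=> t t1; rewrite /psi normrM ger0_norm; last by nonneg.
have t0 : 0 <= t by exact: le_trans t1.
have e1 : ee (lam / 2) t <= 1 by apply: ee_le1 => //; nonneg.
have e0 : 0 <= ee (lam / 2) t := ee_ge0 _ _.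
have := h1 t t1; have := h2 t t1.
move: (ee _ _) e0 e1 (Af _ _ _) (Af _ _ _) (sf _ _) (sf _ _) => E e0 e1 x y u v hx hy.
rewrite -[leRHS]mulrA; apply: ler_wpM2l; first by nonneg.
rewrite !mulrDl; apply: (le_trans (ler_normD _ _)).
apply: lerD; [apply: (le_trans (ler_normD _ _)); apply: lerD|].
- rewrite normrM mulrAC; apply: ler_pM => //.
  by apply: (le_trans hx); rewrite ler_piMr.
- by rewrite !normrM ger0_norm// -!mulrA; do 2 (apply: ler_wpM2l => //).
- by rewrite !normrM ger0_norm// -!mulrA; do 2 (apply: ler_wpM2l => //).
Qed.

Lemma RI_split1 (f : R -> R) : itg Rp f ->
  \int[mu]_(x in Rp) f x = \int[mu]_(x in `]0%R, 1%R]) f x + \int[mu]_(x in `[1%R, +oo[) f x.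
Proof.
move=> fi.
have := @Rintegral_itvB R f (BRight 0) +oo%O 1 fi.
rewrite !bnd_simp => /(_ ler01 isT) /eqP; rewrite subr_eq addrC => /eqP ->.
congr (_ + _); rewrite RI_cy//.
apply: (itgS _ _ _ fi) => // x /=; rewrite !in_itv/= !andbT; exact: lt_trans.
Qed.

Lemma RI_x01 : itg `]0%R, 1%R] (fun x : R => x) /\ \int[mu]_(x in `]0%R, 1%R]) (x : R) = 2^-1.
Proof.
have i1 : itg `[0%R, 1%R] (fun x : R => x) by apply: itg_cc => x _; exact: cvg_id.
have i2 : itg `]0%R, 1%R] (fun x : R => x).
  by apply: (itgS _ _ _ i1) => // x /=; rewrite !in_itv/= => /andP[/ltW-> ->].
split => //; rewrite Rintegral_itv_obnd_cbnd//.
have dF (x : R) : 0 <= x <= 1 -> dv (fun x => 2^-1 * (x * x)) x x.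
  by move=> _; apply: dv_eq (dvZ 2^-1 (dvM (dv_id x) (dv_id x))); field.
have cF (x : R) : 0 <= x <= 1 -> {for x, continuous (fun x : R => x)} by move=> _; exact: cvg_id.
by rewrite (@ftc _ (fun x => 2^-1 * (x * x)) (fun x => x) 0 1 ler01 dF cF); ring.
Qed.

Section Lf_inv_pairing.
Variables (al be ga de : nat).
Hypotheses (alN : (0 < al < N)%N) (gaN : (0 < ga < N)%N) (deN : (0 < de < N)%N) (beN : (be < N)%N).

Let f1 (x : R) := x^-1 * (Tz be de x * Tz al ga x).

Let alN' : (al < N)%N. Proof. by case/andP: alN. Qed.
Let gaN' : (ga < N)%N. Proof. by case/andP: gaN. Qed.
Let deN' : (de < N)%N. Proof. by case/andP: deN. Qed.
Let al0 : (0 < al)%N. Proof. by case/andP: alN. Qed.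

Let cf1 : cpos f1.
Proof.
apply: cposM; last by apply: cposM; exact: Tz_cpos.
by move=> x x0; apply: inv_continuous; rewrite lt0r_neq0.
Qed.

Let sub1 : `[1%R, +oo[%classic `<=` Rp.
Proof. by move=> x /=; rewrite !in_itv/= !andbT; exact: lt_le_trans. Qed.

Let sub01 : `]0%R, 1%R]%classic `<=` Rp.
Proof. by move=> x /=; rewrite !in_itv/= andbT => /andP[]. Qed.

Let if1 : itg `[1%R, +oo[ f1.
Proof.
have [C C0 hC] := @TT_bound be de al ga beN deN' alN' gaN' ltac:(by rewrite al0 orbT).
have l4 : 0 < lam / 4 by rewrite divr_gt0.
have iC : itg `[1%R, +oo[ (fun x => C * ee (lam / 4) x).
  by apply: itgZ => //; apply: (itgS _ _ _ (itg_ee l4)).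
apply: (itg_le _ _ _ iC) => //; first by apply: measurable_funS (cpos_meas cf1).
move=> x /=; rewrite in_itv/= andbT => x1; have x0 : 0 < x by exact: lt_le_trans x1.
rewrite /f1 normrM ger0_norm ?invr_ge0 ?(ltW x0)//.
by apply: (le_trans _ (hC x x1)); rewrite ler_piMl// invf_le1.
Qed.

(** The linear term of [Lf] is integrated by [RI_Yf_inv] and contributes a multiple of [Cl ga]. The
    rest goes through [rogers_zudilin]; completing its integrand to a product of two [Tz]
    contributes the opposite multiple, through [RI_x_Af]. *)
Lemma Lf_inv_pairing : itg Rp (fun t => Lf al be t^-1 * (lam * Yf ga de t)) /\
  \int[mu]_(t in Rp) (Lf al be t^-1 * (lam * Yf ga de t)) = - (pi / 2) * Lam0 be de al ga.
Proof.
have [iV iTA eV] := @rogers_zudilin R N N0 al be ga de alN gaN deN.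
have [iY eY] := @RI_Yf_inv R N N0 ga de gaN deN.
have [iA eA] := @RI_x_Af R N N0 al ga alN' gaN.
pose Bv : R := B2 (al%:R / N%:R).
have e1 t : - (pi * Bv) * lam * (t^-1 * Yf ga de t) - lam * (Vf al be t^-1 * Yf ga de t) =
    Lf al be t^-1 * (lam * Yf ga de t) by rewrite /Lf -/Bv; ring.
have iZ1 := itgZ (- (pi * Bv) * lam) mRp iY.
have iZ2 := itgZ lam mRp iV.
split; first by apply: (eq_itg _ mRp (itgB mRp iZ1 iZ2)) => t _; exact: e1.
rewrite -(eq_RI (fun t _ => e1 t)) RIB// !RIZ// eY eV.
(* With this constant, [R1 t] is N / (4 t) times the product of [Tz be de] and [Tz al ga] at 1 / t,
   minus the multiple of t coming from the two constant terms. On ]0, 1] that multiple integrates to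
   the term [g0 / 2] of [Lam0]; on the ray from 1, [R1] is the [psi] part. *)
pose c := 2 * sf de 0 / N%:R.
pose R1 t := Tf al ga t^-1 * Af be de t + c * (t * Af al ga t).
have icA := itgZ c mRp iA.
have iR1 : itg Rp R1 by exact: itgD.
have eR1 : \int[mu]_(t in Rp) R1 t = \int[mu]_(t in Rp) (Tf al ga t^-1 * Af be de t) +
   c * (pi ^+ 2 * Bv * (lam ^- 2 * Cl ga)) by rewrite RID// RIZ// eA.
have TzE t : Tz al ga t = Tf al ga t.
  by rewrite /Tz; case: eqP gaN => [->|].
have [j1 k1] := RI_inv01 cf1 if1.
have [ix ex] := RI_x01.
have Nn := lt0r_neq0 NN0.
have E01 x : `]0%R, 1%R]%classic x -> N%:R / 4 * (x ^- 2 * f1 x^-1) - sf de 0 * sf ga 0 / N%:R * x = R1 x.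
  move=> /sub01; rewrite Rp_gt0 => x0; rewrite /f1 /R1 -TzE !Tz_modular// /c invrK.
  move: (sf _ _) (sf _ _) (Af _ _ _) (Af _ _ _) => u v w z; move: (N%:R : R) Nn (lt0r_neq0 x0) => n nn xn.
  by field; rewrite nn xn.
have E1y x : `[1%R, +oo[%classic x -> R1 x = N%:R / 4 * (x * psi be de al ga x).
  move=> /sub1; rewrite Rp_gt0 => x0; rewrite /psi /R1 -TzE !Tz_modular// /c.
  move: (sf _ _) (sf _ _) (Af _ _ _) (Af _ _ _) => u v w z; move: (N%:R : R) Nn (lt0r_neq0 x0) => n nn xn.
  by field; rewrite nn.
have ip : itg `[1%R, +oo[ (fun x => x * psi be de al ga x).
  have h := itgZ (4 / N%:R) (measurable_itv _) (itgS mRp (measurable_itv _) sub1 iR1).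
  apply: eq_itg h => //.
  move=> x Dx; rewrite E1y//; move: (x * _) => y; move: (N%:R : R) Nn => n nn.
  by field; rewrite nn.
have E : \int[mu]_(t in Rp) R1 t = N%:R / 4 * Lam0 be de al ga.
  rewrite RI_split1// -(eq_RI E01) (eq_RI E1y) RIB//; [|exact: itgZ..].
  rewrite !RIZ// ex -k1 /Lam0 /g0.
  move: (\int[mu]_(x in _) _) (\int[mu]_(x in _) _) => u v.
  move: (sf _ _) (sf _ _) => w z; move: (N%:R : R) Nn => n nn.
  by field; rewrite nn.
have -> : \int[mu]_(t in Rp) (Tf al ga t^-1 * Af be de t) =
   N%:R / 4 * Lam0 be de al ga - c * (pi ^+ 2 * Bv * (lam ^- 2 * Cl ga)) by rewrite -E eR1 addrK.
rewrite /c; rewrite /Bv; have -> : lam = 2 * pi / N%:R by [].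
move: (Lam0 _ _ _ _) (Cl _) (sf _ _) (B2 _) => u v w z.
move: (N%:R : R) Nn (@pi R) (lt0r_neq0 (@pi_gt0 R)) => n nn p pn.
by field; rewrite nn pn.
Qed.
End Lf_inv_pairing.

Lemma RI0 D (f : R -> R) : (forall x, D x -> f x = 0) -> \int[mu]_(x in D) f x = 0.
Proof. by move=> f0; rewrite /Rintegral integral0_eq// => x Dx; rewrite f0. Qed.

Lemma psiC a d b c : psi a d b c = psi b c a d.
Proof.
apply/funext => x; rewrite /psi -!addrA; congr (_ * (_ + _)); first exact: mulrC.
exact: addrC.
Qed.

Lemma Lam0C a d b c : Lam0 a d b c = Lam0 b c a d.
Proof.
have e1 : \int[mu]_(x in `[1%R, +oo[) (x^-1 * (Tz a d x * Tz b c x)) =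
    \int[mu]_(x in `[1%R, +oo[) (x^-1 * (Tz b c x * Tz a d x)).
  by apply: eq_RI => x _; congr (_ * _); exact: mulrC.
have e2 : g0 d c = g0 c d by congr (_ * _); exact: mulrC.
by rewrite /Lam0 e1 e2 psiC.
Qed.

Lemma Lam0_0l a b c : Lam0 a 0 b c = 0.
Proof.
have e1 : \int[mu]_(x in `[1%R, +oo[) (x^-1 * (Tz a 0 x * Tz b c x)) = 0.
  by apply: RI0 => x _; rewrite /Tz eqxx mul0r mulr0.
have e2 : \int[mu]_(x in `[1%R, +oo[) (x * psi a 0 b c x) = 0.
  apply: RI0 => x _; have -> : psi a 0 b c x = 0; last exact: mulr0.
  have h := sf0E 0; have h' := Af0E a x; rewrite /psi h h'.
  by move: (Af _ _ _) (sf _ _) => u v; ring.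
have e3 : g0 0 c = 0 by have h := sf0E 0; rewrite /g0 h mul0r mulr0.
by rewrite /Lam0 e1 e2 e3 mul0r addr0 subr0.
Qed.

(** [Lf_inv_pairing] wants a nonzero first index of [Lf] and nonzero indices of [Yf]. If a = 0 then
    b is nonzero and [Lf_sym] exchanges them; if a is nonzero, t -> 1 / t and [Yf_sym] are used
    instead; if c or d is 0, both sides vanish. *)
Lemma pairing a b c d : (a < N)%N -> (b < N)%N -> (c < N)%N -> (d < N)%N -> (0 < a)%N || (0 < b)%N ->
  itg Rp (fun t => Lf a b t * (lam * Yf c d t)) /\
  \int[mu]_(t in Rp) (Lf a b t * (lam * Yf c d t)) = - (pi / 2) * Lam0 a d b c.
Proof.
move=> aN bN cN dN ab.
have trivial_case : (forall t, 0 < t -> Yf c d t = 0) -> Lam0 a d b c = 0 ->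
    itg Rp (fun t => Lf a b t * (lam * Yf c d t)) /\
    \int[mu]_(t in Rp) (Lf a b t * (lam * Yf c d t)) = - (pi / 2) * Lam0 a d b c.
  move=> Y0 ->; rewrite mulr0.
  have e t : Rp t -> (0 : R) = Lf a b t * (lam * Yf c d t).
    by rewrite Rp_gt0 => t0; rewrite Y0// !mulr0.
  split.
    apply: (eq_itg e mRp).
    by have := @integrable0 _ _ R mu Rp.
  by apply: RI0 => t Dt; rewrite -e.
have [d0|d0] := posnP d.
  by apply: trivial_case => [t _|]; rewrite d0 ?Yf0r ?Lam0_0l.
have [c0|c0] := posnP c.
  by apply: trivial_case => [t t0|]; rewrite c0 ?Yf0l ?d0// Lam0C Lam0_0l.
have cN' : (0 < c < N)%N by rewrite c0.
have dN' : (0 < d < N)%N by rewrite d0.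
have [a0|a0] := posnP a.
  move: ab; rewrite a0 /= => b0; have bN' : (0 < b < N)%N by rewrite b0.
  have [i e] := @Lf_inv_pairing b 0 c d bN' cN' dN' N0.
  have h t : Rp t -> Lf b 0 t^-1 * (lam * Yf c d t) = Lf 0 b t * (lam * Yf c d t).
    by rewrite Rp_gt0 => t0; rewrite Lf_sym.
  by split; [exact: eq_itg i|rewrite -e; apply: eq_RI => t Dt; rewrite h].
have aN' : (0 < a < N)%N by rewrite a0.
have [i e] := @Lf_inv_pairing a b d c aN' dN' cN' bN.
have cL : cpos (fun t => Lf a b t^-1 * (lam * Yf d c t)).
  apply: cposM.
    apply: (@cpos_comp_inv R (Lf a b)) => x x0; apply: cvgB.
      apply: cvgN; have := dv_lin (pi * B2 (a%:R / N%:R)) x; exact: is_derive_cts.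
    by have [_ h] := @Vf_prop R N N0 a b aN; exact: h.
  apply: cposM; first by move=> x _; exact: cvg_cst.
  by have [] := @Yf_prop R N N0 d c dN cN'.
have [i' e'] := RI_inv cL i.
have h t : Rp t -> t ^- 2 * (Lf a b t^-1^-1 * (lam * Yf d c t^-1)) = Lf a b t * (lam * Yf c d t).
  by rewrite Rp_gt0 => t0; rewrite invrK (@Yf_sym R N N0 c d t)//; ring.
split; first exact: eq_itg i'.
by rewrite Lam0C -e e'; apply: eq_RI => t Dt; rewrite h.
Qed.

End Interchange.

Local Open Scope complex_scope.

(** * Complex products and exponentials *)

Section ComplexToolkit.
Variable R : realType.
Notation C := (R[i]^o).
Notation Re := complex.Re.
Notation Im := complex.Im.
Implicit Types (z w : R[i]) (x y : R).

(** The norm of [R[i]] takes its values in [R[i]]; this real modulus gives access to real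
    estimates. *)
Definition modC z : R := Re `|z|.

Lemma modCE z : `|z| = (modC z)%:C.
Proof. by rewrite /modC normc_def. Qed.

Lemma modC_sqrt z : modC z = Num.sqrt (Re z ^+ 2 + Im z ^+ 2).
Proof. by rewrite /modC normc_def. Qed.

Lemma modC_ge0 z : 0 <= modC z.
Proof. by rewrite modC_sqrt sqrtr_ge0. Qed.

Lemma modCM z w : modC (z * w) = modC z * modC w.
Proof. by apply: (@complexI R); rewrite rmorphM /= -!modCE normrM. Qed.

Lemma modCD z w : modC (z + w) <= modC z + modC w.
Proof. by rewrite -lecR rmorphD /= -!modCE ler_normD. Qed.

Lemma modCN z : modC (- z) = modC z.
Proof. by rewrite /modC normrN. Qed.

Lemma modCB z w : modC (z - w) <= modC z + modC w.
Proof. by apply: (le_trans (modCD _ _)); rewrite modCN. Qed.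

Lemma modC0 : modC 0 = 0.
Proof. by rewrite /modC normr0. Qed.

Lemma modC1 : modC 1 = 1.
Proof. by rewrite /modC normr1. Qed.

Lemma modC_eq0 z : (modC z == 0) = (z == 0).
Proof. by rewrite -(inj_eq (@complexI R)) /= -modCE normr_eq0. Qed.

Lemma modC_gt0 z : (0 < modC z) = (z != 0).
Proof. by rewrite lt_neqAle modC_ge0 andbT eq_sym modC_eq0. Qed.

Lemma modCV z : modC z^-1 = (modC z)^-1.
Proof.
have [->|z0] := eqVneq z 0; first by rewrite invr0 modC0 invr0.
have n0 : modC z != 0 by rewrite modC_eq0.
by apply: (mulfI n0); rewrite -modCM !mulfV// modC1.
Qed.

Lemma modCX z n : modC (z ^+ n) = modC z ^+ n.
Proof. by elim: n => [|n IH]; rewrite ?expr0 ?modC1// !exprS modCM IH. Qed.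

Lemma modC_real x : modC x%:C = `|x|.
Proof. by rewrite modC_sqrt /= expr0n addr0 sqrtr_sqr. Qed.

Lemma Re_le z : `|Re z| <= modC z.
Proof. by rewrite modC_sqrt -sqrtr_sqr ler_sqrt ?lerDl ?sqr_ge0// addr_ge0 ?sqr_ge0. Qed.

Lemma Im_le z : `|Im z| <= modC z.
Proof. by rewrite modC_sqrt -sqrtr_sqr ler_sqrt ?lerDr ?sqr_ge0// addr_ge0 ?sqr_ge0. Qed.

Lemma modC_le z : modC z <= `|Re z| + `|Im z|.
Proof.
have h : 0 <= `|Re z| + `|Im z| by rewrite addr_ge0.
rewrite modC_sqrt -(ger0_norm h) -sqrtr_sqr ler_sqrt ?sqr_ge0//.
rewrite sqrrD !real_normK ?num_real// -addrA lerD2l lerDr mulrn_wge0// mulr_ge0//.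
Qed.

Lemma ReCD z w : Re (z + w) = Re z + Re w. Proof. by case: z w => [a b] [c d]. Qed.
Lemma ImCD z w : Im (z + w) = Im z + Im w. Proof. by case: z w => [a b] [c d]. Qed.
Lemma ReCB z w : Re (z - w) = Re z - Re w. Proof. by case: z w => [a b] [c d]. Qed.
Lemma ImCB z w : Im (z - w) = Im z - Im w. Proof. by case: z w => [a b] [c d]. Qed.
Lemma ReCM z w : Re (z * w) = Re z * Re w - Im z * Im w. Proof. by case: z w => [a b] [c d]. Qed.
Lemma ImCM z w : Im (z * w) = Re z * Im w + Im z * Re w. Proof. by case: z w => [a b] [c d]. Qed.
Lemma eqReIm z w : Re z = Re w -> Im z = Im w -> z = w.
Proof. by case: z w => [a b] [c d] /= -> ->. Qed.

Lemma Re_sum (I : Type) (r : seq I) (P : pred I) (F : I -> R[i]) :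
  Re (\sum_(i <- r | P i) F i) = \sum_(i <- r | P i) Re (F i).
Proof. by elim/big_rec2: _ => //= i y z _ <-; rewrite ReCD. Qed.

Lemma Im_sum (I : Type) (r : seq I) (P : pred I) (F : I -> R[i]) :
  Im (\sum_(i <- r | P i) F i) = \sum_(i <- r | P i) Im (F i).
Proof. by elim/big_rec2: _ => //= i y z _ <-; rewrite ImCD. Qed.

Lemma modC_sum (I : Type) (r : seq I) (P : pred I) (F : I -> R[i]) :
  modC (\sum_(i <- r | P i) F i) <= \sum_(i <- r | P i) modC (F i).
Proof.
elim/big_rec2: _ => [|i y z _ h]; first by rewrite modC0.
by apply: (le_trans (modCD _ _)); rewrite lerD2l.
Qed.

Lemma modC_prod (I : Type) (r : seq I) (P : pred I) (F : I -> R[i]) :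
  modC (\prod_(i <- r | P i) F i) = \prod_(i <- r | P i) modC (F i).
Proof. by elim/big_rec2: _ => [|i y z _ <-]; [exact: modC1|exact: modCM]. Qed.

(** In the order of [R[i]] a positive epsilon is one with imaginary part 0 and positive real part,
    so the complex and the real notions of smallness match. *)
Lemma cvg_modC T (F : set_system T) {FF : Filter F} (f : T -> C) (l : C) :
  f @ F --> l <-> modC (f x - l) @[x --> F] --> (0 : R).
Proof.
split => [/cvgrPdist_lt h|/cvgrPdist_lt h].
- apply/cvgrPdist_lt => e e0.
  have e1 : (0 : R[i]) < e%:C by rewrite ltcR.
  apply: filterS (h _ e1) => t ht; rewrite sub0r normrN (ger0_norm (modC_ge0 _)).
  by move: ht; rewrite -normrN opprB modCE ltcR.
- apply/cvgrPdist_lt => e; rewrite ltcE /= => /andP[/eqP ie re].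
  apply: filterS (h _ re) => t; rewrite sub0r normrN (ger0_norm (modC_ge0 _)).
  rewrite -ltcR => ht; rewrite modCE -modCN opprB; apply: (lt_le_trans ht).
  by rewrite lecE /= ie eqxx lexx.
Qed.

Lemma cvg_Re T (F : set_system T) {FF : Filter F} (f : T -> C) (l : C) :
  f @ F --> l -> Re (f x) @[x --> F] --> Re l.
Proof.
move=> /cvg_modC h; apply/cvgrPdist_le => e e0.
move/cvgrPdist_le: h => /(_ _ e0); apply: filterS => t.
rewrite sub0r normrN (ger0_norm (modC_ge0 _)); apply: le_trans.
by rewrite distrC -ReCB; exact: Re_le.
Qed.

Lemma cvg_Im T (F : set_system T) {FF : Filter F} (f : T -> C) (l : C) :
  f @ F --> l -> Im (f x) @[x --> F] --> Im l.
Proof.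
move=> /cvg_modC h; apply/cvgrPdist_le => e e0.
move/cvgrPdist_le: h => /(_ _ e0); apply: filterS => t.
rewrite sub0r normrN (ger0_norm (modC_ge0 _)); apply: le_trans.
by rewrite distrC -ImCB; exact: Im_le.
Qed.

Lemma cvg_ReIm T (F : set_system T) {FF : Filter F} (f : T -> C) (l : C) :
  Re (f x) @[x --> F] --> Re l -> Im (f x) @[x --> F] --> Im l -> f @ F --> l.
Proof.
move=> hr hi; apply/cvg_modC.
apply: (@squeeze_cvgr _ _ _ _ (fun=> 0) (fun t => `|Re (f t) - Re l| + `|Im (f t) - Im l|)).
- apply: filterE => t; rewrite modC_ge0 /= -ReCB -ImCB; exact: modC_le.
- exact: cvg_cst.
- rewrite -[X in _ --> X]addr0; apply: cvgD.
    by apply/norm_cvg0P; rewrite -(subrr (Re l)); apply: cvgB => //; exact: cvg_cst.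
  by apply/norm_cvg0P; rewrite -(subrr (Im l)); apply: cvgB => //; exact: cvg_cst.
Qed.

Lemma cvg_norm_modC T (F : set_system T) {FF : Filter F} (f : T -> C) (l : C) :
  f @ F --> l -> modC (f x) @[x --> F] --> modC l.
Proof.
move=> /cvg_modC h; apply/cvgrPdist_le => e e0.
move/cvgrPdist_le: h => /(_ _ e0); apply: filterS => t.
rewrite sub0r normrN (ger0_norm (modC_ge0 _)); apply: le_trans.
rewrite ler_norml -modCN opprB; have := modCD (l - f t) (f t); have := modCD (f t - l) l.
by rewrite !subrK -[modC (f t - l)]modCN opprB; lra.
Qed.

Lemma Re_series (u : nat -> C) n : Re (series u n) = series (fun k => Re (u k)) n.
Proof. exact: Re_sum. Qed.

Lemma Im_series (u : nat -> C) n : Im (series u n) = series (fun k => Im (u k)) n.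
Proof. exact: Im_sum. Qed.

Lemma cvg_seriesC (u : nat -> C) (l : C) :
  series (fun k => Re (u k)) @ \oo --> Re l -> series (fun k => Im (u k)) @ \oo --> Im l ->
  series u @ \oo --> l.
Proof.
move=> hr hi; apply: cvg_ReIm; first by under eq_fun do rewrite Re_series.
by under eq_fun do rewrite Im_series.
Qed.

Lemma cvg_seriesC_abs (u : nat -> C) (M : nat -> R) :
  (forall n, modC (u n) <= M n) -> cvgn (series M) -> exists l, series u @ \oo --> (l : C).
Proof.
move=> uM cM.
exists (limn (series (fun k => Re (u k))) +i* limn (series (fun k => Im (u k)))).
apply: cvg_seriesC => /=; apply: (series_abs_cvg _ cM) => n; apply: le_trans (uM n).
  exact: Re_le.
exact: Im_le.
Qed.

Lemma cvg_uniqueC T (F : set_system T) {FF : ProperFilter F} (f : T -> C) (l l' : C) :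
  f @ F --> l -> f @ F --> l' -> l = l'.
Proof.
move=> h h'; apply: eqReIm.
  exact: (cvg_unique (@norm_hausdorff _ R) (cvg_Re h) (cvg_Re h')).
exact: (cvg_unique (@norm_hausdorff _ R) (cvg_Im h) (cvg_Im h')).
Qed.

Lemma cvg_limC T (F : set_system T) {FF : ProperFilter F} (f : T -> C) (l : C) :
  f @ F --> l -> lim (f @ F) = l.
Proof. by move=> h; exact: cvg_lim h. Qed.

(** A quadratic remainder gives the complex derivative. All complex derivatives of products and
    integrals below are found this way, which avoids differentiating under a limit. *)
Lemma dvC (f : C -> C) (z D : C) (K d : R) : 0 < d ->
  (forall h : C, modC h < d -> modC (f (h + z) - f z - h * D) <= K * modC h ^+ 2) ->
  is_derive z (1 : C) f D.
Proof.
move=> d0 hK.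
have H : (fun h : C => h^-1 *: ((f \o shift z) (h *: (1 : C)) - f z)) @ 0^' --> D.
  apply/cvg_modC; apply: (@squeeze_cvgr _ _ _ _ (fun=> 0) (fun h => K * modC h)).
  - have nd : \forall h \near (0 : C)^', modC h < d.
      have : (id : C -> C) @ (0 : C)^' --> (0 : C) by exact: nbhs_dnbhs.
      move=> /cvg_modC/cvgrPdist_lt/(_ _ d0); apply: filterS => h.
      by rewrite sub0r normrN (ger0_norm (modC_ge0 _)) subr0.
    have nz : \forall h \near (0 : C)^', h != 0 by exact: nbhs_dnbhs_neq.
    near=> h; have h0 : h != 0 by near: h.
    have hd : modC h < d by near: h.
    rewrite modC_ge0 /=.
    have -> : h^-1 *: (f (h *: (1 : C) + z) - f z) - D = h^-1 * (f (h + z) - f z - h * D).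
      have e1 : h *: (1 : C) = h := mulr1 h.
      have e2 (x : C) : h^-1 *: x = h^-1 * x by [].
      by rewrite e1 e2 [RHS]mulrBr [h^-1 * (h * D)]mulKf.
    rewrite modCM modCV ler_pdivrMl ?modC_gt0//.
    by apply: (le_trans (hK h hd)); rewrite expr2 mulrCA.
  - exact: cvg_cst.
  - rewrite -(mulr0 K); apply: cvgM; first exact: cvg_cst.
    have : (id : C -> C) @ (0 : C)^' --> (0 : C) by exact: nbhs_dnbhs.
    by move=> /cvg_modC; under eq_fun do rewrite subr0.
apply: DeriveDef; first exact: cvgP H.
exact: cvg_limC H.
Unshelve. all: by end_near. Qed.

Section Products.
Variable (u : nat -> R[i]).
Let S n := \sum_(0 <= k < n) modC (u k).
Let P n : R[i] := \prod_(0 <= k < n) (1 + u k).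

Let S0 n : 0 <= S n.
Proof. by apply: sumr_ge0 => k _; exact: modC_ge0. Qed.

Let SS n : S n.+1 = S n + modC (u n).
Proof. by rewrite /S big_nat_recr. Qed.

Let PS n : P n.+1 = P n * (1 + u n).
Proof. by rewrite /P big_nat_recr. Qed.

Let eS n : 1 + modC (u n) <= expR (modC (u n)).
Proof. exact: expR_ge1Dx. Qed.

Lemma modC_prod1_expR n : modC (P n) <= expR (S n).
Proof.
elim: n => [|n IH]; first by rewrite /P /S !big_geq// modC1 expR0.
rewrite PS SS modCM expRD; apply: ler_pM => //; try exact: modC_ge0.
by apply: le_trans (eS n); apply: (le_trans (modCD _ _)); rewrite modC1.
Qed.

Lemma modC_prod1_sub1 n : modC (P n - 1) <= S n * expR (S n).
Proof.
elim: n => [|n IH]; first by rewrite /P /S !big_geq// subrr modC0 mul0r.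
have -> : P n.+1 - 1 = (P n - 1) + P n * u n by rewrite PS; ring.
have u0 := modC_ge0 (u n).
apply: (le_trans (modCD _ _)); rewrite modCM SS [leRHS]mulrDl.
have le1 : expR (S n) <= expR (S n + modC (u n)) by rewrite ler_expR lerDl.
apply: lerD.
  by apply: (le_trans IH); rewrite ler_wpM2l.
rewrite mulrC ler_wpM2l//; apply: (le_trans (modC_prod1_expR n)) => //.
Qed.

(** Second order expansion of a product, uniform in its length; it lets an infinite product be
    differentiated through [dvC]. *)
Lemma modC_prod1_sub_sum n : modC (P n - 1 - \sum_(0 <= k < n) u k) <= S n ^+ 2 * expR (S n).
Proof.
elim: n => [|n IH]; first by rewrite /P /S !big_geq// subrr subr0 modC0 expr0n mul0r.
have -> : P n.+1 - 1 - \sum_(0 <= k < n.+1) u k =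
  (P n - 1 - \sum_(0 <= k < n) u k) + u n * (P n - 1) by rewrite PS big_nat_recr//=; ring.
have u0 := modC_ge0 (u n).
have le1 : expR (S n) <= expR (S n + modC (u n)) by rewrite ler_expR lerDl.
apply: (le_trans (modCD _ _)); rewrite modCM SS.
apply: (@le_trans _ _ ((S n ^+ 2 + modC (u n) * S n) * expR (S n + modC (u n)))).
  rewrite [leRHS]mulrDl; apply: lerD.
    by apply: (le_trans IH); rewrite ler_wpM2l ?sqr_ge0.
  rewrite -[leRHS]mulrA ler_wpM2l//; apply: (le_trans (modC_prod1_sub1 n)).
  by rewrite ler_wpM2l.
rewrite ler_wpM2r ?expR_ge0//.
by have := S0 n; nra.
Qed.

(** Consecutive partial products differ by [P n * u n], with [P n] bounded, so they are partial sums
    of an absolutely convergent series. *)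
Lemma prod_cvgC (M : nat -> R) : (forall n, modC (u n) <= M n) -> cvgn (series M) ->
  exists l : C, (P : nat -> C) @ \oo --> l.
Proof.
move=> uM cM.
have SM n : S n <= limn (series M).
  apply: (@le_trans _ _ (series M n)); first by apply: ler_sum => k _.
  apply: nondecreasing_cvgn_le => //; apply: nondecreasing_series => k _ _.
  exact: le_trans (modC_ge0 _) (uM k).
have [||l hl] := @cvg_seriesC_abs (fun n => P n * u n) (fun n => expR (limn (series M)) * M n).
- move=> n; rewrite modCM; apply: ler_pM; [exact: modC_ge0|exact: modC_ge0| |exact: uM].
  by apply: (le_trans (modC_prod1_expR n)); rewrite ler_expR.
- apply/cvg_ex; exists (expR (limn (series M)) * limn (series M)).
  rewrite (_ : series _ = (fun n => expR (limn (series M)) * series M n)).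
    by apply: cvgM => //; exact: cvg_cst.
  by apply/funext => n; rewrite /series /= big_distrr.
- exists (1 + l).
  rewrite (_ : P = (fun n => 1 + series (fun n => P n * u n : C) n)).
    have c1 : (fun=> 1 : C) @ \oo --> (1 : C) by exact: cvg_cst.
    exact: cvgD c1 hl.
  apply/funext; elim => [|n IH]; first by rewrite /P /series /= !big_geq// addr0.
  by rewrite PS mulrDr mulr1 {1}IH /series /= big_nat_recr//= addrA.
Qed.
End Products.

Lemma cexpD (z w : C) : cexp (z + w) = cexp z * cexp w.
Proof.
case: z w => [a b] [c d]; rewrite /cexp /=; apply: eqReIm => /=.
  by rewrite expRD cosD; ring.
by rewrite expRD sinD; ring.
Qed.

Lemma cexp0 : cexp (0 : C) = 1.
Proof. by rewrite /cexp /= expR0 cos0 sin0 mulr0 mulr1. Qed.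

Lemma modC_cexp (z : C) : modC (cexp z) = expR (Re z).
Proof.
by rewrite modC_sqrt /= !exprMn -mulrDr cos2Dsin2 mulr1 sqrtr_sqr ger0_norm// expR_ge0.
Qed.

Lemma cexp_neq0 (z : C) : cexp z != 0.
Proof. by rewrite -modC_gt0 modC_cexp expR_gt0. Qed.

Lemma cexpN (z : C) : cexp (- z) = (cexp z)^-1.
Proof. by apply: (mulfI (cexp_neq0 z)); rewrite -cexpD subrr cexp0 mulfV// cexp_neq0. Qed.

Lemma cexpX (z : C) n : cexp z ^+ n = cexp (n%:R * z).
Proof.
elim: n => [|n IH]; first by rewrite mul0r cexp0.
by rewrite exprS IH -cexpD -natr1 mulrDl mul1r addrC.
Qed.

Lemma cexp_real (x : R) : cexp (x%:C : C) = (expR x)%:C.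
Proof. by rewrite /cexp /= cos0 sin0 mulr1 mulr0. Qed.

Lemma expR_m1_bounds (x : R) : x <= expR x - 1 <= x * expR x.
Proof.
have h1 := expR_ge1Dx x; have h2 := expR_ge1Dx (- x); have e0 := expR_gt0 x.
have : (1 - x) * expR x <= expR (- x) * expR x by rewrite ler_wpM2r// ltW.
rewrite -expRD addNr expR0 mulrBl mul1r => h3; apply/andP; split; lra.
Qed.

Lemma expR_le_norm (x : R) : expR x <= expR `|x|.
Proof. by rewrite ler_expR ler_norm. Qed.

Lemma expR_m1_le (x : R) : `|expR x - 1| <= `|x| * expR `|x|.
Proof.
have /andP[h1 h2] := expR_m1_bounds x; have e := expR_le_norm x; have e0 := expR_gt0 x.
have e1 : 1 <= expR `|x| by rewrite -expR0 ler_expR.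
rewrite ler_norml; apply/andP; split; have := ler_norm x; have := ler_norm (- x); rewrite normrN => n1 n2; nra.
Qed.

Lemma expR_m1x_le (x : R) : `|expR x - 1 - x| <= x ^+ 2 * expR `|x|.
Proof.
have /andP[h1 h2] := expR_m1_bounds x.
rewrite ger0_norm; last by lra.
have := expR_m1_le x; have n0 := normr_ge0 x.
have : x * (expR x - 1) <= `|x| * `|expR x - 1| by rewrite -normrM ler_norm.
rewrite -[x ^+ 2]real_normK ?num_real//; set e := expR `|x|; have e0 : 0 < e by exact: expR_gt0.
move=> k1 k2; have k3 : `|x| * `|expR x - 1| <= `|x| * (`|x| * e) by rewrite ler_wpM2l.
nra.
Qed.

Lemma sin_le_norm (y : R) : `|sin y| <= `|y|.
Proof.
wlog y0 : y / 0 <= y => [h|].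
  have [/h//|/ltW y0] := leP 0 y.
  by have := h (- y); rewrite sinN !normrN; apply; rewrite oppr_ge0.
rewrite (ger0_norm y0).
have : `|\int[@lebesgue_measure R]_(x in `[0%R, y]) cos x| <= y; last first.
  by rewrite (@ftc _ sin cos 0 y)// ?sin0 ?subr0// => x _; exact: continuous_cos.
have e2 : \int[@lebesgue_measure R]_(x in `[0%R, y]) 1 = y.
  rewrite (@ftc _ id (fun=> 1) 0 y)// ?subr0// => x _; exact: cvg_cst.
rewrite -[leRHS]e2; apply: RI_le; first by [].
- apply: cts_measT; exact: continuous_cos.
- by move=> x _; rewrite ler_norml cos_geN1 cos_le1.
- by apply: itg_cc => x _; exact: cvg_cst.
Qed.

Lemma cos_m1E (y : R) : cos y - 1 = - 2 * sin (y / 2) ^+ 2.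
Proof.
have {1}-> : y = (y / 2) + (y / 2) by field.
have := cos2Dsin2 (y / 2); rewrite cosD => h; nra.
Qed.

Lemma cos_m1_le (y : R) : `|cos y - 1| <= y ^+ 2.
Proof.
have h := sin_le_norm (y / 2).
rewrite cos_m1E mulNr normrN ger0_norm; last by rewrite mulr_ge0 ?sqr_ge0.
have -> : y ^+ 2 = 4 * `|y / 2| ^+ 2 by rewrite real_normK ?num_real//; field.
rewrite -[sin _ ^+ 2]real_normK ?num_real//.
have : `|sin (y / 2)| * `|sin (y / 2)| <= `|y / 2| * `|y / 2| by apply: ler_pM.
by rewrite !expr2; have := mulr_ge0 (normr_ge0 (y / 2)) (normr_ge0 (y / 2)); lra.
Qed.

Lemma cos_m1_le1 (y : R) : `|cos y - 1| <= `|y|.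
Proof.
have h := sin_le_norm (y / 2).
rewrite cos_m1E mulNr normrN ger0_norm; last by rewrite mulr_ge0 ?sqr_ge0.
have -> : `|y| = 2 * `|y / 2| by rewrite normrM [`|2^-1|]ger0_norm//; field.
rewrite -[sin _ ^+ 2]real_normK ?num_real//.
have h1 : `|sin (y / 2)| <= 1 by rewrite ler_norml sin_geN1 sin_le1.
by rewrite ler_pM2l// expr2 -[leRHS]mul1r; apply: ler_pM.
Qed.

Lemma sin_m_le (y : R) : `|sin y - y| <= y ^+ 2.
Proof.
wlog y0 : y / 0 <= y => [h|].
  have [/h//|/ltW y0] := leP 0 y.
  have := h (- y); rewrite sinN -opprD normrN sqrrN; apply; rewrite oppr_ge0//.
have ci : continuous (fun x : R => cos x - 1).
  by move=> x; apply: cvgB; [exact: continuous_cos|exact: cvg_cst].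
have d1 (x : R) : 0 <= x <= y -> dv (fun x => sin x - x) x (cos x - 1).
  by move=> _; apply: dvB.
have e1 := @ftc _ (fun x => sin x - x) (fun x => cos x - 1) 0 y y0 d1 (fun x _ => ci x).
have d2 (x : R) : 0 <= x <= y -> dv (fun x => y * x) x y by move=> _; exact: dv_lin.
have e2 := @ftc _ (fun x => y * x) (fun=> y) 0 y y0 d2 (fun x _ => @cvg_cst _ _ _ _ _).
have -> : sin y - y = \int[@lebesgue_measure R]_(x in `[0%R, y]) (cos x - 1).
  by rewrite e1 sin0 !subr0.
have -> : y ^+ 2 = \int[@lebesgue_measure R]_(x in `[0%R, y]) y by rewrite e2 mulr0 subr0.
apply: RI_le; [by []|exact: cts_measT| |].
- move=> x /=; rewrite in_itv/= => /andP[x0 xy]; apply: (le_trans (cos_m1_le1 x)).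
  by rewrite ger0_norm.
- by apply: itg_cc => x _; exact: cvg_cst.
Qed.

Lemma modC_cexp_m1 (z : C) : modC (cexp z - 1) <= 3 * modC z * expR (modC z).
Proof.
case: z => x y; apply: (le_trans (modC_le _)) => /=; rewrite subr0.
have hx : `|x| <= modC (x +i* y) := Re_le (x +i* y).
have hy : `|y| <= modC (x +i* y) := Im_le (x +i* y).
have hE : expR `|x| <= expR (modC (x +i* y)) by rewrite ler_expR.
have h1 := expR_m1_le x; have h2 := cos_m1_le1 y; have h3 := sin_le_norm y.
have h4 := expR_le_norm x; have h5 := expR_gt0 x.
have h6 : `|cos y| <= 1 by rewrite ler_norml cos_geN1 cos_le1.
have E1 : 1 <= expR `|x| by rewrite -expR0 ler_expR.
have x0 := normr_ge0 x; have y0 := normr_ge0 y.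
apply: (@le_trans _ _ ((`|x| + 2 * `|y|) * expR `|x|)); last first.
  by apply: ler_pM; [lra|lra|lra|exact: hE].
have -> : expR x * cos y - 1 = (expR x - 1) * cos y + (cos y - 1) by ring.
have k1 : `|(expR x - 1) * cos y + (cos y - 1)| <= `|x| * expR `|x| + `|y|.
  apply: (le_trans (ler_normD _ _)); apply: lerD => //.
  by rewrite normrM; apply: le_trans h1; rewrite ler_piMr.
have k2 : `|expR x * sin y| <= expR `|x| * `|y|.
  by rewrite normrM; apply: ler_pM => //; rewrite ger0_norm// ltW.
nra.
Qed.

Lemma modC_cexp_m1z (z : C) : modC (cexp z - 1 - z) <= 4 * modC z ^+ 2 * expR (modC z).
Proof.
case: z => x y; apply: (le_trans (modC_le _)) => /=; rewrite subr0.
have hx : `|x| <= modC (x +i* y) := Re_le (x +i* y).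
have hy : `|y| <= modC (x +i* y) := Im_le (x +i* y).
have hE : expR `|x| <= expR (modC (x +i* y)) by rewrite ler_expR.
have h1 := expR_m1_le x; have h1' := expR_m1x_le x; have h2 := cos_m1_le y; have h3 := sin_m_le y.
have h4 := expR_le_norm x; have h5 := expR_gt0 x; have h6 := expR_gt0 `|x|.
have x0 := normr_ge0 x; have y0 := normr_ge0 y.
have xx : x ^+ 2 = `|x| ^+ 2 by rewrite real_normK ?num_real.
have yy : y ^+ 2 = `|y| ^+ 2 by rewrite real_normK ?num_real.
rewrite xx in h1'; rewrite yy in h2 h3.
apply: (@le_trans _ _ ((`|x| ^+ 2 + 2 * `|y| ^+ 2 + `|x| * `|y|) * expR `|x|)); last first.
  by apply: ler_pM; [nra|lra|nra|exact: hE].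
have -> : expR x * cos y - 1 - x = expR x * (cos y - 1) + (expR x - 1 - x) by ring.
have -> : expR x * sin y - y = expR x * (sin y - y) + (expR x - 1) * y by ring.
have k1 : `|expR x * (cos y - 1) + (expR x - 1 - x)| <= expR `|x| * `|y| ^+ 2 + `|x| ^+ 2 * expR `|x|.
  apply: (le_trans (ler_normD _ _)); apply: lerD => //.
  by rewrite normrM; apply: ler_pM => //; rewrite ger0_norm// ltW.
have k2 : `|expR x * (sin y - y) + (expR x - 1) * y| <= expR `|x| * `|y| ^+ 2 + `|x| * expR `|x| * `|y|.
  apply: (le_trans (ler_normD _ _)); apply: lerD => //.
    by rewrite normrM; apply: ler_pM => //; rewrite ger0_norm// ltW.
  by rewrite normrM; apply: ler_pM.
nra.
Qed.

End ComplexToolkit.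

(** * Siegel units on the imaginary axis *)

Section SiegelUnits.
Variable R : realType.
Notation C := (R[i]^o).
Notation Re := complex.Re.
Notation Im := complex.Im.
Variable N : nat.
Hypothesis N0 : (0 < N)%N.
Notation lam := (lam R N).
Notation sf := (@sf R N).
Notation Kf := (@Kf R N).
Notation th := (@th R N).
Let l0 : 0 < lam. Proof. exact: lam_gt0. Qed.
Let NN0 : 0 < N%:R :> R. Proof. by rewrite ltr0n. Qed.
Let lE : lam = 2 * pi / N%:R. Proof. by []. Qed.

Lemma qpowD (a b : R) (z : C) : qpow (a + b) z = qpow a z * qpow b z.
Proof.
rewrite /qpow -cexpD; congr cexp.
by rewrite mulrDr rmorphD /= !mulrDl.
Qed.

Lemma qpow_add (a : R) (z w : C) : qpow a (z + w) = qpow a z * qpow a w.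
Proof. by rewrite /qpow -cexpD mulrDr. Qed.

Lemma qpow_it (a t : R) : qpow a (t%:C * ci R : C) = (expR (- (2 * pi * a * t)))%:C.
Proof.
rewrite /qpow -cexp_real; congr cexp.
have -> : (2 * pi * a)%:C * ci R * (t%:C * ci R) = (2 * pi * a)%:C * t%:C * (ci R * ci R) by ring.
by apply: eqReIm => /=; ring.
Qed.

Lemma qpow_dv (a : R) (z : C) : is_derive z (1 : C) (qpow a) (qpow a z * ((2 * pi * a)%:C * ci R)).
Proof.
pose k : R := modC ((2 * pi * a)%:C * ci R).
apply: (@dvC R _ z _ (modC (qpow a z) * (4 * k ^+ 2 * expR k)) 1 ltr01) => h h1.
have -> : qpow a (h + z) - qpow a z - h * (qpow a z * ((2 * pi * a)%:C * ci R)) =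
  qpow a z * (qpow a h - 1 - (2 * pi * a)%:C * ci R * h) by rewrite qpow_add; ring.
rewrite modCM -[leRHS]mulrA ler_wpM2l ?modC_ge0//.
apply: (le_trans (modC_cexp_m1z _)); rewrite modCM -/k.
have k0 : 0 <= k := modC_ge0 _; have h0 := modC_ge0 h.
have -> : 4 * k ^+ 2 * expR k * modC h ^+ 2 = 4 * (k * modC h) ^+ 2 * expR k by ring.
rewrite ler_wpM2l ?mulr_ge0 ?sqr_ge0// ler_expR ler_piMr// ltW//.
Qed.

Section HalfProduct.
Variables (p b : nat) (s t : R).
Hypotheses (t0 : 0 < t) (s1 : s ^+ 2 = 1) (H : (0 < p)%N || (0 < b < N)%N).
(** The two products of a Siegel unit share one shape: [p] is a or N - a, [s] is the sign 1 or -1 of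
    the exponent of zeta, and [c] is zeta^(s b). *)
Let c : R[i] := cos (th b) +i* (s * sin (th b)).
Let nu n : R := n%:R + p%:R / N%:R.
Let m n := (N * n + p)%N.
Let f n (tau : C) : C := 1 - c * qpow (nu n) tau.
Let P k (tau : C) : C := \prod_(0 <= n < k) f n tau.
Let tau0 : C := t%:C * ci R.
Let r n : R := ee lam ((m n)%:R * t).
Let A n : R[i] := c * (r n)%:C.
Let lt0 : 0 < lam * t. Proof. exact: mulr_gt0. Qed.

Let nuE n : 2 * pi * nu n = lam * (m n)%:R.
Proof. by rewrite lE /nu /m natrD natrM; move: (@pi R) => q; field; rewrite lt0r_neq0. Qed.

Let qnu n : qpow (nu n) tau0 = (r n)%:C.
Proof. by rewrite qpow_it nuE /r /ee mulrA. Qed.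

Let f0 n : f n tau0 = 1 - A n.
Proof. by rewrite /f qnu. Qed.

Let c1 : modC c = 1.
Proof. by rewrite modC_sqrt /= exprMn s1 mul1r cos2Dsin2 sqrtr1. Qed.

Let r_gt0 n : 0 < r n. Proof. exact: ee_gt0. Qed.

Let ncA n : modC (A n) = r n.
Proof. by rewrite modCM c1 mul1r modC_real ger0_norm// ltW. Qed.

Let mn n : (n <= m n)%N. Proof. rewrite /m; nia. Qed.

Let r_le n : r n <= ee (lam * t) n%:R.
Proof. by rewrite /r mulrC ee_scale ee_decr ?(ltW lt0)// ler_nat. Qed.

(** The exponential [r n] equals 1 only if [m n = 0], that is for p = 0 and n = 0, and then b
    nonzero keeps the factor from vanishing. *)
Let den_gt0 n : 0 < den (th b) (r n).
Proof.
have [m0|m0] := posnP (m n).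
  have bN : (0 < b < N)%N by move: H m0; rewrite /m; case: (posnP p) => //; lia.
  by apply: den_pos2; [exact: cos_th_lt1|exact: ltW].
by apply: den_pos1; apply: q01 => //; rewrite mulr_gt0// ltr0n.
Qed.

Let nc1A n : modC (1 - A n) ^+ 2 = den (th b) (r n).
Proof.
rewrite modC_sqrt sqr_sqrtr; last by rewrite addr_ge0 ?sqr_ge0.
have -> : Re (1 - A n) = 1 - cos (th b) * r n by rewrite /A /c /=; ring.
have -> : Im (1 - A n) = - (s * sin (th b) * r n) by rewrite /A /c /=; ring.
rewrite /den.
have -> : (1 - cos (th b) * r n) ^+ 2 + (- (s * sin (th b) * r n)) ^+ 2 =
  1 - 2 * r n * cos (th b) + r n ^+ 2 * (cos (th b) ^+ 2 + s ^+ 2 * sin (th b) ^+ 2) by ring.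
by rewrite s1 mul1r cos2Dsin2 mulr1.
Qed.

Let nc1A_gt0 n : 0 < modC (1 - A n).
Proof.
rewrite lt_neqAle modC_ge0 andbT eq_sym; apply/eqP => e.
by have := den_gt0 n; rewrite -nc1A e expr0n ltxx.
Qed.

Let ln_nc1A n : ln (modC (1 - A n)) = - Kf b ((m n)%:R * t).
Proof.
rewrite /Kf -/(r n) -nc1A lnXn ?nc1A_gt0// mulr2n; move: (ln _) => y; by field.
Qed.

(** The factor of index 0 is treated apart; the others have |A n| at most e^(-lam t) < 1. *)
Let lower : exists2 m0, 0 < m0 & forall n, m0 <= modC (1 - A n).
Proof.
have e1 : ee (lam * t) 1 < 1 by apply: ee_lt1.
exists (Num.min (modC (1 - A 0)) (1 - ee (lam * t) 1)).
  by rewrite lt_min nc1A_gt0 subr_gt0.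
case=> [|n]; first by rewrite ge_min lexx.
rewrite ge_min; apply/orP; right.
have h : r n.+1 <= ee (lam * t) 1.
  by apply: (le_trans (r_le _)); rewrite ee_decr ?(ltW lt0)// ler1n.
have := modCD (1 - A n.+1) (A n.+1); rewrite subrK modC1 ncA; lra.
Qed.

Let w n (h : C) : R[i] := (2 * pi * nu n)%:C * ci R * h.
(** The relative increment of the n-th factor when the point moves by h; [al n] is its linear
    coefficient, the logarithmic derivative of the factor. *)
Let u n (h : C) : R[i] := - A n * (cexp (w n h) - 1) / (1 - A n).
Let al n : R[i] := - A n * ((2 * pi * nu n)%:C * ci R) / (1 - A n).

Let n1A n : 1 - A n != 0. Proof. by rewrite -modC_gt0 nc1A_gt0. Qed.

Let fu n (h : C) : f n (h + tau0) = (1 - A n) * (1 + u n h).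
Proof.
rewrite /f qpow_add qnu -[qpow _ h]/(cexp (w n h)).
rewrite mulrDr mulr1 /u [(1 - A n) * _]mulrC divfK// /A; ring.
Qed.

Let ncw n (h : C) : modC (w n h) = lam * (m n)%:R * modC h.
Proof.
have ci1 : modC (ci R) = 1 by rewrite modC_sqrt /= expr0n expr1n add0r sqrtr1.
by rewrite !modCM ci1 mulr1 modC_real nuE ger0_norm// mulr_ge0// ltW.
Qed.

Let kap := lam * t / 4.
Let kap0 : 0 < kap. Proof. by rewrite divr_gt0. Qed.

Let mee n : (m n)%:R * ee (lam * t / 2) (m n)%:R <= 8 / (lam * t) * ee kap n%:R.
Proof.
have l2 : 0 < lam * t / 2 by rewrite divr_gt0.
have := xee_le l2 (ler0n R (m n)).
have -> : 2 / (lam * t / 2) = 4 / (lam * t) by move: (lam * t) (lt0r_neq0 lt0) => l ln; field; rewrite ln.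
have -> : lam * t / 2 / 2 = kap by rewrite /kap; field.
move=> h; apply: (le_trans h).
have k0 : 0 <= (lam * t)^-1 by rewrite invr_ge0 ltW.
have e1 : ee kap (m n)%:R <= ee kap n%:R by apply: ee_decr; rewrite ?(ltW kap0)// ler_nat.
by apply: ler_pM; rewrite ?ee_ge0//; [exact: mulr_ge0|rewrite ler_wpM2r// ler_nat].
Qed.

Let mmee n : (m n)%:R ^+ 2 * ee (lam * t / 2) (m n)%:R <= (8 / (lam * t)) ^+ 2 * ee kap n%:R.
Proof.
have -> : ee (lam * t / 2) (m n)%:R = ee kap (m n)%:R * ee kap (m n)%:R.
  by rewrite -eeD /ee /kap; congr expR; field.
have := xee_le kap0 (ler0n R (m n)).
have -> : 2 / kap = 8 / (lam * t) by rewrite /kap; move: (lam * t) (lt0r_neq0 lt0) => l ln; field; rewrite ln.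
move=> h; have k0 : 0 <= 8 / (lam * t) by rewrite divr_ge0// ltW.
have x0 : 0 <= (m n)%:R * ee kap (m n)%:R by rewrite mulr_ge0 ?ee_ge0.
have -> : (m n)%:R ^+ 2 * (ee kap (m n)%:R * ee kap (m n)%:R) = ((m n)%:R * ee kap (m n)%:R) ^+ 2 by ring.
apply: (@le_trans _ _ ((8 / (lam * t) * ee (kap / 2) (m n)%:R) ^+ 2)).
  by rewrite lerXn2r// nnegrE// mulr_ge0 ?ee_ge0.
rewrite exprMn ler_wpM2l ?sqr_ge0// expr2 -eeD.
have -> : ee (kap / 2) ((m n)%:R + (m n)%:R) = ee kap (m n)%:R by rewrite /ee; congr expR; field.
by rewrite ee_decr ?(ltW kap0)// ler_nat.
Qed.

(** Within distance t / 2 the growth caused by h costs at most half of the exponential rate. *)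
Let rexp n (h : C) : modC h < t / 2 -> r n * expR (lam * (m n)%:R * modC h) <= ee (lam * t / 2) (m n)%:R.
Proof.
move=> ht; rewrite /r /ee -expRD ler_expR.
have : lam * (m n)%:R * modC h <= lam * (m n)%:R * (t / 2).
  by rewrite ler_wpM2l ?(ltW ht)// mulr_ge0// ltW.
lra.
Qed.

Let products_bound : exists2 K, 0 <= K & forall n,
  modC (al n) <= K * ee kap n%:R /\
  forall h : C, modC h < t / 2 -> modC (u n h) <= K * modC h * ee kap n%:R /\
    modC (u n h - al n * h) <= K * modC h ^+ 2 * ee kap n%:R.
Proof.
have [m0 mp hm] := lower.
have D0 : 0 < 8 / (lam * t) by rewrite divr_gt0.
set D := 8 / (lam * t) in D0.
exists (4 * lam * D / m0 + 4 * lam ^+ 2 * D ^+ 2 / m0).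
  by nonneg.
have g1 : 0 <= 4 * lam * D / m0 by nonneg.
have g2 : 0 <= 4 * lam ^+ 2 * D ^+ 2 / m0 by nonneg.
move=> n; have E0 : 0 <= ee kap n%:R := ee_ge0 _ _.
have frac (x y : R) : 0 <= y -> x <= y -> x / modC (1 - A n) <= y / m0.
  move=> y0 xy; apply: (@le_trans _ _ (y / modC (1 - A n))).
    by rewrite ler_wpM2r// invr_ge0 modC_ge0.
  by rewrite ler_wpM2l// lef_pV2 ?posrE// nc1A_gt0.
have mm := mee n; have mmm := mmee n; rewrite -/D in mm mmm.
have r0 := ltW (r_gt0 n).
have M0 : 0 <= (m n)%:R :> R by [].
split.
  rewrite /al modCM modCV modCM modCN ncA.
  have -> : modC ((2 * pi * nu n)%:C * ci R) = lam * (m n)%:R.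
    by have := ncw n 1; rewrite /w mulr1 modC1 mulr1.
  apply: (le_trans (frac _ (4 * lam * D * ee kap n%:R) _ _)).
  - by nonneg.
  - have := rexp n (h := 0); rewrite modC0 mulr0 expR0 mulr1 => /(_ ltac:(by rewrite divr_gt0)) hr.
    have : (m n)%:R * r n <= D * ee kap n%:R by apply: le_trans mm; rewrite ler_wpM2l.
    move=> h1; have : lam * ((m n)%:R * r n) <= lam * (D * ee kap n%:R) by rewrite ler_wpM2l// ltW.
    have : 0 <= lam * (D * ee kap n%:R) by nonneg.
    have -> : r n * (lam * (m n)%:R) = lam * ((m n)%:R * r n) by ring.
    have -> : 4 * lam * D * ee kap n%:R = 4 * (lam * (D * ee kap n%:R)) by ring.
    by move: (lam * (D * _)) (lam * (_ * r n)) => z y; lra.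
  - have -> : 4 * lam * D * ee kap n%:R / m0 = 4 * lam * D / m0 * ee kap n%:R by ring.
    by rewrite ler_wpM2r// lerDl.
move=> h ht; have hh := modC_ge0 h; have hr := rexp n ht.
have e2 : u n h - al n * h = - A n * (cexp (w n h) - 1 - w n h) / (1 - A n).
  by rewrite /u /al /w; move: (1 - A n) (n1A n) => z zn; field.
split.
  rewrite /u modCM modCV modCM modCN ncA.
  apply: (le_trans (frac _ (4 * lam * D * modC h * ee kap n%:R) _ _)).
  - by nonneg.
  - apply: (@le_trans _ _ (r n * (3 * (lam * (m n)%:R * modC h) * expR (lam * (m n)%:R * modC h)))).
      by rewrite ler_wpM2l// -ncw modC_cexp_m1.
    have -> : r n * (3 * (lam * (m n)%:R * modC h) * expR (lam * (m n)%:R * modC h)) =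
      3 * (lam * modC h) * ((m n)%:R * (r n * expR (lam * (m n)%:R * modC h))) by ring.
    have -> : 4 * lam * D * modC h * ee kap n%:R = 4 * (lam * modC h) * (D * ee kap n%:R) by ring.
    have lh : 0 <= lam * modC h by rewrite mulr_ge0// ltW.
    apply: ler_pM; [by rewrite mulr_ge0|by rewrite !mulr_ge0 ?expR_ge0| |].
      by rewrite ler_wpM2r// ler_nat.
    by apply: le_trans mm; rewrite ler_wpM2l.
  - have -> : 4 * lam * D * modC h * ee kap n%:R / m0 = 4 * lam * D / m0 * (modC h * ee kap n%:R) by ring.
    by rewrite -[leRHS]mulrA ler_wpM2r ?lerDl// mulr_ge0.
rewrite e2 modCM modCV modCM modCN ncA.
apply: (le_trans (frac _ (4 * lam ^+ 2 * D ^+ 2 * modC h ^+ 2 * ee kap n%:R) _ _)).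
- by nonneg.
- apply: (@le_trans _ _ (r n * (4 * (lam * (m n)%:R * modC h) ^+ 2 * expR (lam * (m n)%:R * modC h)))).
    by rewrite ler_wpM2l// -ncw modC_cexp_m1z.
  have -> : r n * (4 * (lam * (m n)%:R * modC h) ^+ 2 * expR (lam * (m n)%:R * modC h)) =
    4 * (lam * modC h) ^+ 2 * ((m n)%:R ^+ 2 * (r n * expR (lam * (m n)%:R * modC h))) by ring.
  have -> : 4 * lam ^+ 2 * D ^+ 2 * modC h ^+ 2 * ee kap n%:R =
    4 * (lam * modC h) ^+ 2 * (D ^+ 2 * ee kap n%:R) by ring.
  apply: ler_wpM2l; first by nonneg.
  apply: le_trans mmm; apply: ler_wpM2l; [exact: sqr_ge0|exact: hr].
- have -> : 4 * lam ^+ 2 * D ^+ 2 * modC h ^+ 2 * ee kap n%:R / m0 =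
    4 * lam ^+ 2 * D ^+ 2 / m0 * (modC h ^+ 2 * ee kap n%:R) by ring.
  by rewrite -[leRHS]mulrA ler_wpM2r ?lerDr// mulr_ge0 ?sqr_ge0.
Qed.

Let g tau : C := limn (fun k => P k tau).

Let P0 : (fun k => P k tau0) @ \oo --> g tau0.
Proof.
have [||l hl] := @prod_cvgC R (fun n => - A n) (fun n => ee (lam * t) n%:R).
- by move=> n; rewrite modCN ncA; exact: r_le.
- have := @cvg_ee_series R 1 _ lt0.
  suff -> : (fun j : nat => 1 * ee (lam * t) j%:R) = (fun j => ee (lam * t) j%:R) by [].
  by apply/funext => j; rewrite mul1r.
- have hl' : (fun k => P k tau0) @ \oo --> l.
    suff -> : (fun k => P k tau0) = (fun n : nat => \prod_(0 <= k < n) (1 - A k)) by exact: hl.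
    by apply/funext => k; apply: eq_bigr => n _; rewrite f0.
  by rewrite /g (cvg_limC hl').
Qed.

Let Kf_sum : exists S : R, series (fun n => - Kf b ((m n)%:R * t)) @ \oo --> S.
Proof.
pose M (n : nat) : R := 2 / (lam * t) * ee (lam * t / 2) n%:R + (if n is 0 then `|Kf b ((m 0)%:R * t)| else 0).
apply/cvg_ex; apply: (@series_abs_cvg _ _ M).
  case=> [|n]; rewrite normrN /M; first by rewrite lerDr mulr_ge0 ?ee_ge0// divr_ge0// ltW.
  have m0 : 0 < (m n.+1)%:R :> R by rewrite ltr0n /m; lia.
  have mt : 0 < (m n.+1)%:R * t by exact: mulr_gt0.
  apply: (le_trans (Kf_bound_inv N0 b mt)); rewrite addr0.
  apply: ler_pM; [by rewrite divr_ge0// mulr_ge0 ?(ltW mt)// ltW|exact: ee_ge0| |].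
    rewrite ler_wpM2l// lef_pV2 ?posrE//; last exact: mulr_gt0.
    rewrite ler_pM2l//.
    by rewrite ler_peMl ?(ltW t0)// ler1n /m; lia.
  have -> : ee (lam / 2) ((m n.+1)%:R * t) = ee (lam * t / 2) (m n.+1)%:R by rewrite /ee; congr expR; ring.
  by rewrite ee_decr ?ler_nat// divr_ge0// ltW.
apply: is_cvg_seriesD.
  by apply: cvg_ee_series; rewrite divr_gt0.
apply/cvg_ex; exists `|Kf b ((m 0)%:R * t)|.
apply: cvg_near_cst; near=> n.
have n0 : (0 < n)%N by near: n; exists 1%N.
rewrite /series /= -(prednK n0) big_nat_recl//= big1 ?addr0//.
Unshelve. all: by end_near. Qed.

(** The product is differentiated as a whole: near the base point it is its value there times the
    product of the 1 + u_n, compared first with 1 plus the sum of the u_n, then with 1 plus h times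
    the sum of the al_n. The logarithm of the modulus is additive on the factors. *)
Lemma half_product : exists L : C,
  [/\ g tau0 != 0, series (fun n => - Kf b ((m n)%:R * t)) @ \oo --> ln (modC (g tau0)),
   is_derive tau0 (1 : C) g (g tau0 * L) &
   series (fun n => s * lam * ((m n)%:R * sf b ((m n)%:R * t))) @ \oo --> Re L].
Proof.
have [S hS] := Kf_sum.
have lnP k : modC (P k tau0) = expR (series (fun n => - Kf b ((m n)%:R * t)) k).
  rewrite /P modC_prod /series /= expR_sum; apply: eq_bigr => n _.
  by rewrite f0 -ln_nc1A lnK// posrE nc1A_gt0.
have gS : modC (g tau0) = expR S.
  have h1 : (fun k => modC (P k tau0)) @ \oo --> modC (g tau0) by apply: cvg_norm_modC; exact: P0.
  have h2 : (fun k => modC (P k tau0)) @ \oo --> expR S.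
    suff -> : (fun k => modC (P k tau0)) = (fun k => expR (series (fun n => - Kf b ((m n)%:R * t)) k)).
      by apply: continuous_cvg => //; exact: continuous_expR.
    by apply/funext => k; exact: lnP.
  exact: (cvg_unique (@norm_hausdorff _ R) h1 h2).
have [K K0 hK] := products_bound.
have cE : cvgn (series (fun n => K * ee kap n%:R)) by exact: cvg_ee_series.
have cE1 : cvgn (series (fun n => ee kap n%:R)).
  have := @cvg_ee_series R 1 _ kap0.
  suff -> : (fun j : nat => 1 * ee kap j%:R) = (fun j => ee kap j%:R) by [].
  by apply/funext => j; rewrite mul1r.
pose Z := limn (series (fun n => ee kap n%:R)).
have ZS k : \sum_(0 <= n < k) ee kap n%:R <= Z.
  apply: nondecreasing_cvgn_le => //; apply: nondecreasing_series => n _ _; exact: ee_ge0.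
have Z0 : 0 <= Z by have := ZS 0%N; rewrite big_geq.
have [L hL] := @cvg_seriesC_abs R (fun n => al n : C) _ (fun n => (hK n).1) cE.
exists L; split.
- by rewrite -modC_gt0 gS expR_gt0.
- by rewrite gS expRK.
(* The first summand bounds the product against its linear part, by [modC_prod1_sub_sum]; the second
   adds up the quadratic remainders of the single factors. *)
- pose B := (K * Z) ^+ 2 * expR (K * t * Z) + K * Z.
  apply: (@dvC R g tau0 _ (modC (g tau0) * B) (t / 2)); first by rewrite divr_gt0.
  move=> h ht; have hh := modC_ge0 h.
  have hu n := (hK n).2 h ht.
  have cKh : cvgn (series (fun n => K * modC h * ee kap n%:R)) by exact: cvg_ee_series.
  have [l hl] := @prod_cvgC R (fun n => u n h) _ (fun n => (hu n).1) cKh.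
  have gh : g (h + tau0) = g tau0 * l.
    apply: cvg_limC.
    suff -> : (fun k => P k (h + tau0)) = (fun k => P k tau0 * \prod_(0 <= n < k) (1 + u n h)).
      exact: cvgM P0 hl.
    by apply/funext => k; rewrite -big_split /=; apply: eq_bigr => n _; rewrite fu f0.
  have -> : g (h + tau0) - g tau0 - h * (g tau0 * L) = g tau0 * (l - 1 - L * h).
    by rewrite gh; ring.
  rewrite modCM -[leRHS]mulrA ler_wpM2l ?modC_ge0//.
  pose q k : C := \prod_(0 <= n < k) (1 + u n h) - 1 - series (fun n => al n : C) k * h.
  have hc : q @ \oo --> (l - 1 - L * h : C).
    have k1 : (fun _ : nat => 1 : C) @ \oo --> (1 : C) by exact: cvg_cst.
    have k2 : (fun _ : nat => h : C) @ \oo --> (h : C) by exact: cvg_cst.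
    exact: cvgB (cvgB hl k1) (cvgM hL k2).
  have hn : (fun k => modC (q k)) @ \oo --> modC (l - 1 - L * h) by apply: cvg_norm_modC; exact: hc.
  apply: (cvgr_to_le hn); near=> k.
  have -> : q k =
    (\prod_(0 <= n < k) (1 + u n h) - 1 - \sum_(0 <= n < k) u n h) + \sum_(0 <= n < k) (u n h - al n * h).
    rewrite /q sumrB /series /= big_distrl /=; ring.
  have Su : \sum_(0 <= n < k) modC (u n h) <= K * Z * modC h.
    apply: (@le_trans _ _ (\sum_(0 <= n < k) (K * modC h * ee kap n%:R))).
      by apply: ler_sum => n _; exact: (hu n).1.
    rewrite -big_distrr /= [leRHS]mulrAC ler_wpM2l// mulr_ge0//.
  have Su0 : 0 <= \sum_(0 <= n < k) modC (u n h) by apply: sumr_ge0 => n _; exact: modC_ge0.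
  apply: (le_trans (modCD _ _)); rewrite /B mulrDl; apply: lerD.
    apply: (le_trans (@modC_prod1_sub_sum R (fun n => u n h) k)).
    have -> : (K * Z) ^+ 2 * expR (K * t * Z) * modC h ^+ 2 = (K * Z * modC h) ^+ 2 * expR (K * t * Z) by ring.
    apply: ler_pM; [exact: sqr_ge0|exact: expR_ge0| |].
      by rewrite lerXn2r// nnegrE// mulr_ge0// mulr_ge0.
    rewrite ler_expR; apply: (le_trans Su); rewrite mulrAC ler_wpM2r// ler_wpM2l//.
    by move: ht hh t0; lra.
  apply: (le_trans (modC_sum _ _ _)).
  apply: (@le_trans _ _ (\sum_(0 <= n < k) (K * modC h ^+ 2 * ee kap n%:R))).
    by apply: ler_sum => n _; exact: (hu n).2.
  by rewrite -big_distrr /= [leRHS]mulrAC ler_wpM2l// mulr_ge0// sqr_ge0.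
- have hR : (fun k => Re (series (fun n => al n : C) k)) @ \oo --> Re L by apply: cvg_Re; exact: hL.
  move: hR.
  suff -> : (fun k => Re (series (fun n => al n : C) k)) = series (fun n => s * lam * ((m n)%:R * sf b ((m n)%:R * t))) by [].
  apply/funext => k; rewrite Re_series; congr (series _ k); apply/funext => n.
  have d0 := den_gt0 n.
  (* Multiplying by the conjugate of 1 - A makes the denominator real; up to a real factor the real
     part is then Im A = s r sin (th b). *)
  have -> : al n = (lam * (m n)%:R / den (th b) (r n))%:C * (ci R * (- A n * (1 - A n)^*)).
    have nA : (1 - A n) * (1 - A n)^* = (den (th b) (r n))%:C.
      rewrite -nc1A modC_sqrt sqr_sqrtr; last by rewrite addr_ge0 ?sqr_ge0.
      by move: (1 - A n) => [x y]; apply: eqReIm => /=; ring.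
    have nJ : (1 - A n)^* != 0 by rewrite conjc_eq0.
    apply: (mulIf (n1A n)); rewrite /al divfK//.
    have -> : (lam * (m n)%:R / den (th b) (r n))%:C = (lam * (m n)%:R)%:C * ((den (th b) (r n))%:C)^-1.
      by rewrite [LHS](rmorphM (real_complex R)) (fmorphV (real_complex R)).
    rewrite -nA nuE.
    by move: ((1 - A n)^*) (1 - A n) nJ (n1A n) => y x yn xn; field; rewrite xn yn.
  rewrite /sf -/(r n) /A /c /=.
  move: (den _ _) d0 (lt0r_neq0 d0) => d _ dn; move: (lam) (r n) => l q.
  by field; rewrite dn.
Unshelve. all: by end_near. Qed.
End HalfProduct.
End SiegelUnits.

(** * Modulus and argument of Siegel units on the axis *)

Section SiegelLog.
Variable R : realType.
Notation C := (R[i]^o).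
Notation Re := complex.Re.
Notation Im := complex.Im.
Variable N : nat.
Hypothesis N0 : (0 < N)%N.
Notation lam := (lam R N).
Notation sf := (@sf R N).
Notation Kf := (@Kf R N).
Notation th := (@th R N).
Notation Vf := (@Vf R N).
Notation Yf := (@Yf R N).
Notation Lf := (@Lf R N).
Let l0 : 0 < lam. Proof. exact: lam_gt0. Qed.
Let NN0 : 0 < N%:R :> R. Proof. by rewrite ltr0n. Qed.
Let lE : lam = 2 * pi / N%:R. Proof. by []. Qed.

Lemma lim_pred (u : nat -> C) : lim ((fun k => u k.-1) @ \oo) = lim (u @ \oo).
Proof.
congr lim; apply/predeqP => A; split => -[n _ hn].
  by exists n => // k nk; apply: (hn k.+1); exact: leqW.
by exists n.+1 => // -[|k] // nk; exact: hn.
Qed.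

Lemma Zmod_lt (a : Zmod N) : (a < N)%N.
Proof. by apply: (leq_trans (ltn_ord a)); rewrite prednK. Qed.

Lemma Zmod_gt0 (a : Zmod N) : (0 < a)%N = (a != 0).
Proof.
apply/idP/idP => [|]; first by apply: contraTneq => ->.
apply: contraNT; rewrite -eqn0Ngt => /eqP h.
by apply/eqP/val_inj.
Qed.

Lemma Zpair_gt0 (a b : Zmod N) : (a, b) != 0 -> (0 < a)%N || (0 < b)%N.
Proof.
by apply: contraR; rewrite !Zmod_gt0 negb_or !negbK => /andP[/eqP-> /eqP->].
Qed.

Lemma natC n : (n%:R : R[i]) = (n%:R : R)%:C.
Proof. by rewrite (rmorph_nat (real_complex R)). Qed.

Lemma zetaX b : zeta R N ^+ b = cos (th b) +i* (1 * sin (th b)).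
Proof.
rewrite /zeta cexpX natC.
have -> : (b%:R : R)%:C * ((2 * pi / N%:R)%:C * ci R) = 0 +i* th b.
  by apply: eqReIm; rewrite /= /th ?lE; ring.
by rewrite /cexp /= expR0 !mul1r.
Qed.

Lemma zetaV b : zeta R N ^- b = cos (th b) +i* (-1 * sin (th b)).
Proof.
rewrite /zeta cexpX -cexpN natC.
have -> : - ((b%:R : R)%:C * ((2 * pi / N%:R)%:C * ci R)) = 0 +i* (- th b).
  by apply: eqReIm; rewrite /= /th ?lE; ring.
by rewrite /cexp /= expR0 !mul1r cosN sinN mulN1r.
Qed.

Lemma bernE (a : Zmod N) : bern ((a : nat)%:R / N%:R : R) = B2 ((a : nat)%:R / N%:R).
Proof.
have f0 : Num.floor ((a : nat)%:R / N%:R : R) = 0.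
  apply: floor_def; rewrite add0r divr_ge0//= ltr_pdivrMr// mul1r ltr_nat.
  exact: Zmod_lt.
by rewrite /bern /frac_part f0 subr0.
Qed.

Definition half p b (s : R) (tau : C) : C := limn (fun k => \prod_(0 <= n < k)
  (1 - (cos (th b) +i* (s * sin (th b))) * qpow (n%:R + p%:R / N%:R) tau) : C).

(** The second product starts at n = 1, and n - a / N = (n - 1) + (N - a) / N gives it the shape of
    the first; [lim_pred] absorbs the shift of the bound. *)
Lemma siegel_halves (a b : Zmod N) (tau : C) : siegel R (a, b) tau =
  qpow (B2 ((a : nat)%:R / N%:R : R) / 2) tau * half a b 1 tau * half (N - a) b (-1) tau.
Proof.
rewrite /siegel /= bernE /half; congr (_ * _ * _).
  apply: (congr1 (fun u : nat -> C => lim (u @ \oo))); apply/funext => k; apply: eq_bigr => n _.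
  by rewrite zetaX qpowD; congr (1 - _); rewrite mulrC.
rewrite -[RHS]lim_pred; apply: (congr1 (fun u : nat -> C => lim (u @ \oo))); apply/funext => k.
have aN : (a <= N)%N by exact/ltnW/Zmod_lt.
rewrite big_add1; apply: eq_bigr => n _; rewrite zetaV.
have -> : n%:R + (N - a)%:R / N%:R = n.+1%:R + - ((a : nat)%:R / N%:R) :> R.
  by rewrite natrB// -natr1; field; rewrite lt0r_neq0.
by rewrite qpowD [in RHS]mulrC.
Qed.

Lemma dvMC (f g : C -> C) (z A B : C) : is_derive z (1 : C) f (f z * A) ->
  is_derive z (1 : C) g (g z * B) ->
  is_derive z (1 : C) (fun x => f x * g x) (f z * g z * (A + B)).
Proof.
move=> hf hg; have h := is_deriveM hf hg.
have e : f z *: (g z * B) + g z *: (f z * A) = f z * g z * (A + B).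
  by rewrite /GRing.scale /=; ring.
by rewrite e in h.
Qed.

Lemma siegel_it (a b : Zmod N) (t : R) : (a, b) != 0 -> 0 < t ->
  [/\ siegel R (a, b) (t%:C * ci R) != 0,
    logabs (siegel R (a, b) (t%:C * ci R)) = Lf a b t &
    darg (siegel R (a, b)) (t%:C * ci R) (ci R) = lam * Yf a b t].
Proof.
move=> ab t0; set tau0 : C := t%:C * ci R.
have aN := Zmod_lt a; have bN := Zmod_lt b.
have H1 : (0 < a)%N || (0 < b < N)%N.
  by rewrite bN andbT; exact: Zpair_gt0.
have H2 : (0 < N - a)%N || (0 < b < N)%N by rewrite subn_gt0 aN.
have s1 : (1 : R) ^+ 2 = 1 by rewrite expr1n.
have s2 : (-1 : R) ^+ 2 = 1 by rewrite sqrrN expr1n.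
have [L1 [n1 k1 d1 y1]] := @half_product R N N0 a b 1 t t0 s1 H1.
have [L2 [n2 k2 d2 y2]] := @half_product R N N0 (N - a) b (-1) t t0 s2 H2.
rewrite -/(half a b 1) -/tau0 in n1 k1 d1; rewrite -/(half (N - a) b (-1)) -/tau0 in n2 k2 d2.
pose B : R := B2 ((a : nat)%:R / N%:R).
have q0 : qpow (B / 2) tau0 != 0 by exact: cexp_neq0.
have dq := qpow_dv (B / 2) tau0.
have dS : is_derive tau0 (1 : C) (siegel R (a, b))
    (siegel R (a, b) tau0 * ((2 * pi * (B / 2))%:C * ci R + L1 + L2)).
  have := dvMC (dvMC dq d1) d2.
  rewrite (_ : (fun x => _) = siegel R (a, b)); last by apply/funext => x; rewrite siegel_halves.
  by rewrite siegel_halves.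
have g0 : siegel R (a, b) tau0 != 0 by rewrite siegel_halves !mulf_neq0.
split => //.
- rewrite /logabs -/(modC _) siegel_halves !modCM.
  have p1 : 0 < modC (half a b 1 tau0) by rewrite modC_gt0.
  have p2 : 0 < modC (half (N - a) b (-1) tau0) by rewrite modC_gt0.
  have p0 : 0 < modC (qpow (B / 2) tau0) by rewrite modC_gt0.
  rewrite lnM ?posrE ?mulr_gt0// lnM ?posrE//.
  have -> : ln (modC (qpow (B / 2) tau0)) = - (pi * B * t).
    by rewrite qpow_it modC_real ger0_norm ?expR_ge0// expRK; field.
  rewrite /Lf -/B -addrA; congr (_ + _).
  have [cV _] := @Vf_prop R N N0 a b aN.
  have k3 := cvg_seriesD k1 k2.
  have k4 : series (fun n => - pairp N (fun m => Kf b (m%:R * t)) a n) @ \oo --> - Vf a b t.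
    have := @cvg_seriesZ R _ (-1) _ (cV t t0).
    rewrite mulN1r; suff -> : series (fun n => -1 * pairp N (fun m => Kf b (m%:R * t)) a n) =
      series (fun n => - pairp N (fun m => Kf b (m%:R * t)) a n) by [].
    by apply: series_ext => n; rewrite mulN1r.
  apply: (cvg_unique (@norm_hausdorff _ R) k3).
  suff -> : series (fun n => - Kf b ((N * n + a)%:R * t) + - Kf b ((N * n + (N - a))%:R * t)) =
    series (fun n => - pairp N (fun m => Kf b (m%:R * t)) a n) by exact: k4.
  by apply: series_ext => n; rewrite /pairp opprD.
- rewrite /darg derive1E; case: dS => _ ->.
  rewrite [_ * _ / _]mulrAC divff// mul1r.
  (* As the velocity is i, darg is the real part of the logarithmic derivative; the contribution of
     q^(B/2) is purely imaginary. *)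
  have -> z : Im (z * ci R) = Re z by rewrite /ci; case: z => x y /=; ring.
  rewrite !ReCD.
  have -> : Re ((2 * pi * (B / 2))%:C * ci R) = 0 by rewrite /ci /=; ring.
  rewrite add0r.
  have y3 := cvg_seriesD y1 y2.
  apply: (cvg_unique (@norm_hausdorff _ R) y3).
  have y4 : series (pairm N (fun m => m%:R * sf b (m%:R * t)) a) @ \oo --> Yf a b t.
    have [b0|b0] := posnP b.
      rewrite b0 Yf0r; suff -> : series (pairm N (fun m => m%:R * sf 0 (m%:R * t)) a) = series (fun=> 0 : R).
        exact: series0.
      by apply: series_ext => n; rewrite /pairm !sf0E !mulr0 subr0.
    by have [h _] := @Yf_prop R N N0 a b aN ltac:(by rewrite b0 bN); exact: h.
  have := @cvg_seriesZ R _ lam _ y4.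
  set u := series _; set v := series _; suff -> : u = v by [].
  apply: series_ext => n; rewrite /pairm; ring.
Qed.

Lemma along_eta (a b c d : Zmod N) (t : R) : (a, b) != 0 -> (c, d) != 0 -> 0 < t ->
  along_iR (eta_form (siegel R (a, b)) (siegel R (c, d))) t =
  Lf a b t * (lam * Yf c d t) - Lf c d t * (lam * Yf a b t).
Proof.
move=> ab cd t0; have [_ l1 d1] := siegel_it ab t0; have [_ l2 d2] := siegel_it cd t0.
by rewrite /along_iR /eta_form l1 l2 d1 d2.
Qed.

End SiegelLog.

(** * Eisenstein series and their q-expansions *)

Section Grading.
Variable R : realType.
Notation C := (R[i]^o).

Lemma pow_ee p (l : R) : 0 < l -> exists D l', [/\ 0 <= D, 0 < l' &
  forall n : nat, n.+1%:R ^+ p * ee l n%:R <= D * ee l' n%:R].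
Proof.
elim: p l => [|p IH] l l1.
  by exists 1, l; split => // n; rewrite expr0 !mul1r.
have l2 : 0 < l / 2 by rewrite divr_gt0.
have [D [l' [D0 l'0 h]]] := IH _ l2.
exists (D * (expR l * (2 / l))), l'; split => //.
  by nonneg.
move=> n; have e1 : n.+1%:R * ee l n%:R <= expR l * (2 / l) * ee (l / 2) n%:R.
  have := xee_le l1 (ler0n R n.+1).
  have -> : ee l n%:R = expR l * ee l n.+1%:R.
    by rewrite /ee -expRD -natr1; congr expR; ring.
  have : ee (l / 2) n.+1%:R <= ee (l / 2) n%:R by rewrite ee_decr ?(ltW l2)// ler_nat.
  move=> h1 h2; rewrite mulrCA -mulrA ler_wpM2l ?expR_ge0//; apply: (le_trans h2).
  by rewrite ler_wpM2l// divr_ge0// ltW.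
have -> : ee l n%:R = ee (l / 2) n%:R * ee (l / 2) n%:R.
  by rewrite -eeD /ee; congr expR; field.
rewrite exprSr.
have e2 : n.+1%:R * ee (l / 2) n%:R <= expR l * (2 / l).
  have e0 : 0 < ee (l / 2) n%:R := ee_gt0 _ _.
  rewrite -(ler_pM2r e0) -mulrA -eeD.
  by have -> : ee (l / 2) (n%:R + n%:R) = ee l n%:R by rewrite /ee; congr expR; field.
have -> : n.+1%:R ^+ p * n.+1%:R * (ee (l / 2) n%:R * ee (l / 2) n%:R) =
  (n.+1%:R ^+ p * ee (l / 2) n%:R) * (n.+1%:R * ee (l / 2) n%:R) by ring.
have -> : D * (expR l * (2 / l)) * ee l' n%:R = (D * ee l' n%:R) * (expR l * (2 / l)) by ring.
by apply: ler_pM => //; rewrite mulr_ge0 ?ee_ge0// exprn_ge0.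
Qed.

Variables (phi : nat -> nat -> nat) (w : nat -> nat -> R) (D l : R) (z : nat -> C).
Hypotheses (phiw : forall m k, w m k != 0 -> (m <= phi m k)%N && (k <= phi m k)%N).
Hypotheses (wD : forall m k, `|w m k| <= D * (m.+1%:R * k.+1%:R) ^+ 2) (l0 : 0 < l)
  (zl : forall n, modC (z n) <= ee l n%:R).

(** The coefficient of degree n when a double family is regrouped by a degree [phi]: [muln] gives
    divisor sums, [addn] gives Cauchy products. The finite range is complete because a nonzero
    weight forces both indices to be at most the degree. *)
Definition graded n : R := \sum_(0 <= m < n.+1) \sum_(0 <= k < n.+1) (if phi m k == n then w m k else 0).

Let D0 : 0 <= D.
Proof. by apply: le_trans (normr_ge0 (w 0 0)) _; apply: (le_trans (wD 0 0)); rewrite !mulr1 expr1n mulr1. Qed.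

Let wK K m k : (m < K)%N -> (k < K)%N -> `|w m k| <= D * K%:R ^+ 4.
Proof.
move=> mK kK; apply: (le_trans (wD m k)); rewrite ler_wpM2l// exprMn.
have -> : K%:R ^+ 4 = K%:R ^+ 2 * K%:R ^+ 2 :> R by rewrite -exprD.
by apply: ler_pM; rewrite ?sqr_ge0// -!natrX ler_nat leq_exp2r.
Qed.

Let sum_le K (F : nat -> R) B : (forall m, (m < K)%N -> F m <= B) -> \sum_(0 <= m < K) F m <= K%:R * B.
Proof.
move=> FB; rewrite big_nat; apply: (@le_trans _ _ (\sum_(0 <= m < K | (0 <= m < K)%N) B)).
  by apply: ler_sum => m /andP[_]; exact: FB.
by rewrite -big_nat sumr_const_nat subn0 mulr_natl.
Qed.

Lemma graded_bound n : `|graded n| <= D * n.+1%:R ^+ 6.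
Proof.
apply: (le_trans (ler_norm_sum _ _ _)).
have -> : D * n.+1%:R ^+ 6 = n.+1%:R * (n.+1%:R * (D * n.+1%:R ^+ 4)) by ring.
apply: sum_le => m mn; apply: (le_trans (ler_norm_sum _ _ _)).
apply: sum_le => k kn; case: ifP => _; first exact: wK.
by rewrite normr0 mulr_ge0// exprn_ge0.
Qed.

Let gradedE K n : (n < K)%N -> graded n =
  \sum_(0 <= m < K) \sum_(0 <= k < K) (if phi m k == n then w m k else 0).
Proof.
move=> nK.
have z0 m k : (n < m)%N || (n < k)%N -> (if phi m k == n then w m k else 0) = 0.
  move=> h; case: eqP => // e; apply/eqP; apply: contraTT h => /phiw; rewrite e.
  by rewrite negb_or -!leqNgt.
have sub (F : nat -> R) : (forall k, (n < k)%N -> F k = 0) ->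
    \sum_(0 <= k < n.+1) F k = \sum_(0 <= k < K) F k.
  move=> F0; rewrite (big_cat_nat_idem (n := n.+1) _ _ nK)//= ?addr0//.
  by rewrite [X in _ + X]big_nat_cond [X in _ + X]big1 ?addr0// => i; rewrite andbT => /andP[h _]; rewrite F0.
rewrite /graded sub; last by move=> m nm; rewrite big1// => k _; rewrite z0// nm.
by apply: eq_bigr => m _; rewrite sub// => k nk; rewrite z0// nk orbT.
Qed.

Let grad_diff K : \sum_(0 <= m < K) \sum_(0 <= k < K) (w m k)%:C * z (phi m k)
   - \sum_(0 <= n < K) (graded n)%:C * z n =
   \sum_(0 <= m < K) \sum_(0 <= k < K) (if (phi m k < K)%N then 0 else (w m k)%:C * z (phi m k)).
Proof.
have -> : \sum_(0 <= n < K) (graded n)%:C * z n =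
   \sum_(0 <= m < K) \sum_(0 <= k < K) (if (phi m k < K)%N then (w m k)%:C * z (phi m k) else 0).
  transitivity (\sum_(0 <= n < K) \sum_(0 <= m < K) \sum_(0 <= k < K)
     (if phi m k == n then (w m k)%:C * z n else 0)).
    rewrite big_nat [RHS]big_nat; apply: eq_bigr => n /andP[_ nK].
    rewrite (gradedE nK) (rmorph_sum (real_complex R)) big_distrl /=; apply: eq_bigr => m _.
    rewrite (rmorph_sum (real_complex R)) big_distrl /=; apply: eq_bigr => k _.
    by case: ifP => // _; rewrite mul0r.
  rewrite exchange_big /=; apply: eq_bigr => m _.
  rewrite exchange_big /=; apply: eq_bigr => k _.
  case: ifP => [hK|hK].
    rewrite (bigD1_seq (phi m k)) /= ?iota_uniq ?mem_index_iota// eqxx big1 ?addr0// => i.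
    by rewrite eq_sym => /negbTE ->.
  rewrite big_nat big1// => i /andP[_ iK]; case: eqP => // e.
  by rewrite -e hK in iK.
rewrite -sumrB; apply: eq_bigr => m _; rewrite -sumrB; apply: eq_bigr => k _.
by case: ifP => _; rewrite ?subrr ?subr0.
Qed.

(** By [grad_diff] the square sum of side K and the graded sum of length K differ by the terms of
    degree at least K in the square: polynomially many with polynomial weights, each exponentially
    small. *)
Lemma grading : exists s : C,
  series (fun n => (graded n)%:C * z n : C) @ \oo --> s /\
  (fun K => \sum_(0 <= m < K) \sum_(0 <= k < K) (w m k)%:C * z (phi m k) : C) @ \oo --> s.
Proof.
have [E [l' [E0 l'0 hE]]] := pow_ee 6 l0.
have [|s hs] := @cvg_seriesC_abs R (fun n => (graded n)%:C * z n) (fun n => D * E * ee l' n%:R) _ (@cvg_ee_series R (D * E) l' l'0).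
  move=> n; rewrite modCM modC_real.
  apply: (@le_trans _ _ (D * n.+1%:R ^+ 6 * ee l n%:R)).
    by apply: ler_pM => //; [exact: modC_ge0|exact: graded_bound].
  by rewrite -[leLHS]mulrA -[leRHS]mulrA ler_wpM2l// hE.
exists s; split => //.
pose d K : C := \sum_(0 <= m < K) \sum_(0 <= k < K) (if (phi m k < K)%N then 0 else (w m k)%:C * z (phi m k)).
have d0 : d @ \oo --> (0 : C).
  apply/cvg_modC; apply: (@squeeze_cvgr _ _ _ _ (fun=> 0) (fun K => D * E * ee l' K%:R)).
  - apply: filterE => K; rewrite modC_ge0 /= subr0.
    apply: (@le_trans _ _ (D * (K.+1%:R ^+ 6 * ee l K%:R))); last by rewrite -[leRHS]mulrA ler_wpM2l// hE.
    apply: (@le_trans _ _ (K%:R * (K%:R * (D * K%:R ^+ 4 * ee l K%:R)))).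
      apply: (le_trans (modC_sum _ _ _)); apply: sum_le => m mK.
      apply: (le_trans (modC_sum _ _ _)); apply: sum_le => k kK.
      case: ifP => [_|/negbT hK]; first by rewrite modC0 !mulr_ge0 ?ee_ge0// exprn_ge0.
      rewrite modCM modC_real; apply: ler_pM => //; [exact: modC_ge0|exact: wK|].
      by apply: (le_trans (zl _)); rewrite ee_decr ?(ltW l0)// ler_nat leqNgt.
    have -> : K%:R * (K%:R * (D * K%:R ^+ 4 * ee l K%:R)) = D * (K%:R ^+ 6 * ee l K%:R) :> R by ring.
    by rewrite ler_wpM2l// ler_wpM2r ?ee_ge0// lerXn2r ?nnegrE// ler_nat.
  - exact: cvg_cst.
  - rewrite -(mulr0 (D * E)); apply: cvgM; first exact: cvg_cst.
    by apply: (cvg_comp _ _ (@cvgr_idn R)); exact: ee_cvg0.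
have h3 : (fun K => d K + series (fun n => (graded n)%:C * z n : C) K) @ \oo --> 0 + s := cvgD d0 hs.
rewrite add0r in h3.
suff e : (fun K => d K + series (fun n => (graded n)%:C * z n) K) =
  (fun K => \sum_(0 <= m < K) \sum_(0 <= k < K) (w m k)%:C * z (phi m k)) by rewrite -e; exact: h3.
by apply/funext => K; rewrite /d -grad_diff subrK.
Qed.
End Grading.

(** * The q-expansions of the Eisenstein series and their values on the axis *)

Section Eisenstein.
Variable R : realType.
Notation C := (R[i]^o).
Notation Re := complex.Re.
Notation Im := complex.Im.
Variable N : nat.
Hypothesis N0 : (0 < N)%N.
Notation lam := (lam R N).
Notation wf := (@wf R N).
Notation Tf := (@Tf R N).
Notation Tz := (@Tz R N).
Let l0 : 0 < lam. Proof. exact: lam_gt0. Qed.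
Let NN0 : 0 < N%:R :> R. Proof. by rewrite ltr0n. Qed.
Let lE : lam = 2 * pi / N%:R. Proof. by []. Qed.
Implicit Types (a b c d : Zmod N) (tau : C).

Lemma modC_qpow n tau : modC (qpow n%:R tau) = ee (2 * pi * Im tau) n%:R.
Proof. by rewrite modC_cexp /ci /ee; case: tau => x y /=; congr expR; ring. Qed.

Lemma qpow_natD m n tau : qpow (m + n)%:R tau = qpow m%:R tau * qpow n%:R tau :> C.
Proof. by rewrite natrD qpowD. Qed.

Definition wdiv a b (m k : nat) : R :=
  ([&& (0 < m)%N, m == a %[mod N], (0 < k)%N & k == b %[mod N]])%:R.

(** The number of factorizations n = m k with m congruent to a and k to b. *)
Definition sigma a b := graded muln (wdiv a b).

Definition qsquare a b tau K : C :=
  \sum_(1 <= m < K | m == a %[mod N]) \sum_(1 <= n < K | n == b %[mod N]) qpow (m * n)%:R tau.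

Lemma qsum_cvg a b tau : upper_half_plane tau ->
  series (fun n => (sigma a b n)%:C * qpow n%:R tau : C) @ \oo --> qsum a b tau /\
  qsquare a b tau @ \oo --> qsum a b tau.
Proof.
rewrite /upper_half_plane /= => t0.
have l1 : 0 < 2 * pi * Im tau by rewrite !mulr_gt0// pi_gt0.
have [||n|s [h1 h2]] := @grading R muln (wdiv a b) 1 _ (fun n => qpow n%:R tau) _ _ l1 _.
- move=> m k; rewrite /wdiv; case: and4P => [[m0 _ k0 _] _|]; last by rewrite eqxx.
  by rewrite leq_pmulr// leq_pmull.
- move=> m k; rewrite /wdiv mul1r ger0_norm//; apply: (@le_trans _ _ 1).
    by case: [&& _, _, _ & _].
  by rewrite -natrM -natrX ler1n expn_gt0.
- by rewrite modC_qpow.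
have sE : qsquare a b tau = (fun K => \sum_(0 <= m < K) \sum_(0 <= k < K) (wdiv a b m k)%:C * qpow (m * k)%:R tau).
  apply/funext; case=> [|K]; first by rewrite /qsquare !big_geq.
  rewrite /qsquare big_mkcond [RHS]big_nat_recl//= [X in _ = X + _]big1 ?add0r; last first.
    by move=> k _; rewrite /wdiv mul0r.
  rewrite big_add1 /=; apply: eq_bigr => m _.
  rewrite [in RHS]big_nat_recl//= {1}/wdiv /= !andbF mul0r add0r.
  case: ifP => hm; last by rewrite big1// => k _; rewrite /wdiv /= hm mul0r.
  rewrite big_mkcond big_add1 /=; apply: eq_bigr => k _.
  by rewrite /wdiv /= hm /=; case: ifP => hk; rewrite ?mul1r ?mul0r.
rewrite sE; have -> : qsum a b tau = s; last by split; [exact: h1|exact: h2].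
by rewrite /qsum -/(qsquare a b tau) sE; exact: cvg_limC h2.
Qed.

Definition ecoef a b n : R :=
  (if n == 0%N then alpha0 R a b else 0) + sigma a b n - sigma (- a) (- b) n.

Lemma sigma_bound a b n : `|sigma a b n| <= n.+1%:R ^+ 2.
Proof.
apply: (le_trans (ler_norm_sum _ _ _)).
have e : n.+1%:R ^+ 2 = \sum_(0 <= m < n.+1) n.+1%:R :> R by rewrite sumr_const_nat subn0 expr2 -[RHS]mulr_natl.
rewrite e; apply: ler_sum => m _; apply: (le_trans (ler_norm_sum _ _ _)).
have e1 : n.+1%:R = \sum_(0 <= m < n.+1) 1 :> R by rewrite sumr_const_nat subn0.
rewrite e1; apply: ler_sum => k _; case: ifP => _; rewrite ?normr0//.
by rewrite /wdiv; case: [&& _, _, _ & _]; rewrite ?normr1 ?normr0.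
Qed.

Lemma ecoef_bound a b : exists2 D, 0 <= D & forall n, `|ecoef a b n| <= D * n.+1%:R ^+ 2.
Proof.
exists (`|alpha0 R a b| + 2); first by rewrite addr_ge0.
move=> n; rewrite /ecoef; apply: (le_trans (ler_normB _ _)).
rewrite [_ + 2]addrC -[2]/(1 + 1) !mulrDl !mul1r.
have h1 := sigma_bound a b n; have h2 := sigma_bound (- a) (- b) n.
have h3 : `|(if n == 0%N then alpha0 R a b else 0)| <= `|alpha0 R a b| * n.+1%:R ^+ 2.
  case: eqP => _; last by rewrite normr0 mulr_ge0// sqr_ge0.
  by rewrite ler_peMr// -natrX ler1n expn_gt0.
have := ler_normD (if n == 0%N then alpha0 R a b else 0) (sigma a b n); lra.
Qed.

Lemma eis_cvg a b tau : upper_half_plane tau ->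
  series (fun n => (ecoef a b n)%:C * qpow n%:R tau : C) @ \oo --> eis R a b tau.
Proof.
move=> ht; have [h1 _] := qsum_cvg a b ht; have [h2 _] := qsum_cvg (- a) (- b) ht.
pose u n : C := (if n == 0%N then alpha0 R a b else 0)%:C * qpow n%:R tau.
have h0 : series u @ \oo --> ((alpha0 R a b)%:C : C).
  apply: cvg_near_cst; near=> n.
  have n0 : (0 < n)%N by near: n; exists 1%N.
  rewrite /series /= -(prednK n0) big_nat_recl//= [X in _ + X]big1 ?addr0; last first.
    by move=> i _; rewrite /u /= mul0r.
  by rewrite /u /= /qpow mulr0 mul0r mul0r cexp0 mulr1.
have h3 : (fun n => series u n + series (fun n => (sigma a b n)%:C * qpow n%:R tau : C) n -
    series (fun n => (sigma (- a) (- b) n)%:C * qpow n%:R tau : C) n) @ \oo --> eis R a b tau := cvgB (cvgD h0 h1) h2.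
suff e : (fun n => series u n + series (fun n => (sigma a b n)%:C * qpow n%:R tau : C) n -
    series (fun n => (sigma (- a) (- b) n)%:C * qpow n%:R tau : C) n) =
  series (fun n => (ecoef a b n)%:C * qpow n%:R tau) by rewrite -e; exact: h3.
apply/funext => n; rewrite /series /= -big_split /= -sumrB; apply: eq_bigr => i _.
by rewrite /u /ecoef rmorphB rmorphD /=; ring.
Unshelve. all: by end_near. Qed.

Definition conv (u v : nat -> R) := graded addn (fun i j => u i * v j).

Lemma conv_cvg a b c d tau : upper_half_plane tau ->
  series (fun n => (conv (ecoef a b) (ecoef c d) n)%:C * qpow n%:R tau : C) @ \oo -->
    eis R a b tau * eis R c d tau.
Proof.
move=> ht; have l1 : 0 < 2 * pi * Im tau by rewrite !mulr_gt0// pi_gt0.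
have [D D0 hD] := ecoef_bound a b; have [E E0 hE] := ecoef_bound c d.
have [||n|s [h1 h2]] := @grading R addn (fun i j => ecoef a b i * ecoef c d j) (D * E) _ (fun n => qpow n%:R tau) _ _ l1 _.
- by move=> m k _; rewrite leq_addr leq_addl.
- move=> m k; rewrite normrM exprMn mulrACA; exact: ler_pM.
- by rewrite modC_qpow.
suff <- : s = eis R a b tau * eis R c d tau by exact: h1.
apply: (@cvg_uniqueC _ _ _ _ _ _ _ h2).
have h3 := cvgM (@eis_cvg a b tau ht) (@eis_cvg c d tau ht).
suff -> : (fun K => \sum_(0 <= m < K) \sum_(0 <= k < K) (ecoef a b m * ecoef c d k)%:C * qpow (m + k)%:R tau) =
  (fun K => series (fun n => (ecoef a b n)%:C * qpow n%:R tau : C) K *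
            series (fun n => (ecoef c d n)%:C * qpow n%:R tau : C) K) by exact: h3.
apply/funext => K; rewrite /series /= big_distrl /=; apply: eq_bigr => m _.
rewrite big_distrr /=; apply: eq_bigr => k _.
by rewrite qpow_natD rmorphM /=; ring.
Qed.

Lemma conv_bound a b c d : exists2 D, 0 <= D & forall n,
  `|conv (ecoef a b) (ecoef c d) n| <= D * n.+1%:R ^+ 6.
Proof.
have [D D0 hD] := ecoef_bound a b; have [E E0 hE] := ecoef_bound c d.
exists (D * E); first exact: mulr_ge0.
apply: (@graded_bound R addn) => m k; rewrite normrM exprMn mulrACA; exact: ler_pM.
Qed.

Lemma qsumC a b tau : qsum a b tau = qsum b a tau.
Proof.
rewrite /qsum; apply: (congr1 (fun u : nat -> C => lim (u @ \oo))); apply/funext => K.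
rewrite exchange_big /=; apply: eq_bigr => m _; apply: eq_bigr => k _.
by rewrite mulnC.
Qed.

Lemma alpha0C a b : alpha0 R a b = alpha0 R b a.
Proof. by rewrite /alpha0; do 2 case: eqP => //. Qed.

Lemma eisC a b tau : eis R a b tau = eis R b a tau.
Proof. by rewrite /eis alpha0C [qsum a b _]qsumC [qsum (- a) _ _]qsumC. Qed.

Lemma frac_Zmod a : frac_part ((a : nat)%:R / N%:R : R) = (a : nat)%:R / N%:R.
Proof.
have f0 : Num.floor ((a : nat)%:R / N%:R : R) = 0.
  apply: floor_def; rewrite add0r divr_ge0//= ltr_pdivrMr// mul1r ltr_nat.
  exact: Zmod_lt.
by rewrite /frac_part f0 subr0.
Qed.

Lemma Zmod_opp a : a != 0 -> (- a : Zmod N) = (N - a)%N :> nat.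
Proof.
rewrite -Zmod_gt0 => a0; have := Zmod_lt N0 a; move: a0; rewrite /=.
by move: (nat_of_ord a) => x x0 xN; rewrite prednK// modn_small//; lia.
Qed.

Lemma frac_opp a : a != 0 ->
  2^-1 - frac_part ((- a : Zmod N)%:R / N%:R : R) = - (2^-1 - frac_part ((a : nat)%:R / N%:R)).
Proof.
move=> a0; rewrite !frac_Zmod Zmod_opp// natrB ?(ltnW (Zmod_lt N0 a))//.
by field; rewrite lt0r_neq0.
Qed.

Lemma alpha0N a b : alpha0 R (- a) (- b) = - alpha0 R a b.
Proof.
rewrite /alpha0 !oppr_eq0; case: eqP => [_|/eqP a0]; case: eqP => [_|/eqP b0]; rewrite ?oppr0//; exact: frac_opp.
Qed.

Lemma eisN a b tau : eis R (- a) (- b) tau = - eis R a b tau.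
Proof. by rewrite /eis alpha0N !opprK rmorphN /=; ring. Qed.

(** The representative in 1, ..., N: the series start at m = 1, where the class of 0 begins with
    N. *)
Definition res (a : nat) : nat := if a == 0%N then N else a.

Lemma res_sum (V : nmodType) (F : nat -> V) (a : nat) J : (a < N)%N ->
  \sum_(1 <= m < (N * J).+1 | m == a %[mod N]) F m = \sum_(0 <= j < J) F (N * j + res a)%N.
Proof.
move=> aN; elim: J => [|J IH]; first by rewrite muln0 !big_geq.
have ra : (0 < res a <= N)%N by rewrite /res; case: eqP => [_|/eqP]; lia.
have rm i : (0 < i <= N)%N -> (N * J + i == a %[mod N]) = (i == res a).
  move=> /andP[i0 iN]; rewrite [(N * J)%N]mulnC modnMDl (modn_small aN) /res.
  have [a0|a0] := eqVneq a 0%N; move: iN; rewrite leq_eqVlt => /orP[/eqP->|iN].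
  - by rewrite a0 modnn !eqxx.
  - by rewrite a0 modn_small//; lia.
  - by rewrite modnn; lia.
  - by rewrite modn_small.
have h2 : ((N * J).+1 <= (N * J.+1).+1)%N by nia.
rewrite big_nat_recr//= -IH (big_cat_nat_idem (n := (N * J).+1) _ _ h2)//= ?addr0//.
congr (_ + _).
have -> : (N * J.+1).+1 = (N + (N * J).+1)%N by lia.
rewrite -{1}[(N * J).+1]add0n big_addn addnK big_mkcond big_nat.
have [k kE] : exists k, res a = k.+1 by exists (res a).-1; rewrite prednK//; case/andP: ra.
rewrite (eq_bigr (fun i => if i == k then F (N * J + res a)%N else 0)); last first.
  move=> i /andP[_ iN]; have -> : (i + (N * J).+1 = N * J + i.+1)%N by lia.
  by rewrite rm// kE eqSS; case: eqP => [->|].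
rewrite -big_nat -big_mkcond /= big_nat1_eq.
by case: ifP => //; rewrite -kE; lia.
Qed.

Lemma res_opp a : res (- a : Zmod N) = (N - a)%N.
Proof.
have [->|a0] := eqVneq a 0; first by rewrite oppr0 /res /= subn0.
rewrite /res Zmod_opp//; case: eqP => // h.
by have := Zmod_lt N0 a; lia.
Qed.

Lemma resE (a : nat) : a != 0%N -> res a = a.
Proof. by rewrite /res => /negbTE ->. Qed.

Section Axis.
Variable x : R.
Hypothesis x0 : 0 < x.
Let tau : C := (x / N%:R)%:C * ci R.

Let tauH : upper_half_plane tau.
Proof. by rewrite /upper_half_plane /= mulr1 mul0r ?addr0 ?add0r; exact: divr_gt0. Qed.

Lemma qpow_axis n : qpow n%:R tau = (ee lam (n%:R * x))%:C.
Proof.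
by rewrite qpow_it /ee lE; congr ((expR _)%:C); move: (@pi R) => p; field; rewrite lt0r_neq0.
Qed.

Let v (a d j : nat) : R := wf d ((N * j + res a)%:R * x) + wf d ((N * j + (N - a))%:R * x).
Let g (d J m : nat) : R := series (pairm N (fun k => ee lam (k%:R * (m%:R * x))) d) J.
Let T0 (a d : nat) : R := limn (series (v a d)).

(** The squares of [qsum] truncate both sums at the same J, while [Tf] sums its inner series first;
    Tannery reconciles the two. *)
Let T0_lim (a d : nat) : (a < N)%N -> (0 < d < N)%N -> cvgn (series (v a d)) /\
  (fun J => \sum_(0 <= j < J) (g d J (N * j + res a) + g d J (N * j + (N - a))%N)) @ \oo --> T0 a d.
Proof.
move=> aN dN; have [D D0 hD] := @wf_bound R N N0 d.
have lx : 0 < lam * x by rewrite mulr_gt0.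
have r0 j : (0 < N * j + res a)%N by rewrite /res; case: eqP => [_|/eqP]; lia.
have rj j : (j <= N * j + res a)%N by nia.
have hg m j J : (0 < m)%N -> (j <= m)%N -> `|g d J m| <= D * ee (lam * x) j%:R.
  move=> m0 jm; have mx : 0 < m%:R * x by rewrite mulr_gt0// ltr0n.
  apply: (le_trans (wf_partial N0 J dN mx)); apply: (le_trans (hD _ (ltW mx))).
  by rewrite ler_wpM2l// mulrC ee_scale ee_decr ?(ltW lx)// ler_nat.
have gw m : (0 < m)%N -> g d J m @[J --> \oo] --> wf d (m%:R * x).
  by move=> m0; apply: wf_series => //; rewrite mulr_gt0// ltr0n.
apply: (@tannery_lim R (fun J j => g d J (N * j + res a)%N + g d J (N * j + (N - a))%N)
  (v a d) (fun j => 2 * D * ee (lam * x) j%:R)).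
- move=> J j; apply: (le_trans (ler_normD _ _)).
  have := hg _ j J (r0 j) (rj j); have := hg (N * j + (N - a))%N j J ltac:(lia) ltac:(nia).
  lra.
- exact: cvg_ee_series.
- by move=> j; apply: cvgD; apply: gw; [exact: r0|lia].
Qed.

(** For a = 0 the pairs of [Tf] contain the index 0, which [res] replaces by N. The difference
    telescopes to [wf d 0], the constant term of the Eisenstein series. *)
Let TzE (a d : nat) : (a < N)%N -> (0 < d < N)%N ->
  Tz a d x = (if a == 0%N then 1 - 2 * (d%:R / N%:R) else 0) + T0 a d.
Proof.
move=> aN dN; have [cv _] := T0_lim aN dN; have [cT _] := @Tf_prop R N N0 a d aN.
have -> : Tz a d x = Tf a d x by rewrite /Tz; case: eqP dN => [->|].
case: eqP => [a0|/eqP a0]; last first.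
  rewrite add0r; apply: (cvg_unique (@norm_hausdorff _ R) (cT x x0)).
  suff -> : series (pairp N (fun m => wf d (m%:R * x)) a) = series (v a d) by exact: cv.
  by apply: series_ext => j; rewrite /pairp /v resE.
apply: (cvg_unique (@norm_hausdorff _ R) (cT x x0)).
have [D D0 hD] := @wf_bound R N N0 d.
have w0 : (fun n => wf d ((N * n)%:R * x)) @ \oo --> (0 : R).
  apply/norm_cvg0P; apply: (@squeeze_cvgr _ _ _ _ (fun=> 0) (fun n => D * ee (lam * x) n%:R)).
  - apply: filterE => n; rewrite normr_ge0 /=; apply: (le_trans (hD _ _)); first by rewrite mulr_ge0// ltW.
    rewrite ler_wpM2l// mulrC ee_scale; apply: ee_decr; first by nonneg.
    by rewrite ler_nat; nia.
  - exact: cvg_cst.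
  - rewrite -(mulr0 D); apply: cvgM; first exact: cvg_cst.
    by apply: (cvg_comp _ _ (@cvgr_idn R)); apply: ee_cvg0; exact: mulr_gt0.
have E : series (pairp N (fun m => wf d (m%:R * x)) a) =
    (fun n => wf d 0 - wf d ((N * n)%:R * x) + series (v a d) n).
  apply/funext; elim => [|n IH]; first by rewrite /series /= !big_geq// muln0 mul0r subrr addr0.
  rewrite /series /= !big_nat_recr//=; move: IH; rewrite /series /= => ->.
  by rewrite /pairp /v a0 /res eqxx subn0 addn0 mulnS [(N + N * n)%N]addnC; ring.
have c1 : (fun _ : nat => wf d 0) @ \oo --> wf d 0 by exact: cvg_cst.
have h := cvgD (cvgB c1 w0) cv; rewrite subr0 (wf0 R N0 dN) in h.
by rewrite E (wf0 R N0 dN); exact: h.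
Qed.

Let qsq a b J : qsquare a b tau (N * J).+1 =
  (\sum_(0 <= j < J) \sum_(0 <= k < J) ee lam ((N * k + res b)%:R * ((N * j + res a)%:R * x)))%:C.
Proof.
rewrite /qsquare (res_sum _ _ (Zmod_lt N0 a)) (rmorph_sum (real_complex R)); apply: eq_bigr => j _.
rewrite (res_sum _ _ (Zmod_lt N0 b)) (rmorph_sum (real_complex R)); apply: eq_bigr => k _.
rewrite qpow_axis natrM; congr ((ee _ _)%:C); ring.
Qed.

(** Along the truncations at N J + 1, which contain J full periods, the four square sums combine
    into the signed pairs whose sum is [wf d]. *)
Let qcomb a d : d != 0 ->
  qsum a d tau + qsum (- a) d tau - qsum a (- d) tau - qsum (- a) (- d) tau = (T0 a d)%:C.
Proof.
move=> d0; have dN : (0 < d < N)%N by rewrite Zmod_gt0 d0 Zmod_lt.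
have [_ hT] := T0_lim (Zmod_lt N0 a) dN.
have sub b c : (fun J => qsquare b c tau (N * J).+1) @ \oo --> qsum b c tau.
  have [_ h] := qsum_cvg b c tauH; apply: cvg_comp h.
  by apply/cvgnyPge => A; exists A => // n /= An; nia.
pose q J : C := qsquare a d tau (N * J).+1 + qsquare (- a) d tau (N * J).+1 -
     qsquare a (- d) tau (N * J).+1 - qsquare (- a) (- d) tau (N * J).+1.
have h : q @ \oo --> (qsum a d tau + qsum (- a) d tau - qsum a (- d) tau - qsum (- a) (- d) tau : C).
  exact: cvgB (cvgB (cvgD (sub a d) (sub (- a) d)) (sub a (- d))) (sub (- a) (- d)).
suff h' : q @ \oo --> ((T0 a d)%:C : C) by exact: (cvg_uniqueC h h').
apply: cvg_ReIm; last first.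
  suff -> : (fun J => Im (qsquare a d tau (N * J).+1 + qsquare (- a) d tau (N * J).+1 -
     qsquare a (- d) tau (N * J).+1 - qsquare (- a) (- d) tau (N * J).+1)) = (fun=> 0) by exact: cvg_cst.
  by apply/funext => J; rewrite !qsq /= !addr0 !subr0.
suff -> : (fun J => Re (qsquare a d tau (N * J).+1 + qsquare (- a) d tau (N * J).+1 -
     qsquare a (- d) tau (N * J).+1 - qsquare (- a) (- d) tau (N * J).+1)) =
  (fun J => \sum_(0 <= j < J) (g d J (N * j + res a) + g d J (N * j + (N - a))%N)) by exact: hT.
apply/funext => J; rewrite !qsq !ReCB ReCD /= !res_opp -big_split -!sumrB /=; apply: eq_bigr => j _.
rewrite /g /series /= /pairm -big_split -!sumrB -big_split /=; apply: eq_bigr => k _.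
rewrite (@resE d); last by rewrite -lt0n; case/andP: dN.
ring.
Qed.

(** For a = 0 the constant 1 - 2 d / N of [TzE] is the difference of the values of [alpha0] at (0,
    d) and (0, -d); for a nonzero both are 0 since d is nonzero. *)
Lemma eis_diff a d : eis R a d tau - eis R a (- d) tau = (Tz a d x)%:C.
Proof.
have [->|d0] := eqVneq d 0; first by rewrite oppr0 subrr /Tz eqxx.
have dN : (0 < d < N)%N by rewrite Zmod_gt0 d0 Zmod_lt.
rewrite (TzE (Zmod_lt N0 a) dN) rmorphD /= -(qcomb a d0) /eis opprK.
have -> : (if (a : nat) == 0%N then 1 - 2 * ((d : nat)%:R / N%:R) else 0) = alpha0 R a d - alpha0 R a (- d).
  have -> : ((a : nat) == 0%N) = (a == 0) by rewrite -[LHS]negbK -lt0n Zmod_gt0 negbK.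
  rewrite /alpha0 oppr_eq0 (negbTE d0); case: eqP => _; last by rewrite subrr.
  by rewrite frac_opp// frac_Zmod opprK; field; rewrite lt0r_neq0.
by rewrite rmorphB /=; ring.
Qed.

(** Symmetry and oddness reduce the sum to [eis_diff] with indices exchanged: e_(a,-d) = e_(-d,a) =
    - e_(d,-a). *)
Lemma eis_sum a d : eis R a d tau + eis R a (- d) tau = (Tz d a x)%:C.
Proof.
rewrite -eis_diff [eis R a d tau]eisC [eis R a (- d) tau]eisC.
have -> : eis R (- d) a tau = - eis R d (- a) tau by rewrite -eisN opprK.
by [].
Qed.

Lemma F_axis a b c d : eis R a d tau * eis R b (- c) tau + eis R a (- d) tau * eis R b c tau =
  (2^-1 * (Tz d a x * Tz c b x - Tz a d x * Tz b c x))%:C.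
Proof.
have h1 := eis_diff a d; have h2 := eis_sum a d; have h3 := eis_diff b c; have h4 := eis_sum b c.
have -> : (2^-1 * (Tz d a x * Tz c b x - Tz a d x * Tz b c x))%:C =
  2^-1 * ((Tz d a x)%:C * (Tz c b x)%:C - (Tz a d x)%:C * (Tz b c x)%:C) :> R[i].
  by rewrite [LHS]rmorphM rmorphB !rmorphM /= fmorphV rmorph_nat.
rewrite -h1 -h2 -h3 -h4; by field.
Qed.

Lemma axis_upper : upper_half_plane tau. Proof. exact: tauH. Qed.
End Axis.

Section Coefficients.
Variables a b c d : Zmod N.
Hypotheses (hu : (a, b) != 0) (hv : (c, d) != 0).

Definition fcoef n : R := conv (ecoef a d) (ecoef b (- c)) n + conv (ecoef a (- d)) (ecoef b c) n.

Lemma fcoef_cvg tau : upper_half_plane tau ->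
  series (fun n => (fcoef n)%:C * qpow n%:R tau : C) @ \oo -->
  eis R a d tau * eis R b (- c) tau + eis R a (- d) tau * eis R b c tau.
Proof.
move=> ht; have h := cvgD (@conv_cvg a d b (- c) tau ht) (@conv_cvg a (- d) b c tau ht).
suff e : series (fun n => (fcoef n)%:C * qpow n%:R tau : C) =
  (fun n => series (fun n => (conv (ecoef a d) (ecoef b (- c)) n)%:C * qpow n%:R tau : C) n +
     series (fun n => (conv (ecoef a (- d)) (ecoef b c) n)%:C * qpow n%:R tau : C) n).
  by rewrite e; exact: h.
apply/funext => n; rewrite /series /= -big_split /=; apply: eq_bigr => i _.
by rewrite /fcoef rmorphD /= mulrDl.
Qed.

Lemma fcoef_bound : exists2 D, 0 <= D & forall n, `|fcoef n| <= D * n.+1%:R ^+ 6.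
Proof.
have [D D0 hD] := conv_bound a d b (- c); have [E E0 hE] := conv_bound a (- d) b c.
exists (D + E); first exact: addr_ge0.
by move=> n; rewrite mulrDl; apply: (le_trans (ler_normD _ _)); exact: lerD.
Qed.

Lemma ecoef0 p q : ecoef p q 0 = alpha0 R p q.
Proof. by rewrite /ecoef /sigma /graded !big_nat1 /= /wdiv /= addr0 subr0. Qed.

(** [alpha0] is odd in its second argument unless that argument is 0 and the first is not. If both
    pairs are odd, the two products add up, and one vanishes factorwise since a or b is nonzero; if
    exactly one pair is exceptional, the products cancel; both being exceptional means c = d = 0. *)
Lemma fcoef0 : fcoef 0 = 0.
Proof.
rewrite /fcoef /conv /graded !big_nat1 /= !ecoef0.
have nz (p q : Zmod N) : p != 0 -> q != 0 -> alpha0 R p q = 0.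
  by move=> /negbTE p0 /negbTE q0; rewrite /alpha0 p0 q0.
have z0 : alpha0 R (0 : Zmod N) (0 : Zmod N) = 0 by rewrite /alpha0 eqxx.
have Nr (p q : Zmod N) : (alpha0 R p (- q) = - alpha0 R p q /\ (p != 0 -> alpha0 R p q = 0)) \/
    (p != 0 /\ q = 0).
  have [p0|p0] := eqVneq p 0; have [q0|q0] := eqVneq q 0.
  - by left; rewrite p0 q0 oppr0 z0 oppr0.
  - by left; rewrite p0 /alpha0 eqxx oppr_eq0 (negbTE q0); split => //; exact: frac_opp.
  - by right.
  - by left; rewrite !nz ?oppr_eq0// oppr0.
have [[-> ha]|[a0 d0]] := Nr a d; have [[-> hb]|[b0 c0]] := Nr b c.
- have [a0|a0] := eqVneq a 0; last by rewrite ha//; ring.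
  have b0 : b != 0 by apply: contraNneq hu => ->; rewrite a0.
  by rewrite hb//; ring.
- by rewrite c0 oppr0; ring.
- by rewrite d0 oppr0; ring.
- by case/eqP: hv; rewrite c0 d0.
Qed.

Lemma F_series (x : R) : 0 < x -> series (fun n => fcoef n * ee lam (n%:R * x)) @ \oo -->
  2^-1 * (Tz d a x * Tz c b x - Tz a d x * Tz b c x).
Proof.
move=> x0; have h := fcoef_cvg (axis_upper x0); rewrite F_axis// in h.
have hR : (fun n => Re (series (fun n => (fcoef n)%:C * qpow n%:R ((x / N%:R)%:C * ci R) : C) n)) @ \oo -->
  Re (2^-1 * (Tz d a x * Tz c b x - Tz a d x * Tz b c x))%:C by apply: cvg_Re; exact: h.
suff e : (fun n => Re (series (fun n => (fcoef n)%:C * qpow n%:R ((x / N%:R)%:C * ci R) : C) n)) =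
  series (fun n => fcoef n * ee lam (n%:R * x)) by rewrite -e; exact: hR.
apply/funext => n; rewrite Re_series; congr (series _ n); apply/funext => k.
by rewrite qpow_axis// -rmorphM.
Qed.
End Coefficients.
End Eisenstein.

(** * Mellin transforms and the functional equation *)

Section ComplexIntegral.
Variable R : realType.
Notation mu := (@lebesgue_measure R).
Local Notation Rp := (`]0%R, +oo[%classic : set R).
Notation C := (R[i]^o).
Notation Re := complex.Re.
Notation Im := complex.Im.
Implicit Types (D : set R) (g h : R -> C).

Definition CI D g : C := (\int[mu]_(x in D) Re (g x)) +i* (\int[mu]_(x in D) Im (g x)).

Definition citg D g := itg D (fun x => Re (g x)) /\ itg D (fun x => Im (g x)).

Lemma citg_dom D g (G : R -> R) : measurable D ->
  measurable_fun D (fun x => Re (g x)) -> measurable_fun D (fun x => Im (g x)) ->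
  (forall x, D x -> modC (g x) <= G x) -> itg D G -> citg D g.
Proof.
move=> mD mr mi gG iG; split.
  by apply: (itg_le mD mr _ iG) => x Dx; apply: le_trans (gG x Dx); exact: Re_le.
by apply: (itg_le mD mi _ iG) => x Dx; apply: le_trans (gG x Dx); exact: Im_le.
Qed.

Lemma eq_CI D g h : (forall x, D x -> g x = h x) -> CI D g = CI D h.
Proof. by move=> gh; congr (_ +i* _); apply: eq_RI => x Dx; rewrite gh. Qed.

Lemma eq_citg D g h : measurable D -> (forall x, D x -> g x = h x) -> citg D g -> citg D h.
Proof.
by move=> mD gh [i1 i2]; split; [apply: eq_itg i1|apply: eq_itg i2] => // x Dx; rewrite gh.
Qed.

Lemma CID D g h : measurable D -> citg D g -> citg D h ->
  CI D (fun x => g x + h x) = CI D g + CI D h.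
Proof.
move=> mD [g1 g2] [h1 h2]; apply: eqReIm => /=; rewrite -RID//; apply: eq_RI => x _.
  exact: ReCD.
exact: ImCD.
Qed.

Lemma citgD D g h : measurable D -> citg D g -> citg D h -> citg D (fun x => g x + h x).
Proof.
move=> mD [g1 g2] [h1 h2]; split.
  by apply: (eq_itg _ mD (itgD mD g1 h1)) => x _; rewrite ReCD.
by apply: (eq_itg _ mD (itgD mD g2 h2)) => x _; rewrite ImCD.
Qed.

Lemma citgZ D (k : C) g : measurable D -> citg D g -> citg D (fun x => k * g x).
Proof.
move=> mD [g1 g2]; split.
  by apply: (eq_itg _ mD (itgB mD (itgZ (Re k) mD g1) (itgZ (Im k) mD g2))) => x _; rewrite ReCM.
by apply: (eq_itg _ mD (itgD mD (itgZ (Re k) mD g2) (itgZ (Im k) mD g1))) => x _; rewrite ImCM.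
Qed.

Lemma CIZ D (k : C) g : measurable D -> citg D g -> CI D (fun x => k * g x) = k * CI D g.
Proof.
move=> mD [g1 g2]; apply: eqReIm.
  rewrite [RHS]ReCM /= -!RIZ// -RIB//; [|exact: itgZ..].
  by apply: eq_RI => x _; exact: ReCM.
rewrite [RHS]ImCM /= -!RIZ// -RID//; [|exact: itgZ..].
by apply: eq_RI => x _; exact: ImCM.
Qed.

Lemma CIB D g h : measurable D -> citg D g -> citg D h ->
  CI D (fun x => g x - h x) = CI D g - CI D h.
Proof.
move=> mD ig ih; rewrite -[CI D h]mul1r -mulNr -CIZ// -CID//; last exact: citgZ.
by apply: eq_CI => x _; rewrite mulN1r.
Qed.

(** The two components are estimated separately, whence the factor 2. *)
Lemma CI_le D g (G : R -> R) : measurable D -> citg D g ->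
  (forall x, D x -> modC (g x) <= G x) -> itg D G -> modC (CI D g) <= 2 * \int[mu]_(x in D) G x.
Proof.
move=> mD [g1 g2] gG iG; apply: (le_trans (modC_le _)) => /=.
have -> : 2 * \int[mu]_(x in D) G x = \int[mu]_(x in D) G x + \int[mu]_(x in D) G x by ring.
apply: lerD; apply: RI_le => //; try exact: itg_meas.
  by move=> x Dx; apply: le_trans (gG x Dx); exact: Re_le.
by move=> x Dx; apply: le_trans (gG x Dx); exact: Im_le.
Qed.

Lemma Re_cpow (x : R) (s : C) : Re (cpow x s) = expR (Re s * ln x) * cos (Im s * ln x).
Proof. by rewrite /cpow /cexp; case: s => a b /=; rewrite !mulr0 subr0 add0r. Qed.

Lemma Im_cpow (x : R) (s : C) : Im (cpow x s) = expR (Re s * ln x) * sin (Im s * ln x).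
Proof. by rewrite /cpow /cexp; case: s => a b /=; rewrite !mulr0 subr0 add0r. Qed.

Lemma modC_cpow (x : R) (s : C) : modC (cpow x s) = expR (Re s * ln x).
Proof. by rewrite modC_cexp; case: s => a b /=; rewrite mulr0 subr0. Qed.

Lemma cpowD (x : R) (s w : C) : cpow x (s + w) = cpow x s * cpow x w.
Proof. by rewrite /cpow -cexpD mulrDl. Qed.

Lemma cpow0 (x : R) : cpow x (0 : C) = 1.
Proof. by rewrite /cpow mul0r cexp0. Qed.

Lemma cpowN (x : R) (s : C) : cpow x (- s) = (cpow x s)^-1.
Proof. by rewrite /cpow -cexpN mulNr. Qed.

Lemma cpow1 (x : R) : 0 < x -> cpow x (1 : C) = x%:C.
Proof. by move=> x0; rewrite /cpow mul1r cexp_real lnK. Qed.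

Lemma cpowM (x y : R) (s : C) : 0 < x -> 0 < y -> cpow (x * y) s = cpow x s * cpow y s.
Proof. by move=> x0 y0; rewrite /cpow -cexpD lnM// rmorphD /= mulrDr. Qed.

Lemma cpowV (x : R) (s : C) : 0 < x -> cpow x^-1 s = cpow x (- s).
Proof. by move=> x0; rewrite /cpow lnV// rmorphN /= mulrN mulNr. Qed.

Lemma dv_Re_cpow (x : R) (k s : C) : 0 < x ->
  dv (fun y => Re (k * cpow y s)) x (Re (k * s * cpow x s) / x).
Proof.
move=> x0; have dl (c : R) : dv (fun y => c * ln y) x (c / x).
  by apply: dv_eq (dvZ c (@dv_ln R id x 1 x0 (dv_id x))); rewrite mulrA mulr1.
have d1 := dvM (dv_exp (dl (Re s))) (dv_cos (dl (Im s))).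
have d2 := dvM (dv_exp (dl (Re s))) (dv_sin (dl (Im s))).
have d3 := dvB (dvZ (Re k) d1) (dvZ (Im k) d2).
apply: (@dv_ext _ (fun y => Re k * (expR (Re s * ln y) * cos (Im s * ln y)) -
    Im k * (expR (Re s * ln y) * sin (Im s * ln y)))).
  by move=> y; rewrite ReCM Re_cpow Im_cpow.
apply: dv_eq d3; rewrite ReCM Re_cpow Im_cpow ReCM ImCM.
move: (expR _) (cos _) (sin _) (lt0r_neq0 x0) => e p q xn.
by field.
Qed.

Lemma ccpos_cpow (k s : C) : cpos (fun x => Re (k * cpow x s)) /\ cpos (fun x => Im (k * cpow x s)).
Proof.
split; first by move=> x x0; have h := dv_Re_cpow k s x0; exact: is_derive_cts h.
move=> x x0; have h := dv_Re_cpow (- ci R * k) s x0.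
have -> : (fun x => Im (k * cpow x s)) = (fun y => Re (- ci R * k * cpow y s)).
  by apply/funext => y; case: (k) (cpow y s) => [a b] [c d] /=; ring.
exact: is_derive_cts h.
Qed.

Lemma pow_eeR p (l : R) : 0 < l -> exists B l' : R, [/\ 0 <= B, 0 < l' &
  forall x : R, 0 <= x -> (1 + x) ^+ p * ee l x <= B * ee l' x].
Proof.
elim: p l => [|p IH] l l1.
  by exists 1, l; split => // n; rewrite expr0 !mul1r.
have l2 : 0 < l / 2 by rewrite divr_gt0.
have [D [l' [D0 l'0 h]]] := IH _ l2.
exists (D * (1 + 2 / (l / 2))), l'; split => //; first by nonneg.
move=> x x0; have -> : ee l x = ee (l / 2) x * ee (l / 2) x.
  by rewrite -eeD /ee; congr expR; field.
have e2 : (1 + x) * ee (l / 2) x <= 1 + 2 / (l / 2).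
  have h1 := xee_le l2 x0; have h2 : ee (l / 2) x <= 1 by apply: ee_le1 => //; exact: ltW.
  have h3 : ee (l / 2 / 2) x <= 1 by apply: ee_le1 => //; nonneg.
  have h4 : 2 / (l / 2) * ee (l / 2 / 2) x <= 2 / (l / 2) by rewrite ler_piMr//; nonneg.
  rewrite mulrDl mul1r; apply: lerD => //; exact: le_trans h1 h4.
have -> : (1 + x) ^+ p.+1 * (ee (l / 2) x * ee (l / 2) x) =
  ((1 + x) ^+ p * ee (l / 2) x) * ((1 + x) * ee (l / 2) x) by rewrite exprSr; ring.
have -> : D * (1 + 2 / (l / 2)) * ee l' x = (D * ee l' x) * (1 + 2 / (l / 2)) by ring.
have y0 : 0 <= 1 + x by rewrite addr_ge0.
apply: ler_pM; [by rewrite mulr_ge0 ?exprn_ge0 ?ee_ge0|by rewrite mulr_ge0 ?ee_ge0|exact: h|exact: e2].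
Qed.

Lemma pow_nat_bound (r : R) : exists n : nat, forall x : R, 0 < x -> 1 <= x \/ 0 <= r ->
  expR (r * ln x) <= (1 + x) ^+ n.
Proof.
exists (Num.bound `|r|) => x x0 h.
have rn : r <= (Num.bound `|r|)%:R.
  by apply: le_trans (ler_norm r) _; by apply/ltW/archi_boundP.
have n0 : 0 <= (Num.bound `|r|)%:R :> R by [].
have y0 : 0 < 1 + x by rewrite addr_gt0.
have l1 : 0 <= ln (1 + x) by apply: ln_ge0; rewrite lerDl ltW.
have le1 : ln x <= ln (1 + x) by rewrite ler_ln ?posrE// lerDr.
rewrite -[(1 + x) ^+ _]lnK ?posrE ?exprn_gt0// lnXn// ler_expR -mulr_natl.
case: h => h.
  have lx : 0 <= ln x by apply: ln_ge0.
  apply: (@le_trans _ _ ((Num.bound `|r|)%:R * ln x)); first by rewrite ler_wpM2r.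
  by rewrite ler_wpM2l.
apply: (@le_trans _ _ (r * ln (1 + x))); first by rewrite ler_wpM2l.
by rewrite ler_wpM2r.
Qed.

Section Tail.
Variables (f : R -> R) (A kap : R).
Hypotheses (cf : cpos f) (kap0 : 0 < kap) (A0 : 0 <= A) (fA : forall x, 1 <= x -> `|f x| <= A * ee kap x).
Let J := (`[1%R, +oo[%classic : set R).

Let JRp : J `<=` Rp.
Proof. by move=> x; rewrite /J /= !in_itv/= !andbT; apply: lt_le_trans. Qed.

Let mJ : measurable J. Proof. exact: measurable_itv. Qed.

Let Jge x : J x -> 1 <= x. Proof. by rewrite /J /= in_itv/= andbT. Qed.

(** The upper part of a Mellin transform, without the usual shift by 1 in the exponent. *)
Definition MT (s : C) : C := CI J (fun x => (f x)%:C * cpow x s).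

Let ln_le (x : R) : 1 <= x -> 0 <= ln x <= 1 + x.
Proof.
move=> x1; rewrite ln_ge0//=; have x0 : 0 < x by exact: lt_le_trans x1.
have := expR_ge1Dx (ln x); rewrite lnK//; lra.
Qed.

Let tail_bound p (s : C) : exists2 G : R -> R, itg J G &
  forall x, J x -> (1 + x) ^+ p * (`|f x| * modC (cpow x s)) <= G x.
Proof.
have [n hn] := pow_nat_bound (Re s).
have [D [l' [D0 l'0 hD]]] := pow_eeR (p + n) kap0.
exists (fun x => A * D * ee l' x).
  by apply: itgZ => //; apply: (itgS _ _ JRp (itg_ee l'0)) => //; exact: measurable_itv.
move=> x /Jge x1; have x0 : 0 < x by exact: lt_le_trans x1.
have y0 : 0 <= 1 + x by rewrite addr_ge0// ltW.
have e1 : modC (cpow x s) <= (1 + x) ^+ n by rewrite modC_cpow; apply: hn => //; left.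
apply: (@le_trans _ _ ((1 + x) ^+ p * (A * ee kap x * (1 + x) ^+ n))).
  rewrite ler_wpM2l ?exprn_ge0//; apply: ler_pM => //; [exact: modC_ge0|exact: fA].
have -> : (1 + x) ^+ p * (A * ee kap x * (1 + x) ^+ n) = A * ((1 + x) ^+ (p + n) * ee kap x).
  by rewrite exprD; ring.
by rewrite -[leRHS]mulrA ler_wpM2l// hD// ltW.
Qed.

Lemma tail_citg p (s : C) : citg J (fun x => (ln x ^+ p * f x)%:C * cpow x s).
Proof.
have [G iG hG] := tail_bound p s.
have cl : cpos (fun x => ln x ^+ p * f x).
  apply: cposM => //; elim: p {iG hG} => [|q IH]; first by move=> x _; exact: cvg_cst.
  suff -> : (fun x : R => ln x ^+ q.+1) = (fun x => ln x * ln x ^+ q).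
    by apply: cposM => // x x0; exact: continuous_ln.
  by apply/funext => x; rewrite exprS.
have [c1 c2] := ccpos_cpow 1 s.
apply: (citg_dom mJ _ _ _ iG).
- suff -> : (fun x => Re ((ln x ^+ p * f x)%:C * cpow x s)) = (fun x => ln x ^+ p * f x * Re (1 * cpow x s)).
    by apply: measurable_funS (cpos_meas (cposM cl c1)).
  by apply/funext => x; rewrite mul1r ReCM /= mul0r subr0.
- suff -> : (fun x => Im ((ln x ^+ p * f x)%:C * cpow x s)) = (fun x => ln x ^+ p * f x * Im (1 * cpow x s)).
    by apply: measurable_funS (cpos_meas (cposM cl c2)).
  by apply/funext => x; rewrite mul1r ImCM /= mul0r addr0.
- move=> x Jx; apply: le_trans (hG x Jx); have /andP[l1 l2] := ln_le (Jge Jx).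
  rewrite modCM modC_real normrM -mulrA; apply: ler_wpM2r; first by rewrite mulr_ge0 ?modC_ge0.
  rewrite normrX ger0_norm// lerXn2r// nnegrE//; exact: le_trans l2.
Qed.

(** The remainder of e^(h ln x) is quadratic in h with a coefficient of polynomial growth in x, so
    its integral is quadratic too; [dvC] turns this into holomorphy. *)
Lemma MT_est (s : C) : exists (D : C) (K : R), forall h : C, modC h < 1 ->
  modC (MT (h + s) - MT s - h * D) <= K * modC h ^+ 2.
Proof.
(* Two powers of 1 + x for the square of ln x in the remainder, one for e^(|h| ln x) with |h| <
   1. *)
have [G iG hG] := tail_bound 3 s.
exists (CI J (fun x => (ln x ^+ 1 * f x)%:C * cpow x s)), (2 * (4 * \int[mu]_(x in J) G x)) => h h1.
have i0 z : citg J (fun x => (f x)%:C * cpow x z).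
  by have := tail_citg 0 z; apply: eq_citg => // x _; rewrite expr0 mul1r.
have i1 := tail_citg 1 s.
have ih := citgZ h mJ i1.
have i2 : citg J (fun x => (f x)%:C * cpow x (h + s) - (f x)%:C * cpow x s).
  have := citgD mJ (i0 (h + s)) (citgZ (-1) mJ (i0 s)).
  by apply: eq_citg => // x _; rewrite mulN1r.
rewrite /MT -CIB// -CIZ// -CIB//.
have hh := modC_ge0 h.
have iG2 : itg J (fun x => 4 * modC h ^+ 2 * G x) by exact: itgZ.
have -> : 2 * (4 * \int[mu]_(x in J) G x) * modC h ^+ 2 = 2 * \int[mu]_(x in J) (4 * modC h ^+ 2 * G x).
  by rewrite RIZ//; ring.
apply: CI_le => //.
  have := citgD mJ i2 (citgZ (-1) mJ ih).
  by apply: eq_citg => // x _; rewrite mulN1r.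
move=> x Jx; have x1 := Jge Jx; have x0 : 0 < x by exact: lt_le_trans x1.
have /andP[l1 l2] := ln_le x1.
have -> : (f x)%:C * cpow x (h + s) - (f x)%:C * cpow x s - h * ((ln x ^+ 1 * f x)%:C * cpow x s) =
  (f x)%:C * cpow x s * (cexp (h * (ln x)%:C) - 1 - h * (ln x)%:C).
  by rewrite cpowD expr1 rmorphM /= -[cexp _]/(cpow x h); ring.
rewrite modCM modCM modC_real.
have hx : modC (h * (ln x)%:C) = modC h * ln x by rewrite modCM modC_real ger0_norm.
have e1 := modC_cexp_m1z (h * (ln x)%:C); rewrite hx in e1.
have e2 : expR (modC h * ln x) <= 1 + x.
  apply: (@le_trans _ _ (expR (ln x))); first by rewrite ler_expR ler_piMl// ltW.
  by rewrite lnK// lerDr.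
have F0 : 0 <= `|f x| * modC (cpow x s) by rewrite mulr_ge0 ?modC_ge0.
apply: (@le_trans _ _ (`|f x| * modC (cpow x s) * (4 * modC h ^+ 2 * (1 + x) ^+ 3))).
  rewrite ler_wpM2l//; apply: (le_trans e1).
  have -> : 4 * modC h ^+ 2 * (1 + x) ^+ 3 = 4 * (modC h * (1 + x)) ^+ 2 * (1 + x) by ring.
  apply: ler_pM; [by nonneg|exact: expR_ge0| |exact: e2].
  rewrite ler_wpM2l// lerXn2r// ?nnegrE ?mulr_ge0//; first by rewrite addr_ge0// ltW.
  by rewrite ler_wpM2l.
have -> : `|f x| * modC (cpow x s) * (4 * modC h ^+ 2 * (1 + x) ^+ 3) =
  4 * modC h ^+ 2 * ((1 + x) ^+ 3 * (`|f x| * modC (cpow x s))) by ring.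
rewrite ler_wpM2l//; [by nonneg|exact: hG].
Qed.
End Tail.

End ComplexIntegral.

(** * The completed L-function and its continuation *)

Section Mellin.
Variable R : realType.
Notation mu := (@lebesgue_measure R).
Local Notation Rp := (`]0%R, +oo[%classic : set R).
Local Notation J := (`[1%R, +oo[%classic : set R).
Notation C := (R[i]^o).
Notation Re := complex.Re.
Notation Im := complex.Im.

Let mJ : measurable J. Proof. exact: measurable_itv. Qed.
Let mRp : measurable Rp. Proof. exact: measurable_itv. Qed.
Let m01 : measurable (`]0%R, 1%R]%classic : set R). Proof. exact: measurable_itv. Qed.

Let Jgt0 (x : R) : J x -> 0 < x.
Proof. by rewrite /= in_itv/= andbT; apply: lt_le_trans. Qed.

Lemma itg_invsq : itg J (fun x => x ^- 2).
Proof.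
have i1 : itg (`]0%R, 1%R]%classic : set R) (fun=> 1 : R).
  have i0 : itg `[0%R, 1%R] (fun=> 1 : R) by apply: itg_cc => x _; exact: cvg_cst.
  by apply: (itgS _ _ _ i0) => // x /=; rewrite !in_itv/= => /andP[/ltW-> ->].
have c1 : cpos (fun=> 1 : R) by move=> x _; exact: cvg_cst.
have [i _] := RI_inv1y c1 i1.
by apply: (eq_itg _ mJ i) => x _; rewrite mulr1.
Qed.

Section Power.
Variable w : C.
Hypothesis w1 : Re w <= -1.

Let wn : w != 0.
Proof. by apply: contraTneq w1 => ->; rewrite /= -ltNge ltrN10. Qed.

Let cb (x : R) : 1 <= x -> modC (cpow x w) <= x^-1.
Proof.
move=> x1; have x0 : 0 < x by exact: lt_le_trans x1.
rewrite modC_cpow -[leRHS]lnK ?posrE ?invr_gt0// ler_expR lnV// -mulN1r.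
by rewrite ler_wpM2r// ln_ge0.
Qed.

Let cpow_pred (x : R) : 0 < x -> cpow x (w - 1) = cpow x w * (x^-1)%:C.
Proof. by move=> x0; rewrite cpowD cpowN cpow1// fmorphV. Qed.

(** The factor [k] lets one real statement serve twice: k = 1 gives the real part of the integral, k
    = - i the imaginary part. *)
Lemma pow_itg (k : C) : itg J (fun x => Re (k * cpow x (w - 1))) /\
  \int[mu]_(x in J) Re (k * cpow x (w - 1)) = - Re (k / w).
Proof.
have ck (l z : C) : cpos (fun x => Re (l * cpow x z)) by have [] := ccpos_cpow l z.
have ii : itg J (fun x => Re (k * cpow x (w - 1))).
  apply: (itg_le mJ _ _ (itgZ (modC k) mJ itg_invsq)).
    apply: measurable_funS (cpos_meas (ck k (w - 1))) => // x Jx.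
    by rewrite Rp_gt0; exact: Jgt0.
  move=> x Jx; have x0 := Jgt0 Jx; apply: (le_trans (Re_le _)).
  rewrite modCM cpow_pred// modCM modC_real ler_wpM2l ?modC_ge0// ger0_norm ?invr_ge0 ?(ltW x0)//.
  rewrite -exprVn expr2 ler_wpM2r ?invr_ge0 ?(ltW x0)//; apply: cb.
  by move: Jx; rewrite /= in_itv/= andbT.
split => //.
have dF (x : R) : 1 <= x -> dv (fun y => Re (k / w * cpow y w)) x (Re (k * cpow x (w - 1))).
  move=> x1; have x0 : 0 < x by exact: lt_le_trans x1.
  apply: dv_eq (dv_Re_cpow (k / w) w x0).
  by rewrite divfK// cpow_pred// mulrA [RHS]ReCM /= mulr0 subr0.
have F0 : Re (k / w * cpow x w) @[x --> +oo] --> (0 : R).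
  have iv : x^-1 @[x --> +oo] --> (0 : R).
    apply/cvgrPdist_le => e e0; near=> x.
    have x1 : e^-1 <= x by near: x; apply: nbhs_pinfty_ge; rewrite num_real.
    have x0 : 0 < x by apply: lt_le_trans x1; rewrite invr_gt0.
    rewrite sub0r normrN ger0_norm ?invr_ge0 ?(ltW x0)//.
    by rewrite -[e]invrK lef_pV2 ?posrE ?invr_gt0.
  apply/cvgrPdist_le => e e0.
  have iv2 : modC (k / w) * x^-1 @[x --> +oo] --> (0 : R).
    by rewrite -(mulr0 (modC (k / w))); apply: cvgM => //; exact: cvg_cst.
  move/cvgrPdist_le: iv2 => /(_ _ e0) H; near=> x.
  have x1 : 1 <= x by near: x; apply: nbhs_pinfty_ge; rewrite num_real.
  have h : `|0 - modC (k / w) * x^-1| <= e by near: x.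
  apply: le_trans h; rewrite !sub0r !normrN; apply: (le_trans (Re_le _)).
  rewrite modCM normrM (ger0_norm (modC_ge0 _)) ler_wpM2l ?modC_ge0//.
  by apply: (le_trans (cb x1)); exact: ler_norm.
rewrite (@ftcy _ (fun y => Re (k / w * cpow y w)) (fun x => Re (k * cpow x (w - 1))) 1 0 dF _ ii F0).
  by rewrite /cpow ln1 mulr0 cexp0 mulr1 sub0r.
by move=> x x1; apply: ck; exact: lt_le_trans x1.
Unshelve. all: by end_near. Qed.

Lemma pow_CI : citg J (fun x => cpow x (w - 1)) /\ CI J (fun x => cpow x (w - 1)) = - w^-1.
Proof.
have [i1 e1] := pow_itg 1; have [i2 e2] := pow_itg (- ci R).
have h1 x : Re (1 * cpow x (w - 1)) = Re (cpow x (w - 1)) by rewrite mul1r.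
have h2 x : Re (- ci R * cpow x (w - 1)) = Im (cpow x (w - 1)).
  by case: (cpow _ _) => a b /=; ring.
split.
  by split; [apply: (eq_itg (fun x _ => h1 x) mJ i1)|apply: (eq_itg (fun x _ => h2 x) mJ i2)].
apply: eqReIm.
  by rewrite /= -(eq_RI (fun x _ => h1 x)) e1 div1r; case: (w^-1).
rewrite /= -(eq_RI (fun x _ => h2 x)) e2; case: (w^-1) => a b /=; ring.
Qed.
End Power.

Variable N : nat.
Hypothesis N0 : (0 < N)%N.
Notation lam := (lam R N).
Let l0 : 0 < lam. Proof. exact: lam_gt0. Qed.
Let NN0 : 0 < N%:R :> R. Proof. by rewrite ltr0n. Qed.

Variables (phi psi : R -> R) (gam A kap D : R) (cf : nat -> R).
Hypotheses (cphi : cpos phi) (cpsi : cpos psi) (kap0 : 0 < kap) (A0 : 0 <= A) (D0 : 0 <= D).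
Hypotheses (phiA : forall x, 1 <= x -> `|phi x| <= A * ee kap x)
  (psiA : forall x, 1 <= x -> `|psi x| <= A * ee kap x)
  (phi_inv : forall t, 0 < t -> phi t^-1 = t ^+ 2 * (gam + psi t))
  (cf0 : cf 0 = 0) (cfD : forall n, `|cf n| <= D * n.+1%:R ^+ 6)
  (cf_phi : forall x, 0 < x -> series (fun n => cf n * ee lam (n%:R * x)) @ \oo --> phi x).

(** The Mellin transform of [phi] split at 1 and folded by [phi_inv]: the first term is the part
    above 1, [MT psi] is the inverted part below 1, and the constant [gam] integrates to the polar
    term at 2. The formula makes sense for every s other than 2. *)
Definition Lambda (s : C) : C := MT phi (s - 1) + MT psi (1 - s) + gam%:C / (s - 2).

Let entire (s : C) : C := MT phi (s - 1) + MT psi (1 - s).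

Let entire_dv z : exists D' : C, is_derive z (1 : C) entire D'.
Proof.
have [D1 [K1 h1]] := MT_est cphi kap0 A0 phiA (z - 1).
have [D2 [K2 h2]] := MT_est cpsi kap0 A0 psiA (1 - z).
exists (D1 - D2); apply: (@dvC R _ z _ (K1 + K2) 1 ltr01) => h hh.
have e1 : h + z - 1 = h + (z - 1) by rewrite addrA.
have e2 : 1 - (h + z) = - h + (1 - z) by ring.
rewrite /entire e1 e2.
have -> : MT phi (h + (z - 1)) + MT psi (- h + (1 - z)) - (MT phi (z - 1) + MT psi (1 - z)) - h * (D1 - D2) =
  (MT phi (h + (z - 1)) - MT phi (z - 1) - h * D1) + (MT psi (- h + (1 - z)) - MT psi (1 - z) - - h * D2) by ring.
apply: (le_trans (modCD _ _)); rewrite mulrDl; apply: lerD; first exact: h1.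
by rewrite -(modCN h); apply: h2; rewrite modCN.
Qed.

Let inv_dv (z : C) : z != 2 -> is_derive z (1 : C) (fun s : C => gam%:C / (s - 2) : C) (- gam%:C / (z - 2) ^+ 2 : C).
Proof.
move=> z2; have d0 : z - 2 != 0 by rewrite subr_eq0.
have n0 : 0 < modC (z - 2) by rewrite modC_gt0.
apply: (@dvC R _ z _ (2 * modC gam%:C / modC (z - 2) ^+ 3) (modC (z - 2) / 2)); first by rewrite divr_gt0.
move=> h hh.
have lo : modC (z - 2) / 2 <= modC (h + z - 2).
  have := modCB (h + z - 2) h; have -> : h + z - 2 - h = z - 2 by ring.
  lra.
have p0 : 0 < modC (h + z - 2) by apply: lt_le_trans lo; rewrite divr_gt0.
have d1 : h + z - 2 != 0 by rewrite -modC_gt0.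
have -> : gam%:C / (h + z - 2) - gam%:C / (z - 2) - h * (- gam%:C / (z - 2) ^+ 2) =
   gam%:C * h ^+ 2 / ((z - 2) ^+ 2 * (h + z - 2)) by field; rewrite d0 d1.
rewrite modCM modCV (modCM gam%:C) (modCM ((z - 2) ^+ 2)) !modCX.
have -> : 2 * modC gam%:C / modC (z - 2) ^+ 3 * modC h ^+ 2 = modC gam%:C * modC h ^+ 2 * (modC (z - 2) ^+ 2 * (modC (z - 2) / 2))^-1.
  by field; rewrite lt0r_neq0.
rewrite ler_wpM2l ?mulr_ge0 ?modC_ge0 ?sqr_ge0//.
by rewrite lef_pV2 ?posrE ?mulr_gt0 ?exprn_gt0 ?divr_gt0// ler_wpM2l ?sqr_ge0.
Qed.

Let Lambda_dv (z : C) : z != 2 -> exists D' : C, is_derive z (1 : C) Lambda D'.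
Proof.
move=> z2; have [D1 h1] := entire_dv z; have h2 := inv_dv z2.
exists (D1 + (- gam%:C / (z - 2) ^+ 2)); exact: is_deriveD h1 h2.
Qed.

Let near_neq (p : C) : p != 2 -> \forall s \near p, s != (2 : C).
Proof.
move=> p2; have n0 : 0 < modC (p - 2) by rewrite modC_gt0 subr_eq0.
have : (fun s : C => s) @ p --> p by exact: cvg_id.
move=> /cvg_modC/cvgrPdist_lt/(_ _ n0); apply: filterS => s.
rewrite sub0r normrN (ger0_norm (modC_ge0 _)) => h; apply/eqP => s2.
by move: h; rewrite s2 -modCN opprB ltxx.
Qed.

Lemma Lambda_meromorphic : meromorphic Lambda.
Proof.
move=> p; have [->|p2] := eqVneq p 2; last first.
  exists 0%N, Lambda; split.
    apply: filterS (near_neq p2) => s s2; have [D' h] := Lambda_dv s2.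
    by case: h.
  by apply: filterE => s; rewrite expr0 mul1r.
exists 1%N, (fun s => (s - 2) * entire s + gam%:C); split.
  apply: filterE => s; have [D1 h1] := entire_dv s.
  have h0 : is_derive s (1 : C) (fun z : C => z - 2) 1.
    by apply: (@dvC R _ s _ 0 1 ltr01) => h _; rewrite mul0r mulr1 (_ : _ - _ = 0) ?modC0//; ring.
  have h2 := is_deriveM h0 h1.
  have h3 : is_derive s (1 : C) (fun z : C => gam%:C : C) 0 by exact: is_derive_cst.
  by have [] := is_deriveD h2 h3.
near=> s; have s2 : s - 2 != 0.
  rewrite subr_eq0; near: s; exact: nbhs_dnbhs_neq.
by rewrite expr1 /Lambda mulrDr mulrCA mulfV// mulr1.
Unshelve. all: by end_near. Qed.

(** As [cf 0] vanishes and [Lambda] is differentiable at 0, the limit is a plain value. *)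
Lemma Lambda_lim : Lambda s + (cf 0)%:C / s @[s --> (0 : C)^'] -->
  ((\int[mu]_(x in J) (x^-1 * phi x) + \int[mu]_(x in J) (x * psi x) - gam / 2)%:C : C).
Proof.
have z2 : (0 : C) != 2 by rewrite eq_sym pnatr_eq0.
have [D' [h _]] := Lambda_dv z2.
have c0 : Lambda @ (0 : C) --> Lambda 0.
  by apply/differentiable_continuous; rewrite -derivable1_diffP.
have c1 : Lambda @ (0 : C)^' --> Lambda 0 by apply: cvg_within_filter; exact: c0.
have -> : (\int[mu]_(x in J) (x^-1 * phi x) + \int[mu]_(x in J) (x * psi x) - gam / 2)%:C = Lambda 0.
  have e1 (x : R) : J x -> (phi x)%:C * cpow x (0 - 1 : C) = (x^-1 * phi x)%:C.
    by move=> /Jgt0 x0; rewrite sub0r cpowN cpow1// -fmorphV -rmorphM /= mulrC.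
  have e2 (x : R) : J x -> (psi x)%:C * cpow x (1 - 0 : C) = (x * psi x)%:C.
    by move=> /Jgt0 x0; rewrite subr0 cpow1// -rmorphM /= mulrC.
  rewrite /Lambda /MT (eq_CI e1) (eq_CI e2).
  have z0 : \int[mu]_(x in J) (0 : R) = 0 by apply: RI0.
  have e3 : gam%:C / (0 - 2) = (- (gam / 2))%:C :> R[i].
    by rewrite sub0r invrN mulrN rmorphN rmorphM /= fmorphV rmorph_nat.
  by rewrite e3 /CI /= !z0; apply: eqReIm; rewrite /= ?addr0.
have -> : (fun s : C => Lambda s + (cf 0)%:C / s) = Lambda by apply/funext => s; rewrite cf0 mul0r addr0.
exact: c1.
Qed.

(** The exponent 8 is 6 for the growth of the coefficients plus 2 for summability; the factor 2^6
    replaces n + 2 by n + 1. *)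
Lemma coef_pow (q : R) n : 8%:R <= q ->
  `|cf n.+1| * expR (- (q * ln n.+1%:R)) <= D * 2 ^+ 6 * (n.+1%:R ^+ 2)^-1.
Proof.
move=> q8; have x1 : 1 <= n.+1%:R :> R by rewrite ler1n.
have h1 : `|cf n.+1| <= D * 2 ^+ 6 * n.+1%:R ^+ 6.
  apply: (le_trans (cfD _)); rewrite -mulrA; apply: ler_wpM2l; first exact: D0.
  have le2 : n.+2%:R <= 2 * n.+1%:R :> R by rewrite -natrM ler_nat; lia.
  by rewrite -exprMn; apply: lerXn2r; rewrite ?nnegrE ?ler0n// mulr_ge0 ?ler0n.
move: (n.+1%:R : R) x1 h1 => x x1 h1; have x0 : 0 < x by exact: lt_le_trans x1.
have h2 : expR (- (q * ln x)) <= (x ^+ 8)^-1.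
  rewrite expRN lef_pV2 ?posrE ?expR_gt0 ?exprn_gt0//.
  rewrite -[leLHS]lnK; last by rewrite posrE exprn_gt0.
  rewrite lnXn// ler_expR -mulr_natl; apply: ler_wpM2r; last exact: q8.
  exact: ln_ge0.
have -> : D * 2 ^+ 6 * (x ^+ 2)^-1 = (D * 2 ^+ 6 * x ^+ 6) * (x ^+ 8)^-1.
  have -> : x ^+ 8 = x ^+ 6 * x ^+ 2 by rewrite -exprD.
  move: (D * 2 ^+ 6) => y; move: (x ^+ 6) (x ^+ 2) (lt0r_neq0 (exprn_gt0 6 x0)) (lt0r_neq0 (exprn_gt0 2 x0)) => u v un vn.
  by field; rewrite un vn.
by apply: ler_pM; [exact: normr_ge0|exact: expR_ge0|exact: h1|exact: h2].
Qed.

(** [g] will be the real or imaginary part of x^(s - 1). The hypothesis on absolute values is the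
    scaling of Euler's integral, and it gives the powers of n required by [coef_pow]. *)
Lemma termwise_real (g : R -> R) (q G0 : R) : 8%:R <= q -> 0 <= G0 ->
  (forall k, 0 < k -> itg Rp (fun x => g x * ee k x)) ->
  (forall k, 0 < k -> \int[mu]_(x in Rp) `|g x * ee k x| <= expR (- (q * ln k)) * G0) ->
  itg Rp (fun x => phi x * g x) /\
  series (fun n => cf n.+1 * \int[mu]_(x in Rp) (g x * ee (lam * n.+1%:R) x)) @ \oo -->
    \int[mu]_(x in Rp) (phi x * g x).
Proof.
move=> q8 G00 ig bg.
have lk n : 0 < lam * n.+1%:R by apply: mulr_gt0 => //; rewrite ltr0n.
have phiS x : 0 < x -> series (fun n => cf n.+1 * ee (lam * n.+1%:R) x) @ \oo --> phi x.
  move=> x0; have h := cf_phi x0.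
  have h' : (fun n => series (fun n => cf n * ee lam (n%:R * x)) n.+1) @ \oo --> phi x by rewrite cvg_shiftS.
  suff -> : series (fun n => cf n.+1 * ee (lam * n.+1%:R) x) = (fun n => series (fun n => cf n * ee lam (n%:R * x)) n.+1).
    exact: h'.
  apply/funext => n; rewrite /series /= big_nat_recl//= cf0 mul0r add0r.
  by apply: eq_bigr => k _; rewrite ee_scale.
pose f n x := cf n.+1 * (g x * ee (lam * n.+1%:R) x).
have fi n : itg Rp (f n) by apply: itgZ; [exact: mRp|exact: ig].
have cN : cvgn (series (fun n => \int[mu]_(x in Rp) `|f n x|)).
  apply: (@series_abs_cvg _ _ (fun n => expR (- (q * ln lam)) * G0 * (D * 2 ^+ 6) * (n.+1%:R ^+ 2)^-1)); last first.
    by apply/cvg_ex; exists (expR (- (q * ln lam)) * G0 * (D * 2 ^+ 6) * limn (series (fun k => (k.+1%:R ^+ 2)^-1 : R)));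
       apply: cvg_seriesZ; exact: cvg_invsq.
  move=> n; rewrite ger0_norm; last by apply: Rintegral_ge0.
  have -> : \int[mu]_(x in Rp) `|f n x| = `|cf n.+1| * \int[mu]_(x in Rp) `|g x * ee (lam * n.+1%:R) x|.
    rewrite -RIZ; [|exact: mRp|exact: (itg_norm mRp (ig _ (lk n)))].
    by apply: eq_RI => x _; rewrite /f normrM.
  apply: (le_trans (ler_wpM2l (normr_ge0 _) (bg _ (lk n)))).
  have -> : expR (- (q * ln (lam * n.+1%:R))) = expR (- (q * ln lam)) * expR (- (q * ln n.+1%:R)).
    rewrite lnM ?posrE ?ltr0n//; rewrite -expRD; congr expR; ring.
  have g0 : 0 <= expR (- (q * ln lam)) * G0 by apply: mulr_ge0; [exact: expR_ge0|].
  have -> : `|cf n.+1| * (expR (- (q * ln lam)) * expR (- (q * ln n.+1%:R)) * G0) =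
    expR (- (q * ln lam)) * G0 * (`|cf n.+1| * expR (- (q * ln n.+1%:R))) by ring.
  rewrite -[leRHS]mulrA; apply: ler_wpM2l; first exact: g0.
  exact: coef_pow.
have fF x : Rp x -> series (fun n => f n x) @ \oo --> phi x * g x.
  rewrite Rp_gt0 => x0; have h := @cvg_seriesZ R _ (g x) _ (phiS x x0).
  rewrite mulrC.
  suff -> : series (fun n => f n x) = series (fun n => g x * (cf n.+1 * ee (lam * n.+1%:R) x)) by exact: h.
  by apply: series_ext => n; rewrite /f; ring.
have [iF hF] := series_itg_abs mRp fi cN fF; split; first exact: iF.
suff -> : series (fun n => cf n.+1 * \int[mu]_(x in Rp) (g x * ee (lam * n.+1%:R) x)) =
  series (fun n => \int[mu]_(x in Rp) f n x) by exact: hF.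
by apply: series_ext => n; rewrite RIZ; [|exact: mRp|exact: ig].
Qed.

(* Boxed, so that trivial side conditions are not compared with the numeral. *)
Variant far (z : C) : Prop := Far of 8%:R < Re z.

Lemma farP (z : C) : far z -> 8%:R <= Re z.
Proof. by case=> /ltW. Qed.

Section Dirichlet.
Variable s : C.
Hypothesis s8 : far s.
Let sg := Re s.

Let Re1 : Re (s - 1) = sg - 1.
Proof. by rewrite ReCB. Qed.

Let sg1 : 0 <= sg - 1. Proof. by have := farP s8; rewrite -/sg; lra. Qed.

Let coef n : `|cf n.+1| * expR (- (sg * ln n.+1%:R)) <= D * 2 ^+ 6 * (n.+1%:R ^+ 2)^-1.
Proof. exact: coef_pow (farP s8). Qed.

Let r k (x : R) := expR ((sg - 1) * ln x) * ee k x.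

Let r_cpos k : cpos (r k).
Proof.
apply: cposM; last by apply: cts_cpos; exact: cts_ee.
move=> x x0; apply: (@continuous_comp _ _ _ (fun x => (sg - 1) * ln x) expR).
  by apply: cvgM; [exact: cvg_cst|exact: continuous_ln].
exact: continuous_expR.
Qed.

Let r_itg k : 0 < k -> itg Rp (r k).
Proof.
move=> k0; have [n hn] := pow_nat_bound (sg - 1).
have [B [l' [B0 l'0 hB]]] := pow_eeR n k0.
apply: (itg_bee (C := B) l'0); first exact: cpos_meas.
move=> x x0; rewrite ger0_norm ?mulr_ge0 ?expR_ge0 ?ee_ge0//.
by apply: le_trans (hB x (ltW x0)); rewrite ler_wpM2r ?ee_ge0//; apply: hn => //; right.
Qed.

Let G0 := \int[mu]_(x in Rp) r 1 x.

Let r_scale k : 0 < k -> \int[mu]_(x in Rp) r k x = expR (- (sg * ln k)) * G0.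
Proof.
move=> k0; have [i e] := RI_scale k0 (@r_cpos 1) (r_itg ltr01).
have h x : Rp x -> k * r 1 (k * x) = expR (sg * ln k) * r k x.
  rewrite Rp_gt0 => x0; rewrite /r lnM//.
  have -> : ee 1 (k * x) = ee k x by rewrite ee_scale mul1r.
  have ek : expR (ln k) = k by rewrite lnK.
  rewrite [RHS]mulrA -expRD mulrA; congr (_ * _).
  by rewrite -{1}ek -expRD; congr expR; ring.
rewrite /G0 e (eq_RI h) RIZ; [|exact: mRp|exact: r_itg].
by rewrite mulrA -expRD addNr expR0 mul1r.
Qed.

Let gt k (x : R) : C := cpow x (s - 1) * (ee k x)%:C.

Let nc_gt k x : modC (gt k x) = r k x.
Proof. by rewrite modCM modC_real modC_cpow Re1 ger0_norm// ee_ge0. Qed.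

Let gt_cpos k : cpos (fun x => Re (gt k x)) /\ cpos (fun x => Im (gt k x)).
Proof.
have [c1 c2] := ccpos_cpow 1 (s - 1).
have ce : cpos (ee k) by apply: cts_cpos; exact: cts_ee.
split.
  suff -> : (fun x => Re (gt k x)) = (fun x => Re (1 * cpow x (s - 1)) * ee k x) by exact: cposM.
  by apply/funext => x; rewrite mul1r /gt ReCM /= mulr0 subr0.
suff -> : (fun x => Im (gt k x)) = (fun x => Im (1 * cpow x (s - 1)) * ee k x) by exact: cposM.
by apply/funext => x; rewrite mul1r /gt ImCM /= mulr0 add0r.
Qed.

Let gt_citg k : 0 < k -> citg Rp (gt k).
Proof.
move=> k0; have [c1 c2] := gt_cpos k.
apply: (citg_dom mRp _ _ _ (r_itg k0)); [exact: cpos_meas|exact: cpos_meas|].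
by move=> x _; rewrite nc_gt.
Qed.

Let gamE : cGamma s = CI Rp (gt 1).
Proof.
have e x : Rp x -> cpow x (s - 1) * (expR (- x))%:C = gt 1 x by rewrite /gt /ee mul1r.
by rewrite -(eq_CI e).
Qed.

Let gt_scale k : 0 < k -> CI Rp (gt k) = cpow k (- s) * cGamma s.
Proof.
move=> k0; have [c1 c2] := gt_cpos 1; have [i1 i2] := gt_citg ltr01.
have [_ e1] := RI_scale k0 c1 i1; have [_ e2] := RI_scale k0 c2 i2.
have h x : Rp x -> k%:C * gt 1 (k * x) = cpow k s * gt k x.
  rewrite Rp_gt0 => x0; rewrite /gt (cpowM _ k0 x0) ee_scale mul1r -[in LHS](cpow1 k0) !mulrA -(cpowD k 1).
  by have -> : 1 + (s - 1) = s by ring.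
have -> : cGamma s = cpow k s * CI Rp (gt k).
  have <- := CIZ (cpow k s) mRp (gt_citg k0).
  rewrite gamE -(eq_CI h) /CI e1 e2; congr (_ +i* _); apply: eq_RI => x _.
    by rewrite ReCM /= mul0r subr0.
  by rewrite ImCM /= mul0r addr0.
rewrite mulrA -(cpowD k (- s) s) addNr cpow0; exact: esym (mul1r _).
Qed.

Let Lser : exists L : C, series (fun n => (cf n.+1)%:C * cpow n.+1%:R (- s) : C) @ \oo --> L.
Proof.
apply: (@cvg_seriesC_abs R _ (fun n => D * 2 ^+ 6 * (n.+1%:R ^+ 2)^-1)).
  move=> n; rewrite modCM modC_real modC_cpow; apply: le_trans (coef n).
  have -> : Re (- s) = - sg by rewrite /sg; case: (s).
  by rewrite mulNr.
by apply/cvg_ex; exists (D * 2 ^+ 6 * limn (series (fun k => (k.+1%:R ^+ 2)^-1 : R)));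
   apply: cvg_seriesZ; exact: cvg_invsq.
Qed.

Let mel (x : R) : C := (phi x)%:C * cpow x (s - 1).

Let termwise : citg Rp mel /\
  series (fun n => (cf n.+1)%:C * (cpow (lam * n.+1%:R) (- s) * cGamma s) : C) @ \oo --> CI Rp mel.
Proof.
have lk n : 0 < lam * n.+1%:R by apply: mulr_gt0 => //; rewrite ltr0n.
have part (pr : R[i] -> R) : (forall z, `|pr z| <= modC z) -> (forall (c : R) z, pr (c%:C * z) = c * pr z) ->
    cpos (fun x => pr (cpow x (s - 1))) -> (forall k, 0 < k -> itg Rp (fun x => pr (gt k x))) ->
    itg Rp (fun x => pr (mel x)) /\
    series (fun n => cf n.+1 * \int[mu]_(x in Rp) pr (gt (lam * n.+1%:R) x)) @ \oo -->
      \int[mu]_(x in Rp) pr (mel x).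
  move=> pr1 prZ cpr ig.
  have e1 k x : pr (gt k x) = pr (cpow x (s - 1)) * ee k x.
    by rewrite /gt [cpow _ _ * _]mulrC prZ mulrC.
  have e2 x : phi x * pr (cpow x (s - 1)) = pr (mel x) by rewrite /mel prZ.
  have ig2 k : 0 < k -> itg Rp (fun x => pr (cpow x (s - 1)) * ee k x).
    by move=> k0; exact: (eq_itg (fun x _ => e1 k x) mRp (ig k k0)).
  have b2 k : 0 < k -> \int[mu]_(x in Rp) `|pr (cpow x (s - 1)) * ee k x| <= expR (- (sg * ln k)) * G0.
    move=> k0; rewrite -(r_scale k0).
    apply: (le_RI mRp (itg_norm mRp (ig2 k k0)) (r_itg k0)) => x _.
    by rewrite -e1 -nc_gt; exact: pr1.
  have G00 : 0 <= G0.
    by apply: Rintegral_ge0 => x _; apply: mulr_ge0; [exact: expR_ge0|exact: ee_ge0].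
  have [i1 h1] := @termwise_real (fun x => pr (cpow x (s - 1))) sg G0 (farP s8) G00 ig2 b2.
  split; first exact: (eq_itg (fun x _ => e2 x) mRp i1).
  rewrite -(eq_RI (fun x _ => e2 x)).
  rewrite (series_ext (v := fun n => cf n.+1 * \int[mu]_(x in Rp) (pr (cpow x (s - 1)) * ee (lam * n.+1%:R) x))).
    exact: h1.
  by move=> n; congr (_ * _); apply: eq_RI => x _; exact: e1.
have ReZ (c : R) z : Re (c%:C * z) = c * Re z by rewrite ReCM /= mul0r subr0.
have ImZ (c : R) z : Im (c%:C * z) = c * Im z by rewrite ImCM /= mul0r addr0.
have [c1 c2] := ccpos_cpow 1 (s - 1).
have c1' : cpos (fun x => Re (cpow x (s - 1))) by move: c1; under eq_fun do rewrite mul1r.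
have c2' : cpos (fun x => Im (cpow x (s - 1))) by move: c2; under eq_fun do rewrite mul1r.
have [i1 h1] := part (@complex.Re R) (@Re_le R) ReZ c1' (fun k k0 => (gt_citg k0).1).
have [i2 h2] := part (@complex.Im R) (@Im_le R) ImZ c2' (fun k k0 => (gt_citg k0).2).
split; first by split.
apply: cvg_seriesC.
  suff -> : series (fun n => Re ((cf n.+1)%:C * (cpow (lam * n.+1%:R) (- s) * cGamma s))) =
    series (fun n => cf n.+1 * \int[mu]_(x in Rp) Re (gt (lam * n.+1%:R) x)) by exact: h1.
  by apply: series_ext => n; rewrite -(gt_scale (lk n)) ReZ.
suff -> : series (fun n => Im ((cf n.+1)%:C * (cpow (lam * n.+1%:R) (- s) * cGamma s))) =
  series (fun n => cf n.+1 * \int[mu]_(x in Rp) Im (gt (lam * n.+1%:R) x)) by exact: h2.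
by apply: series_ext => n; rewrite -(gt_scale (lk n)) ImZ.
Qed.

(** On ]0, 1] the inversion and [phi_inv] turn the integrand into (gam + psi x) x^(1 - s) on the ray
    from 1, where [pow_CI] integrates the power. *)
Let mel_split : CI Rp mel = Lambda s.
Proof.
have [[i1 i2] _] := termwise.
have [c1 c2] := ccpos_cpow 1 (s - 1).
have cm1 : cpos (fun x => Re (mel x)).
  suff -> : (fun x => Re (mel x)) = (fun x => phi x * Re (1 * cpow x (s - 1))) by exact: cposM.
  by apply/funext => x; rewrite mul1r /mel ReCM /= mul0r subr0.
have cm2 : cpos (fun x => Im (mel x)).
  suff -> : (fun x => Im (mel x)) = (fun x => phi x * Im (1 * cpow x (s - 1))) by exact: cposM.
  by apply/funext => x; rewrite mul1r /mel ImCM /= mul0r addr0.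
have s01 : (`]0%R, 1%R]%classic : set R) `<=` Rp.
  by move=> x /=; rewrite !in_itv/= andbT => /andP[].
have [j1 e1] := RI_inv1y cm1 (itgS mRp m01 s01 i1).
have [j2 e2] := RI_inv1y cm2 (itgS mRp m01 s01 i2).
have -> : CI Rp mel = CI J (fun x => (x ^- 2)%:C * mel x^-1) + MT phi (s - 1).
  have hr : Re (CI Rp mel) = \int[mu]_(x in J) (x ^- 2 * Re (mel x^-1)) + \int[mu]_(x in J) Re (mel x).
    by rewrite -e1; exact: RI_split1 i1.
  have hi : Im (CI Rp mel) = \int[mu]_(x in J) (x ^- 2 * Im (mel x^-1)) + \int[mu]_(x in J) Im (mel x).
    by rewrite -e2; exact: RI_split1 i2.
  have ReZ (c : R) z : Re (c%:C * z) = c * Re z by rewrite ReCM /= mul0r subr0.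
  have ImZ (c : R) z : Im (c%:C * z) = c * Im z by rewrite ImCM /= mul0r addr0.
  apply: eqReIm.
    rewrite hr [RHS]ReCD /CI [complex.Re (_ +i* _)]/=.
    rewrite [in RHS](eq_RI (fun x _ => ReZ (x ^- 2) (mel x^-1))).
    exact: erefl.
  rewrite hi [RHS]ImCD /CI [complex.Im (_ +i* _)]/=.
  rewrite [in RHS](eq_RI (fun x _ => ImZ (x ^- 2) (mel x^-1))).
  exact: erefl.
have w1 : Re (2 - s) <= -1 by rewrite ReCB; have := farP s8; rewrite /=; lra.
have [ip ep] := pow_CI w1.
have ws : 2 - s - 1 = 1 - s by ring.
rewrite ws in ip ep.
have ipsi : citg J (fun x => (psi x)%:C * cpow x (1 - s)).
  have h := tail_citg cpsi kap0 A0 psiA 0 (1 - s).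
  by apply: (eq_citg mJ _ h) => x _; rewrite expr0 mul1r.
have eJ x : J x -> (x ^- 2)%:C * mel x^-1 = gam%:C * cpow x (1 - s) + (psi x)%:C * cpow x (1 - s).
  move=> /Jgt0 x0; rewrite /mel (phi_inv x0) (cpowV _ x0) mulrA -rmorphM /= (mulKf (expf_neq0 2 (lt0r_neq0 x0))).
  by rewrite rmorphD /= mulrDl opprB.
rewrite (eq_CI eJ) (CID mJ (citgZ gam%:C mJ ip) ipsi) (CIZ gam%:C mJ ip) ep /Lambda -/(MT psi (1 - s)).
have -> : - (2 - s)^-1 = (s - 2)^-1 by rewrite -invrN opprB.
ring.
Qed.

(** Since lam = 2 pi / N, the variable x in tau = i x / N already contains the factor M^(s/2) of
    level M = N^2. *)
Let cpow_lam : cpow lam (- s) = cpow (N ^ 2)%:R (s / 2) * cpow (2 * pi) (- s).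
Proof.
have p0 : 0 < 2 * pi :> R by exact: mulr_gt0 (ltr0Sn R 1) (pi_gt0 R).
have Nr : 0 < N%:R :> R by rewrite ltr0n.
have Ni : 0 < N%:R^-1 :> R by rewrite invr_gt0.
have -> : lam = 2 * pi * N%:R^-1 by [].
rewrite (cpowM _ p0 Ni) (cpowV _ Nr) opprK mulrC; congr (_ * _).
have -> : (N ^ 2)%:R = N%:R * N%:R :> R by rewrite -natrM mulnn.
rewrite (cpowM _ Nr Nr) -(cpowD N%:R).
by congr (cpow _ _); field; rewrite ?pnatr_eq0.
Qed.

Lemma Lambda_dirichlet : exists2 L : C,
  series (fun n => (cf n.+1)%:C * cpow n.+1%:R (- s) : C) @ \oo --> L &
  Lambda s = cpow (N ^ 2)%:R (s / 2) * cpow (2 * pi) (- s) * cGamma s * L.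
Proof.
have [L hL] := Lser; exists L; first exact: hL.
have [_ h] := termwise; rewrite mel_split in h.
have k : (fun _ : nat => cpow lam (- s) * cGamma s : C) @ \oo --> (cpow lam (- s) * cGamma s : C) by exact: cvg_cst.
have h2 : series (fun n => (cf n.+1)%:C * (cpow (lam * n.+1%:R) (- s) * cGamma s) : C) @ \oo -->
    (cpow lam (- s) * cGamma s * L : C).
  suff -> : series (fun n => (cf n.+1)%:C * (cpow (lam * n.+1%:R) (- s) * cGamma s) : C) =
    (fun n => cpow lam (- s) * cGamma s * series (fun n => (cf n.+1)%:C * cpow n.+1%:R (- s) : C) n).
    exact: cvgM k hL.
  apply/funext => n; rewrite /series /= big_distrr /=; apply: eq_bigr => i _.
  by rewrite (cpowM (- s) l0 (ltr0Sn R i)); ring.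
have e : Lambda s = cpow lam (- s) * cGamma s * L by exact: (cvg_uniqueC h h2).
by rewrite e cpow_lam.
Qed.
End Dirichlet.

Lemma Lambda_is_Lambda : is_Lambda (N ^ 2) (fun n => (cf n)%:C) Lambda.
Proof.
split; first exact: Lambda_meromorphic.
exists 8%:R; first by [].
by move=> s s8; apply: Lambda_dirichlet; exact: Far.
Qed.
End Mellin.

(** * Comparison of the two sides *)

Section Tails.
Variable R : realType.
Notation mu := (@lebesgue_measure R).
Local Notation Rp := (`]0%R, +oo[%classic : set R).
Local Notation J := (`[1%R, +oo[%classic : set R).
Variables (f : R -> R) (A kap : R).
Hypotheses (cf : cpos f) (kap0 : 0 < kap).
Hypothesis fA : forall x : R, 1 <= x -> `|f x| <= A * ee kap x.

Let mRp : measurable Rp. Proof. exact: measurable_itv. Qed.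
Let mJ : measurable J. Proof. exact: measurable_itv. Qed.

Let JRp : J `<=` Rp.
Proof. by move=> x /=; rewrite !in_itv/= !andbT; exact: lt_le_trans. Qed.

Lemma itg_tail_inv : itg J (fun x => x^-1 * f x).
Proof.
have iC : itg J (fun x => A * ee kap x).
  by apply: itgZ => //; apply: (itgS mRp mJ JRp (itg_ee kap0)).
have c1 : cpos (fun x => x^-1 * f x).
  by apply: cposM => // x x0; apply: cvgV; [rewrite lt0r_neq0|exact: cvg_id].
apply: (itg_le mJ _ _ iC); first exact: measurable_funS (cpos_meas c1).
move=> x /=; rewrite in_itv/= andbT => x1; have x0 : 0 < x by exact: lt_le_trans x1.
rewrite normrM ger0_norm ?invr_ge0 ?(ltW x0)//.
by apply: (le_trans _ (fA x1)); rewrite ler_piMl// invf_le1.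
Qed.

Lemma itg_tail_id : itg J (fun x => x * f x).
Proof.
have k2 : 0 < kap / 2 by rewrite divr_gt0.
have iC : itg J (fun x => `|A| * (2 / kap) * ee (kap / 2) x).
  by apply: itgZ => //; apply: (itgS mRp mJ JRp (itg_ee k2)).
have c1 : cpos (fun x => x * f x).
  by apply: cposM => // x x0; exact: cvg_id.
apply: (itg_le mJ _ _ iC); first exact: measurable_funS (cpos_meas c1).
move=> x /=; rewrite in_itv/= andbT => x1; have x0 : 0 < x by exact: lt_le_trans x1.
rewrite normrM ger0_norm ?(ltW x0)// -mulrA.
apply: (@le_trans _ _ (`|A| * (x * ee kap x))); last first.
  by apply: ler_wpM2l => //; apply: xee_le => //; exact: ltW.
rewrite [leRHS]mulrCA; apply: ler_wpM2l; first exact: ltW.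
by apply: (le_trans (fA x1)); apply: ler_wpM2r; [exact: ee_ge0|exact: ler_norm].
Qed.
End Tails.

Section Assembly.
Variables (R : realType) (N : nat).
Hypothesis N0 : (0 < N)%N.
Notation mu := (@lebesgue_measure R).
Local Notation lam := (lam R N).
Local Notation Rp := (`]0%R, +oo[%classic : set R).
Local Notation J := (`[1%R, +oo[%classic : set R).
Variables a b c d : Zmod N.
Hypotheses (hu : (a, b) != 0) (hv : (c, d) != 0).

(** F at the point i x / N, by [F_axis]; [Psi] and [Gam] are the decaying part and the constant that
    appear under x -> 1 / x. *)
Definition Phi (x : R) : R := 2^-1 * (Tz N d a x * Tz N c b x - Tz N a d x * Tz N b c x).
Definition Psi (x : R) : R := 2^-1 * (psi N d a c b x - psi N a d b c x).
Definition Gam : R := 2^-1 * (g0 R N a b - g0 R N d c).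

Let aN := Zmod_lt N0 a.
Let bN := Zmod_lt N0 b.
Let cN := Zmod_lt N0 c.
Let dN := Zmod_lt N0 d.

Let cpos2 (f g : R -> R) : cpos f -> cpos g -> cpos (fun x => 2^-1 * (f x - g x)).
Proof.
move=> hf hg x x0; apply: (@cvgM _ _ _ _ (fun=> 2^-1)); first exact: cvg_cst.
by apply: cvgB; [exact: hf|exact: hg].
Qed.

Lemma Phi_cpos : cpos Phi.
Proof.
exact: cpos2 (cposM (@Tz_cpos R N N0 d a dN) (@Tz_cpos R N N0 c b cN))
             (cposM (@Tz_cpos R N N0 a d aN) (@Tz_cpos R N N0 b c bN)).
Qed.

Lemma Psi_cpos : cpos Psi.
Proof. exact: cpos2 (@psi_cpos R N N0 d a c b aN bN) (@psi_cpos R N N0 a d b c dN cN). Qed.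

Lemma Phi_inv (t : R) : 0 < t -> Phi t^-1 = t ^+ 2 * (Gam + Psi t).
Proof.
move=> t0; rewrite /Phi (psi_modular N0 dN aN cN bN t0) (psi_modular N0 aN dN bN cN t0) /Gam /Psi.
move: (g0 _ _ _ _) (g0 _ _ _ _) (psi _ _ _ _ _ _) (psi _ _ _ _ _ _) => u v w z.
ring.
Qed.

Let kap : R := lam / 4.

Let l0 : 0 < lam. Proof. exact: lam_gt0. Qed.

Let kap0 : 0 < kap. Proof. by rewrite divr_gt0. Qed.

(** The decay rests on u and v being nonzero: (a, b) provides a decaying factor for one product of
    [Tz], and (c, d) for the other. *)
Lemma products_bound : exists2 A : R, 0 <= A &
  forall x : R, 1 <= x -> [/\ `|Tz N d a x * Tz N c b x| <= A * ee kap x,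
    `|Tz N a d x * Tz N b c x| <= A * ee kap x, `|psi N d a c b x| <= A * ee kap x &
    `|psi N a d b c x| <= A * ee kap x].
Proof.
have [A1 A10 h1] := TT_bound R N0 dN aN cN bN ltac:(by rewrite orbC Zpair_gt0).
have [A2 A20 h2] := TT_bound R N0 aN dN bN cN (Zpair_gt0 hu).
have [A3 A30 h3] := psi_bound R N0 d c aN bN.
have [A4 A40 h4] := psi_bound R N0 a b dN cN.
have k1 (A B x : R) : 0 <= B -> A <= B -> A * ee kap x <= B * ee kap x.
  by move=> _ h; apply: ler_wpM2r => //; exact: ee_ge0.
have k2 (A B x : R) : 0 <= A -> 1 <= x -> A <= B -> A * ee (lam / 2) x <= B * ee kap x.
  move=> A0' x1 h; apply: ler_pM => //; first exact: ee_ge0.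
  rewrite /ee ler_expR lerN2; apply: ler_wpM2r; first exact: le_trans x1.
  by rewrite /kap; move: (lam) l0 => l ll; lra.
exists (A1 + A2 + A3 + A4); first by rewrite !addr_ge0.
move=> x x1; split.
- by apply: le_trans (h1 x x1) _; apply: k1; lra.
- by apply: le_trans (h2 x x1) _; apply: k1; lra.
- by apply: le_trans (h3 x x1) _; apply: k2 => //; lra.
- by apply: le_trans (h4 x x1) _; apply: k2 => //; lra.
Qed.

Let half_le (u v B : R) : `|u| <= B -> `|v| <= B -> `|2^-1 * (u - v)| <= B.
Proof. by rewrite !ler_norml => /andP[? ?] /andP[? ?]; apply/andP; split; lra. Qed.

Lemma eta_itg : itg Rp (along_iR (eta_form (siegel R (a, b)) (siegel R (c, d)))) /\
  \int[mu]_(t in Rp) along_iR (eta_form (siegel R (a, b)) (siegel R (c, d))) t =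
  pi / 2 * (Lam0 R N d a c b - Lam0 R N a d b c).
Proof.
have mRp : measurable Rp by exact: measurable_itv.
have e t : Rp t -> along_iR (eta_form (siegel R (a, b)) (siegel R (c, d))) t =
    Lf N a b t * (lam * Yf N c d t) - Lf N c d t * (lam * Yf N a b t).
  by rewrite Rp_gt0 => t0; exact: along_eta.
have [i1 e1] := pairing R N0 aN bN cN dN (Zpair_gt0 hu).
have [i2 e2] := pairing R N0 cN dN aN bN (Zpair_gt0 hv).
split.
  by apply: (eq_itg _ mRp (itgB mRp i1 i2)) => t ht; exact: esym (e t ht).
rewrite (eq_RI e) (RIB mRp i1 i2) e1 e2 (Lam0C R N c b d a).
by move: (Lam0 _ _ _ _ _ _) (Lam0 _ _ _ _ _ _) => u v; field.
Qed.

Lemma Lam0_half :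
  \int[mu]_(x in J) (x^-1 * Phi x) + \int[mu]_(x in J) (x * Psi x) - Gam / 2 =
  2^-1 * (Lam0 R N d a c b - Lam0 R N a d b c).
Proof.
have mJ : measurable J by exact: measurable_itv.
have [A A0 hA] := products_bound.
have c1 := cposM (@Tz_cpos R N N0 d a dN) (@Tz_cpos R N N0 c b cN).
have c2 := cposM (@Tz_cpos R N N0 a d aN) (@Tz_cpos R N N0 b c bN).
have i1 : itg J (fun x => x^-1 * (Tz N d a x * Tz N c b x)).
  by apply: (itg_tail_inv c1 kap0 (A := A)) => x /hA[].
have i2 : itg J (fun x => x^-1 * (Tz N a d x * Tz N b c x)).
  by apply: (itg_tail_inv c2 kap0 (A := A)) => x /hA[].
have i3 : itg J (fun x => x * psi N d a c b x).
  by apply: (itg_tail_id (@psi_cpos R N N0 d a c b aN bN) kap0 (A := A)) => x /hA[].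
have i4 : itg J (fun x => x * psi N a d b c x).
  by apply: (itg_tail_id (@psi_cpos R N N0 a d b c dN cN) kap0 (A := A)) => x /hA[].
have e1 x : J x -> x^-1 * Phi x = 2^-1 * (x^-1 * (Tz N d a x * Tz N c b x) - x^-1 * (Tz N a d x * Tz N b c x)).
  by move=> _; rewrite /Phi; move: (Tz N d a x * _) (Tz N a d x * _) => u v; ring.
have e2 x : J x -> x * Psi x = 2^-1 * (x * psi N d a c b x - x * psi N a d b c x).
  by move=> _; rewrite /Psi; move: (psi _ _ _ _ _ _) (psi _ _ _ _ _ _) => u v; ring.
rewrite (eq_RI e1) (eq_RI e2) RIZ//; last exact: itgB.
rewrite [X in _ + X - _]RIZ//; last exact: itgB.
rewrite !RIB// /Lam0 /Gam.
move: (\int[mu]_(x in _) _) (\int[mu]_(x in _) _) (\int[mu]_(x in _) _) (\int[mu]_(x in _) _) => u v w z.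
move: (g0 _ _ _ _) (g0 _ _ _ _) => g h.
by field.
Qed.

Lemma Lambda_star : is_Lambda_star0 (N ^ 2)
  (fun tau => eis R a d tau * eis R b (- c) tau + eis R a (- d) tau * eis R b c tau)
  (2^-1 * (Lam0 R N d a c b - Lam0 R N a d b c))%:C.
Proof.
have [A A0 hA] := products_bound.
have hPhi x : 1 <= x -> `|Phi x| <= A * ee kap x by move=> /hA[? ? _ _]; exact: half_le.
have hPsi x : 1 <= x -> `|Psi x| <= A * ee kap x by move=> /hA[_ _ ? ?]; exact: half_le.
have [D D0 hD] := fcoef_bound R a b c d.
have f0 := fcoef0 R N0 hu hv.
exists (fun n => (fcoef R a b c d n)%:C), (Lambda Phi Psi Gam); split.
- by move=> tau htau; exact: fcoef_cvg htau.
- by apply: (Lambda_is_Lambda N0 Phi_cpos Psi_cpos kap0 A0 D0 hPhi hPsi Phi_inv f0 hD) => x x0; exact: F_series x0.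
rewrite -Lam0_half; exact: (@Lambda_lim R Phi Psi Gam A kap _ Phi_cpos Psi_cpos kap0 A0 hPhi hPsi f0).
Qed.
End Assembly.

Theorem theorem1 (R : realType) (N : nat) (hN : (1 <= N)%N)
    (a b c d : Zmod N) (hu : (a, b) != 0) (hv : (c, d) != 0) :
  let omega : R[i]^o -> R[i]^o -> R := eta_form (siegel R (a, b)) (siegel R (c, d)) in
  let F : R[i]^o -> R[i]^o := fun tau =>
    eis R a d tau * eis R b (- c) tau + eis R a (- d) tau * eis R b c tau in
  (@lebesgue_measure R).-integrable `]0, +oo[ (EFin \o along_iR omega) /\
  exists l : R[i],
    is_Lambda_star0 (N ^ 2) F l /\
    (\int[@lebesgue_measure R]_(t in `]0, +oo[) along_iR omega t)%:C
      = pi%:C * l.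
Proof.
move=> omega F; have [io eo] := eta_itg R hN hu hv; split; first exact: io.
exists (2^-1 * (Lam0 R N d a c b - Lam0 R N a d b c))%:C; split; first exact: Lambda_star.
by rewrite eo -rmorphM /= mulrA.
Qed.
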